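(* Let $h$, $g$, $V$, $\sigma$ and $H(x,p,M,m,\theta)=\frac{|p|^2}{2}-V(x,m,\theta)-\sigma^2\sum_{i=1}^dM_{ii}$ be as in the context, and suppose that (h-regularity), ($h$-Lipschitz), (g-structure) and (V1), (V2), (V3), all formulated in the context, hold. Then there exists a weak solution $(m,u)\in\mathcal{D}'(\mathbb{T}^d)\times\mathcal{D}'(\mathbb{T}^d)$, with $m\ge0$, to $$\begin{cases}-u-\frac{|Du|^2}{2}+V(x,m,h(m))+\sigma^2\Delta u=0,\\ m-\operatorname{div}(mDu)-\sigma^2\Delta m-1=0.\end{cases}$$ Moreover, $(m^{\frac{\alpha+1}{2}},u)\in W^{1,2}(\mathbb{T}^d)\times W^{1,2}(\mathbb{T}^d)$, $\int_{\mathbb{T}^d}m\,dx=1$, $$-u-\frac{|Du|^2}{2}+V(x,m,h(m))+\sigma^2\Delta u\ge0$$ in the sense of distributions, and $$m-\operatorname{div}(mDu)-\sigma^2\Delta m-1=0$$ a.e. in $\mathbb{T}^d$.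
   Context: Setting. $\mathbb{T}^d=\mathbb{R}^d/\mathbb{Z}^d$, $d\ge1$; $\mathbb{E}$ is a fixed set, either $(0,\infty)$ or $[0,\infty)$. $\mathcal{M}_{ac}(\mathbb{T}^d)$ is the space of positive measures on $\mathbb{T}^d$ absolutely continuous with respect to Lebesgue measure; such a measure is identified with its density $m\in L^1(\mathbb{T}^d)$, $m\ge0$ a.e. $h:\mathcal{M}_{ac}(\mathbb{T}^d)\to C(\mathbb{T}^d)$ is a (possibly nonlinear) operator ($h(m)$ is its value at the measure with density $m$), $g:\mathbb{T}^d\times\mathbb{E}\times\mathbb{R}\to\mathbb{R}$ is continuous, $V:\mathbb{T}^d\times\mathbb{E}\times\mathbb{R}\to\mathbb{R}$ is $C^\infty$, $\sigma\in\mathbb{R}$. $V(x,m,h(m))$ denotes $x\mapsto V(x,m(x),h(m)(x))$, similarly for $g,g_1,g_2$. Repeated indices are summed over $\{1,\dots,d\}$. Conditions over $m\in\mathcal{M}_{ac}(\mathbb{T}^d)$ involving $g$ or $V$ are understood for densities with values in $\mathbb{E}$ a.e. Weak solution. For $(\eta,v)\in C^\infty(\mathbb{T}^d;\mathbb{E})\times C^\infty(\mathbb{T}^d)$ let $A(\eta,v)$ be the pair with components $-v-\frac{|Dv|^2}{2}+V(x,\eta,h(\eta))+\sigma^2\Delta v$ and $\eta-\operatorname{div}(\eta Dv)-\sigma^2\Delta\eta-1$. A pair $(m,u)\in\mathcal{D}'(\mathbb{T}^d)\times\mathcal{D}'(\mathbb{T}^d)$ with $m\ge0$ is a weak solution of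 the system if $\langle(\eta,v)-(m,u),A(\eta,v)\rangle\ge0$ for all $(\eta,v)\in C^\infty(\mathbb{T}^d;\mathbb{E})\times C^\infty(\mathbb{T}^d)$ (distributional duality). The a.e. equality means that the distribution $\operatorname{div}(mDu)+\sigma^2\Delta m$ is represented by a function and the identity holds a.e. (h-regularity) For all $\kappa>\frac d2+1$: $h(m)\in W^{\kappa,2}(\mathbb{T}^d)$ for every $m\in W^{\kappa,2}(\mathbb{T}^d)$ ($m\geq 0$), and $m\mapsto h(m)$ is a Fréchet differentiable map from (nonnegative elements of) $W^{\kappa,2}(\mathbb{T}^d)$ to $W^{\kappa,2}(\mathbb{T}^d)$. ($h$-Lipschitz) There is $C>0$ with $\|h(m)-h(\bar m)\|_{L^1(\mathbb{T}^d)}\le C\|m-\bar m\|_{L^1(\mathbb{T}^d)}$ for all $m,\bar m\in\mathcal{M}_{ac}(\mathbb{T}^d)$. (g-structure) (1) There are functions $g_1,g_2$ with $g=g_1+g_2$ on $\mathbb{T}^d\times\mathbb{E}\times\mathbb{R}$ and $g_2(x,m(x),h(m)(x))\ge0$ for all $m\in\mathcal{M}_{ac}(\mathbb{T}^d)$. (2) There is $c>0$ with $\int_{\mathbb{T}^d} g_2(x,m,h(m))\,dx\le c\,(1+\int_{\mathbb{T}^d} m\,dx)$ for all $m\in\mathcal{M}_{ac}(\mathbb{T}^d)$. (3) For all $\delta>0$ there is $C_\delta>0$ with $\max\{\int_{\mathbb{T}^d} g_1(x,m,h(m))\,dx,\int_{\mathbb{T}^d} m\,dx\}\le\delta\int_{\mathbb{T}^d}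 m g_1(x,m,h(m))\,dx+C_\delta$ for all $m\in\mathcal{M}_{ac}(\mathbb{T}^d)$. (4) There is $R\ge0$ with $\int_{\mathbb{T}^d} mg_1(x,m,h(m))\,dx\ge-R$ for all $m\in\mathcal{M}_{ac}(\mathbb{T}^d)$. (V1) There are constants $c_1,c_2,c_3>0$ such that, with the given continuous function $g:\mathbb{T}^d\times\mathbb{E}\times\mathbb{R}\to\mathbb{R}$ (the same $g=g_1+g_2$ as in (g-structure)): $V(x,m,\theta)\ge c_1g(x,m,\theta)-\frac1{c_2}$ for all $(x,m,\theta)\in\mathbb{T}^d\times\mathbb{E}\times\mathbb{R}$; $\int_{\mathbb{T}^d}V(x,m,h(m))\,dx\le c_2+c_3\int_{\mathbb{T}^d}g(x,m,h(m))\,dx$ for all $m\in\mathcal{M}_{ac}(\mathbb{T}^d)$; and $\int_{\mathbb{T}^d}[V(x,\eta,h(\eta))-V(x,\bar\eta,h(\bar\eta))](\eta-\bar\eta)\,dx\ge0$ for all $\eta,\bar\eta\in C^\infty(\mathbb{T}^d;\mathbb{E})$. (V2) There are constants $\alpha>0$, $\kappa_1>0$ such that $g_1(x,m,\theta)\ge\frac1{\kappa_1}m^\alpha-\kappa_1$ for all $(x,m,\theta)\in\mathbb{T}^d\times\mathbb{E}\times\mathbb{R}$, and $\int_{\mathbb{T}^d}(V(x,\eta,h(\eta)))_{x_i}\eta_{x_i}\,dx\ge\frac1{\kappa_1}\int_{\mathbb{T}^d}\eta^{\alpha-1}|D\eta|^2\,dx-\kappa_1$ for all $\eta\in C^\infty(\mathbb{T}^d;\mathbb{E})$.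 (V3) With the same $\alpha,\kappa_1$: $V(x,m,\theta)\le\kappa_1(1+m^\alpha+|\theta|)$ for all $(x,m,\theta)\in\mathbb{T}^d\times\mathbb{E}\times\mathbb{R}$. *)

(* Defs.v *)
From HB Require Import structures.
From mathcomp Require Import all_boot all_order all_algebra.
From mathcomp Require Import all_classical all_reals all_analysis.

Set Implicit Arguments.
Unset Strict Implicit.
Unset Printing Implicit Defensive.

Import Order.TTheory GRing.Theory Num.Theory.
Import numFieldNormedType.Exports.

Local Open Scope classical_set_scope.
Local Open Scope ring_scope.

(* A function on the torus R^d / Z^d is a Z^d-periodic function on R^d, and
   elements of Lebesgue and Sobolev spaces are periodic functions taken up to
   almost everywhere equality.  The Haar (Lebesgue) measure of the torus is
   the Lebesgue measure of R^d restricted to the unit cube. *)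

Definition rV_display : measure_display -> measure_display.
Proof. exact. Qed.

(* The product sigma-algebra, i.e. the Borel sets when T is the real line. *)
Section measurable_rV.
Context {d} {T : measurableType d} (n : nat).

Definition rV_coord (i : 'I_n) (x : 'rV[T]_n) : T := x ord0 i.

Let rV_set0 : g_sigma_preimage rV_coord set0.
Proof. exact: sigma_algebra0. Qed.

Let rV_setC A : g_sigma_preimage rV_coord A -> g_sigma_preimage rV_coord (~` A).
Proof. exact: sigma_algebraC. Qed.

Let rV_bigcup (F : _^nat) : (forall i, g_sigma_preimage rV_coord (F i)) ->
  g_sigma_preimage rV_coord (\bigcup_i (F i)).
Proof. exact: sigma_algebra_bigcup. Qed.

HB.instance Definition _ := @isMeasurable.Build (rV_display d) 'rV[T]_n
  (g_sigma_preimage rV_coord) rV_set0 rV_setC rV_bigcup.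
End measurable_rV.

Section measurable_rV_theory.
Context d1 d2 (T1 : measurableType d1) (T2 : measurableType d2).

Lemma measurable_rV_coord n (i : 'I_n) :
  measurable_fun setT (fun x : 'rV[T2]_n => x ord0 i).
Proof.
move=> _ Y mY; rewrite setTI; apply: sub_sigma_algebra => /=.
rewrite -bigcup_seq/=; exists i => /=; first by rewrite mem_index_enum.
by exists Y => //; rewrite setTI.
Qed.

Lemma measurable_fun_rV n (f : T1 -> 'rV[T2]_n) :
  (forall i, measurable_fun setT (fun x => f x ord0 i)) ->
  measurable_fun setT f.
Proof.
move=> mf.
suff prefS : g_sigma_preimage (fun i => @rV_coord _ T2 n i \o f) `<=` measurable.
  move=> _ A mA; apply: prefS.
  by rewrite g_sigma_preimage_comp; exists A.
apply: smallest_sub; first exact: sigma_algebra_measurable.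
case: n => [|n] in f mf *; first by rewrite big_ord0.
rewrite -bigcup_mkord_ord; apply: bigcup_sub => i Ii.
by move=> A [B mB <-]; exact: mf.
Qed.

End measurable_rV_theory.


Section unit_cube.
Variable R : realType.

Definition unit_interval_measure : set (measurableTypeR R) -> \bar R :=
  mrestr (@lebesgue_measure R) (measurable_itv `[0%R, 1%R]).

HB.instance Definition _ := Measure.copy unit_interval_measure
  (mrestr (@lebesgue_measure R) (measurable_itv `[0%R, 1%R])).

Let unit_interval_setT : unit_interval_measure setT = 1%E.
Proof.
rewrite /unit_interval_measure /mrestr setTI lebesgue_measure_itv/= lte01.
by rewrite sube0.
Qed.

HB.instance Definition _ := Measure_isProbability.Build _ _ _
  unit_interval_measure unit_interval_setT.

Definition rV_cons n (p : R * 'rV[R]_n) : 'rV[R]_n.+1 :=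
  row_mx (p.1)%:M p.2 : 'rV[R]_(1 + n).

Lemma measurable_rV_cons n : measurable_fun setT (@rV_cons n).
Proof.
apply: measurable_fun_rV => i; case: (split_ordP (i : 'I_(1 + n))) => j ij.
  rewrite (_ : (fun _ => _) = fst); first exact: measurable_fst.
  by apply/funext => p; rewrite ij [LHS]row_mxEl !ord1 mxE eqxx.
rewrite (_ : (fun _ => _) = (fun x : 'rV[R]_n => x ord0 j) \o snd).
  by apply: measurableT_comp; [exact: measurable_rV_coord|exact: measurable_snd].
by apply/funext => p; rewrite ij [LHS]row_mxEr.
Qed.

Definition cube_step n (P : probability 'rV[R]_n R) : set 'rV[R]_n.+1 -> \bar R :=
  pushforward (unit_interval_measure \x P)%E (@rV_cons n).

Section cube_step.
Variables (n : nat) (P : probability 'rV[R]_n R).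

Let cube_step0 : cube_step P set0 = 0%E.
Proof. by rewrite /cube_step /pushforward preimage_set0 measure0. Qed.

Let cube_step_ge0 A : (0 <= cube_step P A)%E.
Proof. by rewrite /cube_step /pushforward measure_ge0. Qed.

Let cube_step_additive : semi_sigma_additive (cube_step P).
Proof.
move=> F mF tF mUF; rewrite /cube_step /pushforward preimage_bigcup.
apply: measure_semi_sigma_additive.
- by move=> k; rewrite -[X in measurable X]setTI; exact: measurable_rV_cons.
- apply/trivIsetP => /= i j _ _ ij; rewrite -preimage_setI.
  by move/trivIsetP : tF => /(_ _ _ _ _ ij) ->//; rewrite preimage_set0.
- rewrite -preimage_bigcup -[X in measurable X]setTI.
  exact: measurable_rV_cons.
Qed.

HB.instance Definition _ := isMeasure.Build _ _ _
  (cube_step P) cube_step0 cube_step_ge0 cube_step_additive.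

Let cube_step_setT : cube_step P setT = 1%E.
Proof. by rewrite /cube_step /pushforward preimage_setT probability_setT. Qed.

HB.instance Definition _ := Measure_isProbability.Build _ _ _
  (cube_step P) cube_step_setT.

End cube_step.

Fixpoint torus_measure n : probability 'rV[R]_n R :=
  if n is n'.+1 then cube_step (torus_measure n')
  else dirac (0 : 'rV[R]_0).

End unit_cube.

Section smooth.
Context {R : realType} {U : normedModType R}.
Implicit Types f : U -> R.

(* All iterated directional derivatives exist and are continuous; for
   finite-dimensional U this is the usual notion of a C^oo function. *)
Definition iter_derive f (s : seq U) : U -> R :=
  foldr (fun v k => 'D_v k) f s.

Definition smooth f := forall s : seq U,
  continuous (iter_derive f s) /\
  forall x v, derivable (iter_derive f s) x v.

(* Smoothness on an arbitrary subset D: f is locally the restriction to D of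
   a smooth function (smooth up to the boundary). *)
Definition smooth_on (D : set U) f := forall p, D p ->
  exists2 k, smooth k & \forall q \near p, D q -> f q = k q.

End smooth.

Section torus.
Context {R : realType} {d : nat}.
Local Notation Rd := 'rV[R]_d.
Local Notation mu := (torus_measure R d).
Implicit Types (f k m u eta v phi : Rd -> R) (S T : (Rd -> R) -> R).

Definition periodic {Y : Type} (f : Rd -> Y) :=
  forall (x : Rd) (i : 'I_d), f (x + delta_mx 0 i) = f x.

Definition torus_continuous f := periodic f /\ continuous f.
Definition torus_smooth f := periodic f /\ smooth f.

Definition pd (i : 'I_d) f : Rd -> R := 'D_(delta_mx 0 i) f.
Definition pds (s : seq 'I_d) f : Rd -> R := foldr pd f s.
Definition laplacian f (x : Rd) : R := \sum_(i < d) pd i (pd i f) x.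

Definition torus_L1 f := periodic f /\ mu.-integrable setT (EFin \o f).
Definition torus_L2 f := [/\ periodic f, measurable_fun setT f &
  mu.-integrable setT (fun x => (f x ^+ 2)%:E)].

Definition torus_ae_eq f k := {ae mu, forall x, f x = k x}.
Definition torus_ae_ge0 f := {ae mu, forall x, 0 <= f x}.

(* Convergence to 0 in C^oo: all derivatives converge to 0 uniformly. *)
Definition smooth_cvg0 (phi : nat -> Rd -> R) :=
  forall (s : seq 'I_d) (e : R), 0 < e ->
    \forall n \near \oo, forall x, `|pds s (phi n) x| < e.

Definition is_distribution T :=
  (forall (a : R) phi psi, torus_smooth phi -> torus_smooth psi ->
     T (fun x => a * phi x + psi x) = a * T phi + T psi) /\
  (forall phi : nat -> Rd -> R, (forall n, torus_smooth (phi n)) ->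
     smooth_cvg0 phi -> T (phi n) @[n --> \oo] --> (0 : R)).

Definition dist_ge0 T :=
  forall phi, torus_smooth phi -> (forall x, 0 <= phi x) -> 0 <= T phi.

Definition dist_of f : (Rd -> R) -> R := fun phi => \int[mu]_x (f x * phi x).
Definition dist_pd (i : 'I_d) T : (Rd -> R) -> R := fun phi => - T (pd i phi).
Definition dist_pds (s : seq 'I_d) T := foldr dist_pd T s.
Definition dist_laplacian T : (Rd -> R) -> R :=
  fun phi => \sum_(i < d) dist_pd i (dist_pd i T) phi.

Definition represents f T :=
  torus_L1 f /\ forall phi, torus_smooth phi -> T phi = dist_of f phi.

Definition is_weak_pds (s : seq 'I_d) f k :=
  torus_L1 f /\ represents k (dist_pds s (dist_of f)).

(* Unspecified when f has no weak derivative along s. *)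
Definition weak_pds (s : seq 'I_d) f : Rd -> R := get (is_weak_pds s f).
Definition weak_pd (i : 'I_d) f : Rd -> R := weak_pds [:: i] f.

Definition sobolev (k : nat) f := torus_L2 f /\
  forall s : seq 'I_d, (size s <= k)%N -> exists2 f', is_weak_pds s f f' & torus_L2 f'.

(* The square root of the sum over n <= k of the integrals of |D^n f|^2, where
   |D^n f| is the Euclidean norm of the tensor of n-th derivatives. *)
Definition sobolev_norm (k : nat) f : R := Num.sqrt
  (\sum_(n < k.+1) \sum_(s : n.-tuple 'I_d) \int[mu]_x (weak_pds s f x ^+ 2)).

(* A measure in M_ac(T^d) is identified with its density. *)
Definition Mac m := torus_L1 m /\ torus_ae_ge0 m.
Definition Mac_in (E : set R) m := Mac m /\ {ae mu, forall x, E (m x)}.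

Definition smooth_in (E : set R) eta := torus_smooth eta /\ forall x, E (eta x).

(* h is an operator on measures, hence it only depends on the almost
   everywhere class of the density. *)
Definition is_operator (h : (Rd -> R) -> Rd -> R) :=
  (forall m, Mac m -> torus_continuous (h m)) /\
  (forall m m', Mac m -> Mac m' -> torus_ae_eq m m' -> h m = h m').

Definition nem (h : (Rd -> R) -> Rd -> R) (F : Rd -> R -> R -> R) m : Rd -> R :=
  fun x => F x (m x) (h m x).

Definition domain (E : set R) : set (Rd * R * R) := [set p | E p.1.2].
Definition uncurry3 (F : Rd -> R -> R -> R) (p : Rd * R * R) : R :=
  F p.1.1 p.1.2 p.2.

(* F is defined on T^d x E x R; its values for e outside E are irrelevant. *)
Definition torus_param (E : set R) (F : Rd -> R -> R -> R) :=
  forall e theta, E e -> periodic (fun x => F x e theta).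

Definition param_continuous (E : set R) (F : Rd -> R -> R -> R) :=
  torus_param E F /\ {within domain E, continuous (uncurry3 F)}.
Definition param_smooth (E : set R) (F : Rd -> R -> R -> R) :=
  torus_param E F /\ smooth_on (domain E) (uncurry3 F).

(* Frechet differentiability on the set D, with respect to D, of H as a map
   into W^{k,2}; L is the derivative, a bounded linear operator of W^{k,2}. *)
Definition frechet_differentiable_on (k : nat) (D : set (Rd -> R))
    (H : (Rd -> R) -> Rd -> R) :=
  forall m, D m -> exists L : (Rd -> R) -> Rd -> R,
  [/\ (forall f, sobolev k f -> sobolev k (L f)),
      (forall (a : R) f f', sobolev k f -> sobolev k f' ->
         torus_ae_eq (L (fun x => a * f x + f' x))
                     (fun x => a * L f x + L f' x)),
      (exists C : R, forall f, sobolev k f ->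
         sobolev_norm k (L f) <= C * sobolev_norm k f) &
      (forall e : R, 0 < e -> exists2 r : R, 0 < r &
         forall m', D m' -> sobolev_norm k (fun x => m' x - m x) < r ->
           sobolev_norm k
             (fun x => H m' x - H m x - L (fun y => m' y - m y) x)
           <= e * sobolev_norm k (fun x => m' x - m x))].

(* The exponent k in W^{k,2} is an integer; asking less of h than a condition
   over all real exponents does. *)
Definition h_regularity (h : (Rd -> R) -> Rd -> R) :=
  forall k : nat, d%:R / 2 + 1 < k%:R :> R ->
    (forall m, sobolev k m -> torus_ae_ge0 m -> sobolev k (h m)) /\
    frechet_differentiable_on k [set m | sobolev k m /\ torus_ae_ge0 m] h.

Definition h_lipschitz (h : (Rd -> R) -> Rd -> R) :=
  exists2 C : R, 0 < C & forall m m', Mac m -> Mac m' ->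
    (\int[mu]_x (`|h m x - h m' x|)%:E <=
     C%:E * \int[mu]_x (`|m x - m' x|)%:E)%E.

Definition ae_measurable f :=
  exists2 f', measurable_fun setT f' & torus_ae_eq f f'.

(* No regularity is imposed on g1 and g2 beyond what gives a meaning to their
   integrals, namely the Lebesgue measurability of x |-> g_i(x, m(x), h(m)(x)).
   The integrals are extended real numbers. *)
Definition g_structure (E : set R) (h : (Rd -> R) -> Rd -> R)
    (g g1 g2 : Rd -> R -> R -> R) :=
  [/\ [/\ torus_param E g1, torus_param E g2 &
       forall m, Mac_in E m ->
         ae_measurable (nem h g1 m) /\ ae_measurable (nem h g2 m)],
      (forall x e theta, E e -> g x e theta = g1 x e theta + g2 x e theta) /\
      (forall m, Mac_in E m -> torus_ae_ge0 (nem h g2 m)),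
      (exists2 c : R, 0 < c & forall m, Mac_in E m ->
         (\int[mu]_x (nem h g2 m x)%:E <=
          c%:E * (1 + \int[mu]_x (m x)%:E))%E),
      (forall delta : R, 0 < delta -> exists2 C : R, 0 < C &
         forall m, Mac_in E m ->
         (Order.max (\int[mu]_x (nem h g1 m x)%:E) (\int[mu]_x (m x)%:E) <=
          delta%:E * \int[mu]_x (m x * nem h g1 m x)%:E + C%:E)%E) &
      (exists2 r : R, 0 <= r & forall m, Mac_in E m ->
         ((- r)%:E <= \int[mu]_x (m x * nem h g1 m x)%:E)%E)].

Definition V1 (E : set R) (h : (Rd -> R) -> Rd -> R)
    (g V : Rd -> R -> R -> R) :=
  exists c1 c2 c3 : R, [/\ 0 < c1, 0 < c2, 0 < c3 &
  [/\ (forall x e theta, E e -> c1 * g x e theta - c2^-1 <= V x e theta),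
      (forall m, Mac_in E m ->
         (\int[mu]_x (nem h V m x)%:E <=
          c2%:E + c3%:E * \int[mu]_x (nem h g m x)%:E)%E) &
      (forall eta eta', smooth_in E eta -> smooth_in E eta' ->
         (0 <= \int[mu]_x
           ((nem h V eta x - nem h V eta' x) * (eta x - eta' x))%:E)%E)]].

(* Where eta vanishes so does D eta, hence eta^(alpha - 1) |D eta|^2 is 0 there
   for every alpha > 0, as with the conventions of powR. *)
Definition V2 (E : set R) (h : (Rd -> R) -> Rd -> R)
    (g1 V : Rd -> R -> R -> R) (alpha kappa1 : R) :=
  [/\ 0 < alpha, 0 < kappa1,
      (forall x e theta, E e -> kappa1^-1 * e `^ alpha - kappa1 <= g1 x e theta) &
      (forall eta, smooth_in E eta ->
         (kappa1^-1%:E * \int[mu]_x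
              (eta x `^ (alpha - 1) * \sum_(i < d) pd i eta x ^+ 2)%:E
            - kappa1%:E <=
          \int[mu]_x (\sum_(i < d) pd i (nem h V eta) x * pd i eta x)%:E)%E)].

Definition V3 (E : set R) (V : Rd -> R -> R -> R) (alpha kappa1 : R) :=
  forall x e theta, E e -> V x e theta <= kappa1 * (1 + e `^ alpha + `|theta|).

Definition A1 (h : (Rd -> R) -> Rd -> R) (V : Rd -> R -> R -> R) (sigma : R)
    eta v (x : Rd) : R :=
  - v x - (\sum_(i < d) pd i v x ^+ 2) / 2 + nem h V eta x
  + sigma ^+ 2 * laplacian v x.

Definition A2 (sigma : R) eta v (x : Rd) : R :=
  eta x - \sum_(i < d) pd i (fun y => eta y * pd i v y) x
  - sigma ^+ 2 * laplacian eta x - 1.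

Definition weak_solution (E : set R) (h : (Rd -> R) -> Rd -> R)
    (V : Rd -> R -> R -> R) (sigma : R) (m u : (Rd -> R) -> R) :=
  [/\ is_distribution m, is_distribution u, dist_ge0 m &
  forall eta v, smooth_in E eta -> torus_smooth v ->
    0 <= (dist_of eta (A1 h V sigma eta v) - m (A1 h V sigma eta v))
       + (dist_of v (A2 sigma eta v) - u (A2 sigma eta v))].

(* - u - |Du|^2 / 2 + V(x,m,h(m)) + sigma^2 Lap u >= 0 in the sense of
   distributions, for functions m and u, the gradient being the weak one. *)
Definition hj_supersolution (h : (Rd -> R) -> Rd -> R)
    (V : Rd -> R -> R -> R) (sigma : R) m u :=
  [/\ torus_L1 u, torus_L1 (fun x => \sum_(i < d) weak_pd i u x ^+ 2),
      mu.-integrable setT (EFin \o nem h V m) &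
  dist_ge0 (fun phi =>
    - dist_of u phi
    - dist_of (fun x => (\sum_(i < d) weak_pd i u x ^+ 2) / 2) phi
    + dist_of (nem h V m) phi
    + sigma ^+ 2 * dist_laplacian (dist_of u) phi)].

(* div(m Du) + sigma^2 Lap m is a distribution, because m Du is integrable, and
   is represented by the integrable function F. *)
Definition fokker_planck_ae (sigma : R) m u :=
  [/\ torus_L1 m, (forall i : 'I_d, torus_L1 (fun x => m x * weak_pd i u x)) &
  exists2 F : Rd -> R,
    represents F (fun phi =>
      \sum_(i < d) dist_pd i (dist_of (fun x => m x * weak_pd i u x)) phi
      + sigma ^+ 2 * dist_laplacian (dist_of m) phi) &
    {ae mu, forall x, m x - F x - 1 = 0}].

End torus.

(* Main.v *)
(* The system is the variational inequality of the monotone operator A. It is first solved with m in the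
   convex set of trigonometric polynomials of degree n with m >= 1/(n+2), and u in the space of trigonometric
   polynomials of degree N >= n. On bounded subsets this is Minty's lemma in finite dimension, which for
   finitely many test points is the existence of an optimal strategy in a nearly skew-symmetric game. The
   test points (c, 0), c = 1/2, 1, 2, bound m in L^(alpha+1), u in W^(1,2) and the integral of m |Du|^2
   independently of the subset, of n and of N, so that the inequality holds for all (eta, v).
   Two further tests give compactness. The averages of opposite translates of m are admissible, and together
   with the Fokker-Planck equation tested on the second derivatives of u they bound, by (V2), the integrals
   of m |D^2 u|^2 and m^(alpha-1) |Dm|^2. The Fokker-Planck equation tested on a polynomial close to ln m,
   which exists if N is large compared with n, bounds the integral of - ln m, so that the limit density is
   positive almost everywhere.
   By Rellich's theorem m_n converges almost everywhere, hence V(x, m_n, h(m_n)) converges in L^1 by (V3),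
   and sqrt(m_n) Du_n converges weakly. The Fokker-Planck equation then passes to the limit, the
   Hamilton-Jacobi inequality does by lower semicontinuity, and so does the inequality in Minty's form, for
   polynomial test functions; mollification and the regularity of h extend it to smooth ones. *)

Require Import Defs.
From HB Require Import structures.
From mathcomp Require Import all_boot all_order all_algebra.
From mathcomp Require Import all_classical all_reals all_analysis.
From mathcomp Require Import measurable_realfun ring lra.
From mathcomp Require finmap.

Set Implicit Arguments.
Unset Strict Implicit.
Unset Printing Implicit Defensive.

Import Order.TTheory GRing.Theory Num.Theory.
Import numFieldNormedType.Exports.

Local Open Scope classical_set_scope.
Local Open Scope ring_scope.

(** * Measurability of functions on R^d *)

(** The two unknowns are not constrained alike. Since [v] ranges over a vector space, the
    Fokker-Planck equation holds with equality against polynomials of degree N; since the density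
    ranges over a convex set bounded below, the Hamilton-Jacobi equation survives only as an
    inequality against nonnegative polynomials. The bound m >= 1/(n+2) keeps m inside E, where V(x,
    m, h(m)), ln m and the powers of m are differentiable, but it fades as n grows. As E may be (0,
    oo), the limit must be shown positive before V(x, m, h(m)) makes sense for it: this is what the
    integral of - ln m is for. A perturbation of m by its second derivatives may violate the lower
    bound, an average of translates never does. On general densities h is only Lipschitz for the L^1
    norm, so h(m_n) converges almost everywhere only along a further subsequence; the Sobolev
    regularity of h acts on smooth densities. Spaces of trigonometric polynomials are stable under
    translations and derivatives, and convolution with a single polynomial kernel provides uniform
    approximation, the Poincare inequality, the Sobolev embedding and Rellich's theorem. *)

Lemma measurable_countable_factor (R : realType) dT (T : measurableType dT)
    (C : countType) (r : T -> C) (F : C -> R) :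
  (forall z, measurable (r @^-1` [set z])) -> measurable_fun setT (F \o r).
Proof.
move=> mr _ Y mY; rewrite setTI.
rewrite (_ : _ @^-1` _ = \bigcup_(z in [set z | Y (F z)]) (r @^-1` [set z])).
  rewrite bigcup_mkcond; apply: countable_bigcupT_measurable => [|z].
    exact: countableP.
  by case: ifP.
apply/seteqP; split=> [x Yx|x [z Yz /= rxz]]; first by exists (r x).
by rewrite /preimage/= rxz.
Qed.

Section rounding.
Context {R : realType} {dT : measure_display} {T : measurableType dT}.

(** Rounding to a grid of step 1/(k+1) turns a function into a pointwise limit of functions that
    factor through a countable type, for which only the level sets have to be measurable. Continuous
    functions on R^d thus become measurable for the product sigma-algebra without comparing it with
    the topology. *)
Definition iround (k : nat) (x : R) : int := Num.floor (x * k.+1%:R).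
Definition rdown (k : nat) (z : int) : R := z%:~R / k.+1%:R.
Definition rup (k : nat) (z : int) : R := (z%:~R + 1) / k.+1%:R.

Lemma measurable_iround k (f : T -> R) z : measurable_fun setT f ->
  measurable ((iround k \o f) @^-1` [set z]).
Proof.
move=> mf; rewrite (_ : _ @^-1` _ =
    setT `&` f @^-1` `[z%:~R / k.+1%:R, (z + 1)%:~R / k.+1%:R[%classic).
  by apply: mf => //; exact: measurable_itv.
apply/seteqP; split=> x /=; rewrite in_itv/= /iround ler_pdivrMr// ltr_pdivlMr//.
  by move=> <-; rewrite Num.Theory.floor_le ?num_real// Num.Theory.floorD1_gt// num_real.
by move=> [_]; move=> h; apply: Num.Theory.floor_def; rewrite h.
Qed.

Lemma rdown_near k (x : R) : `|x - rdown k (iround k x)| <= k.+1%:R^-1.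
Proof.
rewrite /rdown /iround; set y := x * _; have -> : x = y / k.+1%:R.
  by rewrite mulfK.
rewrite -mulrBl normrM (ger0_norm (_ : 0 <= k.+1%:R^-1))// ler_piMl//.
rewrite ger0_norm ?subr_ge0 ?Num.Theory.floor_le ?num_real// lerBlDr.
by apply/ltW; rewrite addrC -[X in _ + X](_ : 1%:~R = 1)// -intrD Num.Theory.floorD1_gt// num_real.
Qed.

Lemma rup_near k (x : R) : 0 <= rup k (iround k x) - x <= k.+1%:R^-1.
Proof.
rewrite /rup /iround; set y := x * _; have -> : x = y / k.+1%:R.
  by rewrite mulfK.
rewrite -mulrBl.
have h1 : (Num.floor y)%:~R <= y by rewrite Num.Theory.floor_le ?num_real.
have h2 : y <= (Num.floor y)%:~R + 1.
  by apply/ltW; rewrite -[X in _ + X](_ : 1%:~R = 1)// -intrD Num.Theory.floorD1_gt// num_real.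
rewrite mulr_ge0 ?subr_ge0//= ler_piMl// lerBlDr addrC lerD2l//.
Qed.

Lemma cvg_harm_squeeze {U : normedModType R} (u : nat -> U) (x : U) :
  (forall k, `|x - u k| <= k.+1%:R^-1) -> u k @[k --> \oo] --> x.
Proof.
move=> h; apply/cvgrPdist_le => e e0.
have := @cvg_harmonic R => /cvgrPdist_le/(_ e e0); apply: filterS => k.
rewrite sub0r normrN /= => he; apply: le_trans (h k) _.
by apply: le_trans he; rewrite ler_norm.
Qed.

Lemma cvg_rdown (x : R) : rdown k (iround k x) @[k --> \oo] --> x.
Proof. by apply: cvg_harm_squeeze => k; exact: rdown_near. Qed.

Lemma cvg_rup (x : R) : rup k (iround k x) @[k --> \oo] --> x.
Proof.
apply: cvg_harm_squeeze => k; have /andP[h1 h2] := rup_near k x.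
by rewrite distrC ger0_norm.
Qed.

End rounding.

Section rV_measurability.
Context {R : realType} {d : nat}.
Local Notation Rd := 'rV[R]_d.

Definition mround k (x : Rd) : 'rV[int]_d := map_mx (iround k) x.
Definition mdown k (z : 'rV[int]_d) : Rd := map_mx (rdown k) z.

Lemma measurable_mround k z : measurable (mround k @^-1` [set z]).
Proof.
rewrite (_ : _ @^-1` _ =
    \bigcap_(i in [set: 'I_d]) ((iround k \o (fun x : Rd => x ord0 i)) @^-1` [set z ord0 i])).
  apply: fin_bigcap_measurable => [|i _]; first exact: finite_finset.
  by apply: measurable_iround; exact: measurable_rV_coord.
apply/seteqP; split=> x /=; first by move=> <- i _ /=; rewrite mxE.
by move=> h; apply/rowP => i; rewrite mxE -(h i).
Qed.

Lemma rV_norm_leP (x : Rd) e : 0 <= e -> (`|x| <= e) <-> (forall i, `|x ord0 i| <= e).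
Proof.
move=> e0; rewrite [ `|x|]mx_normrE; split=> [h i|h].
  apply: le_trans h; exact: (le_bigmax _ (fun i : 'I_1 * 'I_d => `|x i.1 i.2|) (ord0, i)).
by apply/bigmax_leP; split=> // -[i j] _ /=; rewrite ord1.
Qed.

Lemma coord_le_norm (x : Rd) i : `|x ord0 i| <= `|x|.
Proof. by move: i; apply/rV_norm_leP. Qed.

Lemma cvg_mdown (x : Rd) : mdown k (mround k x) @[k --> \oo] --> x.
Proof.
apply: cvg_harm_squeeze => k; apply/rV_norm_leP => // i.
by rewrite !mxE; exact: rdown_near.
Qed.

Lemma continuous_measurable_rV (f : Rd -> R) : continuous f -> measurable_fun setT f.
Proof.
move=> cf; have cvgf (x : Rd) : f (mdown k (mround k x)) @[k --> \oo] --> f x.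
  exact: (cvg_comp _ _ (@cvg_mdown x) (cf x)).
apply: (@measurable_fun_cvg _ _ _ _ (fun k => (f \o mdown k) \o mround k)).
  by move=> k; apply: measurable_countable_factor => z; exact: measurable_mround.
by move=> x _; exact: cvgf.
Qed.

End rV_measurability.

Section caratheodory.
Context {R : realType} {d : nat}.
Local Notation Rd := 'rV[R]_d.

Lemma within_domain_eps (E : set R) (F : Rd -> R -> R -> R) x e t (eps : R) :
  {within domain E, continuous (uncurry3 F)} -> E e -> 0 < eps ->
  exists2 del : R, 0 < del & forall x' e' t', E e' -> `|x - x'| < del ->
    `|e - e'| < del -> `|t - t'| < del -> `|F x e t - F x' e' t'| < eps.
Proof.
move=> cF Ee eps0.
have /= cFx : uncurry3 F @ within (domain E) (nbhs (x, e, t)) --> F x e t.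
  by have := cF (x, e, t); rewrite /continuous_at /nbhs/= -nbhs_subspace_in; last exact: Ee.
have {cFx} : within (domain E) (nbhs (x, e, t)) [set q | `|F x e t - uncurry3 F q| < eps].
  exact: (@cvgr_dist_lt _ _ _ _ _ (uncurry3 F) _ cFx eps eps0).
rewrite /within/= => /nbhs_ballP[del /= del0 sub].
exists del => // x' e' t' Ee' hx he ht.
have := sub (x', e', t'); apply => //=.
by split; [split|]; rewrite -ball_normE.
Qed.

Lemma within_domain_cvg (E : set R) (F : Rd -> R -> R -> R) x e t
    (x_ : nat -> Rd) (e_ t_ : nat -> R) :
  {within domain E, continuous (uncurry3 F)} -> E e -> (forall n, E (e_ n)) ->
  x_ n @[n --> \oo] --> x -> e_ n @[n --> \oo] --> e -> t_ n @[n --> \oo] --> t ->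
  F (x_ n) (e_ n) (t_ n) @[n --> \oo] --> F x e t.
Proof.
move=> cF Ee Ee_ cx ce ct; apply/cvgrPdist_lt => eps eps0.
have [del del0 h] := @within_domain_eps E F x e t eps cF Ee eps0.
have h1 := @cvgr_dist_lt _ _ _ _ _ _ _ cx del del0.
have h2 := @cvgr_dist_lt _ _ _ _ _ _ _ ce del del0.
have h3 := @cvgr_dist_lt _ _ _ _ _ _ _ ct del del0.
near=> n; apply: h => //; near: n; [exact: h1|exact: h2|exact: h3].
Unshelve. all: end_near. Qed.

(* Joint continuity only holds on Rd x E x R: the second argument is rounded up
   so that it stays in E. *)
Lemma measurable_nemytskii (E : set R) (F : Rd -> R -> R -> R) (m k : Rd -> R) :
  (forall x y, E x -> x <= y -> E y) ->
  {within domain E, continuous (uncurry3 F)} -> (forall x, E (m x)) ->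
  measurable_fun setT m -> measurable_fun setT k ->
  measurable_fun setT (fun x => F x (m x) (k x)).
Proof.
move=> Eup cF Em mm mk.
pose r n (x : Rd) := (mround n x, iround n (m x), iround n (k x)).
pose G n (p : 'rV[int]_d * int * int) := F (mdown n p.1.1) (rup n p.1.2) (rdown n p.2).
have cvgF (x : Rd) : G n (r n x) @[n --> \oo] --> F x (m x) (k x).
  apply: (within_domain_cvg cF (Em x) _ (@cvg_mdown _ _ x) (@cvg_rup _ (m x)) (@cvg_rdown _ (k x))) => n.
  by apply: Eup (Em x) _ => /=; have /andP[+ _] := rup_near n (m x); rewrite subr_ge0.
apply: (@measurable_fun_cvg _ _ _ _ (fun n => G n \o r n)).
  move=> n; apply: measurable_countable_factor => -[[z1 z2] z3].
  rewrite (_ : _ @^-1` _ = mround n @^-1` [set z1] `&`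
     (iround n \o m) @^-1` [set z2] `&` (iround n \o k) @^-1` [set z3]).
    apply: measurableI; first apply: measurableI.
    - exact: measurable_mround.
    - exact: measurable_iround.
    - exact: measurable_iround.
  apply/seteqP; split=> x; rewrite /r /preimage/=.
    by move=> [-> -> ->].
  by move=> [[-> ->] ->].
by move=> x _; exact: cvgF.
Qed.
End caratheodory.

(** * Integration on the torus *)

Section unit_interval_integral.
Context {R : realType}.
Local Notation uim := (@unit_interval_measure R).
Local Notation leb := (@lebesgue_measure R).
Implicit Types g : R -> R.

Lemma bounded_integrable {dT} {T : measurableType dT} (P : {finite_measure set T -> \bar R})
    (f : T -> R) M :
  measurable_fun setT f -> (forall x, `|f x| <= M) -> P.-integrable setT (EFin \o f).
Proof.
move=> mf fM; apply: measurable_bounded_integrable => //.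
  by have := fin_num_measure P setT measurableT; rewrite ge0_fin_numE.
by exists M; split; [exact: num_real|move=> N MN x _ /=; exact: le_trans (fM x) (ltW MN)].
Qed.

Lemma continuous_integrable_itv g (a b : R) : continuous g ->
  leb.-integrable `[a, b] (EFin \o g).
Proof.
move=> cg; apply: continuous_compact_integrable; first exact: segment_compact.
exact: continuous_subspaceT.
Qed.

Lemma unit_interval_integral g (M : R) : continuous g -> (forall t, `|g t| <= M) ->
  (\int[uim]_t (g t)%:E = \int[leb]_(t in `[0%R, 1%R]) (g t)%:E)%E.
Proof.
move=> cg gM; have mg : measurable_fun setT g by exact: continuous_measurable_fun.
have gi : uim.-integrable setT (EFin \o g).
  exact: (@bounded_integrable _ (measurableTypeR R) uim g M mg gM).
rewrite (@negligible_integral _ (measurableTypeR R) _ _ setT (~` `[0%R, 1%R]%classic))//=.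
- rewrite setTD setCK; apply: eq_measure_integral => A mA AI.
  change (leb (A `&` `[0%R, 1%R]%classic) = leb A); by rewrite setIidl.
- exact/measurableC.
- change (leb (~` `[0%R, 1%R]%classic `&` `[0%R, 1%R]%classic) = 0%E).
  by rewrite setICl measure0.
Qed.

Lemma continuous_primitive g (L : R) : continuous g ->
  exists P : R -> R, forall x, - L < x -> x < L -> is_derive x 1 P (g x).
Proof.
move=> cg; exists (fun x => \int[leb]_(t in `[(- L)%R, x]) g t)%R => x Lx xL.
have [D <-] := continuous_FTC1_closed xL (@continuous_integrable_itv g (- L) L cg) Lx (cg x).
rewrite derive1E; exact: DeriveDef.
Qed.

(** With a primitive [P] of [g], the shifted integral is [P (1 + b) - P (0 + b)]. Its derivative in
    [b] is [g (b + 1) - g (b + 0)], which vanishes by periodicity, so the value at [a] equals the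
    value at 0. *)
Lemma unit_interval_shift g (a M : R) : continuous g -> (forall t, `|g t| <= M) -> (forall t, g (t + 1) = g t) ->
  (\int[uim]_t (g (t + a))%:E = \int[uim]_t (g t)%:E)%E.
Proof.
move=> cg gM pg.
have cga (b : R) : continuous (fun t => g (t + b)).
  move=> t; apply: (@continuous_comp _ _ _ (fun t => t + b) g); last exact: cg.
  by apply: cvgD; [exact: cvg_id|exact: cvg_cst].
rewrite (@unit_interval_integral _ M)// (@unit_interval_integral _ M)//.
(* [P] is a primitive on []-L, L[] only. The margin 3 keeps [x + b] inside for x between -1 and 2
   and |b| <= |a|, hence a two-sided derivative at both ends of the unit interval. *)
set L : R := `|a| + 3; have [P dP] := continuous_primitive L cg.
have dsh (c x : R) : - L < x + c -> x + c < L -> is_derive x 1 (fun t => P (t + c)) (g (x + c)).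
  move=> h1 h2; have d1 : is_derive x 1 (fun t => t + c) 1 by apply: is_derive_eq; rewrite addr0.
  have d2 : is_derive (x + c) 1 P (g (x + c)) by exact: dP.
  by have := is_derive1_comp (f := P) (g := fun t => t + c); move=> /(_ x _ _ d2 d1); rewrite mulr1.
have dPs (b x : R) : `|b| <= `|a| -> 0 - 1 < x -> x < 2 -> is_derive x 1 (fun t => P (t + b)) (g (x + b)).
  move=> ba x0 x1.
  have := ler_norm b; have := ler_norm (- b); rewrite normrN => h1 h2.
  by apply: dsh; rewrite /L; lra.
have intE (b : R) : `|b| <= `|a| ->
    (\int[leb]_(t in `[0%R, 1%R]) (g (t + b))%:E = (P (1 + b) - P (0 + b))%:E)%E.
  move=> ba; rewrite (@continuous_FTC2 _ _ (fun t => P (t + b)))//.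
  - exact: continuous_subspaceT.
  - have cP (x : R) : 0 <= x <= 1 -> (fun t => P (t + b)) @ x --> P (x + b).
      move=> /andP[x0 x1]; have [||D _] := dPs b x ba; [lra|lra|].
      exact/differentiable_continuous/derivable1_diffP.
    split=> [x||]; rewrite ?in_itv/=.
    + by move=> /andP[x0 x1]; have [||D _] := dPs b x ba; [lra|lra|].
    + by apply: cvg_at_right_filter; apply: cP; rewrite lexx ler01.
    + by apply: cvg_at_left_filter; apply: cP; rewrite lexx ler01.
  - move=> x; rewrite in_itv/= => /andP[x0 x1]; rewrite derive1E.
    by apply: derive_val; apply: dPs; lra.
rewrite intE// -[in RHS](_ : (fun t => g (t + 0)) = g); last by apply/funext => t; rewrite addr0.
rewrite intE ?normr0//; congr EFin.
pose Q (b : R) := P (1 + b) - P (0 + b).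
have dQ (b : R) : `|b| <= `|a| -> is_derive b 1 Q 0.
  move=> ba; have := ler_norm b; have := ler_norm (- b); rewrite normrN => h1 h2.
  have e0 : is_derive b 1 (fun t => P (1 + t)) (g (b + 1)).
    rewrite (_ : (fun t => P (1 + t)) = (fun t => P (t + 1))); last by apply/funext => t; rewrite addrC.
    by apply: dsh; rewrite /L; lra.
  have e1 : is_derive b 1 (fun t => P (0 + t)) (g (b + 0)).
    rewrite (_ : (fun t => P (0 + t)) = (fun t => P (t + 0))); last by apply/funext => t; rewrite addrC.
    by apply: dsh; rewrite /L; lra.
  by apply: is_derive_eq; rewrite pg addr0 subrr.
suff : Q a = Q 0 by [].
have h b1 b2 : `|b1| <= `|a| -> `|b2| <= `|a| -> b1 <= b2 -> Q b2 = Q b1.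
  rewrite !ler_norml => /andP[h1 h2] /andP[h3 h4] b12.
  apply/eqP; rewrite -subr_eq0; apply/eqP.
  have [||c _ ->] := @MVT_segment _ Q (fun=> 0) b1 b2 b12; last by rewrite mul0r.
    by move=> x; rewrite in_itv/= => /andP[x1 x2]; apply: dQ; rewrite ler_norml; lra.
  apply: derivable_within_continuous => x; rewrite in_itv/= => /andP[x1 x2].
  by have [|] := dQ x; [rewrite ler_norml; lra|].
have [a0|a0] := leP 0 a; first by apply: h; rewrite ?normr0.
by apply/esym/h; rewrite ?normr0// ltW.
Qed.
End unit_interval_integral.

Section periodic_functions.
Context {R : realType} {d : nat}.
Local Notation Rd := 'rV[R]_d.
Local Notation mu := (torus_measure R d).
Local Notation periodic := Defs.periodic.
Implicit Types f k : Rd -> R.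

Lemma continuous_epsP {U V : normedModType R} (f : U -> V) : continuous f <->
  forall x (e : R), 0 < e -> exists2 del : R, 0 < del &
    forall y, `|x - y| < del -> `|f x - f y| < e.
Proof.
split=> [cf x e e0|h x].
  have /cvgrPdist_lt/(_ e e0)/nbhs_ballP[del /= del0 sub] := cf x.
  by exists del => // y xy; apply: sub; rewrite -ball_normE.
apply/cvgrPdist_lt => e e0; have [del del0 sub] := h x e e0.
apply/nbhs_ballP; exists del => //= y; rewrite -ball_normE /= => xy.
exact: sub.
Qed.

Lemma periodicMn f (x : Rd) (i : 'I_d) (n : nat) : periodic f -> f (x + delta_mx 0 i *+ n) = f x.
Proof. by move=> pf; elim: n => [|n ih]; rewrite ?mulr0n ?addr0// mulrSr addrA pf ih. Qed.

Lemma periodicMz f (x : Rd) (i : 'I_d) (z : int) : periodic f -> f (x + delta_mx 0 i *~ z) = f x.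
Proof.
move=> pf; case: z => n; first by rewrite -pmulrn periodicMn.
by rewrite NegzE mulrNz -pmulrn -{2}(subrK (delta_mx 0 i *+ n.+1) x) periodicMn.
Qed.

Lemma periodicD f (x : Rd) (z : 'rV[int]_d) : periodic f -> f (x + map_mx intr z) = f x.
Proof.
move=> pf; rewrite [map_mx intr z]row_sum_delta.
elim: (index_enum _) x => [|j r ih] x; first by rewrite big_nil addr0.
by rewrite big_cons addrA ih mxE scaler_int periodicMz.
Qed.

Lemma cube_reduction (x : Rd) : exists z : 'rV[int]_d,
  forall i, 0 <= (x + map_mx intr z) ord0 i <= 1.
Proof.
pose z : 'rV[int]_d := map_mx Num.floor x.
exists (- z) => i; rewrite !mxE mulrNz subr_ge0 lerBlDr.
by rewrite Num.Theory.floor_le ?num_real//= addrC -[X in _ + X](_ : 1%:~R = 1)// -intrD ltW// Num.Theory.floorD1_gt// num_real.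
Qed.

Lemma cube_compact : compact [set y : Rd | forall i, 0 <= y ord0 i <= 1].
Proof.
have := @rV_compact R d (fun=> `[0%R, 1%R]%classic) (fun=> @segment_compact R 0 1).
congr compact; apply/seteqP; split=> y /= yi i; have := yi i; by rewrite in_itv.
Qed.

Lemma torus_continuous_bounded f : torus_continuous f -> exists M : R, forall x, `|f x| <= M.
Proof.
move=> [pf cf]; have := continuous_compact (continuous_subspaceT cf) cube_compact.
move=> /compact_bounded[M [_ /(_ (M + 1))]]; rewrite ltrDl ltr01 => /(_ isT) h.
by exists (M + 1) => x; have [z y01] := cube_reduction x; rewrite -(periodicD x z pf); apply: h; eexists; [exact: y01|].
Qed.

Lemma torus_continuous_measurable f : torus_continuous f -> measurable_fun setT f.
Proof. by move=> [_ cf]; exact: continuous_measurable_rV. Qed.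

Lemma torus_continuous_integrable f : torus_continuous f -> mu.-integrable setT (EFin \o f).
Proof.
move=> tf; have [M fM] := torus_continuous_bounded tf.
exact: (bounded_integrable _ (torus_continuous_measurable tf) fM).
Qed.

Lemma torus_continuous_cst (a : R) : torus_continuous (fun _ : Rd => a).
Proof. by split => // x; exact: cst_continuous. Qed.

Lemma torus_continuousD f k : torus_continuous f -> torus_continuous k ->
  torus_continuous (fun x => f x + k x).
Proof.
move=> [pf cf] [pk ck]; split=> [x i|x]; first by rewrite pf pk.
by have /= := continuousD (cf x) (ck x).
Qed.

Lemma torus_continuousM f k : torus_continuous f -> torus_continuous k ->
  torus_continuous (fun x => f x * k x).
Proof.
move=> [pf cf] [pk ck]; split=> [x i|x]; first by rewrite pf pk.
exact: (@continuousM _ _ f k x (cf x) (ck x)).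
Qed.

Lemma torus_continuousN f : torus_continuous f -> torus_continuous (fun x => - f x).
Proof.
by move=> [pf cf]; split=> [x i|x]; [rewrite pf|exact: (@continuousN _ _ _ f x (cf x))].
Qed.

Lemma torus_continuousB f k : torus_continuous f -> torus_continuous k ->
  torus_continuous (fun x => f x - k x).
Proof. by move=> tf tk; apply: torus_continuousD => //; exact: torus_continuousN. Qed.

Lemma torus_continuousX f n : torus_continuous f -> torus_continuous (fun x => f x ^+ n).
Proof.
move=> tf; elim: n => [|n ih]; first exact: torus_continuous_cst.
rewrite (_ : (fun _ => _) = fun x => f x * f x ^+ n); first exact: torus_continuousM.
by apply/funext => x; rewrite exprS.
Qed.

Lemma torus_continuous_sum (J : Type) (r : seq J) (P : pred J) (F : J -> Rd -> R) :
  (forall j, torus_continuous (F j)) -> torus_continuous (fun x => \sum_(j <- r | P j) F j x).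
Proof.
move=> tF; elim: r => [|j r ih].
  rewrite (_ : (fun _ => _) = fun=> 0); first exact: torus_continuous_cst.
  by apply/funext => x; rewrite big_nil.
case: (boolP (P j)) => Pj.
  rewrite (_ : (fun _ => _) = fun x => F j x + \sum_(j <- r | P j) F j x).
    exact: torus_continuousD.
  by apply/funext => x; rewrite big_cons Pj.
rewrite (_ : (fun _ => _) = fun x => \sum_(j <- r | P j) F j x)//.
by apply/funext => x; rewrite big_cons (negbTE Pj).
Qed.

Lemma torus_continuous_comp f (k : R -> R) : torus_continuous f -> continuous k ->
  torus_continuous (fun x => k (f x)).
Proof.
move=> [pf cf] ck; split=> [x i|x]; first by rewrite pf.
by apply: (@continuous_comp _ _ _ f k); [exact: cf|exact: ck].
Qed.

Lemma torus_continuous_shift f (a : Rd) : torus_continuous f ->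
  torus_continuous (fun x => f (x + a)).
Proof.
move=> [pf cf]; split=> [x i|x]; first by rewrite addrAC pf.
have h : {for x, continuous (fun x : Rd => x + a)}.
  by apply: continuousD; [exact: cvg_id|exact: cst_continuous].
exact: (continuous_comp h (cf _)).
Qed.

Lemma torus_continuous_reflect f (a : Rd) : torus_continuous f ->
  torus_continuous (fun x => f (a - x)).
Proof.
move=> [pf cf]; split=> [x i|x].
  by rewrite opprD addrA -[in RHS](subrK (delta_mx 0 i) (a - x)) pf.
have h : {for x, continuous (fun x : Rd => a - x)}.
  by apply: continuousB; [exact: cst_continuous|exact: cvg_id].
exact: (continuous_comp h (cf _)).
Qed.

End periodic_functions.

Lemma integral_transfer (R : realType) d1 d2 (X : measurableType d1) (Y : measurableType d2)
    (P : {measure set X -> \bar R}) (Q : {measure set Y -> \bar R}) (phi : X -> Y)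
    (f : Y -> \bar R) :
  measurable_fun setT phi -> (forall A, measurable A -> Q A = P (phi @^-1` A)) ->
  measurable_fun setT f -> P.-integrable setT (f \o phi) ->
  (\int[Q]_y f y = \int[P]_x f (phi x))%E.
Proof.
move=> mphi QP mf fi; have := @integral_pushforward _ _ _ _ _ _ mphi P setT f mf fi measurableT.
by rewrite preimage_setT => <-; apply: eq_measure_integral => A mA _; rewrite QP.
Qed.

Section slices.
Context {R : realType} {n : nat}.
Local Notation periodic := Defs.periodic.
Local Notation uim := (@unit_interval_measure R).
Implicit Types f : 'rV[R]_n.+1 -> R.

Lemma rV_consD (t s : R) (y z : 'rV[R]_n) :
  rV_cons (t + s, y + z) = rV_cons (t, y) + rV_cons (s, z).
Proof. by rewrite /rV_cons/= raddfD/= -add_row_mx. Qed.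

Lemma rV_consE (a : 'rV[R]_n.+1) : exists s z, a = rV_cons (s, z).
Proof.
exists ((lsubmx (a : 'rV_(1 + n))) 0 0), (rsubmx (a : 'rV_(1 + n))).
by rewrite /rV_cons/= -mx11_scalar hsubmxK.
Qed.

Lemma rV_cons_head : rV_cons (1, 0) = delta_mx 0 0 :> 'rV[R]_n.+1.
Proof.
apply/rowP => i; case: (split_ordP (i : 'I_(1 + n))) => j ->.
  by rewrite [LHS]row_mxEl !ord1 !mxE !eqxx.
by rewrite [LHS]row_mxEr !mxE.
Qed.

Lemma rV_cons_delta (i : 'I_n) : rV_cons (0, delta_mx 0 i) = delta_mx 0 (lift ord0 i) :> 'rV[R]_n.+1.
Proof.
apply/rowP => k; case: (split_ordP (k : 'I_(1 + n))) => j ->.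
  by rewrite [LHS]row_mxEl !ord1 !mxE.
by rewrite [LHS]row_mxEr !mxE eqxx/=.
Qed.

Lemma norm_rV_cons (t : R) (y : 'rV[R]_n) e : 0 <= e -> `|t| <= e -> `|y| <= e -> `|rV_cons (t, y)| <= e.
Proof.
move=> e0 te ye; apply/rV_norm_leP => // i.
case: (split_ordP (i : 'I_(1 + n))) => j ->.
  by rewrite [rV_cons _ _ _]row_mxEl !ord1 !mxE /=.
rewrite [rV_cons _ _ _]row_mxEr; exact: le_trans (coord_le_norm y j) ye.
Qed.

Lemma slice_tail_continuous f t : torus_continuous f -> torus_continuous (fun y => f (rV_cons (t, y))).
Proof.
move=> [pf cf]; split=> [y i|].
  by rewrite -[t]addr0 rV_consD rV_cons_delta pf addr0.
apply/continuous_epsP => y e e0; have /continuous_epsP/(_ (rV_cons (t, y)) e e0)[del del0 h] := cf.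
exists del => // z yz; apply: h; apply: le_lt_trans yz.
rewrite (_ : _ - rV_cons _ = rV_cons (0, y - z)).
  by apply: norm_rV_cons => //; rewrite normr0.
by apply/eqP; rewrite subr_eq -rV_consD add0r subrK.
Qed.

Lemma slice_head_continuous f y : torus_continuous f ->
  continuous (fun t => f (rV_cons (t, y))) /\ forall t, f (rV_cons (t + 1, y)) = f (rV_cons (t, y)).
Proof.
move=> [pf cf]; split=> [|t]; last first.
  by rewrite -[y in LHS]addr0 rV_consD rV_cons_head pf.
apply/continuous_epsP => t e e0; have /continuous_epsP/(_ (rV_cons (t, y)) e e0)[del del0 h] := cf.
exists del => // s ts; apply: h; apply: le_lt_trans ts.
rewrite (_ : _ - rV_cons _ = rV_cons (t - s, 0)).
  by apply: norm_rV_cons => //; rewrite normr0.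
by apply/eqP; rewrite subr_eq -rV_consD add0r subrK.
Qed.

Lemma fubini_rV_cons f M : measurable_fun setT f -> (forall x, `|f x| <= M) ->
  ((\int[torus_measure R n.+1]_x (f x)%:E = \int[uim]_t \int[torus_measure R n]_y (f (rV_cons (t, y)))%:E) /\
   (\int[torus_measure R n.+1]_x (f x)%:E = \int[torus_measure R n]_y \int[uim]_t (f (rV_cons (t, y)))%:E))%E.
Proof.
move=> mf fM.
have mfc : measurable_fun setT (f \o @rV_cons R n).
  by apply: measurableT_comp => //; exact: measurable_rV_cons.
have ifc : (uim \x torus_measure R n)%E.-integrable setT (EFin \o (f \o @rV_cons R n)).
  apply: measurable_bounded_integrable => //.
    have := @product_measure1E _ _ _ _ _ uim (torus_measure R n) setT setT measurableT measurableT.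
    rewrite setXTT => h; apply: (@le_lt_trans _ _ (uim setT * torus_measure R n setT)%E).
      by rewrite -h.
    by rewrite !probability_setT mule1 ltry.
  by exists M; split; [exact: num_real|move=> N MN x _ /=; exact: le_trans (fM _) (ltW MN)].
have mf' : measurable_fun setT (EFin \o f) by exact/measurable_EFinP.
rewrite (@integral_transfer _ _ _ _ _ (uim \x torus_measure R n)%E (torus_measure R n.+1) (@rV_cons R n) (EFin \o f)) => //.
split.
  by rewrite -integral12_prod_meas1.
by rewrite -integral21_prod_meas1.
exact: measurable_rV_cons.
Qed.

End slices.

Section torus_shift.
Context {R : realType}.
Local Notation uim := (@unit_interval_measure R).

(** Induction on the dimension: the translation of the tail is absorbed slice by slice by the
    induction hypothesis, and the translation of the head becomes one-dimensional once the order of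
    integration is exchanged. *)
Lemma torus_shift_ereal n (f : 'rV[R]_n -> R) a : torus_continuous f ->
  (\int[torus_measure R n]_x (f (x + a))%:E = \int[torus_measure R n]_x (f x)%:E)%E.
Proof.
elim: n f a => [|n ih] f a tf.
  by apply: eq_integral => x _; rewrite thinmx0 (thinmx0 x).
have [M fM] := torus_continuous_bounded tf.
have mf := torus_continuous_measurable tf.
have [s [z ->]] := rV_consE a.
have [-> _] := fubini_rV_cons (torus_continuous_measurable (torus_continuous_shift (rV_cons (s, z)) tf)) (fun x => fM _).
transitivity (\int[uim]_t \int[torus_measure R n]_y (f (rV_cons (t, y) + rV_cons (s, 0)))%:E)%E.
  apply: eq_integral => t _.
  rewrite -(ih (fun y => f (rV_cons (t, y) + rV_cons (s, 0))) z).
    by apply: eq_integral => y _; rewrite -!rV_consD addr0.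
  exact: (slice_tail_continuous t (torus_continuous_shift _ tf)).
have ts := torus_continuous_shift (rV_cons (s, 0)) tf.
have [<- ->] := fubini_rV_cons (torus_continuous_measurable ts) (fun x => fM _).
have [_ ->] := fubini_rV_cons mf fM.
apply: eq_integral => y _.
have [cg pg] := slice_head_continuous y tf.
rewrite -(@unit_interval_shift _ (fun t => f (rV_cons (t, y))) s M)//.
by apply: eq_integral => t _; rewrite -rV_consD addr0.
Qed.

Lemma torus_shift n (f : 'rV[R]_n -> R) a : torus_continuous f ->
  \int[torus_measure R n]_x f (x + a) = \int[torus_measure R n]_x f x.
Proof. by move=> tf; rewrite /Rintegral torus_shift_ereal. Qed.

End torus_shift.

Lemma Rintegral_dominated (R : realType) dT (T : measurableType dT)
    (P : {measure set T -> \bar R}) (f_ : nat -> T -> R) (f g : T -> R) :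
  (forall n, measurable_fun setT (f_ n)) -> measurable_fun setT f ->
  {ae P, forall x, f_ n x @[n --> \oo] --> f x} ->
  P.-integrable setT (EFin \o g) ->
  {ae P, forall x n, `|f_ n x| <= g x} ->
  P.-integrable setT (EFin \o f) /\
  \int[P]_x f_ n x @[n --> \oo] --> \int[P]_x f x.
Proof.
move=> mf_ mf cf ig fg.
have mf_' n : measurable_fun setT (EFin \o f_ n) by exact/measurable_EFinP.
have mf' : measurable_fun setT (EFin \o f) by exact/measurable_EFinP.
have [] := @dominated_convergence _ _ _ P setT measurableT (fun n => EFin \o f_ n) (EFin \o f) (EFin \o g) mf_' mf'.
- by apply: filterS cf => x cfx _; apply/cvg_EFin; [exact: nearW|].
- exact: ig.
- by apply: filterS fg => x fgx n _ /=; rewrite lee_fin.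
move=> fi _ ci; split=> //; apply: fine_cvg; rewrite fineK; first exact: ci.
exact: integrable_fin_num.
Qed.

Lemma cvg_seq_unique (R : realType) (u : nat -> R) (a b : R) :
  u n @[n --> \oo] --> a -> u n @[n --> \oo] --> b -> a = b.
Proof.
by move=> ua ub; rewrite -(cvg_lim (@Rhausdorff R) ua) -(cvg_lim (@Rhausdorff R) ub).
Qed.

(** * Directional derivatives and integration by parts on the torus *)

Section directional.
Context {R : realType} {V : normedModType R}.
Implicit Types (f k : V -> R) (x v : V).

(** A directional derivative is the ordinary derivative of the restriction to a line; the chain
    rule, the mean value theorem and the effect of translations and reflections are imported from
    one variable through this equivalence. *)
Lemma is_derive_lineP f x v (t l : R) :
  is_derive (x + t *: v) v f l <-> is_derive t 1 (fun s : R => f (x + s *: v)) l.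
Proof.
have e : (fun h : R => h^-1 *: (((fun s : R => f (x + s *: v)) \o shift t) (h *: (1 : R)) - f (x + t *: v))) =
    (fun h : R => h^-1 *: ((f \o shift (x + t *: v)) (h *: v) - f (x + t *: v))).
  by apply/funext => h /=; rewrite [h *: (1 : R)](mulr1) scalerDl addrCA.
by split=> -[D <-]; split; move: D; rewrite /derivable /derive e.
Qed.

Lemma is_derive_line f x v (t l : R) :
  is_derive (x + t *: v) v f l -> is_derive t 1 (fun s : R => f (x + s *: v)) l.
Proof. by move/is_derive_lineP. Qed.

Lemma line_derivable f x v l :
  is_derive (0 : R) 1 (fun s : R => f (x + s *: v)) l -> is_derive x v f l.
Proof. by move/is_derive_lineP; rewrite scale0r addr0. Qed.

Lemma is_derive_comp_real f (phi : R -> R) x v l l' :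
  is_derive x v f l -> is_derive (f x) 1 phi l' -> is_derive x v (phi \o f) (l' * l).
Proof.
move=> df dphi; apply: line_derivable.
have d1 : is_derive (0 : R) 1 (fun s : R => f (x + s *: v)) l.
  by apply: is_derive_line; rewrite scale0r addr0.
apply: (@is_derive1_comp _ phi (fun s : R => f (x + s *: v))).
by rewrite scale0r addr0.
Qed.

Lemma line_mvt f v : (forall x, derivable f x v) -> forall x (t : R),
  exists s : R, `|s| <= `|t| /\ f (x + t *: v) - f x = t * 'D_v f (x + s *: v).
Proof.
move=> df x t.
have D (s : R) : is_derive s 1 (fun s : R => f (x + s *: v)) ('D_v f (x + s *: v)).
  by apply: is_derive_line; exact: derivableP.
have C : continuous (fun s : R => f (x + s *: v)).
  by move=> s; have [D1 _] := D s; exact/differentiable_continuous/derivable1_diffP.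
have [t0|t0] := leP 0 t.
  have [|c] := @MVT_segment _ (fun s : R => f (x + s *: v)) (fun s => 'D_v f (x + s *: v)) 0 t t0.
    exact: continuous_subspaceT.
  rewrite in_itv/= => /andP[c0 ct]; rewrite scale0r addr0 subr0 mulrC => e.
  by exists c; split=> //; rewrite !ger0_norm.
have [|c] := @MVT_segment _ (fun s : R => f (x + s *: v)) (fun s => 'D_v f (x + s *: v)) t 0 (ltW t0).
  exact: continuous_subspaceT.
rewrite in_itv/= => /andP[ct c0]; rewrite scale0r addr0 sub0r => e.
exists c; split; first by rewrite !ler0_norm// ?lerN2// ltW.
by rewrite -opprB e mulrN opprK mulrC.
Qed.

End directional.

Section torus_C1.
Context {R : realType} {d : nat}.
Local Notation Rd := 'rV[R]_d.
Local Notation mu := (torus_measure R d).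
Implicit Types f k : Rd -> R.

Definition torus_C1 f := torus_continuous f /\ forall i : 'I_d,
  (forall x, derivable f x (delta_mx 0 i)) /\ torus_continuous (pd i f).

Lemma torus_C1_intro f (df : 'I_d -> Rd -> R) : torus_continuous f ->
  (forall i, torus_continuous (df i)) ->
  (forall i x, is_derive x (delta_mx 0 i) f (df i x)) -> torus_C1 f /\ forall i, pd i f = df i.
Proof.
move=> tf tdf D.
have e i : pd i f = df i by apply/funext => x; have [_ <-] := D i x.
by split=> //; split=> // i; split=> [x|]; [have [] := D i x|rewrite e].
Qed.

Lemma torus_C1_derive f i x : torus_C1 f -> is_derive x (delta_mx 0 i) f (pd i f x).
Proof. by move=> [_ /(_ i)[h _]]; exact: derivableP. Qed.

Lemma norm_delta (i : 'I_d) : `|delta_mx 0 i : Rd| <= 1.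
Proof.
apply/rV_norm_leP => // j; rewrite mxE eqxx /=.
by case: (_ == _); rewrite ?normr1 ?normr0.
Qed.

Lemma torus_C1_cst (a : R) : torus_C1 (fun _ : Rd => a) /\ forall i : 'I_d, pd i (fun=> a) = fun=> 0.
Proof.
apply: (torus_C1_intro (df := fun i x => 0)) => [|i]; exact: torus_continuous_cst.
Qed.

Lemma torus_C1D f k : torus_C1 f -> torus_C1 k ->
  torus_C1 (fun x => f x + k x) /\ forall i, pd i (fun x => f x + k x) = fun x => pd i f x + pd i k x.
Proof.
move=> cf ck; apply: (torus_C1_intro (df := fun i x => pd i f x + pd i k x)) => [|i|i x].
- by apply: torus_continuousD; [exact: cf.1|exact: ck.1].
- by apply: torus_continuousD; [exact: (cf.2 i).2|exact: (ck.2 i).2].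
- by apply: is_deriveD; exact: torus_C1_derive.
Qed.

Lemma torus_C1M f k : torus_C1 f -> torus_C1 k ->
  torus_C1 (fun x => f x * k x) /\
  forall i, pd i (fun x => f x * k x) = fun x => f x * pd i k x + k x * pd i f x.
Proof.
move=> cf ck; apply: (torus_C1_intro (df := fun i x => f x * pd i k x + k x * pd i f x)) => [|i|i x].
- by apply: torus_continuousM; [exact: cf.1|exact: ck.1].
- apply: torus_continuousD; apply: torus_continuousM;
    by [exact: cf.1|exact: ck.1|exact: (cf.2 i).2|exact: (ck.2 i).2].
- by apply: is_deriveM; exact: torus_C1_derive.
Qed.

Lemma torus_C1_comp f (phi phi' : R -> R) : torus_C1 f ->
  (forall x, is_derive (f x) 1 phi (phi' (f x))) ->
  torus_continuous (phi \o f) -> torus_continuous (phi' \o f) ->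
  torus_C1 (fun x => phi (f x)) /\
  forall i, pd i (fun x => phi (f x)) = fun x => phi' (f x) * pd i f x.
Proof.
move=> cf D c1 c2; apply: (torus_C1_intro (df := fun i x => phi' (f x) * pd i f x)) => [//|i|i x].
- by apply: torus_continuousM => //; exact: (cf.2 i).2.
- by apply: is_derive_comp_real (D x); exact: torus_C1_derive.
Qed.

(** The difference quotients have integral 0 by invariance under translations. They converge to the
    derivative, and the mean value theorem dominates them by its supremum. *)
Lemma Rintegral_pd f i : torus_C1 f -> \int[mu]_x pd i f x = 0.
Proof.
move=> cf; have tp := (cf.2 i).2; have [M pM] := torus_continuous_bounded tp.
pose q n (x : Rd) := n.+1%:R * (f (x + n.+1%:R^-1 *: delta_mx 0 i) - f x).
have mvt n x : exists s : R, `|s| <= n.+1%:R^-1 /\ q n x = pd i f (x + s *: delta_mx 0 i).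
  have [s [sn e]] := line_mvt (cf.2 i).1 x n.+1%:R^-1.
  by exists s; split; [rewrite -[leRHS]ger0_norm|rewrite /q e mulrA mulfV// mul1r].
have tq n : torus_continuous (q n).
  apply: torus_continuousM; first exact: torus_continuous_cst.
  by apply: torus_continuousB; [apply: torus_continuous_shift|]; exact: cf.1.
have qc x : q n x @[n --> \oo] --> pd i f x.
  apply/cvgrPdist_lt => e e0.
  have /continuous_epsP/(_ x e e0)[del del0 h] := tp.2.
  have := @cvg_harmonic R => /cvgrPdist_lt/(_ del del0); apply: filterS => n.
  rewrite sub0r normrN => hn; have [s [sn ->]] := mvt n x; apply: h.
  rewrite opprD addNKr normrN normrZ.
  apply: le_lt_trans (_ : n.+1%:R^-1 < del).
    by rewrite -[leRHS]mulr1 ler_pM// norm_delta.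
  by apply: le_lt_trans hn; rewrite ler_norm.
have [|||||_] := @Rintegral_dominated _ _ _ mu q (pd i f) (fun=> M).
- by move=> n; exact: torus_continuous_measurable.
- exact: torus_continuous_measurable.
- by apply: aeW => x; exact: qc.
- exact: torus_continuous_integrable (torus_continuous_cst _).
- by apply: aeW => x n; have [s [_ ->]] := mvt n x.
rewrite (_ : (fun n => _) = fun=> 0); last first.
  apply/funext => n; rewrite RintegralZl//; last first.
    apply: torus_continuous_integrable.
    by apply: torus_continuousB; [apply: torus_continuous_shift|]; exact: cf.1.
  rewrite RintegralB//; last 2 first.
  - by apply: torus_continuous_integrable; apply: torus_continuous_shift; exact: cf.1.
  - by apply: torus_continuous_integrable; exact: cf.1.
  by rewrite torus_shift ?subrr ?mulr0//; exact: cf.1.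
move=> h; have h0 : (fun _ : nat => (0 : R)) n @[n --> \oo] --> (0 : R) by exact: cvg_cst.
exact: (cvg_seq_unique h h0).
Qed.

Lemma Rintegral_by_parts f k i : torus_C1 f -> torus_C1 k ->
  \int[mu]_x (pd i f x * k x) = - \int[mu]_x (f x * pd i k x).
Proof.
move=> cf ck; have [cfk /(_ i) e] := torus_C1M cf ck; have := Rintegral_pd i cfk.
rewrite e RintegralD//; last 2 first.
- by apply: torus_continuous_integrable; apply: torus_continuousM; [exact: cf.1|exact: (ck.2 i).2].
- by apply: torus_continuous_integrable; apply: torus_continuousM; [exact: ck.1|exact: (cf.2 i).2].
by move/eqP; rewrite addrC addr_eq0 => /eqP <-; apply: eq_Rintegral => x _; rewrite mulrC.
Qed.

End torus_C1.

(** * Trigonometric polynomials and mollification *)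

Section trigonometric_polynomials.
Context {R : realType} {d : nat}.
Local Notation Rd := 'rV[R]_d.
Local Notation mu := (torus_measure R d).
Local Notation periodic := Defs.periodic.
Implicit Types f k : Rd -> R.

Definition trig_index := option ('I_d * bool)%type.

Definition trig_gen (g : trig_index) (x : Rd) : R :=
  match g with
  | None => 1
  | Some (i, true) => cos (2 * pi * x ord0 i)
  | Some (i, false) => sin (2 * pi * x ord0 i)
  end.

(** A polynomial of degree at most n is a combination of words of length n in the generators. The
    constant 1 is a generator, so shorter words can be padded and the spaces increase with n. The
    recursion on words turns translation and derivation into matrices acting on one generator at a
    time. *)
Fixpoint trig_poly (n : nat) (f : Rd -> R) : Prop :=
  if n is n'.+1 then exists f_ : trig_index -> Rd -> R,
    (forall g, trig_poly n' (f_ g)) /\ f = fun x => \sum_g f_ g x * trig_gen g x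
  else exists a : R, f = fun=> a.

Lemma trig_poly_cst n (a : R) : trig_poly n (fun=> a).
Proof.
elim: n a => [|n ih] a /=; first by exists a.
exists (fun g => fun=> if g is None then a else 0); split; first by move=> g; exact: ih.
apply/funext => x; rewrite (bigD1 None)//= mulr1 big1 ?addr0// => -[g|]//.
by rewrite mul0r.
Qed.

Lemma trig_polyD n f k : trig_poly n f -> trig_poly n k -> trig_poly n (fun x => f x + k x).
Proof.
elim: n f k => [|n ih] f k /=; first by move=> [a ->] [b ->]; exists (a + b).
move=> [f_ [hf ->]] [k_ [hk ->]]; exists (fun g x => f_ g x + k_ g x); split.
  by move=> g; exact: ih.
by apply/funext => x; rewrite -big_split; apply: eq_bigr => g _; rewrite mulrDl.
Qed.

Lemma trig_polyZ n (a : R) f : trig_poly n f -> trig_poly n (fun x => a * f x).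
Proof.
elim: n f => [|n ih] f /=; first by move=> [b ->]; exists (a * b).
move=> [f_ [hf ->]]; exists (fun g x => a * f_ g x); split; first by move=> g; exact: ih.
by apply/funext => x; rewrite mulr_sumr; apply: eq_bigr => g _; rewrite mulrA.
Qed.

Lemma trig_poly_sum n (J : Type) (r : seq J) (P : pred J) (F : J -> Rd -> R) :
  (forall j, trig_poly n (F j)) -> trig_poly n (fun x => \sum_(j <- r | P j) F j x).
Proof.
move=> tF; elim: r => [|j r ih].
  rewrite (_ : (fun _ => _) = fun=> 0); first exact: trig_poly_cst.
  by apply/funext => x; rewrite big_nil.
case: (boolP (P j)) => Pj.
  rewrite (_ : (fun _ => _) = fun x => F j x + \sum_(j <- r | P j) F j x).
    exact: trig_polyD.
  by apply/funext => x; rewrite big_cons Pj.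
rewrite (_ : (fun _ => _) = fun x => \sum_(j <- r | P j) F j x)//.
by apply/funext => x; rewrite big_cons (negbTE Pj).
Qed.

Lemma trig_poly_gen n f g : trig_poly n f -> trig_poly n.+1 (fun x => f x * trig_gen g x).
Proof.
move=> hf; exists (fun g' x => (g' == g)%:R * f x); split=> [g'|]; first exact: trig_polyZ.
apply/funext => x; rewrite (bigD1 g)//= eqxx mul1r big1 ?addr0// => g' /negbTE ->.
by rewrite !mul0r.
Qed.

Lemma trig_polyS n f : trig_poly n f -> trig_poly n.+1 f.
Proof.
move=> /(trig_poly_gen None); congr trig_poly; apply/funext => x.
by rewrite /= mulr1.
Qed.

Lemma trig_poly_le n p f : (n <= p)%N -> trig_poly n f -> trig_poly p f.
Proof.
by move=> /subnKC <-; elim: (p - n)%N => [|q ih] hf; rewrite ?addn0// addnS; exact/trig_polyS/ih.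
Qed.

Lemma trig_polyM n p f f' : trig_poly n f -> trig_poly p f' ->
  trig_poly (n + p) (fun x => f x * f' x).
Proof.
elim: p f' => [|p ih] f' hf /=.
  move=> [a ->]; rewrite addn0; move: (trig_polyZ a hf); congr trig_poly.
  by apply/funext => x; rewrite mulrC.
move=> [f_ [hf_ ->]]; rewrite addnS; exists (fun g x => f x * f_ g x); split.
  by move=> g; exact: ih.
by apply/funext => x; rewrite mulr_sumr; apply: eq_bigr => g _; rewrite mulrA.
Qed.

(* An operator that acts linearly on the generators and as a derivation or a
   morphism preserves the degree. *)
Lemma trig_poly_mix n (f_ : trig_index -> Rd -> R) (A : trig_index -> trig_index -> R) :
  (forall g, trig_poly n (f_ g)) ->
  trig_poly n.+1 (fun x => \sum_g f_ g x * \sum_g' A g g' * trig_gen g' x).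
Proof.
move=> hf; exists (fun g' x => \sum_g A g g' * f_ g x); split.
  by move=> g'; apply: trig_poly_sum => g; exact: trig_polyZ.
apply/funext => x; under eq_bigr do rewrite mulr_sumr.
rewrite exchange_big; apply: eq_bigr => g' _; rewrite mulr_suml.
by apply: eq_bigr => g _; ring.
Qed.

Definition shift_coef (a : Rd) (g g' : trig_index) : R :=
  match g, g' with
  | None, None => 1
  | Some (i, true), Some (j, true) => (i == j)%:R * cos (2 * pi * a ord0 i)
  | Some (i, true), Some (j, false) => - ((i == j)%:R * sin (2 * pi * a ord0 i))
  | Some (i, false), Some (j, true) => (i == j)%:R * sin (2 * pi * a ord0 i)
  | Some (i, false), Some (j, false) => (i == j)%:R * cos (2 * pi * a ord0 i)
  | _, _ => 0
  end.

Definition derive_coef (v : Rd) (g g' : trig_index) : R :=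
  match g, g' with
  | Some (i, true), Some (j, false) => - ((i == j)%:R * (2 * pi * v ord0 i))
  | Some (i, false), Some (j, true) => (i == j)%:R * (2 * pi * v ord0 i)
  | _, _ => 0
  end.

Lemma sum_trig_index (F : trig_index -> R) :
  \sum_g F g = F None + \sum_i (F (Some (i, true)) + F (Some (i, false))).
Proof.
rewrite (bigD1 None)//=; congr (_ + _).
rewrite (reindex_omap Some id)/=; last by case.
rewrite (eq_bigl predT) => [|ib]; last by rewrite eqxx.
transitivity (\sum_i \sum_b F (Some (i, b))).
  by rewrite pair_bigA; apply: eq_bigr => -[].
by apply: eq_bigr => i _; rewrite big_bool.
Qed.

Lemma trig_gen_shift g (a x : Rd) :
  trig_gen g (x + a) = \sum_g' shift_coef a g g' * trig_gen g' x.
Proof.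
rewrite sum_trig_index; case: g => [[i [|]]|] /=.
- rewrite mul0r add0r (bigD1 i)//= big1 => [|j]; rewrite ?eqxx; last first.
    by rewrite eq_sym => /negbTE ->; rewrite mulr0n; ring.
  by rewrite mulr1n mxE mulrDr cosD; ring.
- rewrite mul0r add0r (bigD1 i)//= big1 => [|j]; rewrite ?eqxx; last first.
    by rewrite eq_sym => /negbTE ->; rewrite mulr0n; ring.
  by rewrite mulr1n mxE mulrDr sinD; ring.
- by rewrite mul1r big1 ?addr0// => i _; rewrite !mul0r addr0.
Qed.

Lemma is_derive_coord (i : 'I_d) (x v : Rd) : is_derive x v (fun y : Rd => y ord0 i) (v ord0 i).
Proof.
apply: line_derivable.
rewrite (_ : (fun _ => _) = fun s : R => x ord0 i + s * v ord0 i); last first.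
  by apply/funext => s; rewrite !mxE.
by apply: is_derive_eq; rewrite /GRing.scale/=; ring.
Qed.

Lemma trig_gen_derive g (v x : Rd) :
  is_derive x v (trig_gen g) (\sum_g' derive_coef v g g' * trig_gen g' x).
Proof.
rewrite sum_trig_index; case: g => [[i [|]]|] /=.
- rewrite [X in is_derive _ _ _ X](_ : _ = - sin (2 * pi * x ord0 i) * (2 * pi * v ord0 i)); last first.
    rewrite mul0r add0r (bigD1 i)//= big1 => [|j]; rewrite ?eqxx; last first.
      by rewrite eq_sym => /negbTE ->; rewrite mulr0n; ring.
    by rewrite mulr1n; ring.
  apply: (@is_derive_comp_real _ _ (fun y : Rd => 2 * pi * y ord0 i) cos).
  apply: is_deriveZ; exact: is_derive_coord.
- rewrite [X in is_derive _ _ _ X](_ : _ = cos (2 * pi * x ord0 i) * (2 * pi * v ord0 i)); last first.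
    rewrite mul0r add0r (bigD1 i)//= big1 => [|j]; rewrite ?eqxx; last first.
      by rewrite eq_sym => /negbTE ->; rewrite mulr0n; ring.
    by rewrite mulr1n; ring.
  apply: (@is_derive_comp_real _ _ (fun y : Rd => 2 * pi * y ord0 i) sin).
  apply: is_deriveZ; exact: is_derive_coord.
- rewrite mul0r big1 ?addr0 => [|i _]; last by rewrite !mul0r addr0.
  exact: is_derive_cst.
Qed.

Lemma trig_poly_shift n f a : trig_poly n f -> trig_poly n (fun x => f (x + a)).
Proof.
elim: n f => [|n ih] f /=; first by move=> [b ->]; exists b.
move=> [f_ [hf ->]]; have := trig_poly_mix (shift_coef a) (fun g => ih _ (hf g)).
by congr trig_poly; apply/funext => x; apply: eq_bigr => g _; rewrite trig_gen_shift.
Qed.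

Lemma trig_poly_derivable n f v : trig_poly n f ->
  exists2 f', trig_poly n f' & forall x, is_derive x v f (f' x).
Proof.
elim: n f => [|n ih] f /=.
  by move=> [b ->]; exists (fun=> 0); [exists 0|move=> x; exact: is_derive_cst].
move=> [f_ [hf ->]].
have /choice[f'_ hf'] : forall g, exists f', trig_poly n f' /\ forall x, is_derive x v (f_ g) (f' x).
  by move=> g; have [f' ? ?] := ih _ (hf g); exists f'.
exists (fun x => \sum_g f'_ g x * trig_gen g x +
   \sum_g f_ g x * \sum_g' derive_coef v g g' * trig_gen g' x).
  apply: (@trig_polyD n.+1); last exact: trig_poly_mix.
  by exists f'_; split=> // g; have [] := hf' g.
move=> x; rewrite -big_split/=.
pose dg g := \sum_g' derive_coef v g g' * trig_gen g' x.
rewrite (_ : (fun _ => _) = \sum_g (f_ g * trig_gen g)); last first.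
  by apply/funext => y; rewrite fct_sumE.
rewrite (eq_bigr (fun g => f'_ g x * trig_gen g x + f_ g x * dg g)) => [|//].
elim: (index_enum _) => [|g r ihr]; first by rewrite !big_nil; exact: is_derive_cst.
rewrite !big_cons; apply: is_deriveD; rewrite /dg; have D1 := (hf' g).2 x; have D2 := trig_gen_derive g v x.
by apply: is_derive_eq; rewrite /GRing.scale/= addrC; congr (_ + _); rewrite mulrC.
Qed.

Lemma trig_gen_continuous g : torus_continuous (trig_gen g).
Proof.
split=> [x j|].
  case: g => [[i b]|//] /=; rewrite !mxE eqxx /=.
  case: (i == j); last by rewrite mulr0n addr0.
  rewrite mulr1n mulrDr mulr1 (_ : 2 * pi = pi *+ 2 :> R); last by rewrite mulr_natl.
  by case: b; [exact: cosD2pi|exact: sinD2pi].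
case: g => [[i b]|]; last by move=> x; exact: cst_continuous.
have ci : continuous (fun x : Rd => 2 * pi * x ord0 i).
  move=> x; apply: (@continuousM _ _ (fun=> 2 * pi) (fun x : Rd => x ord0 i)).
    exact: cst_continuous.
  exact: coord_continuous.
case: b => x.
  exact: (continuous_comp (ci x) (@continuous_cos R _)).
exact: (continuous_comp (ci x) (@continuous_sin R _)).
Qed.

Lemma trig_poly_continuous n f : trig_poly n f -> torus_continuous f.
Proof.
elim: n f => [|n ih] f /=; first by move=> [a ->]; exact: torus_continuous_cst.
move=> [f_ [hf ->]]; apply: torus_continuous_sum => g.
by apply: torus_continuousM; [exact/ih|exact: trig_gen_continuous].
Qed.

Lemma trig_poly_derive n f v : trig_poly n f -> trig_poly n ('D_v f).
Proof.
move=> hf; have [f' hf' D] := trig_poly_derivable v hf.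
by rewrite (_ : 'D_v f = f')//; apply/funext => x; have [_ ->] := D x.
Qed.

Lemma trig_poly_pd n f i : trig_poly n f -> trig_poly n (pd i f).
Proof. exact: trig_poly_derive. Qed.

Lemma trig_poly_smooth n f : trig_poly n f -> torus_smooth f.
Proof.
move=> hf; split; first exact: (trig_poly_continuous hf).1.
move=> s; have hs : trig_poly n (iter_derive f s).
  by elim: s => [//|v s ih]; exact: trig_poly_derive.
split=> [|x v]; first exact: (trig_poly_continuous hs).2.
by have [f' _ /(_ x)[]] := trig_poly_derivable v hs.
Qed.

Lemma trig_poly_C1 n f : trig_poly n f -> torus_C1 f.
Proof.
move=> hf; split; first exact: trig_poly_continuous hf.
move=> i; split=> [x|]; last exact: trig_poly_continuous (trig_poly_pd i hf).
by have [f' _ /(_ x)[]] := trig_poly_derivable (delta_mx 0 i) hf.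
Qed.

(** The words of length n form a spanning family that is in general linearly dependent, since
    reordering a word gives the same function. *)
Lemma trig_poly_family n : exists (J : finType) (phi : J -> Rd -> R),
  (forall j, trig_poly n (phi j)) /\
  forall f, trig_poly n f -> exists c : J -> R, f = fun x => \sum_j c j * phi j x.
Proof.
elim: n => [|n [J [phi [hphi span]]]].
  exists unit, (fun _ _ => 1); split; first by move=> _; exact: (trig_poly_cst 0 1).
  move=> f [a ->]; exists (fun=> a); apply/funext => x.
  by rewrite (bigD1 tt)//= mulr1 big1 ?addr0// => -[].
exists (J * trig_index)%type, (fun jg x => phi jg.1 x * trig_gen jg.2 x); split.
  by move=> [j g]; exact: trig_poly_gen.
move=> f [f_ [hf ->]].
have /choice[c hc] : forall g, exists c : J -> R, f_ g = fun x => \sum_j c j * phi j x.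
  by move=> g; exact: span (hf g).
exists (fun jg => c jg.2 jg.1); apply/funext => x.
rewrite -(pair_big predT predT (fun j g => c g j * (phi j x * trig_gen g x)))/= exchange_big/=.
by apply: eq_bigr => g _; rewrite hc mulr_suml; apply: eq_bigr => j _; rewrite mulrA.
Qed.

End trigonometric_polynomials.

(** * Integrals of real-valued functions *)

Section real_integrals.
Context {R : realType} {dT : measure_display} {T : measurableType dT}.
Variable P : {measure set T -> \bar R}.
Implicit Types f k : T -> R.

Definition integrableR f := P.-integrable setT (EFin \o f).

Lemma integrableR_measurable f : integrableR f -> measurable_fun setT f.
Proof. by move=> /integrableP[/measurable_EFinP]. Qed.

Lemma integrableR_le f k : measurable_fun setT f -> integrableR k ->
  (forall x, `|f x| <= `|k x|) -> integrableR f.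
Proof.
move=> mf ik fk; apply: le_integrable ik => //; first exact/measurable_EFinP.
by move=> x _ /=; rewrite lee_fin.
Qed.

Lemma integrableRD f k : integrableR f -> integrableR k -> integrableR (fun x => f x + k x).
Proof. by move=> hf hk; have := integrableD measurableT hf hk. Qed.

Lemma integrableRN f : integrableR f -> integrableR (fun x => - f x).
Proof. by move=> hf; have := integrableN hf. Qed.

Lemma integrableRB f k : integrableR f -> integrableR k -> integrableR (fun x => f x - k x).
Proof. by move=> hf hk; apply: integrableRD => //; exact: integrableRN. Qed.

Lemma integrableRZ (a : R) f : integrableR f -> integrableR (fun x => a * f x).
Proof. by move=> hf; have := integrableZl measurableT a hf. Qed.

Lemma integrableR_sum (J : Type) (r : seq J) (Q : pred J) (F : J -> T -> R) :
  (forall j, integrableR (F j)) -> integrableR (fun x => \sum_(j <- r | Q j) F j x).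
Proof.
move=> tF; elim: r => [|j r ih].
  rewrite (_ : (fun _ => _) = fun=> 0); first exact: integrable0.
  by apply/funext => x; rewrite big_nil.
case: (boolP (Q j)) => Qj.
  rewrite (_ : (fun _ => _) = fun x => F j x + \sum_(j <- r | Q j) F j x).
    exact: integrableRD.
  by apply/funext => x; rewrite big_cons Qj.
rewrite (_ : (fun _ => _) = fun x => \sum_(j <- r | Q j) F j x)//.
by apply/funext => x; rewrite big_cons (negbTE Qj).
Qed.

Lemma integrableR_boundedM f k (M : R) : measurable_fun setT k -> (forall x, `|k x| <= M) ->
  integrableR f -> integrableR (fun x => k x * f x).
Proof.
move=> mk kM hf; apply: (integrableR_le _ (integrableRZ M hf)).
  by apply: measurable_funM => //; exact: integrableR_measurable.
move=> x; rewrite !normrM ler_wpM2r//; apply: le_trans (kM x) _; exact: ler_norm.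
Qed.

Lemma integrableR_abs f : integrableR f -> integrableR (fun x => `|f x|).
Proof. by move=> hf; have := integrable_abse hf. Qed.

Lemma Rint_ext f k : (forall x, f x = k x) -> \int[P]_x f x = \int[P]_x k x.
Proof. by move=> fk; apply: eq_Rintegral => x _; exact: fk. Qed.

Lemma RintD f k : integrableR f -> integrableR k ->
  \int[P]_x (f x + k x) = \int[P]_x f x + \int[P]_x k x.
Proof. by move=> hf hk; rewrite RintegralD. Qed.

Lemma RintB f k : integrableR f -> integrableR k ->
  \int[P]_x (f x - k x) = \int[P]_x f x - \int[P]_x k x.
Proof. by move=> hf hk; rewrite RintegralB. Qed.

Lemma RintZ (a : R) f : integrableR f -> \int[P]_x (a * f x) = a * \int[P]_x f x.
Proof. by move=> hf; rewrite RintegralZl. Qed.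

Lemma RintN f : integrableR f -> \int[P]_x (- f x) = - \int[P]_x f x.
Proof. by move=> hf; rewrite -mulN1r -RintZ//; apply: eq_Rintegral => x _; rewrite mulN1r. Qed.

Lemma Rint_sum (J : Type) (r : seq J) (Q : pred J) (F : J -> T -> R) :
  (forall j, integrableR (F j)) ->
  \int[P]_x (\sum_(j <- r | Q j) F j x) = \sum_(j <- r | Q j) \int[P]_x F j x.
Proof.
move=> tF; elim: r => [|j r ih].
  rewrite big_nil; under eq_Rintegral do rewrite big_nil.
  by rewrite Rintegral_cst// mul0r.
rewrite big_cons; case: ifP => Qj; under eq_Rintegral do rewrite big_cons Qj.
  by rewrite RintD ?ih//; exact: integrableR_sum.
exact: ih.
Qed.

Lemma Rint_le f k : integrableR f -> integrableR k -> (forall x, f x <= k x) ->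
  \int[P]_x f x <= \int[P]_x k x.
Proof. by move=> hf hk fk; rewrite le_Rintegral. Qed.

Lemma Rint_ge0 f : (forall x, 0 <= f x) -> 0 <= \int[P]_x f x.
Proof. by move=> f0; rewrite Rintegral_ge0. Qed.

Lemma Rint_abs f : integrableR f -> `|\int[P]_x f x| <= \int[P]_x `|f x|.
Proof. by move=> hf; rewrite le_normr_Rintegral. Qed.

Lemma Rint_EFin f : integrableR f -> (\int[P]_x (f x)%:E)%E = (\int[P]_x f x)%:E.
Proof. by move=> hf; rewrite /Rintegral fineK//; exact: integrable_fin_num. Qed.

End real_integrals.

Section torus_integrals.
Context {R : realType} {d : nat}.
Local Notation Rd := 'rV[R]_d.
Local Notation mu := (torus_measure R d).
Implicit Types f k : Rd -> R.

Lemma tcI f : torus_continuous f -> integrableR mu f.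
Proof. exact: torus_continuous_integrable. Qed.

Lemma tcMI f k : torus_continuous k -> integrableR mu f -> integrableR mu (fun x => k x * f x).
Proof.
move=> tk; have [M kM] := torus_continuous_bounded tk.
by apply: integrableR_boundedM kM; exact: torus_continuous_measurable.
Qed.

Lemma Rint_cst (a : R) : \int[mu]_x a = a.
Proof. rewrite Rintegral_cst//; have := @probability_setT _ _ _ mu.
by move=> /= ->; rewrite mulr1. Qed.

End torus_integrals.

(** * A trigonometric approximation kernel *)

Section kernel.
Context {R : realType} {d : nat}.
Local Notation Rd := 'rV[R]_d.
Local Notation mu := (torus_measure R d).
Implicit Types f k : Rd -> R.

(** Kernels of finite rank. Convolution with such a kernel is a finite combination of moments, so
    exchanging it with another integral, differentiating it, or passing to a weak limit in it are
    operations on finite sums. *)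
Definition separated n (F : Rd -> Rd -> R) := exists (J : finType) (phi c : J -> Rd -> R),
  [/\ forall j, trig_poly n (phi j), forall j, trig_poly n (c j) &
      F = fun x y => \sum_j phi j x * c j y].

Lemma separatedD n (F G : Rd -> Rd -> R) : separated n F -> separated n G ->
  separated n (fun x y => F x y + G x y).
Proof.
move=> [J [phi [c [h1 h2 ->]]]] [K [psi [b [h3 h4 ->]]]].
exists (J + K)%type, (fun s => match s with inl j => phi j | inr k => psi k end),
  (fun s => match s with inl j => c j | inr k => b k end); split; try by case.
by apply/funext => x; apply/funext => y; rewrite big_sumType.
Qed.

Lemma separatedM n p (F G : Rd -> Rd -> R) : separated n F -> separated p G ->
  separated (n + p) (fun x y => F x y * G x y).
Proof.
move=> [J [phi [c [h1 h2 ->]]]] [K [psi [b [h3 h4 ->]]]].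
exists (J * K)%type, (fun s x => phi s.1 x * psi s.2 x), (fun s x => c s.1 x * b s.2 x).
split; try by move=> s; exact: trig_polyM.
apply/funext => x; apply/funext => y; rewrite mulr_suml.
transitivity (\sum_i \sum_j (phi i x * psi j x) * (c i y * b j y)).
  by apply: eq_bigr => i _; rewrite mulr_sumr; apply: eq_bigr => j _; ring.
by rewrite pair_bigA.
Qed.

Lemma separated_cst n (a : R) : separated n (fun _ _ => a).
Proof.
exists unit, (fun _ _ => a), (fun _ _ => 1); split; try by move=> _; exact: trig_poly_cst.
by apply/funext => x; apply/funext => y; rewrite (bigD1 tt)//= mulr1 big1 ?addr0// => -[].
Qed.

Lemma separated_gen (g : @trig_index d) : separated 1 (fun x y => trig_gen g (x - y)).
Proof.
have tg g' : trig_poly 1 (@trig_gen R d g').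
  have := trig_poly_gen g' (trig_poly_cst 0 (1 : R)); congr trig_poly.
  by apply/funext => x; rewrite mul1r.
case: g => [[i b]|]; last exact: (separated_cst 1 1).
exists bool, (fun b' => trig_gen (Some (i, b'))),
  (fun b' x => if b then trig_gen (Some (i, b')) x else (if b' then -1 else 1) * trig_gen (Some (i, ~~ b')) x).
split=> // [b'|].
  by case: b => //; exact: trig_polyZ.
apply/funext => x; apply/funext => y; rewrite big_bool /= !mxE.
by case: b; rewrite mulrBr ?cosB ?sinB /=; ring.
Qed.

Lemma separated_trig n f : trig_poly n f -> separated n (fun x y => f (x - y)).
Proof.
elim: n f => [|n ih] f /=; first by move=> [a ->]; exact: separated_cst.
move=> [f_ [hf ->]]; elim: (index_enum _) => [|g r ihr].
  have := separated_cst n.+1 0; congr separated.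
  by apply/funext => x; apply/funext => y; rewrite big_nil.
have h : separated n.+1 (fun x y => f_ g (x - y) * trig_gen g (x - y)).
  by rewrite -addn1; apply: separatedM; [exact: ih|exact: separated_gen].
have := separatedD h ihr; congr separated.
by apply/funext => x; apply/funext => y; rewrite big_cons.
Qed.

(** This is the square of cos (pi z_i). Its normalized powers form the de la Vallee-Poussin kernel,
    and [kern] is the product of these kernels over the coordinates. The quantity [1 - bump1 i z]
    plays the role of a squared distance from z_i to the integers. *)
Definition bump1 (i : 'I_d) (z : Rd) : R := (1 + cos (2 * pi * z ord0 i)) / 2.
Definition bump N (z : Rd) : R := \prod_i bump1 i z ^+ N.

Lemma bump1_itv i z : 0 <= bump1 i z <= 1.
Proof.
have := cos_geN1 (2 * pi * z ord0 i); have := cos_le1 (2 * pi * z ord0 i).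
by rewrite /bump1 => h1 h2; apply/andP; split; lra.
Qed.

Lemma trig_gen1 (g : @trig_index d) : trig_poly 1 (@trig_gen R d g).
Proof.
have := trig_poly_gen g (trig_poly_cst 0 (1 : R)); congr trig_poly.
by apply/funext => x; rewrite mul1r.
Qed.

Lemma trig_bump1 i : trig_poly 1 (bump1 i).
Proof.
have := trig_polyZ 2^-1 (trig_polyD (trig_poly_cst 1 1) (trig_gen1 (Some (i, true)))).
by congr trig_poly; apply/funext => z; rewrite /bump1 /= mulrC.
Qed.

Lemma trig_polyX n f N : trig_poly n f -> trig_poly (N * n) (fun x => f x ^+ N).
Proof.
move=> hf; elim: N => [|N ih]; first exact: (trig_poly_cst _ 1).
have := trig_polyM hf ih; rewrite mulSn; congr trig_poly.
by apply/funext => x; rewrite exprS.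
Qed.

Lemma trig_bump_seq N (r : seq 'I_d) : trig_poly (size r * N) (fun z => \prod_(i <- r) bump1 i z ^+ N).
Proof.
elim: r => [|i r ih].
  have := trig_poly_cst (R := R) (d := d) 0 1; congr trig_poly.
  by apply/funext => z; rewrite big_nil.
have := trig_polyM (trig_polyX N (trig_bump1 i)) ih; rewrite muln1 -mulSn; congr trig_poly.
by apply/funext => z; rewrite big_cons.
Qed.

Lemma trig_bump N : trig_poly (d * N) (bump N).
Proof.
have := trig_bump_seq N (index_enum 'I_d).
by rewrite (_ : size _ = d)// -[RHS]card_ord cardT enumT.
Qed.

Lemma bump_ge0 N z : 0 <= bump N z.
Proof. by apply: prodr_ge0 => i _; apply: exprn_ge0; case/andP: (bump1_itv i z). Qed.

Lemma bumpN N z : bump N (- z) = bump N z.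
Proof. by apply: eq_bigr => i _; rewrite /bump1 mxE mulrN cosN. Qed.

(** Induction on the coordinates. A shift by half a period in coordinate j exchanges [bump1 j] with
    [1 - bump1 j] and leaves the other factors alone, so the integral is half that of the sum of the
    two powers. One of the two bases is at least 1/2, whence a factor [2^-1 ^+ N]. *)
Lemma bump_int_gt0 N : 0 < \int[mu]_z bump N z.
Proof.
have : uniq (index_enum 'I_d) by exact: index_enum_uniq.
rewrite /bump; elim: (index_enum _) => [_|j r ih /=/andP[jr ur]].
  by under eq_Rintegral do rewrite big_nil; rewrite Rint_cst.
pose F z := \prod_(i <- r) bump1 i z ^+ N.
have tF : torus_continuous F by exact: trig_poly_continuous (trig_bump_seq N r).
have tj : torus_continuous (bump1 j) by exact: trig_poly_continuous (trig_bump1 j).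
have tjN := torus_continuousX N tj.
pose a : Rd := 2^-1 *: delta_mx 0 j.
have Fa z : F (z + a) = F z.
  rewrite /F; apply: eq_big_seq => i ir; rewrite /bump1 !mxE eqxx/=.
  case: eqP => [ij|_]; last by rewrite mulr0 addr0.
  by move: jr; rewrite -ij ir.
have ja z : bump1 j (z + a) = 1 - bump1 j z.
  rewrite /bump1 !mxE !eqxx/= mulr1 mulrDr (_ : 2 * pi * 2^-1 = pi :> R); last by field.
  by rewrite cosDpi; field.
have tG := torus_continuousM tjN tF.
have e : \int[mu]_z (bump1 j z ^+ N * F z) = 2^-1 * \int[mu]_z ((bump1 j z ^+ N + (1 - bump1 j z) ^+ N) * F z).
  have h := torus_shift a tG.
  rewrite (@Rint_ext _ _ _ _ _ (fun z => (1 - bump1 j z) ^+ N * F z)) in h; last by move=> z; rewrite ja Fa.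
  rewrite [in RHS](@Rint_ext _ _ _ _ _ (fun z => bump1 j z ^+ N * F z + (1 - bump1 j z) ^+ N * F z)); last first.
    by move=> z; rewrite mulrDl.
  rewrite RintD; [rewrite h; field => //| exact: tcI|].
  apply: tcI; apply: torus_continuousM => //; apply: torus_continuousX.
  by apply: torus_continuousB => //; exact: torus_continuous_cst.
rewrite (@Rint_ext _ _ _ _ _ (fun z => bump1 j z ^+ N * F z)); last by move=> z; rewrite big_cons.
rewrite e mulr_gt0//; apply: lt_le_trans (_ : 0 < 2^-1 ^+ N * \int[mu]_z F z) _.
  by rewrite mulr_gt0 ?exprn_gt0// ih.
rewrite -RintZ; last exact: tcI.
apply: Rint_le.
- by apply: integrableRZ; exact: tcI.
- apply: tcI; apply: torus_continuousM => //; apply: torus_continuousD => //; apply: torus_continuousX.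
  by apply: torus_continuousB => //; exact: torus_continuous_cst.
move=> z; have F0 : 0 <= F z.
  by apply: prodr_ge0 => i _; apply: exprn_ge0; case/andP: (bump1_itv i z).
rewrite ler_wpM2r//; have /andP[b0 b1] := bump1_itv j z.
have [h|h] := leP 2^-1 (bump1 j z).
  by rewrite -[leLHS]addr0 lerD// ?lerXn2r ?nnegrE// ?exprn_ge0; lra.
by rewrite -[leLHS]add0r lerD// ?lerXn2r ?nnegrE// ?exprn_ge0//; lra.
Qed.

Lemma is_derive_cos_coord (j : 'I_d) (z v : Rd) :
  is_derive z v (fun y : Rd => cos (2 * pi * y ord0 j)) (- sin (2 * pi * z ord0 j) * (2 * pi * v ord0 j)).
Proof.
apply: (@is_derive_comp_real _ _ (fun y : Rd => 2 * pi * y ord0 j) cos).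
by apply: is_deriveZ; exact: is_derive_coord.
Qed.

Lemma is_derive_sin_coord (j : 'I_d) (z v : Rd) :
  is_derive z v (fun y : Rd => sin (2 * pi * y ord0 j)) (cos (2 * pi * z ord0 j) * (2 * pi * v ord0 j)).
Proof.
apply: (@is_derive_comp_real _ _ (fun y : Rd => 2 * pi * y ord0 j) sin).
by apply: is_deriveZ; exact: is_derive_coord.
Qed.

Lemma pd_bump1 (i j : 'I_d) z :
  pd i (bump1 j) z = - ((j == i)%:R * pi * sin (2 * pi * z ord0 j)).
Proof.
have D := is_derive_cos_coord j z (delta_mx 0 i).
have [_ e] : is_derive z (delta_mx 0 i) (2^-1 \*: (cst 1 + fun y : Rd => cos (2 * pi * y ord0 j)))
   (2^-1 *: (0 + - sin (2 * pi * z ord0 j) * (2 * pi * (delta_mx 0 i : Rd) ord0 j))).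
  by apply: is_deriveZ; apply: is_deriveD; exact: is_derive_cst.
rewrite /pd (_ : bump1 j = 2^-1 \*: (cst 1 + fun y : Rd => cos (2 * pi * y ord0 j))).
  by rewrite e !mxE eqxx/= /GRing.scale/= add0r; field.
by apply/funext => y; rewrite /bump1 /= mulrC.
Qed.

(** The relation [P c F] states that sin times the i-th logarithmic derivative of F is - c (1 -
    bump1 i). The constants c add up under products. The factor [bump1 j] has constant 0 for j
    different from i, and 4 pi for j = i because sin^2 = 4 b (1 - b) with b = [bump1 i]. *)
Lemma bump_pd N (i : 'I_d) (z : Rd) : sin (2 * pi * z ord0 i) * pd i (bump N) z =
  - (4 * pi * N%:R) * ((1 - bump1 i z) * bump N z).
Proof.
pose P (c : R) (F : Rd -> R) := torus_C1 F /\ forall z : Rd, sin (2 * pi * z ord0 i) * pd i F z =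
  - c * ((1 - bump1 i z) * F z).
have PM c c' F F' : P c F -> P c' F' -> P (c + c') (fun z => F z * F' z).
  move=> [CF eF] [CF' eF']; have [C e] := torus_C1M CF CF'; split=> // y.
  rewrite e mulrDr [X in X + _]mulrCA [X in _ + X]mulrCA.
  by rewrite (eF' y) (eF y); ring.
have P1 : P 0 (fun=> 1).
  have [C e] := @torus_C1_cst R d 1; split=> // y.
  by rewrite e; ring.
have Pb j : P ((j == i)%:R * (4 * pi)) (bump1 j).
  split; first exact: trig_poly_C1 (trig_bump1 j).
  move=> y; rewrite pd_bump1; case: eqP => [->|_]; last by rewrite !mul0r; ring.
  have e := cos2Dsin2 (2 * pi * y ord0 i); rewrite /bump1.
  set c := cos _ in e *; set s := sin _ in e *.
  have -> : s * - (1 * pi * s) = - pi * s ^+ 2 by ring.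
  have -> : s ^+ 2 = 1 - c ^+ 2 by rewrite -e; ring.
  by rewrite mulr1n; field.
have PX c F n : P c F -> P (n%:R * c) (fun z => F z ^+ n).
  move=> PF; elim: n => [|n ih]; first by rewrite mul0r.
  have := PM _ _ _ _ PF ih; rewrite (_ : c + n%:R * c = n.+1%:R * c); last by rewrite -natr1; ring.
  congr P.
  by apply/funext => y; rewrite exprS.
have Pr (r : seq 'I_d) : P ((count_mem i r)%:R * (4 * pi * N%:R)) (fun z => \prod_(j <- r) bump1 j z ^+ N).
  elim: r => [|j r ih] /=.
    by rewrite mul0r (_ : (fun z => _) = fun=> 1)//; apply/funext => y; rewrite big_nil.
  have := PM _ _ _ _ (PX _ _ N (Pb j)) ih.
  rewrite (_ : N%:R * _ + _ = ((j == i) + count_mem i r)%:R * (4 * pi * N%:R)); last by rewrite natrD; ring.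
  by congr P; apply/funext => y; rewrite big_cons.
have [_ ->] := Pr (index_enum 'I_d).
by rewrite count_uniq_mem ?index_enum_uniq// mem_index_enum mul1r.
Qed.

(* Integration by parts against sin (2 pi z_i). *)
Lemma bump_concentration N i :
  \int[mu]_z ((1 - bump1 i z) * bump N z) = (\int[mu]_z bump N z) / (2 * N.+1%:R).
Proof.
pose s (z : Rd) := sin (2 * pi * z ord0 i).
have Cs : torus_C1 s by exact: trig_poly_C1 (trig_gen1 (Some (i, false))).
have ds z : pd i s z = 2 * pi * (2 * bump1 i z - 1).
  have [_ e] := is_derive_sin_coord i z (delta_mx 0 i).
  rewrite /pd e; by rewrite !mxE !eqxx/= /bump1; field.
have Cb := trig_poly_C1 (trig_bump N).
have tb := Cb.1; have t1 := trig_poly_continuous (trig_bump1 i).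
have tb1 : torus_continuous (fun z => (1 - bump1 i z) * bump N z).
  by apply: torus_continuousM => //; apply: torus_continuousB => //; exact: torus_continuous_cst.
have [C e] := torus_C1M Cs Cb; have := Rintegral_pd i C; rewrite e.
rewrite (@Rint_ext _ _ _ _ _ (fun z => - (4 * pi * N.+1%:R) * ((1 - bump1 i z) * bump N z) + 2 * pi * bump N z)); last first.
  by move=> z; rewrite bump_pd ds -natr1; ring.
rewrite RintD; last 2 first.
- by apply: integrableRZ; exact: tcI.
- by apply: integrableRZ; exact: tcI.
rewrite RintZ ?RintZ; [|exact: tcI..] => h.
have pi0 : (pi : R) != 0 by rewrite gt_eqF// pi_gt0.
have n0 : (N.+1%:R : R) != 0 by rewrite pnatr_eq0.
apply: (@mulfI _ (4 * pi * N.+1%:R)); first by rewrite !mulf_neq0.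
have -> : 4 * pi * N.+1%:R * (\int[mu]_z bump N z / (2 * N.+1%:R)) = 2 * pi * \int[mu]_z bump N z by field.
by move: h => /eqP; rewrite addrC mulNr subr_eq0 => /eqP <-.
Qed.

Definition kern N (z : Rd) : R := bump N z / \int[mu]_z bump N z.

Lemma kern_ge0 N z : 0 <= kern N z.
Proof. by rewrite divr_ge0 ?bump_ge0// ltW// bump_int_gt0. Qed.

Lemma kernN N z : kern N (- z) = kern N z.
Proof. by rewrite /kern bumpN. Qed.

Lemma trig_kern N : trig_poly (d * N) (kern N).
Proof.
have := trig_polyZ (\int[mu]_z bump N z)^-1 (trig_bump N); congr trig_poly.
by apply/funext => z; rewrite mulrC.
Qed.

Lemma kern_int N x : \int[mu]_y kern N (x - y) = 1.
Proof.
have e (y : Rd) : kern N (x - y) = kern N (y + - x) by rewrite -kernN opprB.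
under eq_Rintegral do rewrite e.
rewrite torus_shift; last exact: trig_poly_continuous (trig_kern N).
rewrite (@Rint_ext _ _ _ _ _ (fun z => (\int[mu]_z bump N z)^-1 * bump N z)); last first.
  by move=> z; rewrite mulrC.
rewrite RintZ ?mulVf ?gt_eqF ?bump_int_gt0//.
exact/tcI/trig_poly_continuous/trig_bump.
Qed.

Lemma kern_concentration N x i :
  \int[mu]_y (kern N (x - y) * (1 - bump1 i (x - y))) = (2 * N.+1%:R)^-1.
Proof.
have b1N (z : Rd) : bump1 i (- z) = bump1 i z by rewrite /bump1 mxE mulrN cosN.
have e (y : Rd) : kern N (x - y) * (1 - bump1 i (x - y)) = kern N (y + - x) * (1 - bump1 i (y + - x)).
  by rewrite -kernN -b1N opprB.
under eq_Rintegral do rewrite e.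
have tk := trig_poly_continuous (trig_kern N).
have tb := trig_poly_continuous (trig_bump N).
have t1 : torus_continuous (fun z : Rd => 1 - bump1 i z).
  apply: torus_continuousB; first exact: torus_continuous_cst.
  exact: trig_poly_continuous (trig_bump1 i).
rewrite (@torus_shift _ _ (fun z => kern N z * (1 - bump1 i z))); last exact: torus_continuousM.
rewrite (@Rint_ext _ _ _ _ _ (fun z => (\int[mu]_z bump N z)^-1 * ((1 - bump1 i z) * bump N z))); last first.
  by move=> z; rewrite /kern; ring.
rewrite RintZ; last by apply: tcI; exact: torus_continuousM.
by rewrite bump_concentration mulrA mulVf ?mul1r// gt_eqF// bump_int_gt0.
Qed.

Definition tconv N f (x : Rd) : R := \int[mu]_y (kern N (x - y) * f y).

End kernel.

Section torus_C1_more.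
Context {R : realType} {d : nat}.
Local Notation Rd := 'rV[R]_d.
Local Notation mu := (torus_measure R d).
Local Notation periodic := Defs.periodic.
Implicit Types f k phi : Rd -> R.

Lemma tint_ext k f : (forall x, f x = k x) -> \int[mu]_x f x = \int[mu]_x k x.
Proof. exact: Rint_ext. Qed.

Lemma torus_C1_sum (J : Type) (r : seq J) (F : J -> Rd -> R) : (forall j, torus_C1 (F j)) ->
  torus_C1 (fun x => \sum_(j <- r) F j x) /\
  forall i, pd i (fun x => \sum_(j <- r) F j x) = fun x => \sum_(j <- r) pd i (F j) x.
Proof.
move=> CF; elim: r => [|j r [ih1 ih2]].
  have [h1 h2] := @torus_C1_cst R d 0.
  rewrite (_ : (fun _ => _) = fun=> 0); last by apply/funext => x; rewrite big_nil.
  by split=> // i; rewrite h2; apply/funext => x; rewrite big_nil.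
rewrite (_ : (fun _ => _) = fun x => F j x + \sum_(j <- r) F j x); last first.
  by apply/funext => x; rewrite big_cons.
have [h1 h2] := torus_C1D (CF j) ih1; split=> // i.
by rewrite h2 ih2; apply/funext => x; rewrite big_cons.
Qed.

Lemma torus_C1Z (a : R) f : torus_C1 f ->
  torus_C1 (fun x => a * f x) /\ forall i, pd i (fun x => a * f x) = fun x => a * pd i f x.
Proof.
move=> Cf; have [C0 e0] := @torus_C1_cst R d a; have [C e] := torus_C1M C0 Cf.
by split=> // i; rewrite e; apply/funext => x; rewrite e0 mulr0 addr0.
Qed.

Lemma torus_C1_lincomb (J : finType) (a : J -> R) (F : J -> Rd -> R) : (forall j, torus_C1 (F j)) ->
  torus_C1 (fun x => \sum_j a j * F j x) /\
  forall i, pd i (fun x => \sum_j a j * F j x) = fun x => \sum_j a j * pd i (F j) x.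
Proof.
move=> CF; have [h1 h2] := torus_C1_sum (index_enum J) (fun j => (torus_C1Z (a j) (CF j)).1).
split=> // i; rewrite h2; apply/funext => x; apply: eq_bigr => j _.
by rewrite (torus_C1Z (a j) (CF j)).2.
Qed.

Lemma is_derive_shift_line f (x a v : Rd) l : is_derive (x + a) v f l ->
  is_derive x v (fun y => f (y + a)) l.
Proof.
move=> D; apply: line_derivable.
rewrite (_ : (fun s => _) = fun s : R => f ((x + a) + s *: v)).
  by apply: is_derive_line; rewrite scale0r addr0.
by apply/funext => s; rewrite addrAC.
Qed.

Lemma is_derive_reflect f (x a v : Rd) l : is_derive (a - x) v f l ->
  is_derive x v (fun y => f (a - y)) (- l).
Proof.
move=> D; apply: line_derivable.
have D1 : is_derive (- (0 : R)) 1 (fun s : R => f ((a - x) + s *: v)) l.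
  by apply: is_derive_line; rewrite oppr0 scale0r addr0.
have D2 : is_derive (0 : R) 1 (fun s : R => - s) (- 1) by apply: is_deriveN; exact: is_derive_id.
have := @is_derive1_comp _ (fun s : R => f ((a - x) + s *: v)) (fun s : R => - s) 0 _ _ D1 D2.
rewrite mulrN1; congr is_derive; apply/funext => s /=.
by rewrite scaleNr opprD addrA.
Qed.

Lemma torus_C1_shift f (a : Rd) : torus_C1 f ->
  torus_C1 (fun x => f (x + a)) /\ forall i, pd i (fun x => f (x + a)) = fun x => pd i f (x + a).
Proof.
move=> Cf; apply: torus_C1_intro => [|i|i x].
- exact: torus_continuous_shift Cf.1.
- exact: torus_continuous_shift (Cf.2 i).2.
- by apply: is_derive_shift_line; exact: torus_C1_derive.
Qed.

Lemma torus_C1_reflect f (a : Rd) : torus_C1 f ->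
  torus_C1 (fun x => f (a - x)) /\ forall i, pd i (fun x => f (a - x)) = fun x => - pd i f (a - x).
Proof.
move=> Cf; apply: torus_C1_intro => [|i|i x].
- exact: torus_continuous_reflect Cf.1.
- by apply: torus_continuousN; exact: torus_continuous_reflect (Cf.2 i).2.
- by apply: is_derive_reflect; exact: torus_C1_derive.
Qed.

Lemma periodic_pd f i : periodic f -> periodic (pd i f).
Proof.
move=> pf x k; rewrite /pd /derive.
rewrite (_ : (fun h : R => _) = fun h : R => h^-1 *: ((f \o shift x) (h *: delta_mx 0 i) - f x))//.
by apply/funext => h /=; rewrite pf addrA pf.
Qed.

Lemma torus_smooth_C1 phi : torus_smooth phi -> torus_C1 phi.
Proof.
move=> [pphi sphi]; split; first by split=> //; exact: (sphi [::]).1.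
move=> j; split; first by move=> x; exact: (sphi [::]).2.
by split; [exact: periodic_pd|exact: (sphi [:: delta_mx 0 j]).1].
Qed.

Lemma torus_smooth_pd phi i : torus_smooth phi -> torus_smooth (pd i phi).
Proof.
move=> [pphi sphi]; split; first exact: periodic_pd.
by move=> s; have := sphi (rcons s (delta_mx 0 i)); rewrite /iter_derive foldr_rcons.
Qed.

End torus_C1_more.

(** * Convolution with the kernel *)

Section convolution.
Context {R : realType} {d : nat}.
Local Notation Rd := 'rV[R]_d.
Local Notation mu := (torus_measure R d).
Local Notation periodic := Defs.periodic.
Implicit Types f k phi : Rd -> R.

Lemma tconv_separated N : exists (J : finType) (phi c : J -> Rd -> R),
  [/\ forall j, trig_poly (d * N) (phi j), forall j, trig_poly (d * N) (c j),
      forall x y, kern N (x - y) = \sum_j phi j x * c j y,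
      forall f, integrableR mu f -> tconv N f = fun x => \sum_j (\int[mu]_y (c j y * f y)) * phi j x &
      forall f x, integrableR mu f -> integrableR mu (fun y => kern N (x - y) * f y)].
Proof.
have [J [phi [c [hphi hc e]]]] := separated_trig (@trig_kern R d N).
have {}e x y : kern N (x - y) = \sum_j phi j x * c j y.
  by have := congr1 (fun F : Rd -> Rd -> R => F x y) e.
exists J, phi, c; split=> // [f hf|f x hf].
  apply/funext => x; rewrite /tconv.
  rewrite (@tint_ext _ _ (fun y : Rd => \sum_j phi j x * (c j y * f y))); last first.
    by move=> y; rewrite e mulr_suml; apply: eq_bigr => j _; rewrite mulrA.
  have hi j : integrableR mu (fun y => c j y * f y).
    by apply: tcMI => //; exact: trig_poly_continuous (hc j).
  rewrite Rint_sum => [|j]; last exact: integrableRZ.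
  by apply: eq_bigr => j _; rewrite RintZ// mulrC.
apply: tcMI hf; apply: torus_continuous_reflect.
exact: trig_poly_continuous (trig_kern N).
Qed.

Lemma tconv_trig N f : integrableR mu f -> trig_poly (d * N) (tconv N f).
Proof.
move=> hf; have [J [phi [c [hphi _ _ /(_ _ hf) -> _]]]] := tconv_separated N.
by apply: trig_poly_sum => j; exact: trig_polyZ.
Qed.

Lemma kern_integrable N f x : integrableR mu f -> integrableR mu (fun y => kern N (x - y) * f y).
Proof. by move=> hf; have [J [phi [c [_ _ _ _]]]] := tconv_separated N; exact. Qed.

Lemma tconv_adjoint N f k : integrableR mu f -> integrableR mu k ->
  \int[mu]_x (tconv N f x * k x) = \int[mu]_x (f x * tconv N k x).
Proof.
move=> hf hk; have [J [phi [c [hphi hc e cv _]]]] := tconv_separated N.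
have cv' : tconv N k = fun y => \sum_j (\int[mu]_x (phi j x * k x)) * c j y.
  apply/funext => y; rewrite /tconv.
  rewrite (@tint_ext _ _ (fun x : Rd => \sum_j c j y * (phi j x * k x))); last first.
    by move=> x; rewrite -kernN opprB e mulr_suml; apply: eq_bigr => j _; ring.
  have hi j : integrableR mu (fun x => phi j x * k x).
    by apply: tcMI => //; exact: trig_poly_continuous (hphi j).
  rewrite Rint_sum => [|j]; last exact: integrableRZ.
  by apply: eq_bigr => j _; rewrite RintZ// mulrC.
rewrite (@tint_ext _ _ (fun x : Rd => \sum_j (\int[mu]_y (c j y * f y)) * (phi j x * k x))); last first.
  by move=> x; rewrite (cv _ hf) mulr_suml; apply: eq_bigr => j _; ring.
rewrite [RHS](@tint_ext _ _ (fun x : Rd => \sum_j (\int[mu]_y (phi j y * k y)) * (c j x * f x))); last first.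
  by move=> x; rewrite cv' mulr_sumr; apply: eq_bigr => j _; ring.
rewrite !Rint_sum => [|j|j]; first apply: eq_bigr => j _.
- by rewrite !RintZ 1?mulrC//; apply: tcMI => //; [exact: trig_poly_continuous (hc j)|exact: trig_poly_continuous (hphi j)].
- by apply: integrableRZ; apply: tcMI => //; exact: trig_poly_continuous (hc j).
- by apply: integrableRZ; apply: tcMI => //; exact: trig_poly_continuous (hphi j).
Qed.

(** The derivative falls on the kernel, and [y |-> kern N (x - y)] is itself an admissible test
    function for the weak derivative. The two signs, one from the reflection of the argument and one
    from the weak formulation, cancel. *)
Lemma tconv_pd_weak N (i : 'I_d) f f' : integrableR mu f -> integrableR mu f' ->
  (forall phi, torus_smooth phi -> \int[mu]_x (f' x * phi x) = - \int[mu]_x (f x * pd i phi x)) ->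
  pd i (tconv N f) = tconv N f'.
Proof.
move=> hf hf' w; have [J [phi [c [hphi hc e cv _]]]] := tconv_separated N.
have Cphi j : torus_C1 (phi j) by exact: trig_poly_C1 (hphi j).
have tk := @trig_kern R d N; have Ck := trig_poly_C1 tk.
have ti j : integrableR mu (fun y => c j y * f y).
  by apply: tcMI => //; exact: trig_poly_continuous (hc j).
rewrite (cv _ hf); have [_ /(_ i) ->] := torus_C1_lincomb (fun j => \int[mu]_y (c j y * f y)) Cphi.
apply/funext => x.
rewrite -[tconv N f' x]/(\int[mu]_y (kern N (x - y) * f' y)).
have pk y : pd i (kern N) (x - y) = \sum_j c j y * pd i (phi j) x.
  have [_ /(_ i)/(congr1 (@^~ x)) /= <-] := torus_C1_shift (- y) Ck.
  have [_ /(_ i)/(congr1 (@^~ x)) /= <-] := torus_C1_lincomb (fun j => c j y) Cphi.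
  by congr pd; apply/funext => x'; rewrite e; apply: eq_bigr => j _; rewrite mulrC.
have srefl : torus_smooth (fun y => kern N (x - y)).
  have := trig_poly_smooth (trig_poly_shift (- x) tk); congr torus_smooth.
  by apply/funext => y; rewrite -kernN opprB addrC.
have := w _ srefl.
have [_ /(_ i) ->] := torus_C1_reflect x Ck.
rewrite (@tint_ext _ _ (fun y : Rd => kern N (x - y) * f' y)) => [->|y]; last exact: mulrC.
rewrite (@tint_ext _ _ (fun y : Rd => - \sum_j pd i (phi j) x * (c j y * f y))); last first.
  move=> y; rewrite mulrN pk mulr_sumr; congr (- _); apply: eq_bigr => j _; ring.
rewrite RintN; last by apply: integrableR_sum => j; exact: integrableRZ.
rewrite opprK Rint_sum; last by move=> j; exact: integrableRZ.
by apply: eq_bigr => j _; rewrite RintZ// mulrC.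
Qed.

Lemma tconv_pd N (i : 'I_d) f : torus_C1 f -> pd i (tconv N f) = tconv N (pd i f).
Proof.
move=> Cf; apply: tconv_pd_weak.
- exact: tcI Cf.1.
- exact: tcI (Cf.2 i).2.
by move=> phi /torus_smooth_C1 Cphi; exact: Rintegral_by_parts.
Qed.

Lemma tconv_cst N (a : R) : tconv N (fun _ : Rd => a) = fun=> a.
Proof.
apply/funext => x; rewrite /tconv.
rewrite (@tint_ext _ _ (fun y : Rd => a * kern N (x - y))) => [|y]; last by rewrite mulrC.
rewrite RintZ ?kern_int ?mulr1//; apply: tcI; apply: torus_continuous_reflect.
exact: trig_poly_continuous (trig_kern N).
Qed.

Lemma tconvD N f k : integrableR mu f -> integrableR mu k ->
  tconv N (fun x => f x + k x) = fun x => tconv N f x + tconv N k x.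
Proof.
move=> hf hk; apply/funext => x; rewrite /tconv -RintD; [|exact: kern_integrable..].
by apply: Rint_ext => y; rewrite mulrDr.
Qed.

Lemma tconv_le N f k x : integrableR mu f -> integrableR mu k -> (forall y, f y <= k y) ->
  tconv N f x <= tconv N k x.
Proof.
move=> hf hk fk; apply: Rint_le => [||y]; [exact: kern_integrable..|].
by rewrite ler_wpM2l// kern_ge0.
Qed.

Lemma tconv_abs N f x : integrableR mu f -> `|tconv N f x| <= tconv N (fun y => `|f y|) x.
Proof.
move=> hf; apply: le_trans (Rint_abs (kern_integrable N x hf)) _.
rewrite le_eqVlt; apply/orP; left; apply/eqP; apply: Rint_ext => y.
by rewrite normrM ger0_norm// kern_ge0.
Qed.

(** The convolution of |f| is paired with the constant 1, and self-adjointness moves the kernel onto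
    this constant, which it preserves. *)
Lemma tconv_L1 N f : integrableR mu f -> \int[mu]_x `|tconv N f x| <= \int[mu]_x `|f x|.
Proof.
move=> hf; have haf := integrableR_abs hf.
have tc1 : torus_continuous (tconv N f) by exact: trig_poly_continuous (tconv_trig N hf).
have tc2 : torus_continuous (tconv N (fun y => `|f y|)) by exact: trig_poly_continuous (tconv_trig N haf).
apply: (@le_trans _ _ (\int[mu]_x (tconv N (fun y => `|f y|) x * 1))).
  apply: Rint_le => [||x]; last by rewrite mulr1 tconv_abs.
    by apply: integrableR_abs; exact: tcI.
  by apply: tcI; apply: torus_continuousM => //; exact: torus_continuous_cst.
rewrite tconv_adjoint//; last exact: tcI (torus_continuous_cst _).
rewrite tconv_cst le_eqVlt; apply/orP; left; apply/eqP; apply: Rint_ext => x.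
by rewrite mulr1.
Qed.

Lemma tconv_sub N f x : torus_continuous f ->
  tconv N f x - f x = \int[mu]_y (kern N (x - y) * (f y - f x)).
Proof.
move=> tf; have tk : torus_continuous (fun y => kern N (x - y)).
  by apply: torus_continuous_reflect; exact: trig_poly_continuous (trig_kern N).
rewrite (@tint_ext _ _ (fun y : Rd => kern N (x - y) * f y - f x * kern N (x - y))); last first.
  by move=> y; ring.
rewrite RintB ?RintZ ?kern_int ?mulr1//.
- exact: tcI.
- by apply: tcI; exact: torus_continuousM.
- by apply: integrableRZ; exact: tcI.
Qed.

(** Korovkin's principle: once the oscillation of f is dominated by a constant plus a multiple of
    the functions [1 - bump1 i], the error is read off the exact convolution of these functions,
    given by [kern_concentration]. *)
Lemma tconv_korovkin N f (a b : R) x : torus_continuous f ->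
  (forall y, `|f y - f x| <= a + b * \sum_i (1 - bump1 i (x - y))) ->
  `|tconv N f x - f x| <= a + b * d%:R / (2 * N.+1%:R).
Proof.
move=> tf h; rewrite tconv_sub//.
have tk : torus_continuous (fun y => kern N (x - y)).
  by apply: torus_continuous_reflect; exact: trig_poly_continuous (trig_kern N).
have t1 i : torus_continuous (fun y => kern N (x - y) * (1 - bump1 i (x - y))).
  apply: torus_continuousM => //; apply: torus_continuousB; first exact: torus_continuous_cst.
  by apply: torus_continuous_reflect; exact: trig_poly_continuous (trig_bump1 i).
have ti : integrableR mu (fun y => kern N (x - y) * (f y - f x)).
  by apply: kern_integrable; apply: tcI; apply: torus_continuousB => //; exact: torus_continuous_cst.
apply: le_trans (Rint_abs ti) _.
apply: (@le_trans _ _ (\int[mu]_y (a * kern N (x - y) + b * \sum_i (kern N (x - y) * (1 - bump1 i (x - y)))))).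
  apply: Rint_le => [||y].
  - exact: integrableR_abs.
  - apply: integrableRD; first by apply: integrableRZ; exact: tcI.
    by apply: integrableRZ; apply: integrableR_sum => i; exact: tcI.
  rewrite normrM ger0_norm ?kern_ge0// -mulr_sumr mulrC.
  rewrite [leRHS](_ : _ = (a + b * \sum_i (1 - bump1 i (x - y))) * kern N (x - y)); last by ring.
  by rewrite ler_wpM2r ?kern_ge0.
rewrite RintD; last 2 first.
- by apply: integrableRZ; exact: tcI.
- by apply: integrableRZ; apply: integrableR_sum => i; exact: tcI.
rewrite RintZ ?RintZ; [|by apply: integrableR_sum => i; exact: tcI|exact: tcI].
rewrite kern_int mulr1 lerD2l Rint_sum; last by move=> i; exact: tcI.
under eq_bigr do rewrite kern_concentration.
by rewrite sumr_const card_ord -[_ *+ d]mulr_natl mulrA.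
Qed.

End convolution.

(** * The distance to the lattice and uniform approximation *)

Section sine_distance.
Context {R : realType}.

Lemma cos_double (x : R) : cos (x + x) = 2 * cos x ^+ 2 - 1 /\ cos (x + x) = 1 - 2 * sin x ^+ 2.
Proof.
have := cos2Dsin2 x; rewrite cosD; set c := cos x; set s := sin x => e.
by split; [have -> : s * s = 1 - c ^+ 2 by rewrite -e; ring|have -> : c * c = 1 - s ^+ 2 by rewrite -e; ring]; ring.
Qed.

(** For s <= 1/4 the derivative pi cos (pi c) is at least 1, because cos^2 >= 1/2 on [0, pi/4] and
    pi >= 2. Beyond 1/4, sin^2 >= 1/2 whereas s <= 1/2. *)
Lemma sin_ge_id (s : R) : 0 <= s <= 2^-1 -> s <= sin (pi * s).
Proof.
move=> /andP[s0 s1]; have pi2 : (2 : R) <= pi by exact: pi_ge2.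
have [s4|s4] := leP s 4^-1.
  have D (x : R) : is_derive x 1 (fun s : R => sin (pi * s)) (cos (pi * x) * pi).
    have h1 : is_derive x 1 (fun s : R => pi *: s) (pi *: 1) by apply: is_deriveZ.
    have := @is_derive1_comp _ sin (fun s : R => pi *: s) x _ _ (is_derive_sin _) h1.
    by rewrite /GRing.scale/= mulr1.
  have [|c cs] := @MVT_segment R (fun s => sin (pi * s)) (fun s => cos (pi * s) * pi) 0 s s0 (fun x _ => D x).
    by apply: derivable_within_continuous => x _; have [] := D x.
  rewrite mulr0 sin0 !subr0 => ->; rewrite -[leLHS]mul1r ler_wpM2r//.
  move: cs; rewrite in_itv/= => /andP[c0 cs].
  have pc : 0 <= pi * c <= pi / 4.
    by rewrite mulr_ge0 ?pi_ge0//= ler_wpM2l ?pi_ge0//; apply: le_trans cs _.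
  have [e _] := cos_double (pi * c).
  have h1 : 0 <= cos (pi * c) by apply: cos_ge0_pihalf; lra.
  have h2 : 0 <= cos (pi * c + pi * c) by apply: cos_ge0_pihalf; lra.
  by nra.
have ps : pi / 4 <= pi * s <= pi / 2.
  by rewrite !ler_wpM2l ?pi_ge0// ltW.
have [_ e] := cos_double (pi * s).
have h1 : 0 <= sin (pi * s) by apply: sin_ge0_pi; lra.
have h2 : 0 <= - cos (pi * s + pi * s).
  have -> : - cos (pi * s + pi * s) = cos (pi * s + pi * s - pi) by rewrite cosB sinpi cospi; ring.
  by apply: cos_ge0_pihalf; lra.
by nra.
Qed.

Lemma cos_2pi_int (v : R) (z : int) : cos (2 * pi * (v + z%:~R)) = cos (2 * pi * v).
Proof.
have shiftn (n : nat) (w : R) : cos (2 * pi * (w + n%:R)) = cos (2 * pi * w).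
  rewrite -(periodicn (@cosD2pi R) n (2 * pi * w)); congr cos.
  by rewrite mulrDr -[pi *+ 2]mulr_natl mulr_natr.
case: z => n; first by rewrite -pmulrn shiftn.
by rewrite NegzE mulrNz -pmulrn -(shiftn n.+1) subrK.
Qed.

(** The right-hand side is sin^2 (pi t). The integer is the nearest one: the floor if the fractional
    part is at most 1/2, its successor otherwise, where the symmetry sin (pi - x) = sin x reduces to
    the first case. *)
Lemma integer_distance (t : R) : exists k : int, (t - k%:~R) ^+ 2 <= (1 - cos (2 * pi * t)) / 2.
Proof.
have sc (u : R) : (1 - cos (2 * pi * u)) / 2 = sin (pi * u) ^+ 2.
  by rewrite (_ : 2 * pi * u = pi * u + pi * u); [rewrite (cos_double _).2; field|ring].
pose k := Num.floor t; pose u := t - k%:~R.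
have u0 : 0 <= u by rewrite subr_ge0 Num.Theory.floor_le ?num_real.
have u1 : u <= 1.
  by rewrite lerBlDr addrC -[X in _ + X](_ : 1%:~R = 1)// -intrD ltW// Num.Theory.floorD1_gt// num_real.
have sq (v w : R) : 0 <= v -> v <= w -> v ^+ 2 <= w ^+ 2.
  by move=> v0 vw; rewrite ler_pXn2r// nnegrE// (le_trans v0 vw).
have sp (z : int) (v : R) : sin (pi * (v + z%:~R)) ^+ 2 = sin (pi * v) ^+ 2.
  rewrite -!sc; by rewrite cos_2pi_int.
have tE : t = u + k%:~R by rewrite subrK.
rewrite sc tE sp; have [uh|uh] := leP u 2^-1.
  by exists k; rewrite addrK; apply: sq => //; apply: sin_ge_id; rewrite u0.
exists (k + 1); rewrite intrD (_ : u + _ - _ = - (1 - u)); last by ring.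
rewrite sqrrN; have -> : sin (pi * u) = sin (pi * (1 - u)).
  have -> : pi * (1 - u) = pi - pi * u by ring.
  by rewrite sinB sinpi cospi; ring.
apply: sq; first by rewrite subr_ge0.
by apply: sin_ge_id; apply/andP; split; lra.
Qed.

End sine_distance.

Lemma le_add_sqr_div (R : realType) (a e : R) : 0 < e -> 0 <= a -> a <= e + a ^+ 2 / e.
Proof.
move=> e0 a0; rewrite -(ler_pM2r e0) mulrDl mulfVK ?gt_eqF//.
have : 0 <= (a - e) ^+ 2 by exact: sqr_ge0.
by nra.
Qed.

Section modulus.
Context {R : realType} {d : nat}.
Local Notation Rd := 'rV[R]_d.
Local Notation mu := (torus_measure R d).
Local Notation periodic := Defs.periodic.
Implicit Types f k phi : Rd -> R.

Lemma bump1_distance (z : Rd) : exists k : 'rV[int]_d,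
  forall i, (z ord0 i - (k ord0 i)%:~R) ^+ 2 <= 1 - bump1 i z.
Proof.
have /choice[k hk] : forall i : 'I_d, exists k : int, (z ord0 i - k%:~R) ^+ 2 <= 1 - bump1 i z.
  move=> i; have [k hk] := integer_distance (z ord0 i); exists k; apply: le_trans hk _.
  by rewrite /bump1; lra.
by exists (\row_i k i) => i; rewrite mxE.
Qed.

Lemma coordinate_path f (L : 'I_d -> R) (x : Rd) (r : seq 'I_d) (t : 'I_d -> R) :
  (forall i y s, `|f (y + s *: delta_mx 0 i) - f y| <= `|s| * L i) ->
  `|f (x + \sum_(i <- r) t i *: delta_mx 0 i) - f x| <= \sum_(i <- r) `|t i| * L i.
Proof.
move=> h; elim: r x => [|i r ih] x; first by rewrite !big_nil addr0 subrr normr0.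
rewrite !big_cons addrA.
rewrite -[f _ - f x](subrKA (f (x + t i *: delta_mx 0 i))) [leRHS]addrC.
by apply: le_trans (ler_normD _ _) _; apply: lerD.
Qed.

(** The kernel controls squared distances, whereas the Lipschitz bound is linear in the
    displacement. The inequality t <= e + t^2 / e in each coordinate converts one into the other,
    after a lattice translation that makes the displacement small. *)
Lemma lipschitz_modulus f (L e : R) x y : 0 < e -> torus_C1 f -> (forall i x, `|pd i f x| <= L) ->
  `|f y - f x| <= L * d%:R * e + L / e * \sum_i (1 - bump1 i (x - y)).
Proof.
move=> e0 Cf hL; have [k hk] := bump1_distance (x - y).
have L0 (i : 'I_d) : 0 <= L by apply: le_trans (hL i x).
pose z : Rd := \sum_i (- (x - y) ord0 i + (k ord0 i)%:~R) *: delta_mx 0 i.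
have -> : f y = f (x + z).
  rewrite -(periodicD y k Cf.1.1); congr f; apply/rowP => j.
  rewrite mxE [in RHS]mxE /z summxE (bigD1 j)//= big1 => [|i ij]; last first.
    by rewrite !mxE eqxx eq_sym (negbTE ij) mulr0.
  by rewrite !mxE !eqxx/=; ring.
apply: (le_trans (@coordinate_path f (fun=> L) x _ _ _)).
  move=> i y' s; have [s' [_ ->]] := line_mvt (Cf.2 i).1 y' s.
  by rewrite normrM ler_wpM2l//; exact: hL.
rewrite [L * d%:R * e](_ : _ = \sum_(i < d) L * e); last first.
  by rewrite sumr_const card_ord -[RHS]mulr_natl; ring.
rewrite mulr_sumr -big_split/=; apply: ler_sum => i _.
have -> : L * e + L / e * (1 - bump1 i (x - y)) = (e + (1 - bump1 i (x - y)) / e) * L by field; rewrite gt_eqF.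
rewrite ler_wpM2r ?(L0 i)//; set t := (_ + _).
apply: (@le_trans _ _ (e + t ^+ 2 / e)); last first.
  rewrite lerD2l; apply: ler_wpM2r; first by rewrite invr_ge0 ltW.
  apply: le_trans (hk i); by rewrite /t -sqrrN opprD opprK.
rewrite -real_normK ?num_real//; exact: le_add_sqr_div.
Qed.

(** On the compact set of pairs (x, z) of the cube with |f (x + z) - f x| >= a, the sum of the
    [1 - bump1 i z] does not vanish: otherwise z would be an integer vector and periodicity would
    give a difference 0. It is therefore bounded below by some s > 0 there, and b = 2 M / s is large
    enough. *)
Lemma continuous_modulus f (a : R) : torus_continuous f -> 0 < a ->
  exists2 b : R, 0 <= b & forall x y, `|f y - f x| <= a + b * \sum_i (1 - bump1 i (x - y)).
Proof.
move=> tf a0; have [M fM] := torus_continuous_bounded tf.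
pose S (z : Rd) := \sum_i (1 - bump1 i z).
have tS : torus_continuous S.
  apply: torus_continuous_sum => i; apply: torus_continuousB; first exact: torus_continuous_cst.
  exact: trig_poly_continuous (trig_bump1 i).
have S0 z : 0 <= S z by apply: sumr_ge0 => i _; have := bump1_itv i z; rewrite subr_ge0 => /andP[].
pose cube := [set y : Rd | forall i, 0 <= y ord0 i <= 1].
pose G (p : Rd * Rd) := `|f (p.1 + p.2) - f p.1|.
have cG : continuous G.
  move=> p; apply: (@continuous_comp _ _ _ (fun p : Rd * Rd => f (p.1 + p.2) - f p.1) (fun r : R => `|r|)); last exact: norm_continuous.
  apply: continuousB.
    apply: (@continuous_comp _ _ _ (fun p : Rd * Rd => p.1 + p.2) f); last exact: tf.2.
    by apply: cvgD; [exact: cvg_fst|exact: cvg_snd].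
  by apply: (@continuous_comp _ _ _ fst f); [exact: cvg_fst|exact: tf.2].
pose K := (cube `*` cube) `&` G @^-1` [set r | a <= r].
have cK : compact K.
  apply: compact_closedI; first by apply: compact_setX; exact: cube_compact.
  by apply: closed_comp => [p _|]; [exact: cG|exact: closed_ge].
have cSK : compact ((S \o snd) @` K).
  apply: continuous_compact => //; apply: continuous_subspaceT => p.
  by apply: continuous_comp; [exact: cvg_snd|exact: tS.2].
have : ~ ((S \o snd) @` K) 0.
  move=> [[x z] [_ /= aG] /= Sz].
  have [k hk] := bump1_distance z.
  have z0 i : z ord0 i = (k ord0 i)%:~R.
    apply/eqP; rewrite -subr_eq0 -sqrf_eq0 eq_le sqr_ge0 andbT.
    apply: le_trans (hk i) _; have /eqP := Sz; rewrite psumr_eq0 => [|j _]; last first.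
      by have := bump1_itv j z; rewrite subr_ge0 => /andP[].
    by move=> /allP/(_ i (mem_index_enum _))/eqP ->.
  move: aG; rewrite /G/= (_ : z = map_mx intr k); last by apply/rowP => i; rewrite mxE z0.
  by rewrite (periodicD _ _ tf.1) subrr normr0 leNgt a0.
have oC : open (~` ((S \o snd) @` K)) by apply: closed_openC; exact: compact_closed.
move=> n0; have /nbhs_ballP[s /= s0 hs] := open_nbhs_nbhs (conj oC n0).
have hs' x z : cube x -> cube z -> a <= G (x, z) -> s <= S z.
  move=> Cx Cz aG; rewrite leNgt; apply/negP => Ssz.
  apply: (hs (S z)); first by rewrite -ball_normE /= sub0r normrN ger0_norm.
  by exists (x, z).
exists (2 * M / s) => [|x y].
  apply: divr_ge0; last exact: ltW.
  by apply: mulr_ge0 => //; exact: le_trans (fM 0).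
have [kx Cx] := cube_reduction x; have [kz Cz] := cube_reduction (y - x).
have ex : f x = f (x + map_mx intr kx) by rewrite (periodicD _ _ tf.1).
have ey : f y = f ((x + map_mx intr kx) + ((y - x) + map_mx intr kz)).
  by rewrite addrA (periodicD _ _ tf.1) addrAC subrKC (periodicD _ _ tf.1).
have eS : \sum_i (1 - bump1 i (x - y)) = S ((y - x) + map_mx intr kz).
  rewrite (periodicD _ _ tS.1) /S; apply: eq_bigr => i _.
  by rewrite -(opprB y x) /bump1 [in LHS]mxE mulrN cosN.
rewrite eS; have [h|h] := ltP (`|f y - f x|) a.
  by apply: (le_trans (ltW h)); rewrite lerDl mulr_ge0// divr_ge0 ?(ltW s0)// mulr_ge0//; exact: le_trans (fM 0).
have M0 : 0 <= M by exact: le_trans (fM 0).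
have sS : s <= S ((y - x) + map_mx intr kz) by apply: hs' Cx Cz _; rewrite /G/= -ex -ey.
apply: (@le_trans _ _ (2 * M / s * s)).
  rewrite mulfVK ?gt_eqF//; apply: le_trans (ler_normB _ _) _.
  by rewrite mulr2n mulrDl mul1r lerD.
apply: le_trans (_ : 2 * M / s * S ((y - x) + map_mx intr kz) <= _).
  by rewrite ler_wpM2l// divr_ge0 ?(ltW s0)// mulr_ge0.
by rewrite lerDr ltW.
Qed.

Lemma tconv_uniform f (e : R) : torus_continuous f -> 0 < e ->
  exists N0, forall N, (N0 <= N)%N -> forall x, `|tconv N f x - f x| <= e.
Proof.
move=> tf e0; have e20 : 0 < e / 2 by rewrite divr_gt0.
have [b b0 hb] := continuous_modulus tf e20.
pose N0 := Num.truncn (b * d%:R / e); exists N0 => N N0N x.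
apply: le_trans (tconv_korovkin N tf (hb x)) _.
rewrite [leRHS](splitr e) lerD2l ler_pdivrMr//.
have : b * d%:R / e < N.+1%:R.
  apply: lt_le_trans (_ : N0.+1%:R <= _); last by rewrite ler_nat.
  by rewrite /N0 truncnS_gt.
by rewrite ltr_pdivrMr// => /ltW h; apply: le_trans h _; rewrite le_eqVlt; apply/orP; left; apply/eqP; field.
Qed.

(** The rank depends on L and e but not on f. This uniformity allows the degree for u to be fixed
    before the approximate density, whose logarithm is to be mollified, is known. *)
Lemma tconv_lipschitz (L e : R) : 0 < e -> 0 <= L -> exists N0, forall N, (N0 <= N)%N ->
  forall f, torus_C1 f -> (forall i x, `|pd i f x| <= L) -> forall x, `|tconv N f x - f x| <= e.
Proof.
move=> e0 L0; pose e' := e / (2 * (L * d%:R + 1)).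
have D0 : 0 < L * d%:R + 1 by rewrite ltr_wpDl// mulr_ge0.
have e'0 : 0 < e' by rewrite divr_gt0// mulr_gt0.
pose b := L / e'; pose N0 := Num.truncn (b * d%:R / e); exists N0 => N N0N f Cf hL x.
apply: le_trans (tconv_korovkin N Cf.1 (fun y => lipschitz_modulus x y e'0 Cf hL)) _.
rewrite [leRHS](splitr e) lerD//.
  have -> : L * d%:R * e' = (e / 2) * (L * d%:R / (L * d%:R + 1)) by rewrite /e'; field; rewrite gt_eqF.
  rewrite ler_piMr//; first by rewrite divr_ge0// ltW.
  by rewrite ler_pdivrMr// mul1r lerDl.
rewrite ler_pdivrMr//.
have : b * d%:R / e < N.+1%:R.
  apply: lt_le_trans (_ : N0.+1%:R <= _); last by rewrite ler_nat.
  by rewrite /N0 truncnS_gt.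
by rewrite ltr_pdivrMr// => /ltW h; apply: le_trans h _; rewrite le_eqVlt; apply/orP; left; apply/eqP; field.
Qed.

(** Every convolution of f is at most the supremum of the kernel times the integral of f, hence 0,
    and the convolutions converge uniformly to f. *)
Lemma torus_full_support f : torus_continuous f -> (forall x, 0 <= f x) ->
  \int[mu]_x f x = 0 -> forall x, f x = 0.
Proof.
move=> tf f0 If x; apply/eqP; rewrite eq_le f0 andbT; apply/ler_addgt0Pl => e e0; rewrite addr0.
have [N0 /(_ N0 (leqnn _) x)] := tconv_uniform tf e0.
suff -> : tconv N0 f x = 0 by rewrite sub0r normrN ger0_norm.
have tk : torus_continuous (fun y : Rd => kern N0 (x - y)).
  by apply: torus_continuous_reflect; exact: trig_poly_continuous (trig_kern N0).
have [M kM] := torus_continuous_bounded tk.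
apply/eqP; rewrite eq_le Rint_ge0 ?andbT => [|y]; last by rewrite mulr_ge0 ?kern_ge0.
apply: (@le_trans _ _ (\int[mu]_y (M * f y))).
  apply: Rint_le => [||y]; [by apply: tcMI => //; exact: tcI|by apply: integrableRZ; exact: tcI|].
  by rewrite ler_wpM2r//; apply: le_trans (kM y); exact: ler_norm.
by rewrite RintZ ?If ?mulr0//; exact: tcI.
Qed.

End modulus.

Section real_sequences.
Context {R : realType}.
Implicit Types u v : nat -> R.

Lemma cvg_seq_ge u (a l : R) : u n @[n --> \oo] --> l -> (forall n, a <= u n) -> a <= l.
Proof.
move=> ul au; rewrite -(cvg_lim (@Rhausdorff R) ul); apply: limr_ge; first exact: cvgP ul.
exact: nearW.
Qed.

Lemma cvg_seq_le u (a l : R) : u n @[n --> \oo] --> l -> (forall n, u n <= a) -> l <= a.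
Proof.
move=> ul au; rewrite -(cvg_lim (@Rhausdorff R) ul); apply: limr_le; first exact: cvgP ul.
exact: nearW.
Qed.

Lemma cvg_seq_le2 u v (a b : R) : u n @[n --> \oo] --> a -> v n @[n --> \oo] --> b ->
  (forall n, u n <= v n) -> a <= b.
Proof. by move=> ua vb uv; apply: (ler_cvg_to ua vb); exact: nearW. Qed.

Lemma cvg_seqP u (l : R) : u n @[n --> \oo] --> l <->
  forall e : R, 0 < e -> exists N, forall n, (N <= n)%N -> `|u n - l| <= e.
Proof.
split=> [/cvgrPdist_le h e /h [N _ hN]|h].
  by exists N => n Nn; rewrite distrC; exact: hN.
by apply/cvgrPdist_le => e /h[N hN]; exists N => // n Nn; rewrite distrC; exact: hN.
Qed.

End real_sequences.

(** * Translations in L^2 and the Poincare inequality *)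

Section poincare.
Context {R : realType} {d : nat}.
Local Notation Rd := 'rV[R]_d.
Local Notation mu := (torus_measure R d).
Local Notation periodic := Defs.periodic.
Implicit Types f k phi : Rd -> R.

Lemma torus_product_integrable (F : Rd * Rd -> R) (M : R) : measurable_fun setT F ->
  (forall p, `|F p| <= M) -> (mu \x mu)%E.-integrable setT (EFin \o F).
Proof.
move=> mF FM; apply: measurable_bounded_integrable => //.
  have := @product_measure1E _ _ _ _ _ mu mu setT setT measurableT measurableT.
  rewrite setXTT => h; apply: (@le_lt_trans _ _ (mu setT * mu setT)%E).
    by rewrite -h.
  by rewrite !probability_setT mule1 ltry.
by exists M; split; [exact: num_real|move=> N MN x _ /=; exact: le_trans (FM _) (ltW MN)].
Qed.

Lemma torus_slice_integrable (F : Rd * Rd -> R) (M : R) : measurable_fun setT F ->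
  (forall p, `|F p| <= M) -> integrableR mu (fun x => \int[mu]_y F (x, y)).
Proof.
move=> mF FM; have iF := torus_product_integrable mF FM.
have i1 x : integrableR mu (fun y => F (x, y)).
  apply: (bounded_integrable _ _ (M := M)) => [|y //].
  by apply: measurableT_comp => //; exact: measurable_pair1.
have := @integrable_fubini_F _ _ _ _ R mu mu (EFin \o F) iF.
by congr (_.-integrable _ _); apply/funext => x; rewrite /fubini_F /= (Rint_EFin (i1 x)).
Qed.

Lemma torus_fubini (F : Rd * Rd -> R) (M : R) : measurable_fun setT F -> (forall p, `|F p| <= M) ->
  [/\ integrableR mu (fun x => \int[mu]_y F (x, y)), integrableR mu (fun y => \int[mu]_x F (x, y)) &
  \int[mu]_x \int[mu]_y F (x, y) = \int[mu]_y \int[mu]_x F (x, y)].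
Proof.
move=> mF FM; have iF := torus_product_integrable mF FM.
have i1 x : integrableR mu (fun y => F (x, y)).
  apply: (bounded_integrable _ _ (M := M)) => [|y //].
  by apply: measurableT_comp => //; exact: measurable_pair1.
have i2 y : integrableR mu (fun x => F (x, y)).
  apply: (bounded_integrable _ _ (M := M)) => [|x //].
  by apply: measurableT_comp => //; exact: measurable_pair2.
split.
- exact: torus_slice_integrable mF FM.
- apply: (@torus_slice_integrable (F \o (fun p : Rd * Rd => (p.2, p.1))) M) => [|p]; last exact: FM.
  apply: measurableT_comp => //; exact: (measurable_fun_pair measurable_snd measurable_fst).
rewrite {1 3}/Rintegral; congr fine.
rewrite (eq_integral (fun x => (\int[mu]_y (F (x, y))%:E)%E)) => [|x _]; last by rewrite -(Rint_EFin (i1 x)).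
by rewrite (Fubini iF); apply: eq_integral => y _; rewrite -(Rint_EFin (i2 y)).
Qed.

(** A form of Minkowski's inequality: in (a + b)^2 <= (1 + 1/k) a^2 + (1 + k) b^2 with k = n + 1,
    the weights are those for which the bound k^2 for k steps turns into (k + 1)^2 for one more
    step. *)
Lemma sqr_shift_iter f (v : Rd) n : torus_continuous f ->
  \int[mu]_x (f (x + n.+1%:R *: v) - f x) ^+ 2 <=
  n.+1%:R ^+ 2 * \int[mu]_x (f (x + v) - f x) ^+ 2.
Proof.
move=> tf.
have tD (a : Rd) : torus_continuous (fun x => (f (x + a) - f x) ^+ 2).
  by apply: torus_continuousX; apply: torus_continuousB => //; exact: torus_continuous_shift.
elim: n => [|n ih]; first by rewrite scale1r expr1n mul1r.
pose a x := f (x + n.+1%:R *: v + v) - f (x + v); pose b x := f (x + v) - f x.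
have ta : torus_continuous (fun x => a x ^+ 2).
  have := torus_continuous_shift v (tD (n.+1%:R *: v)); congr torus_continuous.
  by apply/funext => x; rewrite /a addrAC.
have e : \int[mu]_x a x ^+ 2 = \int[mu]_x (f (x + n.+1%:R *: v) - f x) ^+ 2.
  rewrite -[RHS](torus_shift v (tD _)); apply: tint_ext => x.
  by rewrite /a addrAC.
pose k : R := n.+1%:R; have k0 : 0 < k by rewrite ltr0n.
apply: (@le_trans _ _ (\int[mu]_x ((1 + k^-1) * a x ^+ 2 + (1 + k) * b x ^+ 2))).
  apply: Rint_le => [||x].
  - exact: tcI.
  - by apply: integrableRD; apply: integrableRZ; [exact: tcI ta|exact: tcI (tD v)].
  have -> : f (x + n.+2%:R *: v) - f x = a x + b x.
    by rewrite /a /b -[n.+2]addn1 natrD scalerDl scale1r addrA; ring.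
  rewrite -subr_ge0 (_ : _ - _ = (a x - k * b x) ^+ 2 / k); first by rewrite divr_ge0 ?sqr_ge0// ltW.
  by field; rewrite gt_eqF.
have tb : torus_continuous (fun x => b x ^+ 2) by exact: tD.
rewrite RintD ?RintZ ?e; [|by [apply: integrableRZ; exact: tcI|exact: tcI]..].
set S := \int[mu]_x b x ^+ 2.
apply: (@le_trans _ _ ((1 + k^-1) * (k ^+ 2 * S) + (1 + k) * S)).
  rewrite lerD2r; apply: ler_wpM2l; last exact: ih.
  by rewrite addr_ge0// invr_ge0 ltW.
rewrite le_eqVlt; apply/orP; left; apply/eqP.
by rewrite -[n.+2]addn1 natrD -/k; field; rewrite gt_eqF.
Qed.

(** The translation is cut into n + 1 equal steps. By [sqr_shift_iter] its squared norm is at most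
    the integral of the rescaled difference quotient [q n], which tends to that of the squared
    derivative by dominated convergence. *)
Lemma sqr_shift f i (t : R) : torus_C1 f ->
  \int[mu]_x (f (x + t *: delta_mx 0 i) - f x) ^+ 2 <= t ^+ 2 * \int[mu]_x (pd i f x) ^+ 2.
Proof.
move=> Cf; have tp := (Cf.2 i).2; have [M pM] := torus_continuous_bounded tp.
pose q n (x : Rd) := (n.+1%:R * (f (x + (t / n.+1%:R) *: delta_mx 0 i) - f x)) ^+ 2.
have mvt n x : exists s : R, `|s| <= `|t| / n.+1%:R /\ q n x = t ^+ 2 * pd i f (x + s *: delta_mx 0 i) ^+ 2.
  have [s [sn e]] := line_mvt (Cf.2 i).1 x (t / n.+1%:R).
  exists s; split; first by apply: le_trans sn _; rewrite normrM [X in _ * X]ger0_norm.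
  by rewrite /q e -exprMn; congr (_ ^+ 2); rewrite mulrA mulrCA mulfV// mulr1.
have tq n : torus_continuous (q n).
  apply: torus_continuousX; apply: torus_continuousM; first exact: torus_continuous_cst.
  by apply: torus_continuousB; [apply: torus_continuous_shift|]; exact: Cf.1.
have tpX := torus_continuousX 2 tp.
have tl : torus_continuous (fun x => t ^+ 2 * pd i f x ^+ 2).
  by apply: torus_continuousM => //; exact: torus_continuous_cst.
have qc x : q n x @[n --> \oo] --> t ^+ 2 * pd i f x ^+ 2.
  apply/cvgrPdist_lt => e e0.
  have /continuous_epsP/(_ x e e0)[del del0 h] := tl.2.
  have t10 : 0 < `|t| + 1 by rewrite ltr_wpDl.
  have := @cvg_harmonic R => /cvgrPdist_lt/(_ (del / (`|t| + 1)) (divr_gt0 del0 t10)); apply: filterS => n.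
  rewrite sub0r normrN => hn; have [s [sn ->]] := mvt n x; apply: h.
  rewrite opprD addNKr normrN normrZ.
  apply: le_lt_trans (_ : `|t| / n.+1%:R < del).
    by rewrite -[leRHS]mulr1 ler_pM// norm_delta.
  move: hn; rewrite /= ger0_norm// ltr_pdivlMr// mulrC => hn.
  by apply: le_lt_trans hn; rewrite ler_wpM2r// lerDl.
have [|||||_] := @Rintegral_dominated _ _ _ mu q (fun x => t ^+ 2 * pd i f x ^+ 2) (fun=> t ^+ 2 * M ^+ 2).
- by move=> n; exact: torus_continuous_measurable.
- exact: torus_continuous_measurable.
- by apply: aeW => x; exact: qc.
- exact: torus_continuous_integrable (torus_continuous_cst _).
- apply: aeW => x n; have [s [_ ->]] := mvt n x.
  rewrite ger0_norm; last by rewrite mulr_ge0// sqr_ge0.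
  apply: ler_wpM2l; first exact: sqr_ge0.
  by rewrite -real_normK ?num_real// ler_pXn2r ?nnegrE// (le_trans _ (pM x)).
rewrite RintZ; last exact: tcI.
move=> h; apply: cvg_seq_ge h _ => n.
have := sqr_shift_iter ((t / n.+1%:R) *: delta_mx 0 i) n Cf.1.
rewrite scalerA mulrCA mulfV ?pnatr_eq0// mulr1 => h; apply: le_trans h _.
rewrite -RintZ; last first.
  apply: tcI; apply: torus_continuousX; apply: torus_continuousB; last exact: Cf.1.
  exact: torus_continuous_shift Cf.1.
by rewrite le_eqVlt; apply/orP; left; apply/eqP; apply: tint_ext => x; rewrite /q exprMn.
Qed.

Lemma sqr_shift_path f (r : seq 'I_d) (t : 'I_d -> R) : torus_C1 f ->
  \int[mu]_x (f (x + \sum_(i <- r) t i *: delta_mx 0 i) - f x) ^+ 2 <=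
  (size r)%:R * \sum_(i <- r) t i ^+ 2 * \int[mu]_x (pd i f x) ^+ 2.
Proof.
move=> Cf; have tf := Cf.1.
have tD (a : Rd) : torus_continuous (fun x => (f (x + a) - f x) ^+ 2).
  by apply: torus_continuousX; apply: torus_continuousB => //; exact: torus_continuous_shift.
elim: r => [|i r ih].
  rewrite !big_nil (@tint_ext _ _ (fun=> 0)) ?Rint_cst ?mulr0// => x.
  by rewrite addr0 subrr expr0n.
rewrite !big_cons; set z := \sum_(j <- r) _ in ih *; set A := t i ^+ 2 * _.
set B := \sum_(j <- r) _ in ih *.
pose a (x : Rd) := f (x + t i *: delta_mx 0 i + z) - f (x + t i *: delta_mx 0 i).
pose b (x : Rd) := f (x + t i *: delta_mx 0 i) - f x.
have ta : torus_continuous (fun x => a x ^+ 2) by exact: torus_continuous_shift (tD z).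
have tb : torus_continuous (fun x => b x ^+ 2) by exact: tD.
have ea : \int[mu]_x a x ^+ 2 <= (size r)%:R * B.
  by rewrite /a (torus_shift (t i *: delta_mx 0 i) (tD z)).
have eb : \int[mu]_x b x ^+ 2 <= A by exact: sqr_shift.
have ab x : f (x + (t i *: delta_mx 0 i + z)) - f x = a x + b x by rewrite /a /b addrA; ring.
have [r0|r0] := posnP (size r).
  rewrite (@tint_ext _ _ (fun x => b x ^+ 2)) => [|x].
    by rewrite /B (size0nil r0) big_nil addr0 mul1r.
  by rewrite /b /z (size0nil r0) big_nil addr0.
pose k : R := (size r)%:R; have k0 : 0 < k by rewrite ltr0n.
apply: (@le_trans _ _ (\int[mu]_x ((1 + k^-1) * a x ^+ 2 + (1 + k) * b x ^+ 2))).
  apply: Rint_le => [||x].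
  - exact: tcI.
  - by apply: integrableRD; apply: integrableRZ; exact: tcI.
  rewrite ab -subr_ge0 (_ : _ - _ = (a x - k * b x) ^+ 2 / k); first by rewrite divr_ge0 ?sqr_ge0// ltW.
  by field; rewrite gt_eqF.
rewrite RintD ?RintZ; [|by [apply: integrableRZ; exact: tcI|exact: tcI]..].
rewrite /= -natr1 -/k.
apply: (@le_trans _ _ ((1 + k^-1) * (k * B) + (1 + k) * A)).
  by rewrite lerD// ler_wpM2l// addr_ge0// ?invr_ge0 ltW.
by rewrite le_eqVlt; apply/orP; left; apply/eqP; field; rewrite gt_eqF.
Qed.

(** By periodicity z may be replaced by its difference with the integer vector of [bump1_distance],
    whose squared coordinates are bounded by the [1 - bump1 i z], exactly the functions whose
    average against the kernel is explicit. *)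
Lemma sqr_shift_bump f (z : Rd) : torus_C1 f ->
  \int[mu]_x (f (x + z) - f x) ^+ 2 <=
  d%:R * \sum_i (1 - bump1 i z) * \int[mu]_x (pd i f x) ^+ 2.
Proof.
move=> Cf; have [k hk] := bump1_distance z.
pose t i := z ord0 i - (k ord0 i)%:~R.
have h := sqr_shift_path (index_enum 'I_d) t Cf.
have zE : z = \sum_i t i *: delta_mx 0 i + map_mx intr k.
  rewrite {1}[z]row_sum_delta [map_mx _ _]row_sum_delta -big_split/=; apply: eq_bigr => i _.
  by rewrite -scalerDl mxE /t subrK.
rewrite (@tint_ext _ _ (fun x => (f (x + \sum_i t i *: delta_mx 0 i) - f x) ^+ 2)); last first.
  by move=> x; rewrite {1}zE addrA (periodicD _ _ Cf.1.1).
apply: le_trans h _; rewrite (_ : size _ = d); last by rewrite -[RHS]card_ord cardT enumT.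
rewrite ler_wpM2l//; apply: ler_sum => i _; rewrite ler_wpM2r//; last exact: hk.
by apply: Rint_ge0 => x; exact: sqr_ge0.
Qed.

(* For N = 0 the kernel is constant and this is the Poincare inequality. *)
Lemma tconv_sqr f N : torus_C1 f ->
  \int[mu]_x (tconv N f x - f x) ^+ 2 <= d%:R / (2 * N.+1%:R) * \sum_i \int[mu]_x (pd i f x) ^+ 2.
Proof.
move=> Cf; have tf := Cf.1; have [M fM] := torus_continuous_bounded tf.
have tk := trig_poly_continuous (@trig_kern R d N); have [K kK] := torus_continuous_bounded tk.
pose F (p : Rd * Rd) := kern N p.2 * (f (p.1 + p.2) - f p.1) ^+ 2.
have mF : measurable_fun setT F.
  apply: measurable_funM; first by apply: measurableT_comp => //; exact: torus_continuous_measurable.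
  apply: measurable_funX; apply: measurable_funB.
    apply: (@measurableT_comp _ _ _ _ _ _ f); first exact: torus_continuous_measurable.
    apply: measurable_fun_rV => i; rewrite (_ : (fun p => _) = fun p : Rd * Rd => p.1 ord0 i + p.2 ord0 i).
      apply: measurable_funD.
        by apply: (@measurableT_comp _ _ _ _ _ _ (fun x : Rd => x ord0 i)) => //; exact: measurable_rV_coord.
      by apply: (@measurableT_comp _ _ _ _ _ _ (fun x : Rd => x ord0 i)) => //; exact: measurable_rV_coord.
    by apply/funext => p; rewrite mxE.
  by apply: (@measurableT_comp _ _ _ _ _ _ f) => //; exact: torus_continuous_measurable.
have FM p : `|F p| <= K * (2 * M) ^+ 2.
  rewrite /F normrM normrX; apply: ler_pM => //.
  rewrite ler_pXn2r ?nnegrE ?mulr_ge0//; last exact: le_trans (fM 0).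
  by apply: le_trans (ler_normB _ _) _; rewrite mulr2n mulrDl mul1r lerD.
have [iF iF' eF] := torus_fubini mF FM.
have tsh x : torus_continuous (fun z => f (x + z) - f x).
  apply: torus_continuousB; last exact: torus_continuous_cst.
  have := torus_continuous_shift x tf; congr torus_continuous; apply/funext => z; by rewrite addrC.
have jensen x : (tconv N f x - f x) ^+ 2 <= \int[mu]_z F (x, z).
  have e : tconv N f x - f x = \int[mu]_z (kern N z * (f (x + z) - f x)).
    rewrite tconv_sub// -(@torus_shift _ _ (fun z => kern N z * (f (x + z) - f x)) (- x)).
      by apply: tint_ext => y; rewrite subrKC -kernN opprB.
    exact: (torus_continuousM tk (tsh x)).
  set c := tconv N f x - f x in e *.
  have i1 : \int[mu]_z kern N z = 1.
    by rewrite -[RHS](@kern_int R d N 0); apply: tint_ext => z; rewrite sub0r kernN.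
  have t2 : torus_continuous (fun z => kern N z * (f (x + z) - f x)) by exact: torus_continuousM.
  have t3 : torus_continuous (fun z => kern N z * (f (x + z) - f x) ^+ 2).
    exact: (torus_continuousM tk (torus_continuousX 2 (tsh x))).
  have : 0 <= \int[mu]_z (kern N z * (f (x + z) - f x - c) ^+ 2).
    by apply: Rint_ge0 => z; rewrite mulr_ge0 ?kern_ge0 ?sqr_ge0.
  rewrite (@tint_ext _ _ (fun z => kern N z * (f (x + z) - f x) ^+ 2 - (2 * c * (kern N z * (f (x + z) - f x)) - c ^+ 2 * kern N z))); last first.
    by move=> z; ring.
  rewrite RintB; [|exact: tcI|by apply: integrableRB; apply: integrableRZ; exact: tcI].
  rewrite RintB; [|by apply: integrableRZ; exact: tcI..].
  rewrite RintZ ?RintZ; [|exact: tcI..]; rewrite -e i1 /F/=.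
  set J := \int[mu]_z _; rewrite mulr1 (_ : J - _ = J - c ^+ 2); last by ring.
  by rewrite subr_ge0.
apply: (@le_trans _ _ (\int[mu]_x \int[mu]_z F (x, z))).
  apply: Rint_le; [|exact: iF|exact: jensen].
  apply: tcI; apply: torus_continuousX; apply: torus_continuousB; last exact: tf.
  by apply: trig_poly_continuous; apply: tconv_trig; exact: tcI.
rewrite eF; pose A i := \int[mu]_x (pd i f x) ^+ 2.
have tb i : torus_continuous (fun z : Rd => kern N z * (1 - bump1 i z)).
  apply: (torus_continuousM tk); apply: torus_continuousB; first exact: torus_continuous_cst.
  exact: trig_poly_continuous (trig_bump1 i).
apply: (@le_trans _ _ (\int[mu]_z (d%:R * \sum_i A i * (kern N z * (1 - bump1 i z))))).
  apply: Rint_le.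
  - exact: iF'.
  - by apply: integrableRZ; apply: integrableR_sum => i; apply: integrableRZ; exact: tcI.
  move=> z; rewrite /F/= RintZ; last first.
    by apply: tcI; apply: torus_continuousX; apply: (torus_continuousB _ tf); exact: torus_continuous_shift.
  apply: le_trans (_ : kern N z * (d%:R * \sum_i (1 - bump1 i z) * A i) <= _).
    by rewrite ler_wpM2l ?kern_ge0// sqr_shift_bump.
  rewrite mulrCA mulr_sumr le_eqVlt; apply/orP; left; apply/eqP; congr (_ * _).
  by apply: eq_bigr => i _; ring.
rewrite RintZ; last by apply: integrableR_sum => i; apply: integrableRZ; exact: tcI.
rewrite Rint_sum; last by move=> i; apply: integrableRZ; exact: tcI.
rewrite -[leRHS]mulrA; apply: ler_wpM2l; first exact: ler0n.
rewrite mulr_sumr; apply: ler_sum => i _.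
rewrite RintZ; last exact: tcI.
rewrite mulrC ler_wpM2r//; first by apply: Rint_ge0 => x; exact: sqr_ge0.
rewrite -(kern_concentration N 0 i) le_eqVlt; apply/orP; left; apply/eqP; apply: tint_ext => z.
by rewrite sub0r kernN /bump1 mxE mulrN cosN.
Qed.

End poincare.

(** * The fundamental lemma of the calculus of variations *)

Section fundamental_lemma.
Context {R : realType} {d : nat}.
Local Notation Rd := 'rV[R]_d.
Local Notation mu := (torus_measure R d).
Local Notation periodic := Defs.periodic.
Implicit Types f k phi G : Rd -> R.

Lemma rV_cons_lshift n (p : R * 'rV[R]_n) j : rV_cons p ord0 (@lshift 1 n j) = p.1.
Proof. by rewrite [LHS]row_mxEl !ord1 mxE eqxx mulr1n. Qed.

Lemma rV_cons_rshift n (p : R * 'rV[R]_n) j : rV_cons p ord0 (@rshift 1 n j) = p.2 ord0 j.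
Proof. by rewrite [LHS]row_mxEr. Qed.

Lemma torus_marginal n (i : 'I_n) (B : set R) : measurable B ->
  torus_measure R n ((fun x : 'rV[R]_n => x ord0 i) @^-1` B) = @unit_interval_measure R B.
Proof.
move=> mB; elim: n i => [[]//|n ih] i.
have P1 : torus_measure R n setT = 1%E := probability_setT (torus_measure R n).
have Q1 : @unit_interval_measure R setT = 1%E := probability_setT _.
rewrite /= /cube_step /pushforward.
case: (split_ordP (i : 'I_(1 + n))) => j ij.
  rewrite (_ : _ @^-1` _ = (B : set (measurableTypeR R)) `*` setT).
    rewrite (@product_measure1E _ _ (measurableTypeR R) _ R (@unit_interval_measure R) (torus_measure R n) B setT)//.
    by rewrite [X in (_ * X)%E]P1 mule1.
  by apply/seteqP; split => -[t y] /=; rewrite ij rV_cons_lshift => h; [split|case: h].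
rewrite (_ : _ @^-1` _ = setT `*` ((fun x : 'rV[R]_n => x ord0 j) @^-1` B)).
  rewrite (@product_measure1E _ _ (measurableTypeR R) _ R (@unit_interval_measure R) (torus_measure R n))// ?ih//.
    rewrite [X in (X * _)%E]Q1 mul1e; exact: ih.
  by rewrite -[X in measurable X]setTI; exact: measurable_rV_coord.
by apply/seteqP; split => -[t y] /=; rewrite ij rV_cons_rshift => h; [split|case: h].
Qed.

Definition annihilates G := integrableR mu G /\
  forall phi, torus_continuous phi -> \int[mu]_x (G x * phi x) = 0.

(** The good sets: multiplication by their indicator preserves orthogonality to all continuous
    functions. They form a sigma-algebra containing the half-spaces, hence are all the measurable
    sets; tested with the constant 1, an annihilated function then has integral 0 over every
    measurable set. *)
Definition separating (A : set Rd) := measurable A /\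
  forall G, annihilates G -> annihilates (fun x => \1_A x * G x).

Lemma indic_le1 (A : set Rd) (x : Rd) : `|\1_A x : R| <= 1.
Proof. by rewrite indicE; case: (x \in A); rewrite ?normr1 ?normr0. Qed.

Lemma integrableR_indic (A : set Rd) G : measurable A -> integrableR mu G ->
  integrableR mu (fun x => \1_A x * G x).
Proof. by move=> mA; apply: integrableR_boundedM; [exact: measurable_indic|exact: indic_le1]. Qed.

Lemma annihilates_lim G (psi_ : nat -> Rd -> R) (psi : Rd -> R) (M : R) : integrableR mu G ->
  (forall n, measurable_fun setT (psi_ n)) -> measurable_fun setT psi ->
  (forall n x, `|psi_ n x| <= M) -> {ae mu, forall x, psi_ n x @[n --> \oo] --> psi x} ->
  forall phi, torus_continuous phi -> (forall n, \int[mu]_x (psi_ n x * G x * phi x) = 0) ->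
  \int[mu]_x (psi x * G x * phi x) = 0.
Proof.
move=> iG mpsi_ mpsi psiM cpsi phi tphi h.
have mG := integrableR_measurable iG.
have mphi := torus_continuous_measurable tphi.
have [_ c] := @Rintegral_dominated R _ Rd mu (fun n x => psi_ n x * G x * phi x)
  (fun x => psi x * G x * phi x) (fun x => M * `|phi x * G x|)
  (fun n => measurable_funM (measurable_funM (mpsi_ n) mG) mphi)
  (measurable_funM (measurable_funM mpsi mG) mphi)
  ltac:(by apply: filterS cpsi => x cx; apply: cvgM; [apply: cvgM => //|]; exact: cvg_cst)
  (integrableRZ M (integrableR_abs (tcMI tphi iG)))
  ltac:(by apply: aeW => x n; rewrite -mulrA normrM (mulrC (phi x)) ler_wpM2r).
by apply: (@cvg_seq_unique R _ _ _ c); under eq_fun do rewrite h; exact: cvg_cst.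
Qed.

Lemma separatingC (A : set Rd) : separating A -> separating (~` A).
Proof.
move=> [mA hA]; split; first exact: measurableC.
move=> G aG; have [iG hG] := aG; have [iA hAG] := hA _ aG; split.
  by apply: integrableR_indic => //; exact: measurableC.
move=> phi tphi; rewrite (_ : Rintegral _ _ _ = \int[mu]_x (phi x * G x - phi x * (\1_A x * G x))).
  rewrite RintB; [|exact: tcMI..].
  rewrite (tint_ext (k := fun x => G x * phi x)) ?hG//; last by move=> x; rewrite mulrC.
  rewrite (tint_ext (k := fun x => \1_A x * G x * phi x)) ?hAG ?subr0// => x; by rewrite mulrC.
by apply: tint_ext => x; rewrite !indicE in_setC; case: (x \in A) => /=; ring.
Qed.

Lemma separatingI (A B : set Rd) : separating A -> separating B -> separating (A `&` B).
Proof.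
move=> [mA hA] [mB hB]; split; first exact: measurableI.
move=> G aG; have := hA _ (hB _ aG); congr annihilates.
by apply/funext => x; rewrite indicI mulrA.
Qed.

Lemma separating_sigma : sigma_algebra setT separating.
Proof.
have s0 : separating set0.
  split; first exact: measurable0.
  move=> G [iG hG]; split; first exact: integrableR_indic.
  move=> phi tphi; rewrite (tint_ext (k := fun=> 0)) ?Rint_cst//.
  by move=> x; rewrite indicE in_set0 !mul0r.
split => //.
  by move=> A /separatingC; rewrite setTD.
move=> F hF.
have sU n : separating (\big[setU/set0]_(i < n) F i).
  elim: n => [|n ih]; first by rewrite big_ord0.
  rewrite big_ord_recr/= -[X in separating X]setCK setCU.
  by apply: separatingC; apply: separatingI; exact: separatingC.
have mU : measurable (\bigcup_i F i) by apply: bigcup_measurable => i _; case: (hF i).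
split => // G aG; have [iG hG] := aG; split; first exact: integrableR_indic.
move=> phi tphi.
apply: (@annihilates_lim G (fun n => \1_(\big[setU/set0]_(i < n) F i)) _ 1) => //.
- by move=> n; apply: measurable_indic; case: (sU n).
- by move=> n x; exact: indic_le1.
- apply: aeW => x; apply/cvg_seqP => e e0.
  have [[i _ Fix]|nFx] := pselect ((\bigcup_i F i) x).
    exists i.+1 => n ni; rewrite !indicE !mem_set ?subrr ?normr0 ?ltW//; first by exists i.
    by rewrite -bigcup_mkord; exists i.
  exists 0%N => n _; rewrite !indicE !memNset ?subrr ?normr0 ?ltW// -bigcup_mkord.
  by move=> [i _ Fix]; apply: nFx; exists i.
- by move=> n; have [_ h] := (sU n).2 _ aG; exact: h.
Qed.

Lemma separating_null (A B : set Rd) : measurable A -> separating B ->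
  {ae mu, forall x, \1_A x = \1_B x :> R} -> separating A.
Proof.
move=> mA [mB hB] AB; split => // G aG; have [iB hBG] := hB _ aG.
split; first by apply: integrableR_indic => //; case: aG.
move=> phi tphi; rewrite -(hBG _ tphi); congr fine; apply: ae_eq_integral => //.
- by apply/measurable_EFinP; apply: measurable_funM (torus_continuous_measurable tphi); exact: integrableR_measurable (integrableR_indic mA aG.1).
- by apply/measurable_EFinP; apply: measurable_funM (torus_continuous_measurable tphi); exact: integrableR_measurable iB.
- by apply: filterS AB => x /= -> _.
Qed.

Lemma torus_coord_ae (i : 'I_d) : {ae mu, forall x : Rd, 0 < x ord0 i < 1}.
Proof.
have mB : measurable (`]0%R, 1%R[%classic : set R) by exact: measurable_itv.
have mS : measurable ((fun x : Rd => x ord0 i) @^-1` `]0%R, 1%R[%classic).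
  by rewrite -[X in measurable X]setTI; exact: measurable_rV_coord.
exists (~` ((fun x : Rd => x ord0 i) @^-1` `]0%R, 1%R[%classic)); split.
- exact: measurableC.
- rewrite probability_setC// torus_marginal// /unit_interval_measure /mrestr setIidl.
    by rewrite lebesgue_measure_itv/= lte_fin ltr01 sube0 subee.
  by move=> x /=; rewrite !in_itv/= => /andP[a b]; rewrite !ltW.
- by move=> x /= h; rewrite in_itv/=.
Qed.

(** Inside the unit cube the trigonometric polynomial [p] is positive exactly where x_i < a. The
    truncations of k p to [0, 1] are continuous, periodic and tend to the indicator almost
    everywhere. For a <= 0 and a >= 1 the half-space is null or full for the torus measure. *)
Lemma separating_halfspace (i : 'I_d) (a : R) : separating [set x : Rd | x ord0 i < a].
Proof.
have mH : measurable [set x : Rd | x ord0 i < a].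
  rewrite (_ : [set _ | _] = (fun x : Rd => x ord0 i) @^-1` `]-oo, a[%classic).
    by rewrite -[X in measurable X]setTI; apply: measurable_rV_coord => //; exact: measurable_itv.
  by apply/seteqP; split => x /=; rewrite in_itv.
have [s0 sC _] := separating_sigma.
have [a0|a0] := leP a 0.
  apply: separating_null s0 _ => //; apply: filterS (torus_coord_ae i) => x /andP[x0 x1].
  by rewrite !indicE in_set0 memNset//= => xa; lra.
have [a1|a1] := leP 1 a.
  apply: separating_null (sC _ s0) _ => //; apply: filterS (torus_coord_ae i) => x /andP[x0 x1].
  by rewrite setD0 !indicE in_setT mem_set//=; lra.
pose p (x : Rd) : R := sin (pi * x ord0 i) * sin (pi * (a - x ord0 i)).
have pE : p = fun x => (cos (2 * pi * x ord0 i) * cos (pi * a) + sin (2 * pi * x ord0 i) * sin (pi * a) - cos (pi * a)) / 2.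
  apply/funext => x; rewrite /p.
  have -> : 2 * pi * x ord0 i = pi * x ord0 i + pi * x ord0 i by ring.
  have -> : pi * a = pi * x ord0 i + pi * (a - x ord0 i) by ring.
  move: (pi * x ord0 i) (pi * (a - x ord0 i)) => s t.
  have := cos2Dsin2 s; rewrite !cosD !sinD => h.
  have z : ((cos s * cos t + sin s * sin t) / 2) * (cos s ^+ 2 + sin s ^+ 2 - 1) = 0.
    by rewrite h subrr mulr0.
  by rewrite -[LHS]addr0 -z; field.
have tp : torus_continuous p.
  apply: (@trig_poly_continuous R d 1).
  have := trig_polyD (trig_polyD (trig_polyZ (cos (pi * a) / 2) (trig_gen1 (Some (i, true))))
    (trig_polyZ (sin (pi * a) / 2) (trig_gen1 (Some (i, false))))) (trig_poly_cst 1 (- cos (pi * a) / 2)).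
  by congr trig_poly; rewrite pE; apply/funext => x /=; field.
pose q (k : nat) x : R := Num.max 0 (Num.min 1 (k%:R * p x)).
have tq (k : nat) : torus_continuous (q k).
  apply: (@torus_continuous_comp _ _ p (fun t : R => Num.max 0 (Num.min 1 (k%:R * t)))) => // t.
  apply: (@continuous_max _ _ (fun=> 0) (fun t : R => Num.min 1 (k%:R * t))); first exact: cvg_cst.
  apply: (@continuous_min _ _ (fun=> 1) (fun t : R => k%:R * t)); first exact: cvg_cst.
  exact: mulrl_continuous.
split => // G [iG hG]; split; first exact: integrableR_indic.
move=> phi tphi; apply: (@annihilates_lim G q _ 1) => //.
- by move=> n; exact: torus_continuous_measurable.
- move=> n x; rewrite /q ger0_norm ?le_max ?lexx// ge_max ler01 ge_min lexx//.
- apply: filterS (torus_coord_ae i) => x /andP[x0 x1]; apply/cvg_seqP => e e0.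
  have pi0 := pi_gt0 R; rewrite indicE.
  have s1 : 0 < sin (pi * x ord0 i) by apply: sin_gt0_pi; nra.
  have [xa|xa] := ltP (x ord0 i) a.
    have p0 : 0 < p x by apply: mulr_gt0 => //; apply: sin_gt0_pi; nra.
    exists (Num.truncn (p x)^-1).+1 => k hk; rewrite mem_set//.
    rewrite /q min_l ?max_r ?subrr ?normr0 ?ltW//.
    rewrite mulrC -ltr_pdivrMl// mulr1.
    by apply: (lt_le_trans (truncnS_gt _)); rewrite ler_nat.
  exists 0%N => k _; rewrite memNset /=; last by rewrite ltNge xa.
  suff p0 : p x <= 0.
    have kp : k%:R * p x <= 0 by rewrite mulr_ge0_le0.
    have mp : Num.min 1 (k%:R * p x) <= 0 by rewrite ge_min kp orbT.
    by rewrite /q (max_l mp) subrr normr0 ltW.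
  apply: mulr_ge0_le0; first exact: ltW.
  rewrite -opprB mulrN sinN oppr_le0; apply: sin_ge0_pi; nra.
- move=> n; rewrite -[RHS](hG _ (torus_continuousM (tq n) tphi)).
  by apply: tint_ext => x; ring.
Qed.

Lemma separating_measurable (A : set Rd) : measurable A -> separating A.
Proof.
move: A; apply: smallest_sub; first exact: separating_sigma.
have [s0 sC sU] := separating_sigma.
suff sep i : preimage_set_system [set: Rd] (rV_coord i) measurable `<=` separating.
  by move=> A; elim/big_ind : _ A => [A []|A1 A2 h1 h2 A [/h1|/h2]|i _ A /sep].
move=> A [B mB <-]; rewrite setTI.
have {mB} : (@RGenInftyO.G R).-sigma.-measurable B by rewrite -RGenInftyO.measurableE.
move: B; apply: smallest_sub.
  split; first exact: s0.
    by move=> B /sC; rewrite !setTD preimage_setC.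
  by move=> F hF; have := sU _ hF; rewrite -preimage_bigcup.
move=> B [a ->]; have := separating_halfspace i a; congr separating.
Qed.

Lemma annihilates_ae0 G : annihilates G -> {ae mu, forall x, G x = 0}.
Proof.
move=> aG; have [iG _] := aG.
have : ae_eq mu setT (EFin \o G) (EFin \o (fun=> 0)).
  apply: integral_ae_eq => //.
    by apply/measurable_EFinP; exact: measurable_cst.
  move=> A _ mA; have [_ /(_ _ aG) [iA /(_ _ (torus_continuous_cst 1)) hA]] := separating_measurable mA.
  rewrite integral_mkcond (_ : _ \_ A = EFin \o (fun x => \1_A x * G x)).
    rewrite Rint_EFin// (tint_ext (k := fun x => \1_A x * G x * 1)) ?hA//; last by move=> x; rewrite mulr1.
    by rewrite integral0.
  by apply/funext => x; rewrite patchE /= indicE; case: ifP => _; rewrite ?mul1r ?mul0r.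
by apply: filterS => x /(_ I) [].
Qed.

Lemma fundamental_lemma f k : integrableR mu f -> integrableR mu k ->
  (forall phi, torus_smooth phi -> \int[mu]_x (f x * phi x) = \int[mu]_x (k x * phi x)) ->
  {ae mu, forall x, f x = k x}.
Proof.
move=> If Ik h; have iG := integrableRB If Ik.
suff : annihilates (fun x => f x - k x).
  by move=> /annihilates_ae0; apply: filterS => x /eqP; rewrite subr_eq0 => /eqP.
split => // phi tphi.
have hN N : \int[mu]_x ((f x - k x) * tconv N phi x) = 0.
  have s := trig_poly_smooth (tconv_trig N (tcI tphi)).
  rewrite (tint_ext (k := fun x => tconv N phi x * f x - tconv N phi x * k x)); last by move=> x; ring.
  rewrite RintB; [|by apply: tcMI => //; exact: trig_poly_continuous (tconv_trig N (tcI tphi))..].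
  rewrite (tint_ext (k := fun x => f x * tconv N phi x)); last by move=> x; ring.
  by rewrite h// (tint_ext (f := fun x => k x * _) (k := fun x => tconv N phi x * k x)) ?subrr// => x; rewrite mulrC.
pose I := \int[mu]_x `|f x - k x|.
have I0 : 0 <= I by apply: Rint_ge0.
apply/eqP; rewrite -normr_le0; apply/ler_addgt0Pl => e e0; rewrite addr0.
have [N /(_ N (leqnn N)) hc] := tconv_uniform tphi (divr_gt0 e0 (ltr_wpDl I0 ltr01)).
have tN := trig_poly_continuous (tconv_trig N (tcI tphi)).
have iGp : integrableR mu (fun x => (f x - k x) * phi x).
  by have := tcMI tphi iG; congr integrableR; apply/funext => x; rewrite mulrC.
have iGN : integrableR mu (fun x => (f x - k x) * tconv N phi x).
  by have := tcMI tN iG; congr integrableR; apply/funext => x; rewrite mulrC.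
rewrite -[X in `|X|]subr0 -(hN N) -RintB//.
apply: le_trans (Rint_abs (integrableRB iGp iGN)) _.
have h1 : \int[mu]_x `|(f x - k x) * phi x - (f x - k x) * tconv N phi x| <=
    \int[mu]_x (e / (I + 1) * `|f x - k x|).
  apply: Rint_le => [||x]; first exact: integrableR_abs (integrableRB iGp iGN).
    exact: integrableRZ (integrableR_abs iG).
  by rewrite -mulrBr normrM mulrC ler_wpM2r// distrC.
apply: le_trans h1 _; rewrite RintZ; last exact: integrableR_abs.
by rewrite -/I mulrAC ler_pdivrMr ?ltr_wpDl// ler_wpM2l ?ltW// ltrDl.
Qed.

End fundamental_lemma.

(** * Sobolev functions *)

Section sobolev_embedding.
Context {R : realType}.
Local Notation uim := (@unit_interval_measure R).
Local Notation leb := (@lebesgue_measure R).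
Local Notation periodic := Defs.periodic.

(** After a translation t0 = 0. The inequality |g 0| <= |g t| + integral of |g'| holds for each t of
    the unit interval and is then averaged over t. *)
Lemma unit_interval_sup (g g' : R -> R) (M : R) t0 :
  (forall t : R, is_derive t 1 g (g' t)) -> continuous g' -> (forall t, `|g t| <= M) ->
  (forall t, `|g' t| <= M) -> (forall t, g (t + 1) = g t) -> (forall t, g' (t + 1) = g' t) ->
  (`|g t0|%:E <= \int[uim]_t `|g t|%:E + \int[uim]_t `|g' t|%:E)%E.
Proof.
wlog -> : g g' t0 / t0 = 0.
  move=> h dg cg' gM g'M pg pg'.
  have cg : continuous g by move=> t; have [D _] := dg t; exact/differentiable_continuous/derivable1_diffP.
  have := h (fun t => g (t + t0)) (fun t => g' (t + t0)) 0 erefl.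
  have cs (k : R -> R) : continuous k -> continuous (fun t => k (t + t0)).
    move=> ck t; apply: (@continuous_comp _ _ _ (fun t => t + t0) k); last exact: ck.
    by apply: cvgD; [exact: cvg_id|exact: cvg_cst].
  have ca (k : R -> R) : continuous k -> continuous (fun t => `|k t|).
    by move=> ck t; apply: (@continuous_comp _ _ _ k); [exact: ck|exact: norm_continuous].
  rewrite (@unit_interval_shift _ (fun t => `|g t|) t0 M)//; [|exact: ca|by move=> t; rewrite normr_id|by move=> t; rewrite pg].
  rewrite (@unit_interval_shift _ (fun t => `|g' t|) t0 M)//; [|exact: ca|by move=> t; rewrite normr_id|by move=> t; rewrite pg'].
  rewrite add0r; apply => //; [|exact: cs|by move=> t; rewrite addrAC pg|by move=> t; rewrite addrAC pg'].
  move=> t; have d1 : is_derive t 1 (fun t => t + t0) 1 by apply: is_derive_eq; rewrite addr0.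
  by have := is_derive1_comp (f := g) (g := fun t => t + t0); move=> /(_ t _ _ (dg _) d1); rewrite mulr1.
move=> dg cg' gM g'M _ _.
have cg : continuous g by move=> t; have [D _] := dg t; exact/differentiable_continuous/derivable1_diffP.
have ca (k : R -> R) : continuous k -> continuous (fun t => `|k t|).
  by move=> ck t; apply: (@continuous_comp _ _ _ k); [exact: ck|exact: norm_continuous].
rewrite (@unit_interval_integral _ _ M); [|exact: ca|by move=> t; rewrite normr_id].
rewrite (@unit_interval_integral _ _ M); [|exact: ca|by move=> t; rewrite normr_id].
set K := (\int[leb]_(t in _) `|g' t|%:E)%E.
have mI : measurable (`[0%R, 1%R]%classic : set R) by exact: measurable_itv.
have ma (k : R -> R) (A : set R) : continuous k -> measurable_fun A (fun t => `|k t|%:E).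
  move=> ck; have ck' := ca k ck.
  by apply/measurable_EFinP/measurable_funTS; exact: continuous_measurable_fun ck'.
have K0 : (0 <= K)%E by apply: integral_ge0.
have h t : 0 <= t <= 1 -> (`|g 0|%:E <= `|g t|%:E + K)%E.
  move=> /andP[]; rewrite le_eqVlt => /orP[/eqP <- _|t0' t1]; first by rewrite leeDl.
  apply: (@le_trans _ _ (`|g t|%:E + `|g t - g 0|%:E)%E).
    rewrite -EFinD lee_fin -[X in `|X|](subrK (g t)) (le_trans (ler_normD _ _))// addrC distrC//.
  rewrite leeD2l//.
  have e : (\int[leb]_(x in `[0%R, t]) (g' x)%:E = (g t)%:E - (g 0)%:E)%E.
    apply: continuous_FTC2 => //; first exact: continuous_subspaceT.
      split=> [x _||]; first by have [] := dg x.
        by apply: cvg_at_right_filter; exact: cg.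
      by apply: cvg_at_left_filter; exact: cg.
    by move=> x _; rewrite derive1E; apply: derive_val.
  rewrite -[X in (X <= _)%E]/(`|(g t)%:E - (g 0)%:E|)%E -e.
  apply: le_trans (le_abse_integral _ _ _) _ => //.
    by apply/measurable_EFinP/measurable_funTS; exact: continuous_measurable_fun cg'.
  apply: ge0_subset_integral => //; first exact: ma.
  by move=> x /=; rewrite !in_itv/= => /andP[-> xt]; rewrite (le_trans xt).
have l1 : leb (`[0%R, 1%R]%classic) = 1%E.
  by rewrite lebesgue_measure_itv/= lte_fin ltr01 sube0.
have e1 : (`|g 0|%:E = \int[leb]_(t in `[0%R, 1%R]) (cst `|g 0|%:E t))%E.
  by rewrite integral_cst// [X in (_ * X)%E]l1 mule1.
have e2 : (K = \int[leb]_(t in `[0%R, 1%R]) (cst K t))%E.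
  by rewrite integral_cst// [X in (_ * X)%E]l1 mule1.
rewrite {}[in X in (X <= _)%E]e1 [X in (_ <= _ + X)%E]e2 -ge0_integralD//; last exact: ma.
apply: ge0_le_integral => //.
- by move=> t _; rewrite lee_fin.
- by apply: emeasurable_funD => //; exact: ma.
Qed.

Definition torus_Cinf d (f : 'rV[R]_d -> R) := forall s, torus_C1 (pds s f).

Lemma torus_Cinf_pds d (f : 'rV[R]_d -> R) s : torus_Cinf f -> torus_Cinf (pds s f).
Proof. by move=> h s'; rewrite /pds -foldr_cat; exact: h. Qed.

Section slices.
Variable n : nat.
Implicit Types f : 'rV[R]_n.+1 -> R.

Lemma rV_consZ (c t : R) (y : 'rV[R]_n) : rV_cons (c * t, c *: y) = c *: rV_cons (t, y).
Proof.
apply/rowP => i; rewrite [RHS]mxE; case: (split_ordP (i : 'I_(1 + n))) => j ->.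
  by rewrite !rV_cons_lshift.
by rewrite !rV_cons_rshift mxE.
Qed.

Lemma slice_C1 f (t : R) : torus_C1 f ->
  torus_C1 (fun y => f (rV_cons (t, y))) /\
  forall i, pd i (fun y => f (rV_cons (t, y))) = fun y => pd (lift ord0 i) f (rV_cons (t, y)).
Proof.
move=> Cf; apply: torus_C1_intro => [|i|i x].
- exact: slice_tail_continuous Cf.1.
- exact: slice_tail_continuous (Cf.2 _).2.
- apply: line_derivable; have := is_derive_line (t := 0) (x := rV_cons (t, x)).
  have := torus_C1_derive (lift ord0 i) (rV_cons (t, x)) Cf.
  rewrite -[in X in is_derive X _ _ _](addr0 (rV_cons (t, x))) -(scale0r (delta_mx 0 (lift ord0 i))).
  move=> h /(_ _ _ _ h); congr is_derive; apply/funext => s.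
  rewrite -rV_cons_delta; congr f.
  have -> : s *: rV_cons (0, delta_mx 0 i) = rV_cons (0, s *: delta_mx 0 i) :> 'rV[R]_n.+1.
    by rewrite -rV_consZ mulr0.
  by rewrite -rV_consD addr0.
Qed.

Lemma slice_pds f (t : R) s : torus_Cinf f ->
  torus_C1 (pds s (fun y => f (rV_cons (t, y)))) /\
  pds s (fun y => f (rV_cons (t, y))) = fun y => pds (map (lift ord0) s) f (rV_cons (t, y)).
Proof.
move=> Cf; elim: s => [|i s [_ ih]] /=.
  by have [] := slice_C1 t (Cf [::]).
rewrite ih; have [C h] := slice_C1 t (Cf (map (lift ord0) s)).
have [C' h'] := slice_C1 t (Cf (map (lift ord0) (i :: s))).
by rewrite h.
Qed.

Lemma head_derive f (y : 'rV[R]_n) (t : R) : torus_C1 f ->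
  is_derive t 1 (fun t => f (rV_cons (t, y))) (pd ord0 f (rV_cons (t, y))).
Proof.
move=> Cf; have := torus_C1_derive ord0 (rV_cons (t, y)) Cf.
have e (s : R) : rV_cons (s, y) = rV_cons (0, y) + s *: delta_mx 0 ord0.
  rewrite -rV_cons_head.
  have -> : s *: rV_cons (1, 0) = rV_cons (s, 0) :> 'rV[R]_n.+1.
    by rewrite -rV_consZ mulr1 scaler0.
  by rewrite -rV_consD add0r addr0.
move=> h; have := is_derive_line (t := t) (x := rV_cons (0, y)) (v := delta_mx 0 ord0).
rewrite -e => /(_ _ _ h); congr is_derive; apply/funext => s; by rewrite -e.
Qed.

End slices.

(** One list for each subset of the coordinates: the mixed derivatives taken at most once in each
    direction. *)
Fixpoint sobolev_index n : seq (seq 'I_n) :=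
  if n is n'.+1 then
    let L := map (map (lift ord0)) (sobolev_index n') in L ++ map (cons ord0) L
  else [:: [::]].

Lemma sobolev_index_size n s : s \in sobolev_index n -> (size s <= n)%N.
Proof.
elim: n s => [|n ih] s /=; first by rewrite inE => /eqP ->.
rewrite mem_cat => /orP[/mapP[s' /ih h ->]|/mapP[s1 /mapP[s' /ih h ->] ->]] /=.
  by rewrite size_map; exact: leq_trans h _.
by rewrite size_map ltnS.
Qed.

(** The induction hypothesis applies to the slice through x, in the tail variables; the supremum
    over the head variable of each of its terms is then controlled by [unit_interval_sup], which
    adds one derivative along the head. Extended integrals let the slices be compared before any
    integrability in the parameter is known. *)
Lemma sobolev_sup_ereal n (f : 'rV[R]_n -> R) x : torus_Cinf f ->
  (`|f x|%:E <= \sum_(s <- sobolev_index n) \int[torus_measure R n]_y `|pds s f y|%:E)%E.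
Proof.
elim: n f x => [|n ih] f x Cf.
  rewrite big_seq1 /= (eq_integral (cst `|f x|%:E)); last by move=> y _; rewrite (thinmx0 y) (thinmx0 x).
  by rewrite integral_cst// [X in (_ * X)%E](probability_setT (torus_measure R 0)) mule1.
have [t [y ->]] := rV_consE x.
have Cs : torus_Cinf (fun y => f (rV_cons (t, y))) by move=> s; have [] := slice_pds t s Cf.
apply: le_trans (ih _ y Cs) _.
rewrite /= big_cat/= !big_map -big_split/=; apply: lee_sum => s _.
have [_ ->] := slice_pds t s Cf.
set F := pds (map (lift ord0) s) f.
have CF : torus_C1 F by exact: Cf.
have tF := CF.1; have tF' := (CF.2 ord0).2.
have [M FM] := torus_continuous_bounded tF.
have [M' FM'] := torus_continuous_bounded tF'.
have mF := torus_continuous_measurable tF; have mF' := torus_continuous_measurable tF'.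
have mN (k : 'rV[R]_n.+1 -> R) : measurable_fun setT k -> measurable_fun setT (fun x => `|k x|).
  by move=> mk; apply: measurableT_comp mk.
have [_ ->] := @fubini_rV_cons _ _ (fun x => `|F x|) M (mN _ mF) (fun x => eq_ind_r (fun z => z <= M) (FM x) (normr_id _)).
have [_ ->] := @fubini_rV_cons _ _ (fun x => `|pd ord0 F x|) M' (mN _ mF') (fun x => eq_ind_r (fun z => z <= M') (FM' x) (normr_id _)).
have mG (k : 'rV[R]_n.+1 -> R) : measurable_fun setT k ->
    measurable_fun setT (fun y => \int[uim]_t `|k (rV_cons (t, y))|%:E)%E.
  move=> mk.
  apply: (@measurable_fun_fubini_tonelli_G _ _ _ _ _ uim (fun p => `|k (rV_cons p)|%:E)).
    have mc : measurable_fun setT ((fun x => `|k x|) \o @rV_cons R n).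
      exact: measurableT_comp (mN _ mk) (@measurable_rV_cons R n).
    exact/measurable_EFinP.
  by move=> p; rewrite lee_fin.
rewrite -ge0_integralD//; [|by move=> z _; exact: integral_ge0|exact: mG|by move=> z _; exact: integral_ge0|exact: mG].
apply: ge0_le_integral => //.
- apply/measurable_EFinP; apply: torus_continuous_measurable.
  by apply: (@torus_continuous_comp _ _ (fun y => F (rV_cons (t, y)))); [exact: slice_tail_continuous|exact: norm_continuous].
- by apply: emeasurable_funD; exact: mG.
move=> z _; apply: (@unit_interval_sup (fun t => F (rV_cons (t, z))) (fun t => pd ord0 F (rV_cons (t, z))) (M + M')) => //.
- by move=> r; exact: head_derive.
- by have [] := slice_head_continuous z tF'.
- by move=> r; rewrite (le_trans (FM _))// lerDl (le_trans _ (FM' 0)).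
- by move=> r; rewrite (le_trans (FM' _))// lerDr (le_trans _ (FM 0)).
- by have [] := slice_head_continuous z tF.
- by have [] := slice_head_continuous z tF'.
Qed.

Lemma sobolev_sup n (f : 'rV[R]_n -> R) x : torus_Cinf f ->
  `|f x| <= \sum_(s <- sobolev_index n) \int[torus_measure R n]_y `|pds s f y|.
Proof.
move=> Cf; have := sobolev_sup_ereal x Cf.
under eq_bigr => s _.
  rewrite (@Rint_EFin _ _ _ _ (fun y => `|pds s f y|)); last exact: integrableR_abs (tcI (Cf s).1).
  over.
by rewrite sumEFin lee_fin.
Qed.

Lemma trig_poly_Cinf d n (f : 'rV[R]_d -> R) : trig_poly n f -> torus_Cinf f.
Proof.
move=> hf s; apply: (@trig_poly_C1 _ _ n); elim: s => //= i s ih; exact: trig_poly_pd.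
Qed.

End sobolev_embedding.

Section sobolev_spaces.
Context {R : realType} {d : nat}.
Local Notation Rd := 'rV[R]_d.
Local Notation mu := (torus_measure R d).
Local Notation periodic := Defs.periodic.
Implicit Types f k phi F : Rd -> R.

Lemma sqr_integrableR f : measurable_fun setT f -> integrableR mu (fun x => f x ^+ 2) -> integrableR mu f.
Proof.
move=> mf i2; apply: (@integrableR_le _ _ _ mu _ (fun x => 1 + f x ^+ 2)) => //.
  by apply: integrableRD => //; exact: tcI (torus_continuous_cst 1).
move=> x; rewrite [leRHS]ger0_norm ?addr_ge0 ?sqr_ge0//.
have := sqr_ge0 (`|f x| - 1); have := sqr_ge0 (`|f x|); rewrite sqrrB real_normK ?num_real//; lra.
Qed.

Lemma integrableRM_sqr f k : measurable_fun setT f -> measurable_fun setT k ->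
  integrableR mu (fun x => f x ^+ 2) -> integrableR mu (fun x => k x ^+ 2) ->
  integrableR mu (fun x => f x * k x).
Proof.
move=> mf mk i2 j2; apply: (integrableR_le _ (integrableRD i2 j2)) => [|x]; first exact: measurable_funM.
rewrite [leRHS]ger0_norm ?addr_ge0 ?sqr_ge0// normrM -(real_normK (num_real (f x))) -(real_normK (num_real (k x))).
have := sqr_ge0 (`|f x| - `|k x|); have := sqr_ge0 (`|f x|); have := sqr_ge0 (`|k x|); rewrite sqrrB; lra.
Qed.

Lemma cauchy_schwarz f k : measurable_fun setT f -> measurable_fun setT k ->
  integrableR mu (fun x => f x ^+ 2) -> integrableR mu (fun x => k x ^+ 2) ->
  \int[mu]_x `|f x * k x| <= Num.sqrt (\int[mu]_x f x ^+ 2) * Num.sqrt (\int[mu]_x k x ^+ 2).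
Proof.
move=> mf mk i2 j2.
set a := \int[mu]_x f x ^+ 2; set b := \int[mu]_x k x ^+ 2.
have iM := integrableR_abs (integrableRM_sqr mf mk i2 j2).
set c := \int[mu]_x _.
have c0 : 0 <= c by apply: Rint_ge0.
have a0 : 0 <= a by apply: Rint_ge0 => x; exact: sqr_ge0.
have b0 : 0 <= b by apply: Rint_ge0 => x; exact: sqr_ge0.
have h (t : R) : 0 <= t ^+ 2 * a - 2 * t * c + b.
  have : 0 <= \int[mu]_x (t ^+ 2 * f x ^+ 2 - 2 * t * `|f x * k x| + k x ^+ 2).
    apply: Rint_ge0 => x; rewrite normrM -(real_normK (num_real (f x))) -(real_normK (num_real (k x))).
    by rewrite (_ : _ + _ = (t * `|f x| - `|k x|) ^+ 2) ?sqr_ge0//; ring.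
  rewrite RintD//; last by apply: integrableRB; exact: integrableRZ.
  by rewrite RintB ?RintZ//; exact: integrableRZ.
rewrite -sqrtrM// -(ger0_norm c0) -sqrtr_sqr ler_sqrt ?mulr_ge0//.
(* If a = 0 the inequality [h] is affine in t and fails at t = (b + 1) / (2 c) unless c = 0;
   otherwise it is used at its minimizer t = c / a. *)
have [a1|a1] := eqVneq a 0.
  have [->|cn0] := eqVneq c 0; first by rewrite expr0n mulr_ge0.
  have cp : 0 < c by rewrite lt_neqAle eq_sym cn0.
  have := h ((b + 1) / (2 * c)); rewrite a1 mulr0 add0r.
  rewrite (_ : 2 * _ * c = b + 1); last by field; rewrite gt_eqF.
  by move=> ?; lra.
have ap : 0 < a by rewrite lt_neqAle eq_sym a1.
have := h (c / a); rewrite (_ : _ + b = (a * b - c ^+ 2) / a); last by field; rewrite gt_eqF.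
by rewrite pmulr_lge0 ?invr_gt0// subr_ge0.
Qed.

Lemma L1_le_L2 f : measurable_fun setT f -> integrableR mu (fun x => f x ^+ 2) ->
  \int[mu]_x `|f x| <= Num.sqrt (\int[mu]_x f x ^+ 2).
Proof.
move=> mf i2; have := cauchy_schwarz mf (measurable_cst (1 : R)) i2.
rewrite (_ : (fun x : Rd => _ ^+ 2) = fun=> 1); last by apply/funext => x; rewrite expr1n.
rewrite Rint_cst sqrtr1 mulr1 => /(_ (tcI (torus_continuous_cst 1))).
by rewrite (tint_ext (k := fun x => `|f x|)) => // x; rewrite mulr1.
Qed.

Lemma torus_L2_L1 f : torus_L2 f -> torus_L1 f.
Proof. by move=> [pf mf i2]; split => //; exact: sqr_integrableR. Qed.

Lemma torus_L1_lin (a b : R) f k : torus_L1 f -> torus_L1 k -> torus_L1 (fun x => a * f x + b * k x).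
Proof.
move=> [pf If] [pk Ik]; split; first by move=> x i; rewrite pf pk.
by apply: integrableRD; exact: integrableRZ.
Qed.

Lemma torus_L2_lin (a b : R) f k : torus_L2 f -> torus_L2 k -> torus_L2 (fun x => a * f x + b * k x).
Proof.
move=> [pf mf if2] [pk mk ik2].
have m1 : measurable_fun setT (fun x => a * f x + b * k x).
  by apply: measurable_funD; apply: measurable_funM => //; exact: measurable_cst.
split => //; first by move=> x i; rewrite pf pk.
apply: (@integrableR_le _ _ _ mu _ (fun x => 2 * a ^+ 2 * f x ^+ 2 + 2 * b ^+ 2 * k x ^+ 2)).
- exact: measurable_funX.
- by apply: integrableRD; exact: integrableRZ.
- move=> x; rewrite ger0_norm ?sqr_ge0//; apply: le_trans (ler_norm _).
  by rewrite -subr_ge0 (_ : _ - _ = (a * f x - b * k x) ^+ 2) ?sqr_ge0//; ring.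
Qed.

Lemma torus_smooth_pds s phi : torus_smooth phi -> torus_smooth (pds s phi).
Proof. by move=> h; elim: s => [|i s ih]; [exact: h|exact: torus_smooth_pd]. Qed.

Lemma torus_smooth_continuous phi : torus_smooth phi -> torus_continuous phi.
Proof. by move=> /torus_smooth_C1[]. Qed.

Lemma dist_pdsE s (T : (Rd -> R) -> R) phi : dist_pds s T phi = (-1) ^+ size s * T (pds (rev s) phi).
Proof.
elim: s phi => [|i s ih] phi /=; first by rewrite mul1r.
rewrite /dist_pd ih exprS !mulN1r mulNr rev_cons.
by rewrite -cats1 /pds foldr_cat.
Qed.

Lemma is_weak_pdsP s f k : is_weak_pds s f k <-> [/\ torus_L1 f, torus_L1 k &
  forall phi, torus_smooth phi ->
    \int[mu]_x (k x * phi x) = (-1) ^+ size s * \int[mu]_x (f x * pds (rev s) phi x)].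
Proof.
split=> [[Lf [Lk h]]|[Lf Lk h]].
  by split => // phi sphi; rewrite -[LHS]/(dist_of k phi) -h// dist_pdsE.
by split => //; split => // phi sphi; rewrite dist_pdsE -h.
Qed.

Lemma dist_of_integrable f phi : integrableR mu f -> torus_continuous phi -> integrableR mu (fun x => f x * phi x).
Proof. by move=> If tphi; have := tcMI tphi If; congr integrableR; apply/funext => x; rewrite mulrC. Qed.

Lemma is_weak_pds_lin s (a b : R) f f' k k' : is_weak_pds s f f' -> is_weak_pds s k k' ->
  is_weak_pds s (fun x => a * f x + b * k x) (fun x => a * f' x + b * k' x).
Proof.
move=> /is_weak_pdsP[Lf Lf' hf] /is_weak_pdsP[Lk Lk' hk]; apply/is_weak_pdsP; split; try exact: torus_L1_lin.
have lin g g' phi : torus_L1 g -> torus_L1 g' -> torus_continuous phi ->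
    \int[mu]_x ((a * g x + b * g' x) * phi x) = a * \int[mu]_x (g x * phi x) + b * \int[mu]_x (g' x * phi x).
  move=> [_ Lg] [_ Lg'] tphi; have h1 := dist_of_integrable Lg tphi; have h2 := dist_of_integrable Lg' tphi.
  rewrite -!RintZ// -RintD; [|exact: integrableRZ..].
  by apply: tint_ext => x; ring.
move=> phi sphi; have tphi := torus_smooth_continuous sphi.
rewrite !lin//; last exact: torus_smooth_continuous (torus_smooth_pds _ sphi).
by rewrite hf// hk//; ring.
Qed.

Lemma weak_pdsP s f k : is_weak_pds s f k -> is_weak_pds s f (weak_pds s f).
Proof. by move=> h; rewrite /weak_pds; exact: (getPex (ex_intro _ k h)). Qed.

Lemma is_weak_pds_unique s f k k' : is_weak_pds s f k -> is_weak_pds s f k' -> torus_ae_eq k k'.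
Proof.
move=> /is_weak_pdsP[_ [_ Ik] hk] /is_weak_pdsP[_ [_ Ik'] hk'].
by apply: fundamental_lemma => // phi sphi; rewrite hk// hk'.
Qed.

Lemma torus_L2_ae f k : periodic k -> measurable_fun setT k -> torus_ae_eq f k -> torus_L2 f ->
  torus_L2 k /\ \int[mu]_x k x ^+ 2 = \int[mu]_x f x ^+ 2.
Proof.
move=> pk mk fk [pf mf i2].
have mf2 : measurable_fun setT (fun x => f x ^+ 2) by exact: measurable_funX.
have mk2 : measurable_fun setT (fun x => k x ^+ 2) by exact: measurable_funX.
have e : ae_eq mu setT (fun x => (f x ^+ 2)%:E) (fun x => (k x ^+ 2)%:E).
  by apply: filterS fk => x -> _.
split; last by congr fine; apply: ae_eq_integral => //; [exact/measurable_EFinP..|exact: ae_eq_sym e].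
split => //; apply/integrableP; split; first exact/measurable_EFinP.
rewrite (_ : (\int[mu]_x _)%E = (\int[mu]_x `|(f x ^+ 2)%:E|)%E); first by have /integrableP[] := i2.
apply: ae_eq_integral => //.
- by apply: measurableT_comp => //; exact/measurable_EFinP.
- by apply: measurableT_comp => //; exact/measurable_EFinP.
- by apply: filterS fk => x -> _.
Qed.

(** The representative selected by [get] is only known to be integrable. It agrees almost everywhere
    with the square integrable one provided by [sobolev], hence is square integrable too. *)
Lemma sobolev_weak_pds K f s : sobolev K f -> (size s <= K)%N ->
  is_weak_pds s f (weak_pds s f) /\ torus_L2 (weak_pds s f).
Proof.
move=> [_ h] sK; have [k wk Lk] := h s sK; have w := weak_pdsP wk; split => //.
have wP := w; move/is_weak_pdsP : wP => [_ [pw' /integrableR_measurable mw'] _].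
by have [] := torus_L2_ae pw' mw' (is_weak_pds_unique wk w) Lk.
Qed.

Lemma sobolev_lin K (a b : R) f k : sobolev K f -> sobolev K k -> sobolev K (fun x => a * f x + b * k x).
Proof.
move=> [Lf hf] [Lk hk]; split; first exact: torus_L2_lin.
move=> s sK; have [f' wf L2f] := hf s sK; have [k' wk L2k] := hk s sK.
by exists (fun x => a * f' x + b * k' x); [exact: is_weak_pds_lin|exact: torus_L2_lin].
Qed.

Lemma smooth_weak_pds s phi : torus_smooth phi -> is_weak_pds s phi (pds s phi).
Proof.
move=> sphi; have L1 f : torus_smooth f -> torus_L1 f.
  by move=> /torus_smooth_continuous tf; split; [exact: tf.1|exact: tcI].
apply/is_weak_pdsP; split; [exact: L1|exact: L1 (torus_smooth_pds s sphi)|].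
elim: s => [|i s ih] psi spsi /=; first by rewrite mul1r.
rewrite Rintegral_by_parts; [|exact: torus_smooth_C1 (torus_smooth_pds s sphi)|exact: torus_smooth_C1].
rewrite ih; last exact: torus_smooth_pd.
by rewrite rev_cons -cats1 /pds foldr_cat exprS mulN1r mulNr.
Qed.

Lemma torus_continuous_L2 f : torus_continuous f -> torus_L2 f.
Proof.
move=> tf; split; [exact: tf.1|exact: torus_continuous_measurable|].
exact: tcI (torus_continuousX 2 tf).
Qed.

Lemma smooth_sobolev K phi : torus_smooth phi -> sobolev K phi.
Proof.
move=> sphi; split; first exact: torus_continuous_L2 (torus_smooth_continuous sphi).
move=> s _; exists (pds s phi); first exact: smooth_weak_pds.
exact: torus_continuous_L2 (torus_smooth_continuous (torus_smooth_pds s sphi)).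
Qed.

Lemma weak_pds_le_norm K f s : sobolev K f -> (size s <= K)%N ->
  \int[mu]_x `|weak_pds s f x| <= sobolev_norm K f.
Proof.
move=> sf sK; have [w [pw mw i2]] := sobolev_weak_pds sf sK.
apply: le_trans (L1_le_L2 mw i2) _; rewrite /sobolev_norm ler_sqrt; last first.
  by apply: sumr_ge0 => n _; apply: sumr_ge0 => s' _; apply: Rint_ge0 => x; exact: sqr_ge0.
rewrite (bigD1 (Ordinal (sK : (size s < K.+1)%N)))//= (bigD1 (in_tuple s))//= -addrA lerDl addr_ge0//.
  by apply: sumr_ge0 => s' _; apply: Rint_ge0 => x; exact: sqr_ge0.
by apply: sumr_ge0 => n _; apply: sumr_ge0 => s' _; apply: Rint_ge0 => x; exact: sqr_ge0.
Qed.

Lemma tconv_ae N f k : integrableR mu f -> integrableR mu k -> torus_ae_eq f k -> tconv N f = tconv N k.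
Proof.
move=> If Ik fk; apply/funext => x; congr fine; apply: ae_eq_integral => //.
- exact/measurable_EFinP/integrableR_measurable/kern_integrable.
- exact/measurable_EFinP/integrableR_measurable/kern_integrable.
- by apply: filterS fk => y /= -> _.
Qed.

Lemma tconv_weak_pds N K f s : sobolev K f -> (size s <= K)%N ->
  pds s (tconv N f) = tconv N (weak_pds s f).
Proof.
move=> sf; have Lf := torus_L2_L1 sf.1; elim: s => [|i s ih] sK.
  have [w L2w] := sobolev_weak_pds sf sK; have [_ Lw] := torus_L2_L1 L2w.
  apply: tconv_ae => //; first exact: Lf.2.
  apply: (is_weak_pds_unique _ w); apply/is_weak_pdsP; split => // phi _; by rewrite mul1r.
have sK' : (size s <= K)%N by rewrite (leq_trans _ sK)/=.
rewrite /= -/(pds s _) ih//.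
have [/is_weak_pdsP[_ [_ I1] w] _] := sobolev_weak_pds sf sK.
have [/is_weak_pdsP[_ [_ I2] w'] _] := sobolev_weak_pds sf sK'.
apply: tconv_pd_weak => // phi sphi; rewrite w// w'; last exact: torus_smooth_pd.
by rewrite rev_cons -cats1 /pds foldr_cat exprS mulN1r mulNr.
Qed.

Lemma sum_le_size (I : eqType) (r : seq I) (F : I -> R) (C : R) :
  (forall i, i \in r -> F i <= C) -> \sum_(i <- r) F i <= (size r)%:R * C.
Proof.
elim: r => [|i r ih] h; first by rewrite big_nil mul0r.
rewrite big_cons /= -natr1 mulrDl mul1r addrC lerD ?h ?mem_head// ih// => j jr.
by rewrite h// in_cons jr orbT.
Qed.

(** The bound does not depend on N, so it survives the limit: this is how the embedding reaches
    functions with weak derivatives only. It costs d derivatives, those of [sobolev_index]. *)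
Lemma sobolev_tconv_sup K f s N x : sobolev K f -> (size s + d <= K)%N ->
  `|pds s (tconv N f) x| <= (size (sobolev_index d))%:R * sobolev_norm K f.
Proof.
move=> sf sK; have Lf := torus_L2_L1 sf.1.
have C := trig_poly_Cinf (tconv_trig N Lf.2).
apply: le_trans (sobolev_sup x (torus_Cinf_pds s C)) _.
apply: sum_le_size => s' /sobolev_index_size s'd.
have s'K : (size (s' ++ s) <= K)%N by rewrite size_cat addnC (leq_trans _ sK)// leq_add2l.
have -> : pds s' (pds s (tconv N f)) = pds (s' ++ s) (tconv N f) by rewrite /pds foldr_cat.
rewrite (tconv_weak_pds N sf s'K).
apply: le_trans (weak_pds_le_norm sf s'K); apply: tconv_L1.
by have [_ /torus_L2_L1[]] := sobolev_weak_pds sf s'K.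
Qed.

End sobolev_spaces.

(** * Classical regularity of Sobolev functions *)

Section sobolev_continuous.
Context {R : realType} {d : nat}.
Local Notation Rd := 'rV[R]_d.
Local Notation mu := (torus_measure R d).
Local Notation periodic := Defs.periodic.
Implicit Types f k phi F : Rd -> R.

Lemma cauchy_real (u : nat -> R) :
  (forall e : R, 0 < e -> exists N, forall n m, (N <= n)%N -> (N <= m)%N -> `|u n - u m| <= e) ->
  exists l : R, u n @[n --> \oo] --> l.
Proof.
move=> h; apply/cvg_ex; apply/cauchy_cvgP/cauchy_ballP => e e0.
have [N hN] := h (e / 2) (divr_gt0 e0 (ltr0Sn _ 1)).
exists ([set u n | n in [set n | (N <= n)%N]], [set u n | n in [set n | (N <= n)%N]]) => /=.
  by split; exists N => // n nN; exists n.
move=> [_ _] /= [[n nN <-] [m mN <-]]; rewrite /ball/=.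
by apply: le_lt_trans (hN _ _ nN mN) _; rewrite ltr_pdivrMr// mulr_natr mulr2n ltrDl.
Qed.

Lemma ler_norm_halves (a b e : R) : `|a| <= e / 2 -> `|a - b| <= e / 2 -> `|b| <= e.
Proof. by have := ler_normB a (a - b); rewrite opprB addrC subrK; lra. Qed.

Lemma torus_uniform_limit (g : nat -> Rd -> R) (G : Rd -> R) :
  (forall n, torus_continuous (g n)) ->
  (forall e : R, 0 < e -> exists N, forall n, (N <= n)%N -> forall x, `|g n x - G x| <= e) ->
  torus_continuous G.
Proof.
move=> tg h; split.
  move=> x i; apply/eqP; rewrite -subr_eq0 -normr_le0; apply/ler_addgt0Pl => e e0; rewrite addr0.
  have [N /(_ N (leqnn N)) hN] := h (e / 2) (divr_gt0 e0 (ltr0Sn _ 1)).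
  have := hN x; have := hN (x + delta_mx 0 i); rewrite (tg N).1 => h1 h2.
  rewrite -[X in `|X|](_ : (g N x - G x) - (g N x - G (x + delta_mx 0 i)) = _); last by ring.
  by rewrite (le_trans (ler_normB _ _))//; lra.
apply/continuous_epsP => x e e0.
have e4 : 0 < e / 4 by rewrite divr_gt0.
have [N /(_ N (leqnn N)) hN] := h _ e4.
have /continuous_epsP/(_ x _ e4)[del del0 hd] := (tg N).2.
exists del => // y xy; have := hd _ xy; have := hN x; have := hN y => h1 h2 h3.
rewrite (_ : G x - G y = (g N x - g N y) - (g N x - G x) + (g N y - G y)); last by ring.
apply: le_lt_trans (ler_normD _ _) _; have := ler_normB (g N x - g N y) (g N x - G x); lra.
Qed.

Lemma is_derive_quadratic f x v (l B : R) :
  (forall t : R, `|f (x + t *: v) - f x - t * l| <= B * t ^+ 2) -> is_derive x v f l.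
Proof.
move=> h.
have B0 : 0 <= B by have := h 1; rewrite expr1n mulr1; apply: le_trans.
have c : (fun t : R => t^-1 *: ((f \o shift x) (t *: v) - f x)) @ 0^' --> l.
  apply/cvgrPdist_le => e e0.
  have eB : 0 < e / (B + 1) by rewrite divr_gt0// ltr_wpDl.
  near=> t.
  have t0 : t != 0 by near: t; exact: nbhs_dnbhs_neq.
  have te : `|t| <= e / (B + 1).
    near: t; apply: (@dnbhs0_le _ _ (e / (B + 1))) => //.
  have := h t; rewrite /= (addrC (t *: v)) => ht.
  rewrite -[X in `|X|](_ : - (t^-1 * (f (x + t *: v) - f x - t * l)) = _); last first.
    by rewrite /GRing.scale/= mulrBr mulKf// opprB.
  rewrite normrN normrM normfV ler_pdivrMl ?normr_gt0//.
  apply: le_trans ht _; rewrite -real_normK ?num_real// expr2 mulrCA ler_wpM2l//.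
  move: te; rewrite ler_pdivlMr ?ltr_wpDl// mulrC => te; apply: le_trans te.
  by rewrite ler_wpM2r// lerDl.
split; first by apply/cvg_ex; exists l.
exact: cvg_lim c.
Unshelve. all: by end_near.
Qed.

Lemma second_order_remainder f i (B : R) : torus_C1 f -> torus_C1 (pd i f) ->
  (forall x, `|pd i (pd i f) x| <= B) -> forall x (t : R),
  `|f (x + t *: delta_mx 0 i) - f x - t * pd i f x| <= B * t ^+ 2.
Proof.
move=> Cf Cp hB x t.
have [s [st ->]] := line_mvt (Cf.2 i).1 x t.
have [r [_ e]] := line_mvt (Cp.2 i).1 x s.
rewrite -mulrBr [X in _ * X]e !normrM -[t ^+ 2]real_normK ?num_real// expr2.
rewrite (mulrC B) -mulrA ler_wpM2l// ler_pM// ?hB//.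
Qed.

Lemma difference_estimate (gx gy p gx' gy' p' fx fy t q b c : R) :
  `|gy' - gx' - t * p'| <= q -> `|gy - gx - t * p| <= q ->
  `|gx - fx| <= b -> `|gy - fy| <= b -> `|gx' - fx| <= b -> `|gy' - fy| <= b ->
  q <= c / 4 -> b <= c / 8 -> `|t * (p - p')| <= c.
Proof.
rewrite mulrBr !ler_norml; move: (t * p) (t * p') => tp tp'.
move=> /andP[? ?] /andP[? ?] /andP[? ?] /andP[? ?] /andP[? ?] /andP[? ?] ? ?.
by apply/andP; split; lra.
Qed.

(** Interpolation between the uniform convergence of the mollified functions and the uniform bound
    [B] on their second derivatives: a difference quotient with a well chosen step shows that the
    first derivatives are uniformly Cauchy. In the limit the second-order remainder keeps the bound
    B t^2, which identifies the derivative of f. *)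
Lemma sobolev_C1 K f : torus_continuous f -> sobolev K f -> (d + 2 <= K)%N -> torus_C1 f.
Proof.
move=> tf sf dK; pose g N := tconv N f.
have tg N : trig_poly (d * N) (g N) by exact: tconv_trig (tcI tf).
have C1g N : torus_C1 (g N) := trig_poly_C1 (tg N).
have C2g N i : torus_C1 (pd i (g N)) := trig_poly_C1 (trig_poly_pd i (tg N)).
pose B : R := (size (sobolev_index d))%:R * sobolev_norm K f.
have hB N i x : `|pd i (pd i (g N)) x| <= B.
  by have := @sobolev_tconv_sup R d K f [:: i; i] N x sf; apply; rewrite addnC.
have B0 : 0 <= B by apply: mulr_ge0 => //; exact: sqrtr_ge0.
have rem N i x t := second_order_remainder (C1g N) (C2g N i) (hB N i) x t.
have cau i (e : R) : 0 < e -> exists N, forall n m, (N <= n)%N -> (N <= m)%N -> forall x,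
    `|pd i (g n) x - pd i (g m) x| <= e.
  (* This step makes the two remainders, each at most B t^2, small compared with t e; the functions
     are then taken so close that dividing their difference by t is harmless. *)
  move=> e0; pose t : R := e / (4 * (B + 1)).
  have t0 : 0 < t by rewrite divr_gt0// mulr_gt0// ltr_wpDl.
  have et0 : 0 < e * t / 8 by rewrite divr_gt0// mulr_gt0.
  have [N hN] := tconv_uniform tf et0.
  exists N => n m nN mN x.
  set y := x + t *: delta_mx 0 i.
  have := rem n i x t; have := rem m i x t; rewrite -/y => r1 r2.
  have a1 := hN n nN x; have a2 := hN n nN y; have a3 := hN m mN x; have a4 := hN m mN y.
  rewrite -(ler_pM2l t0) -[X in X * `|_|](gtr0_norm t0) -normrM.
  have Bt : B * t ^+ 2 <= t * e / 4.
    rewrite (_ : t * e / 4 = (B + 1) * t ^+ 2); last by rewrite /t; field; rewrite gt_eqF// ltr_wpDl.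
    by rewrite ler_wpM2r ?sqr_ge0// lerDl.
  apply: (difference_estimate r1 r2 a1 a2 a3 a4 Bt).
  by rewrite (mulrC e t).
have lims i x : exists l : R, pd i (g n) x @[n --> \oo] --> l.
  by apply: cauchy_real => e /(cau i)[N hN]; exists N => n m nN mN; exact: hN.
pose G i x : R := limn (fun n => pd i (g n) x).
have hG i x : pd i (g n) x @[n --> \oo] --> G i x.
  by have [l c] := lims i x; rewrite /G (cvg_lim _ c).
have unif i (e : R) : 0 < e -> exists N, forall n, (N <= n)%N -> forall x, `|pd i (g n) x - G i x| <= e.
  move=> /(cau i)[N hN]; exists N => n nN x.
  have c : `|pd i (g n) x - pd i (g m) x| @[m --> \oo] --> `|pd i (g n) x - G i x|.
    by apply: cvg_norm; apply: cvgB; [exact: cvg_cst|exact: hG].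
  rewrite -(cvg_shiftn N) in c.
  by apply: cvg_seq_le c _ => m; rewrite hN// leq_addl.
have [] := @torus_C1_intro R d f G tf.
- by move=> i; apply: torus_uniform_limit (unif i) => n; exact: (C2g n i).1.
- move=> i x; apply: (@is_derive_quadratic _ _ _ _ B) => t.
  have cg y : g n y @[n --> \oo] --> f y.
    apply/cvg_seqP => e /(tconv_uniform tf)[N hN]; exists N => n nN; exact: hN.
  have c : `|g n (x + t *: delta_mx 0 i) - g n x - t * pd i (g n) x| @[n --> \oo] -->
      `|f (x + t *: delta_mx 0 i) - f x - t * G i x|.
    apply: cvg_norm; apply: cvgB; first exact: cvgB.
    by apply: cvgM; [exact: cvg_cst|exact: hG].
  exact: cvg_seq_le c (fun n => rem n i x t).
by [].
Qed.

Lemma cvg_sum_seq (I : Type) (r : seq I) (F : I -> nat -> R) (l : I -> R) :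
  (forall i, F i n @[n --> \oo] --> l i) ->
  \sum_(i <- r) F i n @[n --> \oo] --> \sum_(i <- r) l i.
Proof.
move=> h; elim: r => [|i r ih].
  by rewrite big_nil; under eq_fun do rewrite big_nil; exact: cvg_cst.
by rewrite big_cons; under eq_fun do rewrite big_cons; exact: cvgD.
Qed.

Lemma sobolev_norm_cvg0 K (phi : nat -> Rd -> R) : (forall n, torus_smooth (phi n)) ->
  (forall s (e : R), 0 < e -> exists N, forall n, (N <= n)%N -> forall x, `|pds s (phi n) x| <= e) ->
  sobolev_norm K (phi n) @[n --> \oo] --> (0 : R).
Proof.
move=> sphi h.
pose S (n : nat) : R := \sum_(k < K.+1) \sum_(s : k.-tuple 'I_d) \int[mu]_x (pds s (phi n) x ^+ 2).
have SE n : sobolev_norm K (phi n) = Num.sqrt (S n).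
  congr Num.sqrt; apply: eq_bigr => k _; apply: eq_bigr => s _.
  have ws := smooth_weak_pds s (sphi n).
  have wP := weak_pdsP ws; have /is_weak_pdsP[_ [pw /integrableR_measurable mw] _] := wP.
  by have [] := torus_L2_ae pw mw (is_weak_pds_unique ws wP) (torus_continuous_L2 (torus_smooth_continuous (torus_smooth_pds s (sphi n)))).
under eq_fun do rewrite SE.
suff c : S n @[n --> \oo] --> (0 : R).
  have cc := @continuous_cvg _ _ _ _ _ S Num.sqrt (0 : R) (@sqrt_continuous R 0) c.
  rewrite sqrtr0 in cc; exact: cc.
suff : S n @[n --> \oo] --> (\sum_(k < K.+1) \sum_(s : k.-tuple 'I_d) 0 : R).
  by rewrite big1// => k _; rewrite big1.
apply: cvg_sum_seq => k; apply: cvg_sum_seq => s; apply/cvg_seqP => e e0.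
have [N hN] := h s (Num.sqrt e) ltac:(by rewrite sqrtr_gt0).
exists N => n nN; rewrite subr0 ger0_norm; last by apply: Rint_ge0 => x; exact: sqr_ge0.
rewrite -[leRHS](Rint_cst (R := R) (d := d)); apply: Rint_le => [||x].
- exact: tcI (torus_continuousX 2 (torus_smooth_continuous (torus_smooth_pds s (sphi n)))).
- exact: tcI (torus_continuous_cst _).
- by rewrite -(sqr_sqrtr (ltW e0)) -[leLHS]real_normK ?num_real// ler_pXn2r ?nnegrE ?sqrtr_ge0// hN.
Qed.

(** Differentiability at eta gives smallness in W^{K,2}, and the embedding turns it into smallness
    in the supremum norm. The linear part and the remainder are bounded separately and only added
    after mollification: each is known merely as a Sobolev class, while their sum is the continuous
    function whose values are compared. *)
Lemma frechet_uniform K (D : set (Rd -> R)) (h : (Rd -> R) -> Rd -> R) (eta : Rd -> R)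
    (eta_ : nat -> Rd -> R) : (d <= K)%N ->
  frechet_differentiable_on K D h -> (forall f, D f -> sobolev K f) ->
  (forall f, D f -> sobolev K (h f)) -> (forall f, D f -> torus_continuous (h f)) ->
  D eta -> (forall n, D (eta_ n)) ->
  sobolev_norm K (fun x => eta_ n x - eta x) @[n --> \oo] --> (0 : R) ->
  forall e : R, 0 < e -> exists N, forall n, (N <= n)%N -> forall x, `|h (eta_ n) x - h eta x| <= e.
Proof.
move=> dK hD D1 D2 D3 De Den c e e0.
have [L [L1 _ [C hC] hL]] := hD _ De.
have [r r0 hr] := hL 1 ltr01.
pose S : R := (size (sobolev_index d))%:R.
have S0 : 0 <= S by rewrite ler0n.
have C0 : 0 < `|C| + 1 by rewrite ltr_wpDl.
pose e' := Num.min (r / 2) (e / (2 * (S + 1) * (`|C| + 1))).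
have e'0 : 0 < e' by rewrite lt_min !divr_gt0// !mulr_gt0// ltr_wpDl.
move/cvg_seqP: c => /(_ e' e'0)[N hN]; exists N => n nN x.
have := hN n nN; rewrite subr0 ger0_norm ?sqrtr_ge0// le_min => /andP[n1 n2].
pose del (x : Rd) := eta_ n x - eta x.
have sB f k : sobolev K f -> sobolev K k -> sobolev K (fun x => f x - k x).
  move=> sf sk; have := sobolev_lin 1 (-1) sf sk; congr sobolev.
  by apply/funext => y; rewrite mul1r mulN1r.
have sdel : sobolev K del by apply: sB; exact: D1.
have sLd := L1 _ sdel.
have nd : sobolev_norm K del <= e' by rewrite le_min n1 n2.
pose P (x : Rd) := h (eta_ n) x - h eta x - L del x.
have sP : sobolev K P by apply: (sB _ _ _ sLd); apply: sB; exact: D2.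
have th : torus_continuous (fun x => h (eta_ n) x - h eta x) by apply: torus_continuousB; exact: D3.
have nP : sobolev_norm K P <= e'.
  apply: le_trans (hr _ (Den n) _) _; first by apply: le_lt_trans n1 _; lra.
  by rewrite mul1r.
have nL : sobolev_norm K (L del) <= `|C| * e'.
  apply: le_trans (hC _ sdel) _; apply: (@le_trans _ _ (`|C| * sobolev_norm K del)).
    by rewrite ler_wpM2r ?sqrtr_ge0 ?ler_norm.
  exact: (ler_wpM2l (normr_ge0 C) nd).
have tcE M : tconv M (fun x => h (eta_ n) x - h eta x) = fun x => tconv M P x + tconv M (L del) x.
  rewrite -tconvD; [|exact: (torus_L2_L1 sP.1).2|exact: (torus_L2_L1 sLd.1).2].
  by congr tconv; apply/funext => y; rewrite /P subrK.
have bnd M : `|tconv M (fun x => h (eta_ n) x - h eta x) x| <= e / 2.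
  rewrite tcE.
  have b1 := @sobolev_tconv_sup R d K P [::] M x sP dK.
  have b2 := @sobolev_tconv_sup R d K (L del) [::] M x sLd dK.
  apply: le_trans (ler_normD _ _) _.
  apply: (@le_trans _ _ (S * e' + S * (`|C| * e'))).
    by apply: lerD; [apply: le_trans b1 _|apply: le_trans b2 _]; rewrite ler_wpM2l.
  apply: (@le_trans _ _ ((S + 1) * (`|C| + 1) * (e / (2 * (S + 1) * (`|C| + 1))))).
    rewrite (_ : _ + _ = S * (`|C| + 1) * e'); last by ring.
    apply: ler_pM; [by rewrite mulr_ge0// ltW|exact: ltW| |by rewrite ge_min lexx orbT].
    by rewrite ler_wpM2r ?(ltW C0)// lerDl.
  by rewrite le_eqVlt; apply/orP; left; apply/eqP; field; rewrite !gt_eqF// ltr_wpDl.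
have [M /(_ M (leqnn M) x) hM] := tconv_uniform th (divr_gt0 e0 (ltr0Sn _ 1)).
have := bnd M; move: hM; set a := tconv _ _ _; set b := h (eta_ n) x - h eta x => h1 h2.
exact: ler_norm_halves h2 h1.
Qed.

End sobolev_continuous.

(** * The chain rule for superposition operators *)

Section chain_rule.
Context {R : realType} {d : nat}.
Local Notation Rd := 'rV[R]_d.
Local Notation mu := (torus_measure R d).
Local Notation periodic := Defs.periodic.
Local Notation X := (Rd * R * R)%type.

Lemma difference_quotientE (e : R -> R) :
  (fun t : R => t^-1 *: ((e \o shift 0) (t *: 1) - e 0)) = (fun t : R => t^-1 * (e t - e 0)).
Proof. by apply/funext => t; rewrite /= addr0 /GRing.scale/= mulr1. Qed.

Lemma difference_quotient (e : R -> R) (l : R) : is_derive (0 : R) 1 e l ->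
  (fun t : R => t^-1 * (e t - e 0)) @ 0^' --> l.
Proof.
move=> [D <-]; rewrite -difference_quotientE.
by move: D; rewrite /derivable => /cvg_ex[m c]; rewrite /derive (cvg_lim _ c).
Qed.

Lemma is_derive_quotient (e : R -> R) (l : R) :
  (fun t : R => t^-1 * (e t - e 0)) @ 0^' --> l -> is_derive (0 : R) 1 e l.
Proof.
rewrite -difference_quotientE => c.
by split; [apply/cvg_ex; exists l|exact: cvg_lim c].
Qed.

Lemma norm_triple (p : X) (r : R) : `|p| <= r <-> [/\ `|p.1.1| <= r, `|p.1.2| <= r & `|p.2| <= r].
Proof.
rewrite prod_normE ge_max prod_normE ge_max; split.
  by move=> /andP[/andP[-> ->] ->].
by move=> [-> -> ->].
Qed.

(** [smooth] speaks of directional derivatives, so the increment of k is decomposed along the three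
    factors of the product and the mean value theorem is applied to each. The intermediate points
    stay within [rho t] of p, and continuity of the three directional derivatives at p concludes. *)
Lemma smooth_chain (k : X -> R) (x v : Rd) (e th : R -> R) (e' th' : R) : smooth k ->
  is_derive (0 : R) 1 e e' -> is_derive (0 : R) 1 th th' ->
  is_derive (0 : R) 1 (fun t : R => k (x + t *: v, e t, th t))
    ('D_((v, 0, 0) : X) k (x, e 0, th 0) + e' * 'D_((0, 1, 0) : X) k (x, e 0, th 0)
     + th' * 'D_((0, 0, 1) : X) k (x, e 0, th 0)).
Proof.
move=> sk de dth; pose p : X := (x, e 0, th 0).
pose rho (t : R) := `|t| * `|v| + `|e t - e 0| + `|th t - th 0|.
have [_ dk] := sk [::].
have cD (w : X) : {for p, continuous ('D_w k)} by have [c _] := sk [:: w]; exact: c.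
have H (t : R) : exists abc : R * R * R,
  [/\ exists2 q : X, `|p - q| <= rho t & abc.1.1 = 'D_((v, 0, 0) : X) k q,
      exists2 q : X, `|p - q| <= rho t & abc.1.2 = 'D_((0, 1, 0) : X) k q,
      exists2 q : X, `|p - q| <= rho t & abc.2 = 'D_((0, 0, 1) : X) k q &
      k (x + t *: v, e t, th t) - k p =
        t * abc.1.1 + (e t - e 0) * abc.1.2 + (th t - th 0) * abc.2].
  have scE (s : R) (y : Rd) (a b : R) : s *: ((y, a, b) : X) = (s *: y, s * a, s * b) by [].
  have adE (y z : Rd) (a b a' b' : R) : (y, a, b) + (z, a', b') = (y + z, a + a', b + b') :> X by [].
  have opE (y z : Rd) (a b a' b' : R) : (y, a, b) - (z, a', b') = (y - z, a - a', b - b') :> X by [].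
  have r1 : 0 <= `|t| * `|v| by exact: mulr_ge0.
  have r2 := normr_ge0 (e t - e 0); have r3 := normr_ge0 (th t - th 0).
  have [s1 [h1 E1]] := @line_mvt R _ k ((v, 0, 0) : X) (fun y => dk y _) (x, e t, th t) t.
  have [s2 [h2 E2]] := @line_mvt R _ k ((0, 1, 0) : X) (fun y => dk y _) (x, e 0, th t) (e t - e 0).
  have [s3 [h3 E3]] := @line_mvt R _ k ((0, 0, 1) : X) (fun y => dk y _) (x, e 0, th 0) (th t - th 0).
  move: E1 E2 E3; rewrite !scE !adE !(mulr0, mulr1, scaler0, addr0, add0r) !(addrC _ (_ - _)) !subrK => E1 E2 E3.
  exists ('D_((v, 0, 0) : X) k (x + s1 *: v, e t, th t), 'D_((0, 1, 0) : X) k (x, e 0 + s2, th t),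
    'D_((0, 0, 1) : X) k (x, e 0, th 0 + s3)).
  split.
  - exists (x + s1 *: v, e t, th t) => //.
    rewrite opE opprD addNKr; apply/norm_triple; split; rewrite /= /rho.
    + by rewrite normrN normrZ -addrA ler_wpDr ?addr_ge0// ler_wpM2r.
    + by rewrite distrC; lra.
    + by rewrite distrC; lra.
  - exists (x, e 0 + s2, th t) => //.
    rewrite opE subrr opprD addNKr; apply/norm_triple; split; rewrite /= /rho ?normr0 ?normrN; [lra|lra|].
    by rewrite distrC; lra.
  - exists (x, e 0, th 0 + s3) => //.
    rewrite opE !subrr opprD addNKr; apply/norm_triple; split; rewrite /= /rho ?normr0 ?normrN; lra.
  - by rewrite /= -E1 -E2 -E3; ring.
have [abc habc] := choice H.
have crho : rho @ 0^' --> (0 : R).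
  have cf (f : R -> R) (l : R) : is_derive (0 : R) 1 f l -> (fun t => `|f t - f 0|) @ 0^' --> (0 : R).
    move=> [/derivable1_diffP/differentiable_continuous c _].
    have c1 : f @ 0^' --> f 0 by move=> A /c; exact: nbhs_dnbhs.
    have c2 : (fun t => `|f t - f 0|) @ 0^' --> `|f 0 - f 0|.
      by apply: cvg_norm; apply: cvgB => //; exact: cvg_cst.
    by rewrite subrr normr0 in c2.
  have ct : (fun t : R => `|t| * `|v|) @ 0^' --> (0 : R).
    have c1 : (fun t : R => t) @ 0^' --> (0 : R) by move=> A; exact: nbhs_dnbhs.
    have c2 : (fun t : R => `|t| * `|v|) @ 0^' --> `|0 : R| * `|v|.
      by apply: cvgM; [exact: cvg_norm|exact: cvg_cst].
    by rewrite normr0 mul0r in c2.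
  rewrite -[X in _ --> X]addr0 -[X in _ --> X + _]addr0; apply: cvgD; last exact: cf dth.
  by apply: cvgD; last exact: cf de.
have lim (u : R -> R) (w : X) : (forall t, exists2 q : X, `|p - q| <= rho t & u t = 'D_w k q) ->
    u @ 0^' --> 'D_w k p.
  move=> hu; apply/cvgrPdist_lt => eps eps0.
  have /cvgrPdist_lt/(_ _ eps0)/nbhs_normP[del /= del0 hd] := cD w.
  have /cvgrPdist_lt/(_ _ del0) := crho; apply: filterS => t; rewrite sub0r normrN => ht.
  by have [q hq ->] := hu t; apply: hd; rewrite /= (le_lt_trans hq)// (le_lt_trans (ler_norm _)).
apply: is_derive_quotient; rewrite scale0r addr0 -/p.
have c : (fun t => (abc t).1.1 + (t^-1 * (e t - e 0)) * (abc t).1.2 + (t^-1 * (th t - th 0)) * (abc t).2) @ 0^' -->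
    ('D_((v, 0, 0) : X) k p + e' * 'D_((0, 1, 0) : X) k p + th' * 'D_((0, 0, 1) : X) k p).
  apply: cvgD; [apply: cvgD|].
  - by apply: lim => t; have [] := habc t.
  - by apply: cvgM; [exact: difference_quotient|apply: lim => t; have [] := habc t].
  - by apply: cvgM; [exact: difference_quotient|apply: lim => t; have [] := habc t].
apply: cvg_trans c; apply: near_eq_cvg; near=> t.
have t0 : t != 0 by near: t; exact: nbhs_dnbhs_neq.
have [_ _ _ ->] := habc t.
by field.
Unshelve. all: by end_near.
Qed.

(** [V] is only locally the restriction of a smooth function of the product space. Because eta is
    positive, all points near (x, eta x, th x) have their second coordinate in E, so the composition
    agrees with that of the smooth extension on a full neighbourhood of x. *)
Lemma torus_C1_nemytskii (E : set R) (V : Rd -> R -> R -> R) (eta th : Rd -> R) :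
  (forall e, 0 < e -> E e) -> param_smooth E V ->
  torus_C1 eta -> torus_C1 th -> (forall x, 0 < eta x) ->
  torus_C1 (fun x => V x (eta x) (th x)).
Proof.
move=> Epos [pV sV] Ceta Cth eta0.
pose F (x : Rd) := V x (eta x) (th x); pose P (x : Rd) : X := (x, eta x, th x).
have cP : continuous P.
  apply/continuous_epsP => x e e0; have e2 : 0 < e / 2 by rewrite divr_gt0.
  have /continuous_epsP/(_ x _ e2)[d1 d10 h1] := Ceta.1.2.
  have /continuous_epsP/(_ x _ e2)[d2 d20 h2] := Cth.1.2.
  exists (Num.min (e / 2) (Num.min d1 d2)); first by rewrite !lt_min e2 d10 d20.
  move=> y; rewrite !lt_min => /and3P[y0 /h1 y1 /h2 y2].
  apply: (@le_lt_trans _ _ (e / 2)); last by rewrite ltr_pdivrMr// mulr_natr mulr2n ltrDl.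
  by apply/norm_triple; split; exact: ltW.
pose D (k : X -> R) i (x : Rd) : R := 'D_((delta_mx 0 i, 0, 0) : X) k (P x)
  + pd i eta x * 'D_((0, 1, 0) : X) k (P x) + pd i th x * 'D_((0, 0, 1) : X) k (P x).
have loc (x0 : Rd) : exists2 k : X -> R, smooth k & \forall x \near x0, F x = k (P x) /\
    forall i, is_derive x (delta_mx 0 i) F (D k i x).
  have [k sk Vk] := sV (P x0) (Epos _ (eta0 x0)).
  have pos : \forall q \near P x0, 0 < q.1.2.
    have c : (fun q : X => q.1.2) @ P x0 --> eta x0.
      apply: (@cvg_comp _ _ _ (fun q : X => q.1) snd _ (nbhs (P x0).1)); first exact: cvg_fst.
      exact: cvg_snd.
    move/cvgrPdist_lt: c => /(_ _ (eta0 x0)); apply: filterS => q.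
    by move=> /(le_lt_trans (ler_norm _)); rewrite ltrBlDr ltrDl.
  have near0 : \forall x \near x0, uncurry3 V (P x) = k (P x).
    have Vk' : \forall q \near P x0, uncurry3 V q = k q.
      by apply: filterS2 Vk pos => q hq q0; apply: hq; exact: Epos.
    exact: (cP x0 _ Vk').
  exists k => //.
  (* The identity is needed near each x close to x0: continuity of the derivative at x0 involves the
     derivatives at nearby points. *)
  have near1 : \forall x \near x0, \forall y \near x, F y = k (P y) by exact/near_join.
  apply: filterS near1 => x nx; split; first exact: nbhs_singleton nx.
  move=> i; apply: (@near_eq_is_derive _ _ _ (fun y => k (P y))).
    by apply: filterS nx => y ->.
  apply: line_derivable.
  have e0 (f : Rd -> R) : torus_C1 f -> is_derive (0 : R) 1 (fun t : R => f (x + t *: delta_mx 0 i)) (pd i f x).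
    by move=> Cf; apply: is_derive_line; rewrite scale0r addr0; exact: torus_C1_derive.
  have := smooth_chain x (delta_mx 0 i) sk (e0 _ Ceta) (e0 _ Cth).
  by rewrite scale0r addr0.
have dF x i : is_derive x (delta_mx 0 i) F (pd i F x).
  by have [k sk h] := loc x; have [_ /(_ i) [d1 d2]] := nbhs_singleton h; split.
have tF : torus_continuous F.
  split; first by move=> x i; rewrite /F Ceta.1.1 Cth.1.1 pV//; exact: Epos.
  move=> x; have [k sk h] := loc x; have [Fk _] := nbhs_singleton h.
  rewrite /continuous_at Fk; have [ck _] := sk [::].
  have c : k (P y) @[y --> x] --> k (P x) by apply: continuous_comp; [exact: cP|exact: ck].
  have e : \forall y \near x, k (P y) = F y by apply: filterS h => y [->].
  exact: cvg_trans (near_eq_cvg e) c.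
have [] // := @torus_C1_intro R d F (fun i => pd i F) tF _ (fun i x => dF x i).
move=> i; split; first exact: periodic_pd tF.1.
move=> x; have [k sk h] := loc x.
have E0 : pd i F x = D k i x by have [_ /(_ i) [_ <-]] := nbhs_singleton h.
rewrite /continuous_at E0.
have cD : D k i y @[y --> x] --> D k i x.
  have c (w : X) : 'D_w k (P y) @[y --> x] --> 'D_w k (P x).
    have [ck _] := sk [:: w]; exact: (continuous_comp (f := P) (g := 'D_w k) (cP x) (ck _)).
  exact: (cvgD (cvgD (c _) (cvgM ((Ceta.2 i).2.2 x) (c _))) (cvgM ((Cth.2 i).2.2 x) (c _))).
have e : \forall y \near x, D k i y = pd i F y by apply: filterS h => y [_ /(_ i) [_ <-]].
exact: cvg_trans (near_eq_cvg e) cD.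
Unshelve. all: by end_near.
Qed.

End chain_rule.

(** * Compactness *)

Section extraction.
Context {R : realType}.

Definition subsequence (s : nat -> nat) := forall n, (s n < s n.+1)%N.

Lemma subsequence_lt s n m : subsequence s -> (n < m)%N -> (s n < s m)%N.
Proof.
move=> hs; elim: m => // m ih; rewrite ltnS leq_eqVlt => /orP[/eqP ->//|/ih h].
exact: ltn_trans h (hs m).
Qed.

Lemma subsequence_ge s n : subsequence s -> (n <= s n)%N.
Proof. by move=> hs; elim: n => // n ih; exact: leq_ltn_trans ih (hs n). Qed.

Lemma subsequence_comp s r : subsequence s -> subsequence r -> subsequence (fun n => s (r n)).
Proof. by move=> hs hr n; exact: subsequence_lt. Qed.

Lemma cvg_subsequence (u : nat -> R) (l : R) s : subsequence s ->
  u n @[n --> \oo] --> l -> u (s n) @[n --> \oo] --> l.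
Proof.
move=> hs /cvg_seqP h; apply/cvg_seqP => e /h[N hN]; exists N => n nN.
by apply: hN; exact: leq_trans nN (subsequence_ge n hs).
Qed.

Lemma subsequence_choice (P : nat -> nat -> Prop) :
  (forall k N, exists2 n, (N <= n)%N & P k n) -> exists2 s, subsequence s & forall k, P k (s k).
Proof.
move=> h.
have [f hf] : {f : nat * nat -> nat & forall p, (p.2 <= f p)%N /\ P p.1 (f p)}.
  apply: (@choice _ _ (fun (p : nat * nat) n => (p.2 <= n)%N /\ P p.1 n)) => -[k N].
  by have [n h1 h2] := h k N; exists n.
pose s := fix s k := if k is k'.+1 then f (k, (s k').+1) else f (0%N, 0%N).
exists s => [k|[|k]]; first exact: (hf (k.+1, (s k).+1)).1.
  exact: (hf (0%N, 0%N)).2.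
exact: (hf (k.+1, (s k).+1)).2.
Qed.

(* Limits along an ultrafilter finer than the cofinite one replace the diagonal argument. *)
Lemma diagonal_extraction (C : countType) (a : C -> nat -> R) (M : C -> R) :
  (forall c n, `|a c n| <= M c) ->
  exists2 s, subsequence s & forall c, exists l : R, a c (s n) @[n --> \oo] --> l.
Proof.
move=> aM.
have [U [UU oU]] := @ultraFilterLemma nat \oo _.
have lim c : exists l : R, a c n @[n --> U] --> l.
  have [|l [_ cl]] := @segment_compact R (- M c) (M c) (a c n @[n --> U]) _.
    by apply: (@filterE _ U) => n; rewrite /= in_itv/= -ler_norml.
  exists l => B lB; have [//|nB] := in_ultra_setVsetC (a c @^-1` B) UU.
  have [//|y [nBy By]] := cl (~` B) B _ lB.
  by [].
have [l hl] := choice lim.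
have [s hs h] : exists2 s, subsequence s &
    forall k c, (pickle c <= k)%N -> `|a c (s k) - l c| <= k.+1%:R^-1.
  apply: (@subsequence_choice (fun k n => forall c, (pickle c <= k)%N -> `|a c n - l c| <= k.+1%:R^-1)) => k N.
  have hU j : U [set n | forall c, (pickle c < j)%N -> `|a c n - l c| <= k.+1%:R^-1].
    elim: j => [|j ih]; first by apply: filterE => n c.
    have [[c0 hc0]|nc0] := pselect (exists c0 : C, pickle c0 = j).
      have /cvgrPdist_le/(_ k.+1%:R^-1) := hl c0; rewrite invr_gt0 ltr0n => /(_ isT).
      apply: filterS2 ih => n h1 h2 c; rewrite ltnS leq_eqVlt => /orP[/eqP cj|/h1//].
      have -> : c = c0 by apply: (pcan_inj pickleK); rewrite cj hc0.
      by rewrite distrC.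
    apply: filterS ih => n h1 c; rewrite ltnS leq_eqVlt => /orP[/eqP cj|/h1//].
    by exfalso; apply: nc0; exists c.
  have hN : U [set n | (N <= n)%N] by apply: oU; exists N.
  have [n [h1 h2]] := filter_ex (filterI (hU k.+1) hN).
  by exists n.
exists s => // c; exists (l c); apply/cvg_seqP => e e0.
exists (maxn (pickle c) (Num.truncn e^-1).+1) => n; rewrite geq_max => /andP[cn en].
apply: le_trans (h n c cn) _; rewrite -[leRHS]invrK lef_pV2 ?posrE ?invr_gt0//.
by apply/ltW/(lt_le_trans (truncnS_gt _)); rewrite ler_nat (leq_trans en).
Qed.

End extraction.

Section function_sequences.
Context {R : realType} {d : nat}.
Local Notation Rd := 'rV[R]_d.
Local Notation mu := (torus_measure R d).
Local Notation periodic := Defs.periodic.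
Implicit Types f phi F : Rd -> R.

(** The sum of the series is integrable by monotone convergence and dominates each term. With terms
    weighted by a geometric factor, a single function then gives both a rate of almost everywhere
    convergence and a dominating function. *)
Lemma dominated_series (a : nat -> Rd -> R) : (forall n, integrableR mu (a n)) ->
  (forall n x, 0 <= a n x) -> (forall n, \int[mu]_x a n x <= 2^-1 ^+ n) ->
  exists2 S : Rd -> R, integrableR mu S & {ae mu, forall x n, a n x <= S x}.
Proof.
move=> ia a0 ha; pose T (x : Rd) : \bar R := (\sum_(k <oo) (a k x)%:E)%E.
have ma (k : nat) : measurable_fun setT (fun x => (a k x)%:E).
  by apply/measurable_EFinP; exact: integrableR_measurable.
have T0 x : (0 <= T x)%E by apply: nneseries_ge0 => k _ _; rewrite lee_fin.
have iT : (\int[mu]_x T x <= 2%:E)%E.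
  rewrite integral_nneseries//; last by move=> k x _; rewrite lee_fin.
  apply: lime_le; first by apply: is_cvg_nneseries => k _ _; apply: integral_ge0 => x _; rewrite lee_fin.
  apply: nearW => n; rewrite big_mkord.
  under eq_bigr do rewrite Rint_EFin//.
  rewrite sumEFin lee_fin.
  apply: (@le_trans _ _ (\sum_(k < n) 2^-1 ^+ k)); first exact: ler_sum.
  suff -> : \sum_(k < n) 2^-1 ^+ k = 2 - 2 * 2^-1 ^+ n :> R by rewrite lerBlDr lerDl mulr_ge0// exprn_ge0.
  elim: n => [|n ih]; first by rewrite big_ord0 expr0 mulr1 subrr.
  by rewrite big_ord_recr/= ih exprS; field.
have mT : measurable_fun setT T by apply: ge0_emeasurable_sum => // k x _ _; rewrite lee_fin.
have inT : mu.-integrable setT T.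
  apply/integrableP; split => //; under eq_integral do rewrite gee0_abs//.
  by apply: le_lt_trans iT _; rewrite ltry.
have fT := integrable_ae measurableT inT.
exists (fine \o T).
  apply/integrableP; split; first by apply/measurable_EFinP; exact: measurableT_comp.
  apply: le_lt_trans (_ : _ <= \int[mu]_x `|T x|)%E _; last by have /integrableP[] := inT.
  apply: ge0_le_integral => //.
  - by apply: measurableT_comp => //; apply/measurable_EFinP; exact: measurableT_comp.
  - exact: measurableT_comp.
  - move=> x _ /=; have := T0 x; case: (T x) => [r| |]//= _.
    by rewrite normr0 leey.
apply: filterS fT => x /(_ I) fx k /=.
rewrite -lee_fin fineK// (le_trans _ (@nneseries_lim_ge _ (fun k => (a k x)%:E) xpredT 0%N k.+1 _))//.
  rewrite big_mkord (bigD1 (@ord_max k))//= leeDl// sume_ge0// => j _; by rewrite lee_fin.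
by move=> j _ _; rewrite lee_fin.
Qed.

Lemma pow2_small (e : R) : 0 < e -> exists N, forall n, (N <= n)%N -> (2^-1 : R) ^+ n <= e.
Proof.
move=> e0; exists (Num.truncn e^-1).+1 => n nN.
have n1 : n%:R <= 2 ^+ n :> R by rewrite -natrX ler_nat ltnW// ltn_expl.
have np : 0 < n%:R :> R by rewrite ltr0n (leq_trans _ nN).
rewrite exprVn -[leRHS]invrK lef_pV2 ?posrE ?invr_gt0// ?exprn_gt0//.
apply: le_trans n1; apply/ltW/(lt_le_trans (truncnS_gt _)); by rewrite ler_nat.
Qed.

Lemma L1_subsequence (f : nat -> Rd -> R) F : (forall n, integrableR mu (f n)) -> integrableR mu F ->
  \int[mu]_x `|f n x - F x| @[n --> \oo] --> (0 : R) ->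
  exists s, subsequence s /\ exists2 H : Rd -> R, integrableR mu H &
    {ae mu, forall x, f (s n) x @[n --> \oo] --> F x} /\ {ae mu, forall x n, `|f (s n) x| <= H x}.
Proof.
move=> If IF c.
(* The rate 4^-k leaves room for the weight 2^k: the weighted differences still have summable
   integrals, and their common bound S yields |f (s n) - F| <= 2^-n S. *)
have [s hs h] : exists2 s, subsequence s & forall k, \int[mu]_x `|f (s k) x - F x| <= 4^-1 ^+ k.
  apply: (@subsequence_choice (fun k n => \int[mu]_x `|f n x - F x| <= 4^-1 ^+ k)) => k N.
  have pk : 0 < (4^-1 : R) ^+ k by rewrite exprn_gt0// invr_gt0.
  have [N0 hN] := (cvg_seqP _ _).1 c _ pk.
  exists (maxn N N0); first exact: leq_maxl.
  have := hN _ (leq_maxr N N0); rewrite subr0; apply: le_trans; exact: ler_norm.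
have Id n : integrableR mu (fun x => `|f (s n) x - F x|) by apply: integrableR_abs; exact: integrableRB.
have [|||S IS hS] := @dominated_series (fun n x => 2 ^+ n * `|f (s n) x - F x|).
- by move=> n; exact: integrableRZ.
- by move=> n x; rewrite mulr_ge0// exprn_ge0.
- move=> n; rewrite RintZ//; apply: (@le_trans _ _ (2 ^+ n * 4^-1 ^+ n)).
    by rewrite ler_wpM2l ?exprn_ge0.
  by rewrite -exprMn (_ : 2 * 4^-1 = 2^-1 :> R)//; field.
have hS' : {ae mu, forall x n, `|f (s n) x - F x| <= 2^-1 ^+ n * S x}.
  apply: filterS hS => x hx n; have := hx n.
  by rewrite -ler_pdivlMl ?exprn_gt0// exprVn.
exists s; split => //; exists (fun x => `|F x| + S x).
  by apply: integrableRD => //; exact: integrableR_abs.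
split.
  apply: filterS hS' => x hx; apply/cvg_seqP => e e0.
  have S0 : 0 <= S x by have := hx 0%N; rewrite expr0 mul1r; apply: le_trans.
  have [N hN] := pow2_small (divr_gt0 e0 (ltr_wpDl S0 ltr01)).
  exists N => n nN; apply: le_trans (hx n) _.
  apply: (@le_trans _ _ (e / (S x + 1) * S x)); first by rewrite ler_wpM2r// hN.
  by rewrite mulrAC ler_pdivrMr ?ltr_wpDl// ler_wpM2l ?ltW// ltrDl.
apply: filterS hS' => x hx n; have S0 : 0 <= S x by have := hx 0%N; rewrite expr0 mul1r; apply: le_trans.
have h1 : 2^-1 ^+ n * S x <= S x by rewrite ler_piMl// exprn_ile1// invf_le1 ?ler1n.
by have := ler_normD (f (s n) x - F x) (F x); rewrite subrK; have := hx n; lra.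
Qed.

Lemma geometric_telescope (u : nat -> R) (c : R) : 0 <= c ->
  (forall n, `|u n.+1 - u n| <= c * 2^-1 ^+ n) ->
  forall n m, (n <= m)%N -> `|u m - u n| <= 2 * c * 2^-1 ^+ n.
Proof.
move=> c0 h n m nm; rewrite -(subnK nm); move: (m - n)%N => k {nm m}.
suff : `|u (k + n)%N - u n| <= 2 * c * 2^-1 ^+ n * (1 - 2^-1 ^+ k).
  move/le_trans; apply; rewrite ler_piMr ?mulr_ge0 ?exprn_ge0//.
elim: k => [|k ih]; first by rewrite add0n subrr normr0 expr0 subrr mulr0.
rewrite (_ : u (k.+1 + n)%N - u n = (u (k + n).+1 - u (k + n)%N) + (u (k + n)%N - u n)); last first.
  by rewrite addSn; ring.
apply: le_trans (ler_normD _ _) _; apply: le_trans (lerD (h _) ih) _.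
by rewrite exprD exprS le_eqVlt; apply/orP; left; apply/eqP; field.
Qed.

Lemma L2_complete (f : nat -> Rd -> R) : (forall n, torus_L2 (f n)) ->
  (forall e : R, 0 < e -> exists N, forall n m, (N <= n)%N -> (N <= m)%N ->
     \int[mu]_x (f n x - f m x) ^+ 2 <= e) ->
  exists s F, [/\ subsequence s, torus_L2 F,
    {ae mu, forall x, f (s n) x @[n --> \oo] --> F x},
    exists2 H : Rd -> R, integrableR mu H & {ae mu, forall x n, f (s n) x ^+ 2 <= H x} &
    \int[mu]_x (f (s n) x - F x) ^+ 2 @[n --> \oo] --> (0 : R)].
Proof.
move=> Lf cau.
(* For squared distances at rate 8^-k the weight 4^k can be spent; after a square root the
   successive differences are at most 2^-k times the root of a fixed integrable function, which
   makes them telescope. *)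
have [s hs h] : exists2 s, subsequence s & forall k, forall n m, (s k <= n)%N -> (s k <= m)%N ->
    \int[mu]_x (f n x - f m x) ^+ 2 <= 8^-1 ^+ k.
  apply: (@subsequence_choice (fun k p => forall n m, (p <= n)%N -> (p <= m)%N ->
    \int[mu]_x (f n x - f m x) ^+ 2 <= 8^-1 ^+ k)) => k N.
  have pk : 0 < (8^-1 : R) ^+ k by rewrite exprn_gt0// invr_gt0.
  have [N0 hN] := cau _ pk.
  exists (maxn N N0); first exact: leq_maxl.
  by move=> n m; rewrite !geq_max => /andP[_ h1] /andP[_ h2]; exact: hN.
have Ld n m : torus_L2 (fun x => f n x - f m x).
  have := torus_L2_lin 1 (-1) (Lf n) (Lf m); congr torus_L2.
  by apply/funext => x; rewrite mul1r mulN1r.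
have [|||S IS hS] := @dominated_series (fun n x => 4 ^+ n * (f (s n.+1) x - f (s n) x) ^+ 2).
- by move=> n; apply: integrableRZ; case: (Ld (s n.+1) (s n)).
- by move=> n x; rewrite mulr_ge0 ?sqr_ge0// exprn_ge0.
- move=> n; rewrite RintZ; last by case: (Ld (s n.+1) (s n)).
  apply: (@le_trans _ _ (4 ^+ n * 8^-1 ^+ n)).
    by rewrite ler_wpM2l ?exprn_ge0// h// ltnW.
  by rewrite -exprMn (_ : 4 * 8^-1 = 2^-1 :> R)//; field.
have S0 : {ae mu, forall x, 0 <= S x}.
  by apply: filterS hS => x /(_ 0%N); rewrite expr0 mul1r; apply: le_trans; exact: sqr_ge0.
have tel : {ae mu, forall x n m, (n <= m)%N -> `|f (s m) x - f (s n) x| <= 2 * Num.sqrt (S x) * 2^-1 ^+ n}.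
  apply: filterS2 S0 hS => x S0x hx; apply: (@geometric_telescope (fun n => f (s n) x)) => [|n].
    exact: sqrtr_ge0.
  have := hx n; rewrite -ler_pdivlMl ?exprn_gt0// => hn.
  rewrite -sqrtr_sqr -[leRHS]ger0_norm ?mulr_ge0 ?sqrtr_ge0 ?exprn_ge0//.
  rewrite -sqrtr_sqr ler_sqrt ?sqr_ge0// exprMn sqr_sqrtr// -exprM muln2 -addnn exprD -exprMn.
  by rewrite (_ : 2^-1 * 2^-1 = 4^-1 :> R) ?exprVn 1?mulrC//; field.
have cv : {ae mu, forall x, exists l : R, f (s n) x @[n --> \oo] --> l}.
  apply: filterS tel => x hx; apply: cauchy_real => e e0.
  have c0 : 0 <= 4 * Num.sqrt (S x) by rewrite mulr_ge0// sqrtr_ge0.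
  have [N hN] := pow2_small (divr_gt0 e0 (ltr_wpDl c0 ltr01)).
  exists N => n m nN mN.
  rewrite (_ : _ - _ = (f (s n) x - f (s N) x) - (f (s m) x - f (s N) x)); last by ring.
  apply: le_trans (ler_normB _ _) _; apply: le_trans (lerD (hx _ _ nN) (hx _ _ mN)) _.
  rewrite (_ : _ + _ = 4 * Num.sqrt (S x) * 2^-1 ^+ N); last by ring.
  apply: (@le_trans _ _ (4 * Num.sqrt (S x) * (e / (4 * Num.sqrt (S x) + 1)))).
    by rewrite ler_wpM2l// hN.
  by rewrite mulrA ler_pdivrMr ?ltr_wpDl// mulrC ler_wpM2l ?ltW// ltrDl.
(* The upper limit is defined at every point, so F is measurable, and periodic everywhere rather
   than almost everywhere. *)
pose F (x : Rd) : R := fine (limn_esup (fun n => (f (s n) x)%:E)).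
have cF : {ae mu, forall x, f (s n) x @[n --> \oo] --> F x}.
  apply: filterS cv => x [l cl]; suff -> : F x = l by [].
  have cE : (fun n => (f (s n) x)%:E) @ \oo --> l%:E by apply/cvg_EFin; [exact: nearW|exact: cl].
  by rewrite /F is_cvg_limn_esupE; [rewrite (cvg_lim _ cE)|apply/cvg_ex; exists l%:E].
have pF : periodic F.
  move=> x i; rewrite /F; congr (fine (limn_esup _)); apply/funext => n.
  by have [-> _ _] := Lf (s n).
have mf n : measurable_fun setT (f n) by case: (Lf n).
have mF : measurable_fun setT F.
  apply: measurableT_comp => //; apply: measurable_fun_limn_esup => n; exact/measurable_EFinP.
pose H (x : Rd) : R := 2 * f (s 0%N) x ^+ 2 + 8 * S x.
have IH : integrableR mu H.
  by apply: integrableRD; apply: integrableRZ => //; case: (Lf (s 0%N)).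
have fH : {ae mu, forall x n, f (s n) x ^+ 2 <= H x}.
  apply: filterS2 S0 tel => x S0x hx n; have := hx 0%N n (leq0n n); rewrite expr0 mulr1 => hn.
  have h4 : (f (s n) x - f (s 0%N) x) ^+ 2 <= 4 * S x.
    rewrite -(sqr_sqrtr S0x) -real_normK ?num_real// (_ : 4 * _ = (2 * Num.sqrt (S x)) ^+ 2); last by ring.
    by rewrite ler_pXn2r ?nnegrE// mulr_ge0 ?sqrtr_ge0.
  rewrite /H; have := sqr_ge0 (f (s n) x - 2 * f (s 0%N) x).
  move: h4; move: (f (s n) x) (f (s 0%N) x) => a b; nra.
have FH : {ae mu, forall x, F x ^+ 2 <= H x}.
  apply: filterS2 cF fH => x cx hx; apply: (@cvg_seq_le _ (fun n => f (s n) x ^+ 2)) => //.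
  by rewrite expr2; under eq_fun do rewrite expr2; exact: cvgM.
have [|||||iF _] := @Rintegral_dominated R _ Rd mu (fun n x => f (s n) x ^+ 2) (fun x => F x ^+ 2) H.
- by move=> n; exact: measurable_funX.
- exact: measurable_funX.
- by apply: filterS cF => x cx; rewrite expr2; under eq_fun do rewrite expr2; exact: cvgM.
- exact: IH.
- by apply: filterS fH => x hx n; rewrite ger0_norm ?sqr_ge0.
have [|||||_ cI] := @Rintegral_dominated R _ Rd mu (fun n x => (f (s n) x - F x) ^+ 2) (fun=> 0) (fun x => 4 * H x).
- by move=> n; apply: measurable_funX; apply: measurable_funB.
- exact: measurable_cst.
- apply: filterS cF => x cx.
  have c : (fun n => (f (s n) x - F x) ^+ 2) @ \oo --> (F x - F x) * (F x - F x).
    under eq_fun do rewrite expr2.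
    by apply: cvgM; apply: cvgB => //; exact: cvg_cst.
  by rewrite subrr mulr0 in c.
- exact: integrableRZ.
- apply: filterS2 fH FH => x hx hF n; rewrite ger0_norm ?sqr_ge0//.
  by have := hx n; have := sqr_ge0 (f (s n) x + F x); move: hF; move: (f (s n) x) (F x) => a b; nra.
exists s, F; split => //; first by exists H.
by rewrite Rint_cst in cI.
Qed.

End function_sequences.

(** * Rellich's theorem and weak compactness in L^2 *)

Section compactness.
Context {R : realType} {d : nat}.
Local Notation Rd := 'rV[R]_d.
Local Notation mu := (torus_measure R d).
Local Notation periodic := Defs.periodic.
Implicit Types f phi psi F : Rd -> R.

Lemma L2_pairing f phi : torus_L2 f -> torus_L2 phi -> integrableR mu (fun x => f x * phi x) /\
  `|\int[mu]_x (f x * phi x)| <= Num.sqrt (\int[mu]_x f x ^+ 2) * Num.sqrt (\int[mu]_x phi x ^+ 2).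
Proof.
move=> [_ mf i2] [_ mp j2]; have i := integrableRM_sqr mf mp i2 j2; split => //.
exact: le_trans (Rint_abs i) (cauchy_schwarz mf mp i2 j2).
Qed.

(** In each degree finitely many moments determine all the others, so a diagonal extraction over a
    countable set of moments covers every trigonometric polynomial. *)
Lemma weak_extraction (f : nat -> Rd -> R) (C : R) : (forall n, torus_continuous (f n)) ->
  (forall n, \int[mu]_x f n x ^+ 2 <= C) ->
  exists2 s, subsequence s & forall N phi, trig_poly N phi ->
    exists l : R, \int[mu]_x (f (s n) x * phi x) @[n --> \oo] --> l.
Proof.
move=> tf fC.
have fam (n : nat) : exists J : {J : finType & J -> Rd -> R},
    (forall j, trig_poly n (tagged J j)) /\
    forall phi, trig_poly n phi -> exists c : tag J -> R, phi = fun x => \sum_j c j * tagged J j x.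
  by have [J [ph [h1 h2]]] := trig_poly_family (R := R) (d := d) n; exists (existT _ J ph).
have [J hJ] := choice fam.
pose I := {n : nat & tag (J n)}.
pose ph (c : I) := tagged (J (tag c)) (tagged c).
have tph c : torus_continuous (ph c) := trig_poly_continuous ((hJ (tag c)).1 (tagged c)).
have [s hs h] := @diagonal_extraction R I (fun c n => \int[mu]_x (f n x * ph c x))
  (fun c => Num.sqrt C * Num.sqrt (\int[mu]_x ph c x ^+ 2)) ltac:(move=> c n;
    have [_ h] := L2_pairing (torus_continuous_L2 (tf n)) (torus_continuous_L2 (tph c));
    apply: le_trans h _; rewrite ler_wpM2r ?sqrtr_ge0// ler_sqrt//;
    apply: le_trans (fC n); apply: Rint_ge0 => x; exact: sqr_ge0).
exists s => // N phi /((hJ N).2)[c ->].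
have [l hl] := choice h.
exists (\sum_j c j * l (existT _ N j)).
have -> : (fun n => \int[mu]_x (f (s n) x * \sum_j c j * tagged (J N) j x)) =
    fun n => \sum_j c j * \int[mu]_x (f (s n) x * ph (existT _ N j) x).
  apply/funext => n.
  rewrite (tint_ext (k := fun x => \sum_j c j * (f (s n) x * ph (existT _ N j) x))); last first.
    by move=> x; rewrite mulr_sumr; apply: eq_bigr => j _; rewrite mulrCA.
  have i j : integrableR mu (fun x => f (s n) x * ph (existT _ N j) x).
    by apply: tcI; exact: torus_continuousM.
  rewrite Rint_sum; last by move=> j; exact: integrableRZ.
  by apply: eq_bigr => j _; rewrite RintZ.
apply: cvg_sum_seq => j; apply: cvgM; [exact: cvg_cst|exact: hl].
Qed.

Lemma cvg_cauchy (u : nat -> R) (l e : R) : u n @[n --> \oo] --> l -> 0 < e ->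
  exists N, forall n m, (N <= n)%N -> (N <= m)%N -> `|u n - u m| <= e.
Proof.
move=> /cvg_seqP c e0; have [N hN] := c (e / 2) (divr_gt0 e0 (ltr0Sn _ 1)).
exists N => n m nN mN; have := ler_normB (u n - l) (u m - l); have := hN n nN; have := hN m mN.
by rewrite (_ : u n - l - (u m - l) = u n - u m); [lra|ring].
Qed.

(** For fixed N the convolution depends on finitely many moments of the function, each of which
    converges; the finite rank makes the estimate uniform in x. *)
Lemma tconv_cauchy (f : nat -> Rd -> R) N (e : R) : (forall n, torus_continuous (f n)) ->
  (forall M phi, trig_poly M phi -> exists l : R, \int[mu]_x (f n x * phi x) @[n --> \oo] --> l) ->
  0 < e -> exists N0, forall n m, (N0 <= n)%N -> (N0 <= m)%N ->
    forall x, `|tconv N (f n) x - tconv N (f m) x| <= e.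
Proof.
move=> tf h e0.
have [J [ph [c [hph hc _ hE _]]]] := @tconv_separated R d N.
have [B hB] := choice (fun j => torus_continuous_bounded (trig_poly_continuous (hph j))).
have B0 j : 0 <= B j := le_trans (normr_ge0 _) (hB j 0).
pose S : R := \sum_j B j; have S0 : 0 <= S by apply: sumr_ge0.
have eS : 0 < e / (S + 1) by rewrite divr_gt0// ltr_wpDl.
have [N0 hN0] : exists N0, forall j n, (N0 <= n)%N -> forall m, (N0 <= m)%N ->
    `|\int[mu]_y (c j y * f n y) - \int[mu]_y (c j y * f m y)| <= e / (S + 1).
  have h1 j : exists N1, forall n m, (N1 <= n)%N -> (N1 <= m)%N ->
      `|\int[mu]_y (c j y * f n y) - \int[mu]_y (c j y * f m y)| <= e / (S + 1).
    have [l hl] := h _ _ (hc j).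
    have hl' : \int[mu]_y (c j y * f n y) @[n --> \oo] --> l.
      suff <- : (fun n => \int[mu]_x (f n x * c j x)) = (fun n => \int[mu]_y (c j y * f n y)) by [].
      by apply/funext => n; apply: tint_ext => x; rewrite mulrC.
    exact: cvg_cauchy hl' eS.
  have [N1 hN1] := choice h1; exists (\max_j N1 j) => j n nN m mN.
  by apply: hN1; [apply: leq_trans nN|apply: leq_trans mN]; exact: leq_bigmax.
exists N0 => n m nN mN x; rewrite !hE; [|exact: tcI..].
rewrite -sumrB; apply: le_trans (ler_norm_sum _ _ _) _.
apply: (@le_trans _ _ (\sum_j e / (S + 1) * B j)).
  by apply: ler_sum => j _; rewrite -mulrBl normrM ler_pM// hN0.
by rewrite -mulr_sumr -/S mulrAC ler_pdivrMr ?ltr_wpDl// ler_wpM2l ?ltW// ltrDl.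
Qed.

(** By [tconv_sqr], mollification at a fixed rank N is close to the identity uniformly on bounded
    sets of W^{1,2}. The mollified functions are uniformly Cauchy along a subsequence with
    convergent moments, and completeness of L^2 concludes. *)
Lemma rellich (u : nat -> Rd -> R) (C : R) : (forall n, torus_C1 (u n)) ->
  (forall n, \int[mu]_x u n x ^+ 2 <= C) ->
  (forall n, \sum_i \int[mu]_x pd i (u n) x ^+ 2 <= C) ->
  exists s F, [/\ subsequence s, torus_L2 F,
    {ae mu, forall x, u (s n) x @[n --> \oo] --> F x},
    exists2 H : Rd -> R, integrableR mu H & {ae mu, forall x n, u (s n) x ^+ 2 <= H x} &
    \int[mu]_x (u (s n) x - F x) ^+ 2 @[n --> \oo] --> (0 : R)].
Proof.
move=> Cu uC duC; have tu n : torus_continuous (u n) := (Cu n).1.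
have C0 : 0 <= C by apply: le_trans (uC 0%N); apply: Rint_ge0 => x; exact: sqr_ge0.
have [s hs hw] := weak_extraction tu uC.
have [||r [F [hr LF c1 c2 c3]]] := @L2_complete R d (fun n => u (s n)).
- by move=> n; exact: torus_continuous_L2.
(* The difference is split into two mollification errors and one mollified difference; the square of
   a sum of three terms is at most three times the sum of the squares, hence e / 9 for each. *)
- move=> e e0; have e9 : 0 < e / 9 by rewrite divr_gt0.
  pose D : R := d%:R * C; have D0 : 0 <= D by apply: mulr_ge0.
  have [N hN] : exists N : nat, d%:R / (2 * N.+1%:R) * C <= e / 9.
    exists (Num.truncn (D / (e / 9))).+1.
    pose k := (Num.truncn (D / (e / 9))).+2; rewrite -/k.
    have kD : D / (e / 9) < k%:R.
      have t := truncnS_gt (D / (e / 9)); apply: lt_trans t _; by rewrite ltr_nat.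
    rewrite mulrAC -/D ler_pdivrMr ?mulr_gt0// ; move: kD; rewrite ltr_pdivrMr// => kD.
    apply: le_trans (ltW kD) _; rewrite mulrC ler_wpM2l ?(ltW e9)// ler_peMl//; lra.
  have q9 : 0 < Num.sqrt (e / 9) by rewrite sqrtr_gt0.
  have [N0 hN0] := tconv_cauchy N (fun n => tu (s n)) hw q9.
  exists N0 => n m nN mN.
  have tt k : torus_continuous (tconv N (u k)) := trig_poly_continuous (tconv_trig N (tcI (tu k))).
  have bd k : \int[mu]_x (tconv N (u k) x - u k x) ^+ 2 <= e / 9.
    apply: le_trans (tconv_sqr N (Cu k)) _; apply: le_trans hN.
    by apply: ler_wpM2l => //; rewrite divr_ge0// mulr_ge0.
  have t1 k : torus_continuous (fun x => (tconv N (u k) x - u k x) ^+ 2).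
    by apply: torus_continuousX; exact: torus_continuousB.
  have t2 : torus_continuous (fun x => (tconv N (u (s n)) x - tconv N (u (s m)) x) ^+ 2).
    by apply: torus_continuousX; exact: torus_continuousB.
  have i3 : integrableR mu (fun x => 3 * (tconv N (u (s n)) x - u (s n) x) ^+ 2 +
      3 * (tconv N (u (s m)) x - u (s m) x) ^+ 2 + 3 * (tconv N (u (s n)) x - tconv N (u (s m)) x) ^+ 2).
    by apply: integrableRD; [apply: integrableRD|]; apply: integrableRZ; exact: tcI.
  apply: le_trans (Rint_le _ i3 _) _.
  + by apply: tcI; apply: torus_continuousX; exact: torus_continuousB.
  + move=> x; move: (u (s n) x) (u (s m) x) (tconv N (u (s n)) x) (tconv N (u (s m)) x) => a b p q.
    have := sqr_ge0 ((p - a) + (q - b)); have := sqr_ge0 ((p - a) + (p - q)); have := sqr_ge0 ((q - b) - (p - q)).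
    by nra.
  + rewrite RintD; [|by apply: integrableRD; apply: integrableRZ; exact: tcI|by apply: integrableRZ; exact: tcI].
    rewrite RintD ?RintZ; [|by [exact: tcI|apply: integrableRZ; exact: tcI]..].
    have := bd (s n); have := bd (s m).
    have : \int[mu]_x (tconv N (u (s n)) x - tconv N (u (s m)) x) ^+ 2 <= e / 9.
      rewrite -[leRHS](Rint_cst (R := R) (d := d)); apply: Rint_le => [||x]; [exact: tcI|exact: tcI (torus_continuous_cst _)|].
      by rewrite -(sqr_sqrtr (ltW e9)) -[leLHS]real_normK ?num_real// ler_pXn2r ?nnegrE ?sqrtr_ge0// hN0.
    by lra.
by exists (fun n => s (r n)), F; split => //; exact: subsequence_comp.
Qed.

Definition any_trig phi := exists n, trig_poly n phi.

Lemma any_trig_continuous phi : any_trig phi -> torus_continuous phi.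
Proof. by move=> [n /trig_poly_continuous]. Qed.

Lemma any_trig_lin (a b : R) phi psi : any_trig phi -> any_trig psi ->
  any_trig (fun x => a * phi x + b * psi x).
Proof.
move=> [n h1] [m h2]; exists (maxn n m).
apply: trig_polyD; apply: trig_polyZ; apply: trig_poly_le; [|exact: h1| |exact: h2].
  exact: leq_maxl.
exact: leq_maxr.
Qed.

Lemma sqr_lin (a b : R) phi psi : torus_L2 phi -> torus_L2 psi ->
  \int[mu]_x (a * phi x + b * psi x) ^+ 2 = a ^+ 2 * \int[mu]_x phi x ^+ 2
    + 2 * a * b * \int[mu]_x (phi x * psi x) + b ^+ 2 * \int[mu]_x psi x ^+ 2.
Proof.
move=> Lf Lk; have [i _] := L2_pairing Lf Lk; have [_ _ i1] := Lf; have [_ _ i2] := Lk.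
rewrite (tint_ext (k := fun x => a ^+ 2 * phi x ^+ 2 + 2 * a * b * (phi x * psi x) + b ^+ 2 * psi x ^+ 2)); last first.
  by move=> x; ring.
by rewrite !RintD ?RintZ//; [exact: integrableRZ..|apply: integrableRD; exact: integrableRZ|exact: integrableRZ].
Qed.

Lemma L2_cvg_pairing (f : nat -> Rd -> R) F phi : (forall n, torus_L2 (f n)) -> torus_L2 F -> torus_L2 phi ->
  \int[mu]_x (f n x - F x) ^+ 2 @[n --> \oo] --> (0 : R) ->
  \int[mu]_x (f n x * phi x) @[n --> \oo] --> \int[mu]_x (F x * phi x).
Proof.
move=> Lf LF Lphi c; apply/cvg_seqP => e e0.
set q := Num.sqrt (\int[mu]_x phi x ^+ 2); have q0 : 0 <= q by exact: sqrtr_ge0.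
have eq0 : 0 < (e / (q + 1)) ^+ 2 by rewrite exprn_gt0// divr_gt0// ltr_wpDl.
have [N hN] := (cvg_seqP _ _).1 c _ eq0; exists N => n nN.
have Ld : torus_L2 (fun x => f n x - F x).
  have := torus_L2_lin 1 (-1) (Lf n) LF; congr torus_L2.
  by apply/funext => x; rewrite mul1r mulN1r.
rewrite -RintB; [|by case: (L2_pairing (Lf n) Lphi)|by case: (L2_pairing LF Lphi)].
rewrite (tint_ext (k := fun x => (f n x - F x) * phi x)); last by move=> x; ring.
have [_ h] := L2_pairing Ld Lphi; apply: le_trans h _; rewrite -/q.
have := hN n nN; rewrite subr0 ger0_norm; last by apply: Rint_ge0 => x; exact: sqr_ge0.
move=> h; apply: (@le_trans _ _ (e / (q + 1) * q)).
  rewrite ler_wpM2r// -[leRHS]ger0_norm ?divr_ge0 ?addr_ge0 ?(ltW e0)// -sqrtr_sqr ler_sqrt ?sqr_ge0//.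
by rewrite mulrAC ler_pdivrMr ?ltr_wpDl// ler_wpM2l ?ltW// ltrDl.
Qed.

(* The representing function is the limit of a sequence maximizing 2 L(phi) - |phi|^2. *)
Lemma riesz_trig (L : (Rd -> R) -> R) (C : R) :
  (forall (a b : R) phi psi, any_trig phi -> any_trig psi ->
     L (fun x => a * phi x + b * psi x) = a * L phi + b * L psi) ->
  (forall phi, any_trig phi -> 2 * L phi - \int[mu]_x phi x ^+ 2 <= C) ->
  exists G (b : nat -> Rd -> R), [/\ torus_L2 G, forall n, any_trig (b n),
    \int[mu]_x (b n x - G x) ^+ 2 @[n --> \oo] --> (0 : R) &
    forall psi, any_trig psi -> L psi = \int[mu]_x (G x * psi x)].
Proof.
move=> Llin LC; pose J phi : R := 2 * L phi - \int[mu]_x phi x ^+ 2.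
have L2t phi : any_trig phi -> torus_L2 phi.
  by move=> /any_trig_continuous; exact: torus_continuous_L2.
have t0 : any_trig (fun=> 0) by exists 0%N; exact: trig_poly_cst.
pose A := [set J phi | phi in any_trig].
have hs : has_sup A.
  split; first by exists (J (fun=> 0)), (fun=> 0).
  by exists C => _ [phi tphi <-]; exact: LC.
have Jsup phi : any_trig phi -> J phi <= sup A.
  by move=> tphi; apply: sup_upper_bound => //; exists phi.
have ex n : exists phi, any_trig phi /\ sup A - n.+1%:R^-1 <= J phi.
  have n0 : 0 < n.+1%:R^-1 :> R by rewrite invr_gt0.
  by have [_ [phi tphi <-] /ltW h] := sup_adherent n0 hs; exists phi.
have [p hp] := choice ex.
have tp n := (hp n).1; have Jp n := (hp n).2.
have cau n m : \int[mu]_x (p n x - p m x) ^+ 2 <= 2 * n.+1%:R^-1 + 2 * m.+1%:R^-1.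
  have := Jsup _ (any_trig_lin 2^-1 2^-1 (tp n) (tp m)); have := Jp n; have := Jp m.
  rewrite /J Llin// sqr_lin; [|exact: L2t..].
  have -> : \int[mu]_x (p n x - p m x) ^+ 2 = \int[mu]_x (1 * p n x + (-1) * p m x) ^+ 2.
    by apply: tint_ext => x; rewrite mul1r mulN1r.
  rewrite sqr_lin; [|exact: L2t..].
  move: (n.+1%:R^-1) (m.+1%:R^-1) (\int[mu]_x _) (\int[mu]_x _) (\int[mu]_x _) (L (p n)) (L (p m)) (sup A) => a b P Q S u v w; lra.
have [||s [G [hss LG _ _ cG]]] := @L2_complete R d p.
- by move=> n; exact: L2t.
- move=> e e0; have e4 : 0 < e / 4 by rewrite divr_gt0.
  exists (Num.truncn (e / 4)^-1) => n m nN mN; apply: le_trans (cau n m) _.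
  have inv k : (Num.truncn (e / 4)^-1 <= k)%N -> k.+1%:R^-1 <= e / 4.
    move=> hk; rewrite -[leRHS]invrK lef_pV2 ?posrE ?invr_gt0//.
    by apply/ltW/(lt_le_trans (truncnS_gt _)); rewrite ler_nat.
  by have := inv n nN; have := inv m mN; move: (n.+1%:R^-1) (m.+1%:R^-1) => a b; lra.
exists G, (fun n => p (s n)); split => //.
move=> psi tpsi; have Lpsi := L2t _ tpsi.
have key (t : R) : 2 * t * (L psi - \int[mu]_x (G x * psi x)) <= t ^+ 2 * \int[mu]_x psi x ^+ 2.
  have c1 := L2_cvg_pairing (fun n => L2t _ (tp (s n))) LG Lpsi cG.
  have c2 : (s n).+1%:R^-1 @[n --> \oo] --> (0 : R).
    exact: (cvg_subsequence hss (@cvg_harmonic R)).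
  set Q := \int[mu]_x psi x ^+ 2; set a := \int[mu]_x (G x * psi x).
  have lhs : 2 * t * (L psi - \int[mu]_x (p (s n) x * psi x)) @[n --> \oo] --> 2 * t * (L psi - a).
    by apply: cvgM; [exact: cvg_cst|apply: cvgB; [exact: cvg_cst|exact: c1]].
  have rhs : (s n).+1%:R^-1 + t ^+ 2 * Q @[n --> \oo] --> 0 + t ^+ 2 * Q.
    by apply: cvgD; [exact: c2|exact: cvg_cst].
  rewrite -[leRHS]add0r; apply: cvg_seq_le2 lhs rhs _ => n.
  have := Jsup _ (any_trig_lin 1 t (tp (s n)) tpsi); have := Jp (s n).
  rewrite /J Llin// sqr_lin//; last exact: L2t.
  rewrite -/Q; move: (L psi) (L (p (s n))) (\int[mu]_x _) (\int[mu]_x _) (_^-1) => u v P S w; lra.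
have Q0 : 0 <= \int[mu]_x psi x ^+ 2 by apply: Rint_ge0 => x; exact: sqr_ge0.
move: key Q0; set Q := \int[mu]_x psi x ^+ 2; set a := \int[mu]_x (G x * psi x) => key Q0.
apply/eqP; rewrite -subr_eq0; apply/eqP; move: (L psi - a) key => z key.
have Q1 : 0 < Q + 1 by rewrite ltr_wpDl.
have := key (z / (Q + 1)).
rewrite -subr_ge0 (_ : _ - _ = - (z / (Q + 1)) ^+ 2 * (Q + 2)); last by field; rewrite gt_eqF.
rewrite mulNr oppr_ge0 pmulr_lle0 ?ltr_wpDl// => h.
have /eqP : (z / (Q + 1)) ^+ 2 = 0 by apply/eqP; rewrite eq_le h sqr_ge0.
by rewrite sqrf_eq0 mulf_eq0 invr_eq0 (gt_eqF Q1) orbF => /eqP.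
Qed.

(** Besides the weak limit G, the conclusion provides continuous functions [b] tending to G in L^2:
    they are the test functions used for lower semicontinuity in the Hamilton-Jacobi inequality. *)
Lemma weak_compactness (g : nat -> Rd -> R) (C : R) : (forall n, torus_continuous (g n)) ->
  (forall n, \int[mu]_x g n x ^+ 2 <= C) ->
  exists s G (b : nat -> Rd -> R), [/\ subsequence s, torus_L2 G, forall n, torus_continuous (b n),
    \int[mu]_x (b n x - G x) ^+ 2 @[n --> \oo] --> (0 : R) &
    forall phi, torus_continuous phi ->
      \int[mu]_x (g (s n) x * phi x) @[n --> \oo] --> \int[mu]_x (G x * phi x)].
Proof.
move=> tg gC; have [s hs hw] := weak_extraction tg gC.
pose L phi : R := limn (fun n => \int[mu]_x (g (s n) x * phi x)).
have hL phi : any_trig phi -> \int[mu]_x (g (s n) x * phi x) @[n --> \oo] --> L phi.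
  by move=> [N /hw[l c]]; rewrite /L (cvg_lim _ c).
have Igp n phi : torus_continuous phi -> integrableR mu (fun x => g (s n) x * phi x).
  by move=> tphi; apply: tcI; exact: torus_continuousM.
have [||G [b [LG tb cb hG]]] := @riesz_trig L C.
- move=> a c phi psi tphi tpsi.
  have t1 := any_trig_continuous tphi; have t2 := any_trig_continuous tpsi.
  apply: cvg_seq_unique (hL _ (any_trig_lin a c tphi tpsi)) _.
  have -> : (fun n => \int[mu]_x (g (s n) x * (a * phi x + c * psi x))) =
      fun n => a * \int[mu]_x (g (s n) x * phi x) + c * \int[mu]_x (g (s n) x * psi x).
    apply/funext => n; rewrite -!RintZ -?RintD; [|by [exact: Igp|apply: integrableRZ; exact: Igp]..].
    by apply: tint_ext => x; ring.
  by apply: cvgD; apply: cvgM; try exact: cvg_cst; exact: hL.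
- move=> phi tphi; have t1 := any_trig_continuous tphi.
  have c1 : 2 * \int[mu]_x (g (s n) x * phi x) - \int[mu]_x phi x ^+ 2 @[n --> \oo] -->
      2 * L phi - \int[mu]_x phi x ^+ 2.
    by apply: cvgB; [apply: cvgM; [exact: cvg_cst|exact: hL]|exact: cvg_cst].
  apply: cvg_seq_le c1 _ => n; apply: le_trans (gC (s n)).
  have i1 := tcI (torus_continuousX 2 (tg (s n))); have i2 := tcI (torus_continuousX 2 t1).
  rewrite -RintZ; last exact: Igp.
  rewrite -RintB//; last by apply: integrableRZ; exact: Igp.
  apply: Rint_le => //; first by apply: integrableRB => //; apply: integrableRZ; exact: Igp.
  by move=> x; have := sqr_ge0 (g (s n) x - phi x); rewrite sqrrB; lra.
exists s, G, b; split => //; first by move=> n; exact: any_trig_continuous.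
move=> phi tphi; apply/cvg_seqP => e e0.
have C0 : 0 <= C by apply: le_trans (gC 0%N); apply: Rint_ge0 => x; exact: sqr_ge0.
pose q : R := Num.sqrt C + Num.sqrt (\int[mu]_x G x ^+ 2).
have q0 : 0 <= q by rewrite addr_ge0// sqrtr_ge0.
have eq : 0 < e / (2 * (q + 1)) by rewrite divr_gt0// mulr_gt0// ltr_wpDl.
have [M /(_ M (leqnn M)) hM] := tconv_uniform tphi eq.
have tM : any_trig (tconv M phi) by exists (d * M)%N; exact: tconv_trig (tcI tphi).
have tM' := any_trig_continuous tM.
have td := torus_continuousB tphi tM'; have Ld := torus_continuous_L2 td.
have small : Num.sqrt (\int[mu]_x (phi x - tconv M phi x) ^+ 2) <= e / (2 * (q + 1)).
  rewrite -[leRHS]ger0_norm ?(ltW eq)// -sqrtr_sqr ler_sqrt ?sqr_ge0//.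
  rewrite -[leRHS](Rint_cst (R := R) (d := d)); apply: Rint_le => [||x].
  - exact: tcI (torus_continuousX 2 td).
  - exact: tcI (torus_continuous_cst _).
  - by rewrite -[leLHS]real_normK ?num_real// ler_pXn2r ?nnegrE ?(ltW eq)// distrC.
have e2 : 0 < e / 2 by rewrite divr_gt0.
have [N hN] := (cvg_seqP _ _).1 (hL _ tM) _ e2; exists N => n nN.
have := hN n nN; rewrite hG// => h1.
have [IG hG1] := L2_pairing LG Ld.
have [Ig hg1] := L2_pairing (torus_continuous_L2 (tg (s n))) Ld.
have E1 : \int[mu]_x (g (s n) x * phi x) = \int[mu]_x (g (s n) x * tconv M phi x) +
    \int[mu]_x (g (s n) x * (phi x - tconv M phi x)).
  by rewrite -RintD//; [apply: tint_ext => x; ring|exact: Igp].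
have [IG2 _] := L2_pairing LG (torus_continuous_L2 tM').
have E2 : \int[mu]_x (G x * phi x) = \int[mu]_x (G x * tconv M phi x) +
    \int[mu]_x (G x * (phi x - tconv M phi x)).
  by rewrite -RintD//; apply: tint_ext => x; ring.
have b1 : `|\int[mu]_x (g (s n) x * (phi x - tconv M phi x))| <= Num.sqrt C * (e / (2 * (q + 1))).
  by apply: le_trans hg1 _; rewrite ler_pM ?sqrtr_ge0// ler_sqrt.
have b2 : `|\int[mu]_x (G x * (phi x - tconv M phi x))| <= Num.sqrt (\int[mu]_x G x ^+ 2) * (e / (2 * (q + 1))).
  by apply: le_trans hG1 _; rewrite ler_wpM2l ?sqrtr_ge0.
have b3 : Num.sqrt C * (e / (2 * (q + 1))) + Num.sqrt (\int[mu]_x G x ^+ 2) * (e / (2 * (q + 1))) <= e / 2.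
  rewrite -mulrDl -/q.
  rewrite mulrA ler_pdivrMr ?mulr_gt0 ?ltr_wpDl// (_ : e / 2 * _ = (q + 1) * e); last by field.
  by rewrite ler_wpM2r ?(ltW e0)// lerDl.
rewrite E1 E2; move: b1 b2 b3 h1.
move: (\int[mu]_x _) (\int[mu]_x _) (\int[mu]_x _) (\int[mu]_x _) (_ * _) (_ * _) => A B X Y z w.
by rewrite !ler_norml => /andP[? ?] /andP[? ?] ? /andP[? ?]; apply/andP; split; lra.
Qed.

(* Testing the weak convergence on the terms of the strongly convergent sequence itself avoids
   a density argument. *)
Lemma strong_weak (f g : nat -> Rd -> R) F G (C : R) : (forall n, torus_continuous (f n)) ->
  (forall n, torus_continuous (g n)) -> torus_L2 F -> torus_L2 G ->
  (forall n, \int[mu]_x f n x ^+ 2 <= C) ->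
  (forall phi, torus_continuous phi ->
      \int[mu]_x (f n x * phi x) @[n --> \oo] --> \int[mu]_x (F x * phi x)) ->
  \int[mu]_x (g n x - G x) ^+ 2 @[n --> \oo] --> (0 : R) ->
  \int[mu]_x (f n x * g n x) @[n --> \oo] --> \int[mu]_x (F x * G x).
Proof.
move=> tf tg LF LG fC cf cg; apply/cvg_seqP => e e0.
have C0 : 0 <= C by apply: le_trans (fC 0%N); apply: Rint_ge0 => x; exact: sqr_ge0.
pose q : R := 2 * Num.sqrt C + Num.sqrt (\int[mu]_x F x ^+ 2).
have q0 : 0 <= q by rewrite addr_ge0 ?mulr_ge0 ?sqrtr_ge0.
pose r : R := e / (2 * (q + 1)).
have r0 : 0 < r by rewrite divr_gt0// mulr_gt0// ltr_wpDl.
have r2 : 0 < r ^+ 2 by rewrite exprn_gt0.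
have Lg n : torus_L2 (fun x => g n x - G x).
  have := torus_L2_lin 1 (-1) (torus_continuous_L2 (tg n)) LG; congr torus_L2.
  by apply/funext => x; rewrite mul1r mulN1r.
have [N1 hN1] := (cvg_seqP _ _).1 cg _ r2.
have dist n : (N1 <= n)%N -> Num.sqrt (\int[mu]_x (g n x - G x) ^+ 2) <= r.
  move=> /hN1; rewrite subr0 ger0_norm; last by apply: Rint_ge0 => x; exact: sqr_ge0.
  by move=> h; rewrite -[leRHS]ger0_norm ?(ltW r0)// -sqrtr_sqr ler_sqrt ?sqr_ge0.
have e2 : 0 < e / 2 by rewrite divr_gt0.
have [N2 hN2] := (cvg_seqP _ _).1 (cf _ (tg N1)) _ e2.
exists (maxn N1 N2) => n; rewrite geq_max => /andP[n1 n2].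
have [I1 h1] := L2_pairing (torus_continuous_L2 (tf n)) (Lg n).
have [I2 h2] := L2_pairing (torus_continuous_L2 (tf n)) (Lg N1).
have [I3 h3] := L2_pairing LF (Lg N1).
have h4 := hN2 n n2.
have [I5 _] := L2_pairing (torus_continuous_L2 (tf n)) (torus_continuous_L2 (tg N1)).
have [I6 _] := L2_pairing LF (torus_continuous_L2 (tg N1)).
have E1 : \int[mu]_x (f n x * g n x) = \int[mu]_x (f n x * (g n x - G x)) -
    \int[mu]_x (f n x * (g N1 x - G x)) + \int[mu]_x (f n x * g N1 x).
  rewrite -RintB// -RintD//; last exact: integrableRB.
  by apply: tint_ext => x; ring.
have E2 : \int[mu]_x (F x * G x) = \int[mu]_x (F x * g N1 x) - \int[mu]_x (F x * (g N1 x - G x)).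
  by rewrite -RintB//; apply: tint_ext => x; ring.
have sC : Num.sqrt (\int[mu]_x f n x ^+ 2) <= Num.sqrt C by rewrite ler_sqrt.
have b1 : `|\int[mu]_x (f n x * (g n x - G x))| <= Num.sqrt C * r.
  by apply: le_trans h1 _; rewrite ler_pM ?sqrtr_ge0// dist.
have b2 : `|\int[mu]_x (f n x * (g N1 x - G x))| <= Num.sqrt C * r.
  by apply: le_trans h2 _; rewrite ler_pM ?sqrtr_ge0// dist.
have b3 : `|\int[mu]_x (F x * (g N1 x - G x))| <= Num.sqrt (\int[mu]_x F x ^+ 2) * r.
  by apply: le_trans h3 _; rewrite ler_wpM2l ?sqrtr_ge0// dist.
have b4 : q * r <= e / 2.
  rewrite mulrA ler_pdivrMr ?mulr_gt0 ?ltr_wpDl// (_ : e / 2 * _ = (q + 1) * e); last by field.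
  by rewrite ler_wpM2r ?(ltW e0)// lerDl.
rewrite E1 E2; move: b1 b2 b3 b4 h4; rewrite {1}/q mulrDl -mulrA.
move: (\int[mu]_x _) (\int[mu]_x _) (\int[mu]_x _) (\int[mu]_x _) (\int[mu]_x _) (Num.sqrt C * r) (_ * r) => A B X Y Z z w.
by rewrite !ler_norml => /andP[? ?] /andP[? ?] /andP[? ?] ? /andP[? ?]; apply/andP; split; lra.
Qed.

End compactness.

(** * Monotone inequalities in finite dimension *)

Section minty.
Import finmap.
Context {R : realType}.

Lemma continuous_sumR (U : topologicalType) (I : Type) (r : seq I) (F : I -> U -> R) :
  (forall i, continuous (F i)) -> continuous (fun x => \sum_(i <- r) F i x).
Proof.
move=> cF; elim: r => [|i r ih].
  by under eq_fun do rewrite big_nil; exact: cst_continuous.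
under eq_fun do rewrite big_cons.
by move=> x; exact: (continuousD (cF i x) (ih x)).
Qed.

Lemma closed_forall (U : topologicalType) (I : Type) (P : I -> set U) :
  (forall i, closed (P i)) -> closed [set x | forall i, P i x].
Proof.
move=> cP; rewrite (_ : [set x | _] = \bigcap_(i in setT) P i); first exact: closed_bigI.
by apply/seteqP; split => x /= h i; [move=> _; exact: h|exact: h].
Qed.

Lemma continuous_linear_form D (b : 'I_D -> R) :
  continuous (fun x : 'rV[R]_D => \sum_k x 0 k * b k).
Proof.
apply: continuous_sumR => k x.
exact: (@continuousM R _ (fun x : 'rV[R]_D => x 0 k) (fun=> b k) x (@coord_continuous _ _ _ _ _ _) (@cst_continuous _ _ _ _)).
Qed.

(* Minimize the squared norm of the negative part of S l over the simplex; from a minimizer l with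
   negative part q <> 0, moving towards q / sum q decreases it. *)
Lemma skew_game m (S : 'I_m.+1 -> 'I_m.+1 -> R) : (forall i j, 0 <= S i j + S j i) ->
  exists l : 'I_m.+1 -> R, [/\ forall j, 0 <= l j, \sum_j l j = 1 &
    forall i, 0 <= \sum_j l j * S i j].
Proof.
move=> hS; pose val (l : 'I_m.+1 -> R) i := \sum_j l j * S i j.
pose neg (t : R) := Num.max 0 (- t).
pose f (l : 'I_m.+1 -> R) := \sum_i neg (val l i) ^+ 2.
pose D := [set x : 'rV[R]_m.+1 | (forall j, 0 <= x 0 j) /\ \sum_j x 0 j = 1].
have cX j : continuous (fun x : 'rV[R]_m.+1 => x 0 j) by exact: coord_continuous.
have neg0 t : 0 <= neg t by rewrite /neg le_max lexx.
have cf : continuous (fun x : 'rV[R]_m.+1 => f (fun j => x 0 j)).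
  apply: continuous_sumR => i x.
  have cv : {for x, continuous (fun x : 'rV[R]_m.+1 => val (fun j => x 0 j) i)}.
    exact: continuous_linear_form.
  have cn : {for x, continuous (fun x : 'rV[R]_m.+1 => neg (val (fun j => x 0 j) i))}.
    by apply: continuous_max; [exact: cst_continuous|exact: continuousN cv].
  exact: (continuousM cn cn).
have cD : compact D.
  apply: bounded_closed_compact.
    exists 1; split; first exact: num_real.
    move=> M M1 x [x0 xs] /=; apply: (@le_trans _ _ 1); last exact: ltW.
    apply/rV_norm_leP => // j; rewrite ger0_norm// -xs (bigD1 j)//= lerDl.
    by apply: sumr_ge0.
  apply: closedI.
    apply: closed_forall => j.
    exact: (closed_comp (fun x _ => cX j x) (@closed_ge R 0)).
  apply: (@closed_comp _ _ (fun x : 'rV[R]_m.+1 => \sum_j x 0 j) [set t | t = 1]); last exact: closed_eq.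
  by move=> x _; exact: continuous_sumR.
have D0 : D !=set0.
  exists (\row_j (j == ord0)%:R); split; first by move=> j; rewrite mxE ler0n.
  rewrite (bigD1 ord0)//= mxE eqxx big1 ?addr0// => j jn; by rewrite mxE (negPf jn).
have [x] := @compact_EVT_min _ R _ D D0 cD (continuous_subspaceT cf).
rewrite in_setE => -[x0 xs] xmin; pose l j := x 0 j.
exists l; split => // i0; rewrite leNgt; apply/negP => vi0.
pose q i := neg (val l i); pose Q := \sum_i q i.
have q0 i : 0 <= q i by exact: neg0.
have qi0 : 0 < q i0 by rewrite /q /neg lt_max oppr_gt0 vi0 orbT.
have Q0 : 0 < Q by rewrite /Q (bigD1 i0)//= ltr_pwDl// sumr_ge0.
pose mu i := q i / Q.
have mu0 i : 0 <= mu i by rewrite divr_ge0// ltW.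
have mus : \sum_i mu i = 1 by rewrite -mulr_suml divff// gt_eqF.
have fl : f l = \sum_i q i ^+ 2 by [].
pose K := \sum_i val mu i ^+ 2.
have K0 : 0 <= K by apply: sumr_ge0 => i _; exact: sqr_ge0.
have f0 : 0 < f l by rewrite fl (bigD1 i0)//= ltr_pwDl ?exprn_gt0// sumr_ge0// => i _; exact: sqr_ge0.
have cross : 0 <= \sum_i q i * val mu i.
  have E : 2 * (\sum_i q i * val mu i) = Q^-1 * \sum_i \sum_j q i * q j * (S i j + S j i).
    have E1 : \sum_i q i * val mu i = Q^-1 * \sum_i \sum_j q i * q j * S i j.
      rewrite mulr_sumr; apply: eq_bigr => i _; rewrite /val !mulr_sumr; apply: eq_bigr => j _.
      by rewrite /mu; ring.
    have E2 : \sum_i \sum_j q i * q j * S j i = \sum_i \sum_j q i * q j * S i j.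
      by rewrite exchange_big; apply: eq_bigr => i _; apply: eq_bigr => j _; ring.
    have E3 : \sum_i \sum_j q i * q j * (S i j + S j i) =
        \sum_i \sum_j q i * q j * S i j + \sum_i \sum_j q i * q j * S j i.
      by rewrite -big_split; apply: eq_bigr => i _; rewrite -big_split; apply: eq_bigr => j _; rewrite mulrDr.
    by rewrite E3 E2 E1; ring.
  rewrite -(pmulr_rge0 _ (ltr0Sn R 1)) E mulr_ge0 ?invr_ge0 ?(ltW Q0)//.
  by apply: sumr_ge0 => i _; apply: sumr_ge0 => j _; rewrite !mulr_ge0.
(* The minimizer of (1 - t)^2 f + t^2 K, an upper bound for the new value since the cross term only
   decreases it. *)
pose t := f l / (f l + K).
have fK : 0 < f l + K by rewrite ltr_pwDl.
have t0 : 0 < t by rewrite divr_gt0.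
have t1 : t <= 1 by rewrite ler_pdivrMr// mul1r lerDl.
pose l' j := (1 - t) * l j + t * mu j.
have Dl' : D (\row_j l' j).
  split; first by move=> j; rewrite mxE addr_ge0// mulr_ge0// ?subr_ge0// ltW.
  under eq_bigr do rewrite mxE.
  by rewrite big_split/= -!mulr_sumr mus [X in (1 - t) * X]xs; ring.
have := xmin (\row_j l' j); rewrite in_setE => /(_ Dl').
have -> : (fun j => (\row_j l' j) 0 j) = l' by apply/funext => j; rewrite mxE.
rewrite -/(f l) leNgt => /negP; apply.
have val' i : val l' i = (1 - t) * val l i + t * val mu i.
  by rewrite /val !mulr_sumr -big_split; apply: eq_bigr => j _; rewrite /l' /=; ring.
have negle i : neg (val l' i) ^+ 2 <= ((1 - t) * q i - t * val mu i) ^+ 2.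
  have a0 : - val l i <= q i by rewrite /q /neg le_max lexx orbT.
  have b0 : - val l' i <= (1 - t) * q i - t * val mu i.
    by rewrite val' opprD lerD2r -mulrN ler_wpM2l// subr_ge0.
  rewrite /neg; case: (leP (- val l' i) 0) => h; first by rewrite expr0n sqr_ge0.
  by rewrite ler_pXn2r ?nnegrE ?(ltW h)// (le_trans (ltW h)).
apply: (@le_lt_trans _ _ (\sum_i ((1 - t) * q i - t * val mu i) ^+ 2)); first exact: ler_sum.
have -> : \sum_i ((1 - t) * q i - t * val mu i) ^+ 2 =
    (1 - t) ^+ 2 * f l - 2 * t * (1 - t) * (\sum_i q i * val mu i) + t ^+ 2 * K.
  by rewrite fl /K !mulr_sumr -sumrB -big_split; apply: eq_bigr => i _ /=; ring.
have c1 : 0 <= 2 * t * (1 - t) * (\sum_i q i * val mu i).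
  apply: mulr_ge0 cross; apply: mulr_ge0; last by rewrite subr_ge0.
  by rewrite mulr_ge0// ltW.
have tE : t * (f l + K) = f l by rewrite /t divfK// gt_eqF.
have fin (a b c s : R) : s * (a + b) = a -> 0 <= c -> 0 < s -> 0 < a ->
    (1 - s) ^+ 2 * a - c + s ^+ 2 * b < a.
  move=> sE c0 s0 a0.
  have -> : (1 - s) ^+ 2 * a - c + s ^+ 2 * b = a - c + s * (s * (a + b)) - 2 * s * a by ring.
  by rewrite sE; nra.
exact: fin tE c1 t0 f0.
Qed.

(* The finite intersection property reduces the inequality to finitely many w, where it is the
   existence of a good mixed strategy for an almost skew-symmetric matrix. *)
Lemma minty_finite_dim D (C : set 'rV[R]_D) (T : 'rV[R]_D -> 'rV[R]_D -> R) :
  compact C -> C !=set0 ->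
  (forall m (l : 'I_m -> R) (w : 'I_m -> 'rV[R]_D), (forall j, 0 <= l j) -> \sum_j l j = 1 ->
     (forall j, C (w j)) -> C (\sum_j l j *: w j)) ->
  (forall w, exists (a : R) (b : 'I_D -> R), forall z, T w z = a - \sum_k z 0 k * b k) ->
  (forall w z, C w -> C z -> 0 <= T w z + T z w) ->
  exists2 z, C z & forall w, C w -> 0 <= T w z.
Proof.
move=> cC [c0 Cc0] convC affT monT.
have cT w : continuous (T w).
  have [a [b h]] := affT w.
  have -> : T w = fun z => a - \sum_k z 0 k * b k by apply/funext.
  have ca : continuous (fun _ : 'rV[R]_D => a) by exact: cst_continuous.
  by move=> z; apply: continuousB; [exact: ca|exact: continuous_linear_form].
have := cC; rewrite compact_In0 => /(_ _ C (fun w => C `&` [set z | 0 <= T w z])) [].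
- exists (fun w => [set z | 0 <= T w z]) => // w _.
  exact: (closed_comp (fun x _ => cT w x) (@closed_ge R 0)).
- move=> D' sD'; pose r : seq 'rV[R]_D := finmap.enum_fset D'.
  have inr v : v \in D' -> v \in r by [].
  case E : (size r) => [|m].
    exists c0 => v /= vD'; have : (index v r < size r)%N by rewrite index_mem inr.
    by rewrite E.
  pose w (i : 'I_m.+1) := nth c0 r i.
  have Cw i : C (w i) by have := sD' (w i); rewrite !in_setE; apply; rewrite -[_ \in _]/(w i \in r) mem_nth// E.
  have [l [l0 ls hl]] := skew_game (S := fun i j => T (w i) (w j)) (fun i j => monT _ _ (Cw i) (Cw j)).
  exists (\sum_j l j *: w j) => v /= vD'; split; first exact: convC.
  have vi : (index v r < m.+1)%N by rewrite -E index_mem inr.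
  have wv : w (Ordinal vi) = v by apply: nth_index; exact: inr.
  have := hl (Ordinal vi); rewrite wv.
  have [a [b h]] := affT v.
  suff -> : \sum_j l j * T v (w j) = T v (\sum_j l j *: w j) by [].
  rewrite h; transitivity (\sum_j (l j * a - l j * \sum_k w j 0 k * b k)).
    by apply: eq_bigr => j _; rewrite h mulrBr.
  rewrite sumrB -mulr_suml ls mul1r; congr (_ - _).
  transitivity (\sum_j \sum_k l j * (w j 0 k * b k)).
    by apply: eq_bigr => j _; rewrite mulr_sumr.
  rewrite exchange_big; apply: eq_bigr => k _.
  by rewrite summxE mulr_suml; apply: eq_bigr => j _; rewrite mxE mulrA.
- move=> z hz; exists z; first by have [] := hz _ Cc0.
  by move=> w Cw; have [] := hz _ Cw.
Qed.

End minty.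

(** * Integrals of functions known up to a null set *)

Section integral_ae.
Context {dT} {T : measurableType dT} {R : realType} (P : {measure set T -> \bar R}).
Local Open Scope ereal_scope.
Import HBNNSimple.

Lemma ge0_integral_mono (f k : T -> \bar R) : (forall x, 0 <= f x) -> (forall x, f x <= k x) ->
  \int[P]_x f x <= \int[P]_x k x.
Proof.
move=> f0 fk; have k0 x : 0 <= k x by exact: le_trans (fk x).
rewrite !ge0_integralTE//; apply: le_ereal_sup => _ [h hf <-].
by exists h => // x; exact: le_trans (fk x).
Qed.

(** The integral of a nonnegative function is a supremum over the simple functions below it. A
    simple function below f is almost everywhere below k, which is measurable; conversely k, set to
    0 on the exceptional null set, lies below f everywhere and has the same integral as k. *)
Lemma ge0_integral_ae (f k : T -> \bar R) : (forall x, 0 <= f x) -> (forall x, 0 <= k x) ->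
  measurable_fun setT k -> {ae P, forall x, f x = k x} -> \int[P]_x f x = \int[P]_x k x.
Proof.
move=> f0 k0 mk fk; apply/eqP; rewrite eq_le; apply/andP; split.
  rewrite ge0_integralTE//; apply: ge_ereal_sup => _ [h hf <-].
  have -> : sintegral P h = \int[P]_x (h x)%:E by rewrite integral_nnsfun// patch_setT.
  apply: ae_ge0_le_integral => //.
  - by move=> x _; rewrite lee_fin.
  - by apply/measurable_EFinP.
  - by apply: filterS fk => x <- _.
have [N [mN N0 sN]] := fk.
pose kN x := if x \in N then 0 else k x.
have mkN : measurable_fun setT kN.
  apply: measurable_fun_ifT => //.
  by apply: (measurable_fun_bool true); rewrite setTI (_ : _ @^-1` _ = N)//; apply/seteqP; split => x /=; [move=> /set_mem|move=> /mem_set].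
have -> : \int[P]_x k x = \int[P]_x kN x.
  apply: ae_eq_integral => //; exists N; split => // x /= h.
  by apply: contrapT => nN; apply: h => _; rewrite /kN memNset.
apply: ge0_integral_mono => x; rewrite /kN.
  by case: ifP.
case: ifPn => // /negP xN; rewrite le_eqVlt; apply/orP; left; apply/eqP.
by apply: contrapT => h; apply: xN; rewrite in_setE; apply: sN => /= e; exact: h.
Qed.

(* The lower integral of the library ignores null sets, so f need not be Borel measurable. *)
Lemma integral_ae (f k : T -> \bar R) : measurable_fun setT k ->
  {ae P, forall x, f x = k x} -> \int[P]_x f x = \int[P]_x k x.
Proof.
move=> mk fk; rewrite integralE [RHS]integralE; congr (_ - _); apply: ge0_integral_ae => //.
- exact: measurable_funepos.
- by apply: filterS fk => x e; rewrite !funeposE e.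
- exact: measurable_funeneg.
- by apply: filterS fk => x e; rewrite !funenegE e.
Qed.

End integral_ae.

(** * The nonlinear terms *)

Record mfg_setting {R : realType} {d : nat} (E : set R) (h : ('rV[R]_d -> R) -> 'rV[R]_d -> R)
    (g g1 g2 V : 'rV[R]_d -> R -> R -> R) (alpha kappa1 : R) : Prop := MfgSetting {
  mfg_E : E = [set e | 0 < e] \/ E = [set e | 0 <= e];
  mfg_h : is_operator h;
  mfg_g : param_continuous E g;
  mfg_V : param_smooth E V;
  mfg_reg : h_regularity h;
  mfg_lip : h_lipschitz h;
  mfg_gs : g_structure E h g g1 g2;
  mfg_V1 : V1 E h g V;
  mfg_V2 : V2 E h g1 V alpha kappa1;
  mfg_V3 : V3 E V alpha kappa1 }.

Section setting.
Context {R : realType} {d : nat} (E : set R) (h : ('rV[R]_d -> R) -> 'rV[R]_d -> R)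
  (g g1 g2 V : 'rV[R]_d -> R -> R -> R) (alpha kappa1 : R).
Local Notation Rd := 'rV[R]_d.
Local Notation mu := (torus_measure R d).
Local Notation periodic := Defs.periodic.
Implicit Types f phi eta v m : Rd -> R.
Hypothesis S : mfg_setting E h g g1 g2 V alpha kappa1.

Lemma E_ge0 e : E e -> 0 <= e.
Proof. by case: (mfg_E S) => -> //= /ltW. Qed.

Lemma E_gt0 e : 0 < e -> E e.
Proof. by case: (mfg_E S) => -> //= /ltW. Qed.

Lemma E_up x y : E x -> x <= y -> E y.
Proof. by case: (mfg_E S) => -> /= h1 h2; [exact: lt_le_trans h2|exact: le_trans h2]. Qed.

(** Values lie in E at every point and not just almost everywhere: nothing is known of [V] outside
    E, so the composition is controlled, in particular measurable, for such representatives. *)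
Definition dens m := torus_L1 m /\ forall x, E (m x).

Lemma dens_Mac m : dens m -> Mac_in E m.
Proof.
move=> [Lm Em]; split; last exact: aeW.
by split => //; apply: aeW => x; exact: E_ge0.
Qed.

Lemma dens_continuous m : torus_continuous m -> (forall x, E (m x)) -> dens m.
Proof. by move=> tm Em; split => //; split; [exact: tm.1|exact: tcI]. Qed.

Lemma dens_h m : dens m -> torus_continuous (h m).
Proof. by move=> /dens_Mac[Mm _]; have [+ _] := mfg_h S; apply. Qed.

Lemma V_within : {within domain E, continuous (uncurry3 V)}.
Proof.
have [_ sV] := mfg_V S.
apply/subspace_continuousP => p Ep.
have [k sk Vk] := sV p Ep; have [ck _] := sk [::].
rewrite /from_subspace (nbhs_singleton Vk Ep).
have c : k q @[q --> within (domain E) (nbhs p)] --> k p.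
  by apply: cvg_trans (ck p); apply: cvg_app; exact: cvg_within.
apply: cvg_trans c; apply: near_eq_cvg; rewrite /prop_near1 /within /=.
by apply: filterS Vk => q h1 h2; rewrite h1.
Qed.

Lemma nem_periodic F m : torus_param E F -> dens m -> periodic (nem h F m).
Proof.
move=> pF dm x i; have [[pm _] Em] := dm; have [ph _] := dens_h dm.
by rewrite /nem pm ph pF.
Qed.

Lemma nem_measurable F m : {within domain E, continuous (uncurry3 F)} -> dens m ->
  measurable_fun setT (nem h F m).
Proof.
move=> cF dm; have [[_ /integrableR_measurable mm] Em] := dm.
apply: (measurable_nemytskii E_up cF Em mm).
exact: torus_continuous_measurable (dens_h dm).
Qed.

Lemma nem_g1_lower m x : dens m -> kappa1^-1 * m x `^ alpha - kappa1 <= nem h g1 m x.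
Proof. by move=> [_ Em]; have [_ _ + _] := mfg_V2 S; apply. Qed.

(** V is at least c1 g - 1/c2, and g = g1 + g2 is at least - kappa1 because of the lower bound on g1
    in (V2) and g2 >= 0. The latter holds almost everywhere, hence so does the conclusion. *)
Lemma nem_V_lower : exists2 C : R, 0 <= C & forall m, dens m ->
  {ae mu, forall x, - C <= nem h V m x}.
Proof.
have [c1 [c2 [_ [c10 c20 _ [hV _ _]]]]] := mfg_V1 S.
have [_ k0 _ _] := mfg_V2 S.
exists (c1 * kappa1 + c2^-1); first by rewrite addr_ge0// ?mulr_ge0 ?invr_ge0 ?ltW.
move=> m dm; have [_ [gE /(_ m (dens_Mac dm)) g20] _ _ _] := mfg_gs S.
have [_ Em] := dm; apply: filterS g20 => x g2x.
have g1x := nem_g1_lower x dm.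
apply: le_trans (hV x _ (h m x) (Em x)); rewrite gE//.
have p0 : 0 <= kappa1^-1 * m x `^ alpha by rewrite mulr_ge0 ?powR_ge0// invr_ge0 ltW.
move: g1x g2x; rewrite /nem; move: (g1 _ _ _) (g2 _ _ _) (_ * _ `^ _) (c2^-1) p0 => a b p q p0 g1x g2x.
have : c1 * (- kappa1) <= c1 * (a + b) by apply: ler_wpM2l; [exact: ltW|lra].
lra.
Qed.

Lemma param_torus_continuous F m : torus_param E F -> {within domain E, continuous (uncurry3 F)} ->
  torus_continuous m -> (forall x, E (m x)) -> torus_continuous (nem h F m).
Proof.
move=> pF cF tm Em; have dm := dens_continuous tm Em; split; first exact: nem_periodic.
have [_ ch] := dens_h dm; apply/continuous_epsP => x e e0.
have [del del0 hd] := within_domain_eps x (h m x) cF (Em x) e0.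
have /continuous_epsP/(_ x _ del0)[d1 d10 h1] := tm.2.
have /continuous_epsP/(_ x _ del0)[d2 d20 h2] := ch.
exists (Num.min del (Num.min d1 d2)); first by rewrite !lt_min del0 d10.
by move=> y; rewrite !lt_min => /and3P[y0 /h1 y1 /h2 y2]; exact: hd.
Qed.

Lemma nem_V_continuous m : torus_continuous m -> (forall x, E (m x)) -> torus_continuous (nem h V m).
Proof. by move=> tm Em; apply: param_torus_continuous => //; [case: (mfg_V S)|exact: V_within]. Qed.

Lemma h_lip_real : exists2 C : R, 0 < C & forall m m', dens m -> dens m' ->
  \int[mu]_x `|h m x - h m' x| <= C * \int[mu]_x `|m x - m' x|.
Proof.
have [C C0 hC] := mfg_lip S; exists C => // m m' dm dm'.
have := hC _ _ (dens_Mac dm).1 (dens_Mac dm').1.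
have i1 : integrableR mu (fun x => `|h m x - h m' x|).
  by apply: integrableR_abs; apply: integrableRB; apply: tcI; exact: dens_h.
have i2 : integrableR mu (fun x => `|m x - m' x|).
  by apply: integrableR_abs; apply: integrableRB; [case: dm => -[]|case: dm' => -[]].
by rewrite !Rint_EFin// -EFinM lee_fin.
Qed.

Lemma Rint_lin (a b : R) (f k : Rd -> R) : integrableR mu f -> integrableR mu k ->
  \int[mu]_x (a * f x + b * k x) = a * \int[mu]_x f x + b * \int[mu]_x k x.
Proof. by move=> If Ik; rewrite RintD ?RintZ//; exact: integrableRZ. Qed.

Lemma le_Rint_ae (f k : Rd -> R) : integrableR mu f -> integrableR mu k ->
  {ae mu, forall x, f x <= k x} -> \int[mu]_x f x <= \int[mu]_x k x.
Proof.
move=> If Ik fk; rewrite -subr_ge0 -RintB//.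
have mkf : measurable_fun setT (fun x => k x - f x) by exact: integrableR_measurable (integrableRB Ik If).
have -> : \int[mu]_x (k x - f x) = \int[mu]_x Num.max 0 (k x - f x).
  congr fine; apply: ae_eq_integral => //.
  - exact/measurable_EFinP.
  - by apply/measurable_EFinP/measurable_maxr => //; exact: measurable_cst.
  - by apply: filterS fk => x fkx _; rewrite max_r// subr_ge0.
by apply: Rint_ge0 => x; rewrite le_max lexx.
Qed.

Lemma integrableR_ge0 (f : Rd -> R) (b : R) : measurable_fun setT f -> (forall x, 0 <= f x) ->
  (\int[mu]_x (f x)%:E <= b%:E)%E -> integrableR mu f.
Proof.
move=> mf f0 fb; apply/integrableP; split; first exact/measurable_EFinP.
under eq_integral do rewrite /= ger0_norm//.
by apply: le_lt_trans fb _; rewrite ltry.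
Qed.

(* g1 is replaced by the integrable function k1 = g - k2, with k2 >= 0 a Borel version of g2. *)
Lemma g_splitting m : torus_continuous m -> (forall x, E (m x)) ->
  exists k1 k2 : Rd -> R, [/\ integrableR mu k1, integrableR mu k2, forall x, 0 <= k2 x,
    forall x, nem h g m x = k1 x + k2 x &
    torus_ae_eq (nem h g1 m) k1 /\ torus_ae_eq (nem h g2 m) k2].
Proof.
move=> tm Em; have dm := dens_continuous tm Em.
have [[_ _ gm] [gE g20] [c c0 hc] _ _] := mfg_gs S.
have [_ [f mf gf]] := gm m (dens_Mac dm).
pose k2 (x : Rd) := Num.max 0 (f x).
have k20 x : 0 <= k2 x by rewrite le_max lexx.
have mk2 : measurable_fun setT k2 by apply: measurable_maxr => //; exact: measurable_cst.
have e2 : torus_ae_eq (nem h g2 m) k2.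
  by apply: filterS2 gf (g20 _ (dens_Mac dm)) => x -> f0; rewrite /k2 max_r.
have tg : torus_continuous (nem h g m).
  by have [pg cg] := mfg_g S; exact: param_torus_continuous.
have I2 : integrableR mu k2.
  have := hc m (dens_Mac dm).
  rewrite (@integral_ae _ _ _ _ _ (EFin \o k2)); [|exact/measurable_EFinP|by apply: filterS e2 => x ->].
  rewrite (Rint_EFin (tcI tm)) -EFinD -EFinM => hb; exact: integrableR_ge0 hb.
exists (fun x => nem h g m x - k2 x), k2; split => //.
- by apply: integrableRB => //; exact: tcI.
- by move=> x; rewrite subrK.
- split => //; apply: filterS e2 => x <-.
  by rewrite /nem gE// addrK.
Qed.

Lemma powR_integrable m (a : R) : 0 <= a -> torus_continuous m -> (forall x, 0 <= m x) ->
  integrableR mu (fun x => m x `^ a).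
Proof.
move=> a0 tm m0; have [M mM] := torus_continuous_bounded tm.
apply: (@bounded_integrable R _ Rd mu (fun x => m x `^ a) (M `^ a)).
  exact: measurableT_comp (measurable_powR _) (torus_continuous_measurable tm).
move=> x; rewrite ger0_norm ?powR_ge0// ge0_ler_powR ?nnegrE//.
  exact: le_trans (normr_ge0 _) (mM x).
by apply: le_trans (mM x); exact: ler_norm.
Qed.

(** Here G and Y are the integrals of m g1 and m g2, P and Q those of g1 and g2, M is the mass, A
    and B are the integrals of m V and V, and q is 1/c2. [L] is the total coefficient of the
    quantity W = del G + D that bounds both M and P; the choice del L = c1 / 2 lets half of c1 G
    absorb it. *)
Lemma energy_arith (c c1 c2 c3 c' q G Y M P Q A B D del L : R) :
  0 < c1 -> 0 < c2 -> 0 < c3 -> 0 < c' -> 0 < q -> L = q + 2 * c3 * (1 + c') -> del * L = c1 / 2 ->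
  0 <= c <= 2 -> 0 <= Y -> 0 <= M -> M <= del * G + D -> P <= del * G + D -> Q <= c' * (1 + M) ->
  c1 * (G + Y) - q * M <= A -> B <= c2 + c3 * (P + Q) ->
  c1 / 2 * G - (L * D + 2 * c2 + 2 * c3 * c') <= A - c * B.
Proof.
move=> c10 c20 c30 c'0 q0 LE dL /andP[cg0 cl2] Y0 M0; set W := del * G + D => MW PW QM hA hB.
have W0 : 0 <= W by exact: le_trans MW.
have h1 : Q <= c' * (1 + W) by apply: le_trans QM _; rewrite ler_wpM2l ?(ltW c'0)// lerD2l.
pose X := c2 + c3 * (W + c' * (1 + W)).
have X0 : 0 <= X.
  have W1 : 0 <= 1 + W by exact: addr_ge0.
  have p1 := mulr_ge0 (ltW c'0) W1; have p2 := mulr_ge0 (ltW c30) (addr_ge0 W0 p1).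
  exact: addr_ge0 (ltW c20) p2.
have BX : B <= X by apply: le_trans hB _; rewrite lerD2l ler_wpM2l ?(ltW c30)// lerD.
have cB : c * B <= 2 * X.
  by apply: (@le_trans _ _ (c * X)); [exact: ler_wpM2l|exact: ler_wpM2r].
have qM : q * M <= q * W by rewrite ler_wpM2l// ltW.
have cY : 0 <= c1 * Y by rewrite mulr_ge0// ltW.
have E1 : L * W = c1 / 2 * G + L * D by rewrite /W mulrDr mulrA (mulrC L) dL.
have E2 : q * W + 2 * X = L * W + 2 * c2 + 2 * c3 * c' by rewrite LE /X; ring.
move: hA; rewrite mulrDr => hA.
have -> : c1 / 2 * G - (L * D + 2 * c2 + 2 * c3 * c') = c1 * G - (q * W + 2 * X).
  by rewrite E2 E1; field.
move: (c * B) (2 * X) (c1 * G) (q * W) (q * M) (c1 * Y) cB qM cY hA => *; lra.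
Qed.

(* A priori bounds are read off these inequalities with c = 1, 1/2 and 2. *)
Lemma V_energy : exists a K : R, [/\ 0 < a, 0 < K & forall m, torus_continuous m -> (forall x, E (m x)) ->
  exists G : R, [/\ 0 <= G, \int[mu]_x m x <= K * (G + 1),
    \int[mu]_x m x `^ (alpha + 1) <= K * (G + 1) &
    forall c : R, 0 <= c <= 2 -> a * G - K <= \int[mu]_x (nem h V m x * (m x - c))]].
Proof.
have [c1 [c2 [c3 [c10 c20 c30 [hV1 hV2 _]]]]] := mfg_V1 S.
have [a0 k0 hk _] := mfg_V2 S.
have [[_ _ gm] [gE g20] [c' c'0 hc] hd [r r0 hr]] := mfg_gs S.
pose L : R := c2^-1 + 2 * c3 * (1 + c').
have L0 : 0 < L by rewrite addr_gt0 ?invr_gt0// !mulr_gt0// addr_gt0.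
pose del : R := c1 / (2 * L).
have del0 : 0 < del by rewrite divr_gt0// mulr_gt0.
have [D D0 hD] := hd del del0.
pose T1 : R := del + D; pose T2 : R := kappa1 + kappa1 ^+ 2 * T1.
pose T3 : R := L * D + 2 * c2 + 2 * c3 * c' + c1 / 2 * r.
have T10 : 0 < T1 by exact: addr_gt0.
have T20 : 0 < T2 by rewrite addr_gt0// mulr_gt0// exprn_gt0.
have T30 : 0 <= T3.
  have p1 := mulr_gt0 L0 D0; have p2 := mulr_gt0 c30 c'0.
  have p3 := mulr_ge0 (ltW c10) r0; rewrite /T3 -mulrA; move: p1 p2 p3.
  rewrite (_ : c1 / 2 * r = c1 * r / 2); last by field.
  by move: (L * D) (c3 * c') (c1 * r) => *; lra.
pose K : R := T1 + T2 + T3.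
have K0 : 0 < K by rewrite /K ltr_pwDl// addr_gt0.
exists (c1 / 2), K; split => //; first by rewrite divr_gt0.
move=> m tm Em; have dm := dens_continuous tm Em.
have m0 x : 0 <= m x by exact: E_ge0.
have [k1 [k2 [I1 I2 k20 gE' [e1 e2]]]] := g_splitting tm Em.
have Im := tcI tm.
have Imk f : integrableR mu f -> integrableR mu (fun x => m x * f x) by exact: tcMI.
have mk f : integrableR mu f -> measurable_fun setT (EFin \o f).
  by move=> /integrableR_measurable mf; exact/measurable_EFinP.
pose G := \int[mu]_x (m x * k1 x); pose M := \int[mu]_x m x.
have r1 : (\int[mu]_x (nem h g1 m x)%:E = (\int[mu]_x k1 x)%:E)%E.
  rewrite (@integral_ae _ _ _ _ _ (EFin \o k1)) ?Rint_EFin//; first exact: mk.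
  by apply: filterS e1 => x ->.
have r2 : (\int[mu]_x (nem h g2 m x)%:E = (\int[mu]_x k2 x)%:E)%E.
  rewrite (@integral_ae _ _ _ _ _ (EFin \o k2)) ?Rint_EFin//; first exact: mk.
  by apply: filterS e2 => x ->.
have r3 : (\int[mu]_x (m x * nem h g1 m x)%:E = G%:E)%E.
  rewrite (@integral_ae _ _ _ _ _ (EFin \o (fun x => m x * k1 x))) ?Rint_EFin//; [exact: Imk|exact: mk (Imk _ I1)|].
  by apply: filterS e1 => x ->.
have M0 : 0 <= M by apply: Rint_ge0.
have b2 : \int[mu]_x k2 x <= c' * (1 + M).
  by have := hc m (dens_Mac dm); rewrite r2 Rint_EFin// -EFinD -EFinM lee_fin.
have [b3 b4] : \int[mu]_x k1 x <= del * G + D /\ M <= del * G + D.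
  have := hD m (dens_Mac dm); rewrite r1 r3 Rint_EFin// -EFinM -EFinD ge_max !lee_fin.
  by move=> /andP.
have b5 : - r <= G by have := hr m (dens_Mac dm); rewrite r3 lee_fin.
have G0 : 0 <= G + r by lra.
have G1 : 0 <= G + r + 1 by rewrite addr_ge0.
have T1G : del * G + D <= T1 * (G + r + 1).
  have := mulr_ge0 (ltW D0) G0; have := mulr_ge0 (ltW del0) r0.
  rewrite /T1 (_ : (del + D) * (G + r + 1) = del * G + D + (del * r + del + D * (G + r))); last by ring.
  by move=> ? ?; rewrite lerDl; lra.
have TK (t : R) : t <= K -> t * (G + r + 1) <= K * (G + r + 1) by move=> tK; exact: ler_wpM2r.
(* Part (4) of the structure condition gives G >= - r, so the shifted quantity is nonnegative; the
   price c1 r / 2 is included in [T3]. *)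
exists (G + r); split => //.
- apply: (le_trans b4); apply: (le_trans T1G); apply: TK; rewrite /K; lra.
- have Ia : integrableR mu (fun x => kappa1 * (m x * k1 x) + kappa1 ^+ 2 * m x).
    by apply: integrableRD; apply: integrableRZ => //; exact: Imk.
  have Ima : integrableR mu (fun x => m x `^ (alpha + 1)) by apply: powR_integrable => //; exact: ltW (addr_gt0 a0 ltr01).
  have h1 : \int[mu]_x m x `^ (alpha + 1) <= kappa1 * G + kappa1 ^+ 2 * M.
    rewrite /G /M -(Rint_lin kappa1 (kappa1 ^+ 2) (Imk _ I1) Im).
    apply: le_Rint_ae; [exact: Ima|exact: Ia|].
    apply: filterS e1 => x e1x.
    have := nem_g1_lower x dm; rewrite e1x => hx.
    have := ler_wpM2l (m0 x) hx => /(ler_wpM2l (ltW k0)).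
    rewrite powRD; last by rewrite gt_eqF//; exact: addr_gt0 a0 ltr01.
    rewrite powRr1// !mulrBr.
    rewrite (_ : kappa1 * (m x * (kappa1^-1 * m x `^ alpha)) = m x `^ alpha * m x); last by field; rewrite gt_eqF.
    move: (m x `^ alpha * m x) => z; nra.
  apply: (le_trans h1); apply: (@le_trans _ _ (T2 * (G + r + 1))); last by apply: TK; rewrite /K; lra.
  have h2 := le_trans b4 T1G; have := ler_wpM2l (sqr_ge0 kappa1) h2; rewrite /T2 => h3.
  rewrite mulrDl -mulrA; apply: lerD => //; rewrite ler_wpM2l ?(ltW k0)//; lra.
move=> c hc02.
have IV := tcI (nem_V_continuous tm Em).
have -> : \int[mu]_x (nem h V m x * (m x - c)) = \int[mu]_x (m x * nem h V m x) - c * \int[mu]_x nem h V m x.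
  rewrite -RintZ// -RintB//; [|exact: Imk|exact: integrableRZ].
  by apply: tint_ext => x; ring.
have Ig : integrableR mu (nem h g m).
  by rewrite (_ : nem h g m = fun x => k1 x + k2 x); [exact: integrableRD|apply/funext].
have hA : c1 * (G + \int[mu]_x (m x * k2 x)) - c2^-1 * M <= \int[mu]_x (m x * nem h V m x).
  rewrite /G /M -RintD; [|exact: Imk..].
  rewrite -!RintZ -?RintB; [|by [exact: Im|apply: integrableRD; exact: Imk|apply: integrableRZ; [exact: Im]|apply: integrableRZ; apply: integrableRD; exact: Imk]..].
  apply: Rint_le; [|exact: Imk|].
    by apply: integrableRB; apply: integrableRZ => //; apply: integrableRD; exact: Imk.
  move=> x; have := ler_wpM2l (m0 x) (hV1 x _ (h m x) (Em x)).
  rewrite -[g x _ _]/(nem h g m x) gE' -[V x _ _]/(nem h V m x); apply: le_trans.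
  by rewrite le_eqVlt; apply/orP; left; apply/eqP; ring.
have hB : \int[mu]_x nem h V m x <= c2 + c3 * (\int[mu]_x k1 x + \int[mu]_x k2 x).
  have := hV2 m (dens_Mac dm); rewrite !Rint_EFin// -EFinM -EFinD lee_fin -RintD//.
  by rewrite (tint_ext gE').
have := @energy_arith c c1 c2 c3 c' c2^-1 G _ M _ _ _ _ D del L c10 c20 c30 c'0 _ erefl _ hc02 _ M0 b4 b3 b2 hA hB.
rewrite invr_gt0 => /(_ c20) h1.
have dL : del * L = c1 / 2 by rewrite /del; field; rewrite gt_eqF.
have Y0 : 0 <= \int[mu]_x (m x * k2 x) by apply: Rint_ge0 => x; exact: mulr_ge0.
have {}h1 := h1 dL Y0.
apply: le_trans h1; rewrite mulrDr /K /T3.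
by move: (c1 / 2 * G) (c1 / 2 * r) (L * D) (2 * c3 * c') T10 T20 => *; lra.
Qed.

End setting.

Section smooth_lin.
Context {R : realType}.

Lemma smooth_lin (U : normedModType R) (a b : R) (f k : U -> R) : smooth f -> smooth k ->
  smooth (fun x => a * f x + b * k x).
Proof.
move=> sf sk.
have ed (F G : U -> R) x v : derivable F x v -> derivable G x v ->
    is_derive x v (fun y => a * F y + b * G y) (a * 'D_v F x + b * 'D_v G x).
  move=> dF dG; have h1 : is_derive x v F ('D_v F x) by exact/derivableP.
  have h2 : is_derive x v G ('D_v G x) by exact/derivableP.
  exact: is_deriveD.
have E s : iter_derive (fun x => a * f x + b * k x) s = fun x => a * iter_derive f s x + b * iter_derive k s x.
  elim: s => [//|v s IH]; apply/funext => x.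
  rewrite -[LHS]/('D_v (iter_derive (fun x => a * f x + b * k x) s) x) IH.
  have [_ df] := sf s; have [_ dk] := sk s.
  by have [_ ->] := ed _ _ x v (df x v) (dk x v).
move=> s; rewrite E; have [cf df] := sf s; have [ck dk] := sk s; split.
  by move=> x; apply: cvgD; apply: cvgM; [exact: cvg_cst|exact: cf|exact: cvg_cst|exact: ck].
by move=> x v; have [] := ed _ _ x v (df x v) (dk x v).
Qed.

Lemma torus_smooth_lin d (a b : R) (f k : 'rV[R]_d -> R) : torus_smooth f -> torus_smooth k ->
  torus_smooth (fun x => a * f x + b * k x) /\
  forall s, pds s (fun x => a * f x + b * k x) = fun x => a * pds s f x + b * pds s k x.
Proof.
move=> sf sk; split.
  by split; [move=> x i; rewrite sf.1 sk.1|exact: smooth_lin sf.2 sk.2].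
elim=> [//|i s IH]; rewrite -[LHS]/(pd i (pds s (fun x => a * f x + b * k x))) IH.
have [Cf ef] := torus_C1Z a (torus_smooth_C1 (torus_smooth_pds s sf)).
have [Ck ek] := torus_C1Z b (torus_smooth_C1 (torus_smooth_pds s sk)).
by have [_ ->] := torus_C1D Cf Ck; rewrite ef ek.
Qed.

End smooth_lin.

Section powR_C1.
Context {R : realType} {d : nat}.
Local Notation Rd := 'rV[R]_d.
Implicit Types f : Rd -> R.

Lemma torus_continuous_powR f (a : R) : torus_continuous f -> (forall x, 0 < f x) ->
  torus_continuous (fun x => f x `^ a).
Proof.
move=> [pf cf] f0; split; first by move=> x i; rewrite pf.
move=> x; apply: (@continuous_comp _ _ _ f (fun y : R => y `^ a)); first exact: cf.
apply: differentiable_continuous; apply/derivable1_diffP.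
by have [] := is_derive1_powR a (f0 x).
Qed.

Lemma torus_C1_powR f (a : R) : torus_C1 f -> (forall x, 0 < f x) ->
  torus_C1 (fun x => f x `^ a) /\ forall i, pd i (fun x => f x `^ a) = fun x => a * f x `^ (a - 1) * pd i f x.
Proof.
move=> Cf f0.
apply: (torus_C1_comp Cf (phi := fun y : R => y `^ a) (phi' := fun y : R => a * y `^ (a - 1))).
- by move=> x; exact: is_derive1_powR.
- by apply: torus_continuous_powR => //; exact: Cf.1.
- apply: torus_continuousM; first exact: torus_continuous_cst.
  by apply: torus_continuous_powR => //; exact: Cf.1.
Qed.

Lemma torus_C1_ln f : torus_C1 f -> (forall x, 0 < f x) ->
  torus_C1 (fun x => ln (f x)) /\ forall i, pd i (fun x => ln (f x)) = fun x => (f x)^-1 * pd i f x.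
Proof.
move=> Cf f0.
apply: (torus_C1_comp Cf (phi := fun y : R => ln y) (phi' := fun y : R => y^-1)).
- by move=> x; exact: is_derive1_ln.
- split; first by move=> x i /=; rewrite Cf.1.1.
  move=> x; apply: (@continuous_comp _ _ _ f (fun y : R => ln y)); first exact: Cf.1.2.
  exact: continuous_ln.
- split; first by move=> x i /=; rewrite Cf.1.1.
  move=> x; apply: (@continuous_comp _ _ _ f (fun y : R => y^-1)); first exact: Cf.1.2.
  by apply: inv_continuous; rewrite gt_eqF.
Qed.

End powR_C1.

(** * Convergence and regularity of V(x, m, h(m)) *)

Section setting_analysis.
Context {R : realType} {d : nat} (E : set R) (h : ('rV[R]_d -> R) -> 'rV[R]_d -> R)
  (g g1 g2 V : 'rV[R]_d -> R -> R -> R) (alpha kappa1 : R).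
Local Notation Rd := 'rV[R]_d.
Local Notation mu := (torus_measure R d).
Local Notation periodic := Defs.periodic.
Implicit Types f phi eta v m : Rd -> R.
Hypothesis S : mfg_setting E h g g1 g2 V alpha kappa1.
Local Notation dens := (dens E).

Lemma dens_measurable m : dens m -> measurable_fun setT m.
Proof. by move=> [[_ /integrableR_measurable]]. Qed.

Lemma nem_V_measurable m : dens m -> measurable_fun setT (nem h V m).
Proof. by apply: (nem_measurable S); exact: V_within S. Qed.

Lemma nem_V_bound : exists2 C : R, 0 <= C & forall m, dens m ->
  {ae mu, forall x, `|nem h V m x| <= C * (1 + m x `^ alpha + `|h m x|)}.
Proof.
have [C C0 hC] := nem_V_lower S; have [_ k0 _ _] := mfg_V2 S.
exists (C + kappa1); first by rewrite addr_ge0// ltW.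
move=> m dm; apply: filterS (hC m dm) => x lo.
have [_ Em] := dm; have up := mfg_V3 S x (h m x) (Em x).
have p0 := powR_ge0 (m x) alpha; have n0 := normr_ge0 (h m x).
rewrite -[V x _ _]/(nem h V m x) in up; move: lo up.
set t := 1 + _ + _ => lo up.
have t1 : 1 <= t by rewrite /t -addrA lerDl addr_ge0.
have Ct : C <= C * t by rewrite -[X in X <= _]mulr1; exact: ler_wpM2l.
have kt : 0 <= kappa1 * t by rewrite mulr_ge0 ?(ltW k0)// (le_trans ler01).
have Ct0 : 0 <= C * t by exact: le_trans Ct.
by rewrite mulrDl ler_norml; apply/andP; split; move: (nem h V m x) (C * t) (kappa1 * t) lo up Ct kt Ct0 => *; lra.
Qed.

(** The Lipschitz condition yields convergence of h (m_n) in L^1 only, and a further subsequence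
    gives convergence almost everywhere with an integrable bound. The growth condition (V3) and the
    lower bound of [nem_V_lower] then dominate the nonlinear term. *)
Lemma nem_V_cvg (m_ : nat -> Rd -> R) m (H0 : Rd -> R) : (forall n, dens (m_ n)) -> dens m ->
  {ae mu, forall x, m_ n x @[n --> \oo] --> m x} -> integrableR mu H0 ->
  {ae mu, forall x n, m_ n x <= H0 x} -> {ae mu, forall x n, m_ n x `^ alpha <= H0 x} ->
  exists s, subsequence s /\ exists2 H : Rd -> R, integrableR mu H &
    {ae mu, forall x, nem h V (m_ (s n)) x @[n --> \oo] --> nem h V m x} /\
    {ae mu, forall x n, `|nem h V (m_ (s n)) x| <= H x}.
Proof.
move=> dm_ dm cm IH0 mH0 aH0.
have [Ch Ch0 hlip] := h_lip_real S.
have mm := dens_measurable dm.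
have Im (k : Rd -> R) (dk : dens k) : integrableR mu k by case: dk => -[].
have m0 (k : Rd -> R) (dk : dens k) (x : Rd) : 0 <= k x by apply: (E_ge0 S); case: dk.
have cL1 : \int[mu]_x `|m_ n x - m x| @[n --> \oo] --> (0 : R).
  have := @Rintegral_dominated R _ Rd mu (fun n (x : Rd) => `|m_ n x - m x|) (fun=> 0) (fun x => H0 x + m x).
  rewrite Rint_cst; case.
  - by move=> n; apply: integrableR_measurable (integrableR_abs (integrableRB _ _)); exact: Im.
  - exact: measurable_cst.
  - apply: filterS cm => x cx.
    have : m_ n x - m x @[n --> \oo] --> (0 : R) by rewrite -(subrr (m x)); apply: cvgB => //; exact: cvg_cst.
    by move=> /cvg_norm; rewrite normr0.
  - by apply: integrableRD => //; exact: Im.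
  - apply: filterS mH0 => x mx n; rewrite normr_id.
    apply: le_trans (ler_normB _ _) _; rewrite !ger0_norm; [|exact: m0..].
    by rewrite lerD2r.
  - by [].
have ch : \int[mu]_x `|h (m_ n) x - h m x| @[n --> \oo] --> (0 : R).
  apply/cvg_seqP => e e0.
  have /cvg_seqP/(_ (e / Ch))[|N hN] := cL1; first exact: divr_gt0.
  exists N => n /hN; rewrite !subr0 => hn.
  rewrite ger0_norm; last exact: Rint_ge0.
  apply: le_trans (hlip _ _ (dm_ n) dm) _.
  by rewrite mulrC -ler_pdivlMr//; apply: le_trans hn; exact: ler_norm.
have [s [ss [H IH [cH bH]]]] := L1_subsequence (fun n => tcI (dens_h S (dm_ n))) (tcI (dens_h S dm)) ch.
have [C C0 hC] := nem_V_bound.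
exists s; split => //; exists (fun x => C * (1 + H0 x + H x)).
  by apply: integrableRZ; apply: integrableRD => //; apply: integrableRD => //; apply: tcI; exact: torus_continuous_cst.
split.
  apply: filterS2 cm cH => x cx hx.
  apply: (within_domain_cvg (V_within S) _ _ _ _ hx).
  - by case: dm.
  - by move=> n; case: (dm_ (s n)).
  - exact: cvg_cst.
  - exact: cvg_subsequence ss cx.
have hae : {ae mu, forall x n, `|nem h V (m_ (s n)) x| <= C * (1 + m_ (s n) x `^ alpha + `|h (m_ (s n)) x|)}.
  by apply: ae_foralln => n; exact: hC.
apply: filterS3 hae aH0 bH => x h1 h2 h3 n.
apply: le_trans (h1 n) _; apply: ler_wpM2l => //.
by rewrite lerD// lerD2l.
Qed.

(** The Sobolev index d + 3 used from here on: it is in the range of (h-regularity) and exceeds the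
    d + 2 derivatives that [sobolev_C1] requires. *)
Lemma index_large : (d%:R / 2 + 1 < (d + 3)%:R :> R).
Proof.
have d0 : 0 <= d%:R :> R by exact: ler0n.
by rewrite natrD; lra.
Qed.

Lemma smooth_in_dens eta : smooth_in E eta -> dens eta.
Proof. by move=> [se Ee]; apply: dens_continuous => //; exact: torus_smooth_continuous. Qed.

Lemma smooth_in_ge0 eta : smooth_in E eta -> torus_ae_ge0 eta.
Proof. by move=> [_ Ee]; apply: aeW => x; exact: (E_ge0 S). Qed.

Lemma h_C1 eta : smooth_in E eta -> torus_C1 (h eta).
Proof.
move=> se; have [hs _] := mfg_reg S index_large.
apply: (@sobolev_C1 _ _ (d + 3)); [apply: (dens_h S); exact: smooth_in_dens| |by rewrite leq_add2l].
by apply: hs; [apply: smooth_sobolev; case: se|exact: smooth_in_ge0].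
Qed.

Lemma nem_V_C1 eta : torus_smooth eta -> (forall x, 0 < eta x) -> torus_C1 (nem h V eta).
Proof.
move=> se e0; have sE : smooth_in E eta by split => // x; exact: (E_gt0 S).
apply: (@torus_C1_nemytskii _ _ E) => //; [exact: E_gt0 S|exact: mfg_V S|exact: torus_smooth_C1|exact: h_C1].
Qed.

Lemma h_uniform eta (eta_ : nat -> Rd -> R) : smooth_in E eta -> (forall n, smooth_in E (eta_ n)) ->
  (forall s (e : R), 0 < e -> exists N, forall n, (N <= n)%N -> forall x, `|pds s (eta_ n) x - pds s eta x| <= e) ->
  forall e : R, 0 < e -> exists N, forall n, (N <= n)%N -> forall x, `|h (eta_ n) x - h eta x| <= e.
Proof.
move=> se se_ cu; have [hs hf] := mfg_reg S index_large.
apply: (@frechet_uniform _ _ (d + 3)%N _ h _ _ _ hf).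
- by rewrite leq_addr.
- by move=> f [].
- by move=> f [sf f0]; exact: hs.
- by move=> f [sf f0]; have [+ _] := mfg_h S; apply; split => //; apply: torus_L2_L1; case: sf.
- by split; [apply: smooth_sobolev; case: se|exact: smooth_in_ge0].
- by move=> n; split; [apply: smooth_sobolev; case: (se_ n)|exact: smooth_in_ge0].
have E1 n : (fun x => eta_ n x - eta x) = fun x => 1 * eta_ n x + (-1) * eta x.
  by apply/funext => x; rewrite mul1r mulN1r.
have lin n := torus_smooth_lin 1 (-1) (se_ n).1 se.1.
apply: sobolev_norm_cvg0 => [n|s e e0]; first by rewrite E1; exact: (lin n).1.
have [N hN] := cu s e e0; exists N => n /hN hn x.
by rewrite E1 (lin n).2 mul1r mulN1r.
Qed.

Lemma V_monotone eta eta' : smooth_in E eta -> smooth_in E eta' ->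
  0 <= \int[mu]_x ((nem h V eta x - nem h V eta' x) * (eta x - eta' x)).
Proof.
move=> se se'; have [_ [_ [_ [_ _ _ [_ _ /(_ _ _ se se')]]]]] := mfg_V1 S.
have cV k : smooth_in E k -> torus_continuous (nem h V k).
  by move=> [sk Ek]; apply: (nem_V_continuous S) => //; exact: torus_smooth_continuous.
rewrite Rint_EFin ?lee_fin//; apply: tcI; apply: torus_continuousM; apply: torus_continuousB; try exact: cV.
  by apply: torus_smooth_continuous; case: se.
by apply: torus_smooth_continuous; case: se'.
Qed.

Lemma V_coercive eta : torus_smooth eta -> (forall x, 0 < eta x) ->
  kappa1^-1 * \int[mu]_x (eta x `^ (alpha - 1) * \sum_i pd i eta x ^+ 2) - kappa1 <=
  \sum_i \int[mu]_x (pd i (nem h V eta) x * pd i eta x).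
Proof.
move=> se e0; have [_ _ _ /(_ eta)] := mfg_V2 S.
have sE : smooth_in E eta by split => // x; exact: (E_gt0 S).
have C1e := torus_smooth_C1 se; have C1V := nem_V_C1 se e0.
have cp : torus_continuous (fun x => \sum_i pd i eta x ^+ 2).
  by apply: torus_continuous_sum => i; apply: torus_continuousX; case: (C1e.2 i).
have cw : torus_continuous (fun x => eta x `^ (alpha - 1)).
  by apply: torus_continuous_powR => //; exact: C1e.1.
rewrite Rint_EFin; last by apply: tcI; exact: torus_continuousM.
have cf i : torus_continuous (fun x => pd i (nem h V eta) x * pd i eta x).
  by apply: torus_continuousM; [case: (C1V.2 i)|case: (C1e.2 i)].
rewrite Rint_EFin; last by apply: tcI; exact: torus_continuous_sum.
rewrite -EFinM -EFinB lee_fin Rint_sum; last by move=> i; exact: tcI.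
exact.
Qed.

End setting_analysis.

(** * Galerkin approximation *)

Definition gdot {R : realType} {d : nat} (f k : 'rV[R]_d -> R) (x : 'rV[R]_d) : R :=
  \sum_i pd i f x * pd i k x.

Lemma gdotC (R : realType) d (f k : 'rV[R]_d -> R) : gdot f k = gdot k f.
Proof. by apply/funext => x; apply: eq_bigr => i _; rewrite mulrC. Qed.

Ltac tc_solve := cbv beta; first
  [ match goal with H : torus_continuous ?f |- torus_continuous ?k => constr_eq f k; exact H end
  | match goal with H : torus_continuous (gdot ?f ?k) |- torus_continuous (gdot ?k' ?f') =>
      constr_eq f f'; constr_eq k k'; rewrite (gdotC k' f'); exact H end
  | match goal with H : torus_C1 ?f |- torus_continuous ?k => constr_eq f k; exact H.1 end
  | match goal with H : torus_smooth ?f |- torus_continuous ?k =>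
      constr_eq f k; exact (torus_smooth_continuous H) end
  | match goal with H : torus_C1 ?f |- torus_continuous (pd ?i ?k) => constr_eq f k; exact (H.2 i).2 end
  | match goal with H : torus_smooth ?f |- torus_continuous (pd ?i ?k) =>
      constr_eq f k; exact (torus_smooth_continuous (torus_smooth_pd i H)) end
  | match goal with H : torus_smooth ?f |- torus_continuous (pd ?i (pd ?j ?k)) =>
      constr_eq f k; exact (torus_smooth_continuous (torus_smooth_pd i (torus_smooth_pd j H))) end
  | lazymatch goal with
    | |- torus_continuous (fun x => _ + _) => refine (torus_continuousD _ _); tc_solve
    | |- torus_continuous (fun x => - _) => refine (torus_continuousN _); tc_solve
    | |- torus_continuous (fun x => _ * _) => refine (torus_continuousM _ _); tc_solve
    | |- torus_continuous (fun x => _ ^+ _) => refine (torus_continuousX _ _); tc_solve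
    | |- torus_continuous (fun x => \sum_(i <- _ | _) _) =>
        refine (@torus_continuous_sum _ _ _ _ _ _ _); intro; tc_solve
    | |- torus_continuous (fun x => ?f x) => change (torus_continuous f); tc_solve
    | |- torus_continuous (fun=> ?a) => exact (@torus_continuous_cst _ _ a)
    end
  | match goal with H : torus_continuous ?f |- torus_continuous _ => exact H end ].

Ltac ti_solve := apply: tcI; tc_solve.

(** * Weak forms of the operator and its monotonicity *)

Section weak_forms.
Context {R : realType} {d : nat}.
Local Notation Rd := 'rV[R]_d.
Local Notation mu := (torus_measure R d).
Local Notation periodic := Defs.periodic.
Implicit Types f k phi eta v m u p q : Rd -> R.

Lemma gdot_continuous f k : torus_C1 f -> torus_C1 k -> torus_continuous (gdot f k).
Proof. by move=> Cf Ck; rewrite /gdot; tc_solve. Qed.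

Lemma laplacian_weak u p : torus_smooth u -> torus_C1 p ->
  \int[mu]_x (laplacian u x * p x) = - \int[mu]_x gdot u p x.
Proof.
move=> su Cp; have Cu := torus_smooth_C1 su.
rewrite (@tint_ext _ _ (fun x => \sum_i pd i (pd i u) x * p x)); last by move=> x; rewrite /laplacian big_distrl.
rewrite Rint_sum; last by move=> i; ti_solve.
rewrite Rint_sum; last by move=> i; ti_solve.
rewrite -sumrN; apply: eq_bigr => i _.
exact (Rintegral_by_parts i (torus_smooth_C1 (torus_smooth_pd i su)) Cp).
Qed.

Lemma divergence_weak m u q : torus_smooth m -> torus_smooth u -> torus_C1 q ->
  \int[mu]_x (\sum_i pd i (fun y => m y * pd i u y) x * q x) = - \int[mu]_x (m x * gdot u q x).
Proof.
move=> sm su Cq; have Cm := torus_smooth_C1 sm.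
have CM i : torus_C1 (fun y => m y * pd i u y).
  by apply: (torus_C1M Cm _).1; exact: torus_smooth_C1 (torus_smooth_pd i su).
rewrite Rint_sum; last first.
  by move=> i; apply: tcI; apply: torus_continuousM; [exact: ((CM i).2 i).2|exact: Cq.1].
rewrite (@tint_ext _ _ (fun x => \sum_i m x * pd i u x * pd i q x)); last first.
  by move=> x; rewrite /gdot big_distrr; apply: eq_bigr => i _; rewrite /= mulrA.
rewrite Rint_sum; last by move=> i; ti_solve.
by rewrite -sumrN; apply: eq_bigr => i _; exact (Rintegral_by_parts i (CM i) Cq).
Qed.

Variables (h : (Rd -> R) -> Rd -> R) (V : Rd -> R -> R -> R) (sigma : R).

Lemma A1_weak m u p : torus_continuous (nem h V m) -> torus_smooth u -> torus_C1 p ->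
  \int[mu]_x (A1 h V sigma m u x * p x) =
  \int[mu]_x (nem h V m x * p x + (- (u x * p x) - gdot u u x * p x / 2 - sigma ^+ 2 * gdot u p x)).
Proof.
move=> cV su Cp; have Cu := torus_smooth_C1 su.
have cuu := gdot_continuous Cu Cu; have cup := gdot_continuous Cu Cp.
have cL : torus_continuous (laplacian u) by rewrite /laplacian; tc_solve.
have -> : \int[mu]_x (A1 h V sigma m u x * p x) =
    \int[mu]_x (nem h V m x * p x + (- (u x * p x) - gdot u u x * p x / 2) + sigma ^+ 2 * (laplacian u x * p x)).
  apply: tint_ext => x; rewrite /A1 (_ : \sum_i pd i u x ^+ 2 = gdot u u x); last by apply: eq_bigr => i _; rewrite expr2.
  by field.
rewrite RintD; [|by ti_solve|by ti_solve].
rewrite RintZ; last by ti_solve.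
rewrite laplacian_weak// mulrN -RintZ; last by ti_solve.
rewrite -RintB; [|by ti_solve|by ti_solve].
by apply: tint_ext => x; ring.
Qed.

Lemma A2_weak m u q : torus_smooth m -> torus_smooth u -> torus_C1 q ->
  \int[mu]_x (A2 sigma m u x * q x) =
  \int[mu]_x (m x * q x + m x * gdot u q x + sigma ^+ 2 * gdot m q x - q x).
Proof.
move=> sm su Cq; have Cu := torus_smooth_C1 su; have Cm := torus_smooth_C1 sm.
have cuq := gdot_continuous Cu Cq; have cmq := gdot_continuous Cm Cq.
have cL : torus_continuous (laplacian m) by rewrite /laplacian; tc_solve.
have cD : torus_continuous (fun x => \sum_i pd i (fun y => m y * pd i u y) x * q x).
  apply: torus_continuous_sum => i; apply: torus_continuousM; last exact: Cq.1.
  have := (torus_C1M Cm (torus_smooth_C1 (torus_smooth_pd i su))).1 => CM; exact: (CM.2 i).2.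
have -> : \int[mu]_x (A2 sigma m u x * q x) = \int[mu]_x (m x * q x - q x -
     \sum_i pd i (fun y => m y * pd i u y) x * q x - sigma ^+ 2 * (laplacian m x * q x)).
  by apply: tint_ext => x; rewrite /A2 -big_distrl /=; ring.
rewrite RintB; [|by ti_solve|by ti_solve].
rewrite RintB; [|by ti_solve|by ti_solve].
rewrite RintZ; last by ti_solve.
rewrite laplacian_weak// divergence_weak// mulrN -RintZ; last by ti_solve.
have negE (a b c : R) : a - - b - - c = a + b + c by ring.
rewrite negE (@tint_ext _ _ (fun x => m x * q x - q x + m x * gdot u q x + sigma ^+ 2 * gdot m q x)
  (fun x => m x * q x + m x * gdot u q x + sigma ^+ 2 * gdot m q x - q x)); last by move=> x; ring.
rewrite [RHS]RintD; [|by ti_solve|by ti_solve].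
by congr (_ + _); rewrite [RHS]RintD; [|by ti_solve|by ti_solve].
Qed.

Lemma gdotBl f k p : torus_C1 f -> torus_C1 k -> gdot (fun x => f x - k x) p = fun x => gdot f p x - gdot k p x.
Proof.
move=> Cf Ck; apply/funext => x; rewrite /gdot -sumrB; apply: eq_bigr => i _.
have [CN eN] := torus_C1Z (-1) Ck; have [_ e] := torus_C1D Cf CN.
have -> : (fun x => f x - k x) = fun x => f x + -1 * k x by apply/funext => y; rewrite mulN1r.
by rewrite e eN; ring.
Qed.

Lemma gdotBr f k p : torus_C1 f -> torus_C1 k -> gdot p (fun x => f x - k x) = fun x => gdot p f x - gdot p k x.
Proof. by move=> Cf Ck; rewrite gdotC gdotBl// gdotC (gdotC k). Qed.

Lemma gdot_ge0 f x : 0 <= gdot f f x.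
Proof. by apply: sumr_ge0 => i _; rewrite -expr2 sqr_ge0. Qed.

Lemma smoothB f k : torus_smooth f -> torus_smooth k -> torus_smooth (fun x => f x - k x).
Proof.
move=> sf sk; have := (torus_smooth_lin 1 (-1) sf sk).1.
by rewrite (_ : (fun x => 1 * f x + -1 * k x) = fun x => f x - k x)//; apply/funext => x; ring.
Qed.

Lemma A_torus_continuous m u : torus_continuous (nem h V m) -> torus_smooth m -> torus_smooth u ->
  torus_continuous (A1 h V sigma m u) /\ torus_continuous (A2 sigma m u).
Proof.
move=> cV sm su; have Cm := torus_smooth_C1 sm; split.
  have cL : torus_continuous (laplacian u) by rewrite /laplacian; tc_solve.
  by rewrite /A1; tc_solve.
have cL : torus_continuous (laplacian m) by rewrite /laplacian; tc_solve.
have cD : torus_continuous (fun x => \sum_i pd i (fun y => m y * pd i u y) x).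
  apply: torus_continuous_sum => i.
  have := (torus_C1M Cm (torus_smooth_C1 (torus_smooth_pd i su))).1 => CM; exact: (CM.2 i).2.
by rewrite /A2; tc_solve.
Qed.

(** The operator A at (m, u), paired with a direction (p, q). It is linear in the direction; for the
    inequality the direction is the difference of two pairs. *)
Definition VI m u p q := \int[mu]_x (A1 h V sigma m u x * p x) + \int[mu]_x (A2 sigma m u x * q x).

Lemma VI_weak m u p q : torus_continuous (nem h V m) -> torus_smooth m -> torus_smooth u ->
  torus_C1 p -> torus_C1 q ->
  VI m u p q = \int[mu]_x (nem h V m x * p x + (- (u x * p x) - gdot u u x * p x / 2 - sigma ^+ 2 * gdot u p x +
     (m x * q x + m x * gdot u q x + sigma ^+ 2 * gdot m q x - q x))).
Proof.
move=> cV sm su Cp Cq; have Cu := torus_smooth_C1 su; have Cm := torus_smooth_C1 sm.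
have cuu := gdot_continuous Cu Cu; have cup := gdot_continuous Cu Cp.
have cuq := gdot_continuous Cu Cq; have cmq := gdot_continuous Cm Cq.
rewrite /VI A1_weak// A2_weak// -RintD; [|by ti_solve|by ti_solve].
by apply: tint_ext => x; ring.
Qed.

(* The sum of the two variational expressions is the integral of
   (V(eta) - V(m)) (eta - m) + (eta + m) |Dv - Du|^2 / 2. *)
Lemma VI_monotone m u eta v : torus_continuous (nem h V m) -> torus_continuous (nem h V eta) ->
  torus_smooth m -> torus_smooth u -> torus_smooth eta -> torus_smooth v ->
  (forall x, 0 <= m x) -> (forall x, 0 <= eta x) ->
  0 <= \int[mu]_x ((nem h V eta x - nem h V m x) * (eta x - m x)) ->
  0 <= VI eta v (fun x => eta x - m x) (fun x => v x - u x) +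
       VI m u (fun x => m x - eta x) (fun x => u x - v x).
Proof.
move=> cm ce sm su se sv m0 e0 V0.
have Cm := torus_smooth_C1 sm; have Cu := torus_smooth_C1 su.
have Ce := torus_smooth_C1 se; have Cv := torus_smooth_C1 sv.
have C1 := torus_smooth_C1 (smoothB se sm); have C2 := torus_smooth_C1 (smoothB sv su).
have C3 := torus_smooth_C1 (smoothB sm se); have C4 := torus_smooth_C1 (smoothB su sv).
rewrite !VI_weak//.
have a1 := gdot_continuous Cu Cu; have a2 := gdot_continuous Cv Cv.
have a3 := gdot_continuous Cu Cv; have a4 := gdot_continuous Cm Cu; have a5 := gdot_continuous Cm Cv.
have a6 := gdot_continuous Ce Cu; have a7 := gdot_continuous Ce Cv.
have cV : torus_continuous (fun x => (nem h V eta x - nem h V m x) * (eta x - m x)) by tc_solve.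
have cG : torus_continuous (fun x => (eta x + m x) / 2 * (gdot v v x - gdot u v x *+ 2 + gdot u u x)).
  by rewrite (_ : (fun x => (eta x + m x) / 2 * (gdot v v x - gdot u v x *+ 2 + gdot u u x)) =
   fun x => (eta x + m x) / 2 * (gdot v v x - 2 * gdot u v x + gdot u u x)); [tc_solve|apply/funext => x; ring].
apply: (@le_trans _ _ (\int[mu]_x ((nem h V eta x - nem h V m x) * (eta x - m x)) +
   \int[mu]_x ((eta x + m x) / 2 * (gdot v v x - gdot u v x *+ 2 + gdot u u x)))).
  apply: addr_ge0 => //; apply: Rint_ge0 => x; apply: mulr_ge0; first by rewrite divr_ge0// addr_ge0.
  have <- : gdot (fun x => v x - u x) (fun x => v x - u x) x = gdot v v x - gdot u v x *+ 2 + gdot u u x.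
    by rewrite gdotBl// !gdotBr// (gdotC v u); ring.
  exact: gdot_ge0.
rewrite -RintD; [|exact: tcI|exact: tcI].
rewrite -RintD; last 2 first.
- by rewrite !gdotBr//; ti_solve.
- by rewrite !gdotBr//; ti_solve.
by rewrite le_eqVlt; apply/orP; left; apply/eqP; apply: tint_ext => x; rewrite !gdotBr// (gdotC v u) (gdotC u m) (gdotC v m) (gdotC u eta) (gdotC v eta) ; field.
Qed.

(** At the test point (c, 0) the two second-order contributions are opposite after one integration
    by parts, as are the products m u. What remains is the kinetic energy with weight (c + m) / 2
    and the mean of u with the factor 1 - c, whose sign is at the disposal of the choice of c. *)
Lemma VI_constant m u (c : R) : torus_continuous (nem h V m) -> torus_smooth m -> torus_smooth u ->
  VI m u (fun x => c - m x) (fun x => 0 - u x) =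
  (1 - c) * \int[mu]_x u x - \int[mu]_x ((c + m x) / 2 * gdot u u x) - \int[mu]_x (nem h V m x * (m x - c)).
Proof.
move=> cV sm su; have Cm := torus_smooth_C1 sm; have Cu := torus_smooth_C1 su.
have [Cc ec] := @torus_C1_cst R d c; have [C0 e0] := @torus_C1_cst R d 0.
have CB f (a : R) : torus_smooth f -> torus_C1 (fun x => a - f x).
  move=> sf; have [Ca _] := @torus_C1_cst R d a; have [CN _] := torus_C1Z (-1) (torus_smooth_C1 sf).
  rewrite (_ : (fun x => a - f x) = fun x => a + -1 * f x); first exact: (torus_C1D Ca CN).1.
  by apply/funext => x; rewrite mulN1r.
have g0 k (a : R) : gdot k (fun=> a) = fun=> 0.
  by apply/funext => x; rewrite /gdot; apply: big1 => i _; rewrite (torus_C1_cst a).2 mulr0.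
have a1 := gdot_continuous Cu Cu; have a2 := gdot_continuous Cu Cm.
rewrite VI_weak; [|exact: cV|exact: sm|exact: su|exact: CB|exact: CB].
rewrite -RintZ; last by ti_solve.
rewrite -!RintB; [|by ti_solve..].
apply: tint_ext => x; rewrite !gdotBr// !g0 (gdotC m u); by field.
Qed.

End weak_forms.

Section galerkin.
Context {R : realType} {d : nat} (E : set R) (h : ('rV[R]_d -> R) -> 'rV[R]_d -> R)
  (g g1 g2 V : 'rV[R]_d -> R -> R -> R) (alpha kappa1 sigma : R).
Local Notation Rd := 'rV[R]_d.
Local Notation mu := (torus_measure R d).
Implicit Types f phi eta v m u p q : Rd -> R.
Hypothesis S : mfg_setting E h g g1 g2 V alpha kappa1.
Local Notation VI := (VI h V sigma).
Local Notation dens := (dens E).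

Lemma gdotDZl f k p (t : R) : torus_C1 f -> torus_C1 k ->
  gdot (fun x => f x + t * k x) p = fun x => gdot f p x + t * gdot k p x.
Proof.
move=> Cf Ck; apply/funext => x; rewrite /gdot big_distrr -big_split; apply: eq_bigr => i _ /=.
have [Ct et] := torus_C1Z t Ck; have [_ e] := torus_C1D Cf Ct.
by rewrite e et; ring.
Qed.

Lemma nem_V_smooth m : torus_smooth m -> (forall x, 0 < m x) -> torus_continuous (nem h V m).
Proof.
move=> sm m0; apply: (nem_V_continuous S); first exact: torus_smooth_continuous.
by move=> x; exact: (E_gt0 S).
Qed.

Lemma smooth_dens m : torus_smooth m -> (forall x, 0 < m x) -> dens m.
Proof.
move=> sm m0; apply: dens_continuous; first exact: torus_smooth_continuous.
by move=> x; exact: (E_gt0 S).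
Qed.

Lemma smoothDZ f k (t : R) : torus_smooth f -> torus_smooth k -> torus_smooth (fun x => f x + t * k x).
Proof.
move=> sf sk; have := (torus_smooth_lin 1 t sf sk).1.
by rewrite (_ : (fun x => 1 * f x + t * k x) = fun x => f x + t * k x)//; apply/funext => x; rewrite mul1r.
Qed.

Lemma VI_ray m u p q (t : R) : torus_smooth m -> torus_smooth u -> torus_smooth p -> torus_smooth q ->
  (forall x, 0 < m x + t * p x) ->
  VI (fun x => m x + t * p x) (fun x => u x + t * q x) p q =
  \int[mu]_x (nem h V (fun x => m x + t * p x) x * p x) +
  (\int[mu]_x (- (u x * p x) - gdot u u x * p x / 2 - sigma ^+ 2 * gdot u p x +
     (m x * q x + m x * gdot u q x + sigma ^+ 2 * gdot m q x - q x)) +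
   (t * \int[mu]_x (m x * gdot q q x) + t ^+ 2 * \int[mu]_x (p x * gdot q q x / 2))).
Proof.
move=> sm su sp sq mt0.
have Cm := torus_smooth_C1 sm; have Cu := torus_smooth_C1 su.
have Cp := torus_smooth_C1 sp; have Cq := torus_smooth_C1 sq.
have smt := smoothDZ t sm sp; have cV := nem_V_smooth smt mt0.
have a1 := gdot_continuous Cu Cu; have a2 := gdot_continuous Cu Cp; have a3 := gdot_continuous Cu Cq.
have a4 := gdot_continuous Cm Cq; have a5 := gdot_continuous Cq Cq; have a6 := gdot_continuous Cp Cq.
rewrite VI_weak; [|exact: cV|exact: smt|exact: smoothDZ|exact: Cp|exact: Cq].
rewrite -!RintZ; [|by ti_solve|by ti_solve].
rewrite -RintD; [|by ti_solve|by ti_solve].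
rewrite -RintD; [|by ti_solve|by ti_solve].
rewrite -RintD; [|by ti_solve|by ti_solve].
apply: tint_ext => x.
have -> : gdot (fun x => u x + t * q x) (fun x => u x + t * q x) x = gdot u u x + 2 * t * gdot u q x + t ^+ 2 * gdot q q x.
  rewrite gdotDZl// (gdotC u) (gdotC q) !gdotDZl// (gdotC q u); ring.
rewrite !gdotDZl// (gdotC q p); by field.
Qed.

(** The last step of Minty's argument. Along the segment all terms except the one with V are
    polynomial in the parameter; that one converges along a subsequence, which is enough for the
    sign of the limit. *)
Lemma hemicontinuity m u p q (del : R) : torus_smooth m -> torus_smooth u ->
  torus_smooth p -> torus_smooth q -> 0 < del -> (forall x, del <= m x) -> (forall x, del <= m x + p x) ->
  (forall k : nat, 0 <= VI (fun x => m x + k.+1%:R^-1 * p x) (fun x => u x + k.+1%:R^-1 * q x) p q) ->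
  0 <= VI m u p q.
Proof.
move=> sm su sp sq del0 md mpd hk.
pose t k : R := k.+1%:R^-1.
have t01 k : 0 < t k <= 1 by rewrite invr_gt0 ltr0Sn /=  invf_le1 ?ltr0Sn// ler1n.
have mt0 k x : del <= m x + t k * p x.
  have /andP[t0 t1] := t01 k; move: (md x) (mpd x) t0 t1 => a b c e.
  have h1 : (1 - t k) * del <= (1 - t k) * m x by rewrite ler_wpM2l// subr_ge0.
  have h2 : t k * del <= t k * (m x + p x) by rewrite ler_wpM2l// ltW.
  move: h1 h2; rewrite !mulrBl !mul1r mulrDr.
  by move: (t k * del) (t k * m x) (t k * p x) => ? ? ?; lra.
have mt0' k x : 0 < m x + t k * p x by exact: lt_le_trans (mt0 k x).
have m0 x : 0 < m x by exact: lt_le_trans (md x).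
have ct : t n @[n --> \oo] --> (0 : R) by exact: cvg_harmonic.
have dm := smooth_dens sm m0.
have dk k := smooth_dens (smoothDZ (t k) sm sp) (mt0' k).
have [Mm hMm] := torus_continuous_bounded (torus_smooth_continuous sm).
have [Mp hMp] := torus_continuous_bounded (torus_smooth_continuous sp).
pose H0 : R := Mm + Mp + (Mm + Mp) `^ alpha.
have [al0 _ _ _] := mfg_V2 S.
have ub k x : m x + t k * p x <= Mm + Mp.
  have /andP[t0 t1] := t01 k.
  apply: lerD; first exact: le_trans (ler_norm _) (hMm x).
  apply: (le_trans (ler_norm _)); rewrite normrM (ger0_norm (ltW t0)).
  apply: le_trans (hMp x); rewrite -[X in _ <= X]mul1r.
  exact: ler_wpM2r.
have MM0 : 0 <= Mm + Mp by exact: le_trans (ltW (mt0' 0%N 0)) (ub 0%N 0).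
have [s [ss [H IH [cV bV]]]] : exists s, subsequence s /\ exists2 H : Rd -> R, integrableR mu H &
    {ae mu, forall x, nem h V (fun x => m x + t (s n) * p x) x @[n --> \oo] --> nem h V m x} /\
    {ae mu, forall x n, `|nem h V (fun x => m x + t (s n) * p x) x| <= H x}.
  apply: (nem_V_cvg S (m_ := fun k x => m x + t k * p x) (H0 := fun=> H0) dk dm).
  - apply: aeW => x.
    have c2 : t n * p x @[n --> \oo] --> 0 * p x by apply: cvgM => //; exact: cvg_cst.
    have c3 : m x + t n * p x @[n --> \oo] --> m x + 0 * p x by apply: cvgD => //; exact: cvg_cst.
    by rewrite mul0r addr0 in c3.
  - exact: tcI (torus_continuous_cst _).
  - by apply: aeW => x n; apply: le_trans (ub n x) _; rewrite lerDl powR_ge0.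
  - apply: aeW => x n; rewrite /H0; apply: (@le_trans _ _ ((Mm + Mp) `^ alpha)); last by rewrite lerDr.
    by apply: ge0_ler_powR; rewrite ?nnegrE//; [exact: ltW|exact: ltW (mt0' _ _)].
have cp := torus_smooth_continuous sp.
have [ _ cI] : integrableR mu (fun x => nem h V m x * p x) /\
    \int[mu]_x (nem h V (fun x => m x + t (s n) * p x) x * p x) @[n --> \oo] --> \int[mu]_x (nem h V m x * p x).
  apply: (@Rintegral_dominated R _ Rd mu _ _ (fun x => Mp * H x)).
  - move=> n; apply: measurable_funM; first exact: (nem_V_measurable S).
    exact: torus_continuous_measurable.
  - apply: measurable_funM; first exact: (nem_V_measurable S).
    exact: torus_continuous_measurable.
  - by apply: filterS cV => x cx; apply: cvgM => //; exact: cvg_cst.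
  - exact: integrableRZ.
  - apply: filterS bV => x bx n; rewrite normrM mulrC; apply: ler_pM => //.
rewrite VI_weak; [|exact: nem_V_smooth|exact: sm|exact: su|exact: torus_smooth_C1|exact: torus_smooth_C1].
have Cm := torus_smooth_C1 sm; have Cu := torus_smooth_C1 su.
have Cp := torus_smooth_C1 sp; have Cq := torus_smooth_C1 sq.
have a1 := gdot_continuous Cu Cu; have a2 := gdot_continuous Cu Cp; have a3 := gdot_continuous Cu Cq.
have a4 := gdot_continuous Cm Cq.
have cVm := nem_V_smooth sm m0.
rewrite RintD; [|by ti_solve|by ti_solve].
set F0 := \int[mu]_x (_ + (_ - q x)) in cI *.
pose F1 := \int[mu]_x (m x * gdot q q x); pose F2 := \int[mu]_x (p x * gdot q q x / 2).
have cts := cvg_subsequence ss ct.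
have c1 : t (s n) * F1 @[n --> \oo] --> 0 * F1 by apply: cvgM => //; exact: cvg_cst.
have c2 : t (s n) ^+ 2 * F2 @[n --> \oo] --> 0 * 0 * F2.
  apply: cvgM; last exact: cvg_cst.
  by rewrite (_ : (fun n => t (s n) ^+ 2) = fun n => t (s n) * t (s n)); [exact: cvgM|apply/funext => n; rewrite expr2].
have c3 : F0 + (t (s n) * F1 + t (s n) ^+ 2 * F2) @[n --> \oo] --> F0 + (0 * F1 + 0 * 0 * F2).
  by apply: cvgD; [exact: cvg_cst|exact: cvgD].
pose v n := \int[mu]_x (nem h V (fun x => m x + t (s n) * p x) x * p x) + (F0 + (t (s n) * F1 + t (s n) ^+ 2 * F2)).
have c4 : v n @[n --> \oo] --> \int[mu]_x (nem h V m x * p x) + (F0 + (0 * F1 + 0 * 0 * F2)) by exact: cvgD.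
rewrite !mul0r !addr0 in c4; apply: (cvg_seq_ge c4) => n.
have := hk (s n); rewrite VI_ray//; exact: mt0'.
Qed.

Definition comb D (F : 'I_D -> Rd -> R) (z : 'rV[R]_D) (x : Rd) : R := \sum_k z 0 k * F k x.

Lemma comb_trig n D (F : 'I_D -> Rd -> R) z : (forall k, trig_poly n (F k)) -> trig_poly n (comb F z).
Proof. by move=> tF; apply: trig_poly_sum => k; exact: trig_polyZ. Qed.

Lemma comb_lin D (F : 'I_D -> Rd -> R) (r : nat) (l : 'I_r -> R) (w : 'I_r -> 'rV[R]_D) x :
  comb F (\sum_j l j *: w j) x = \sum_j l j * comb F (w j) x.
Proof.
rewrite /comb; under [RHS]eq_bigr do rewrite big_distrr.
rewrite exchange_big; apply: eq_bigr => k _ /=.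
by rewrite summxE big_distrl; apply: eq_bigr => j _; rewrite mxE mulrA.
Qed.

Lemma A_continuous m u : torus_smooth m -> (forall x, 0 < m x) -> torus_smooth u ->
  torus_continuous (A1 h V sigma m u) /\ torus_continuous (A2 sigma m u).
Proof.
move=> sm m0 su; exact: A_torus_continuous (nem_V_smooth sm m0) sm su.
Qed.

Lemma comb_pairing D (F : 'I_D -> Rd -> R) f z : torus_continuous f -> (forall k, torus_continuous (F k)) ->
  \int[mu]_x (f x * comb F z x) = \sum_k z 0 k * \int[mu]_x (f x * F k x).
Proof.
move=> cf cF.
rewrite (_ : \int[mu]_x (f x * comb F z x) = \int[mu]_x \sum_k z 0 k * (f x * F k x)); last first.
  by apply: tint_ext => x; rewrite /comb big_distrr; apply: eq_bigr => k _ /=; ring.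
have cfF k : torus_continuous (fun x => f x * F k x) by exact: torus_continuousM.
rewrite Rint_sum; last by move=> k; apply: integrableRZ; exact: tcI.
by apply: eq_bigr => k _; rewrite RintZ//; exact: tcI.
Qed.

Lemma VIZ m u p q (t : R) : torus_smooth m -> (forall x, 0 < m x) -> torus_smooth u ->
  torus_continuous p -> torus_continuous q ->
  VI m u (fun x => t * p x) (fun x => t * q x) = t * VI m u p q.
Proof.
move=> sm m0 su cp cq; have [c1 c2] := A_continuous sm m0 su.
rewrite /VI mulrDr -!RintZ; [|by apply: tcI; apply: torus_continuousM|by apply: tcI; apply: torus_continuousM].
by congr (_ + _); apply: tint_ext => x; ring.
Qed.

(** The coefficients of m and u form a single vector, the box makes the constraint set compact, and
    the lower bound keeps it closed and convex. The finite-dimensional lemma yields the inequality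
    with the operator evaluated at w; convexity allows w to be moved towards z, and dividing by the
    parameter and letting it tend to 0 places the operator at z. *)
Lemma galerkin_ball n N D (Phi Psi : 'I_D -> Rd -> R) (B del : R) (z1 : 'rV[R]_D) :
  (forall k, trig_poly n (Phi k)) -> (forall k, trig_poly N (Psi k)) -> 0 < del ->
  let C := [set z : 'rV[R]_D | (forall k, `|z 0 k| <= B) /\ forall x, del <= comb Phi z x] in
  C z1 -> exists2 z, C z & forall w, C w ->
    0 <= VI (comb Phi z) (comb Psi z) (fun x => comb Phi w x - comb Phi z x) (fun x => comb Psi w x - comb Psi z x).
Proof.
move=> tPhi tPsi del0 C Cz1.
have sP z : torus_smooth (comb Phi z) by exact: trig_poly_smooth (comb_trig z tPhi).
have sQ z : torus_smooth (comb Psi z) by exact: trig_poly_smooth (comb_trig z tPsi).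
have cF k : torus_continuous (Phi k) by exact: trig_poly_continuous (tPhi k).
have cG k : torus_continuous (Psi k) by exact: trig_poly_continuous (tPsi k).
have C0 z x : C z -> 0 < comb Phi z x by move=> [_ h1]; exact: lt_le_trans (h1 x).
have convC (r : nat) (l : 'I_r -> R) (w : 'I_r -> 'rV[R]_D) : (forall j, 0 <= l j) -> \sum_j l j = 1 ->
    (forall j, C (w j)) -> C (\sum_j l j *: w j).
  move=> l0 l1 Cw; split => [k|x].
    rewrite summxE; apply: (le_trans (ler_norm_sum _ _ _)).
    rewrite -[B]mul1r -l1 big_distrl; apply: ler_sum => j _.
    by rewrite mxE normrM ger0_norm//; apply: ler_wpM2l => //; have [+ _] := Cw j; apply.
  rewrite comb_lin -[del]mul1r -l1 big_distrl; apply: ler_sum => j _.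
  by apply: ler_wpM2l => //; have [_] := Cw j; apply.
have cC : compact C.
  have cub : compact [set z : 'rV[R]_D | forall k, `|z 0 k| <= B].
    have := @rV_compact R D (fun=> `[- B, B]%classic) (fun=> @segment_compact R (- B) B).
    congr compact; apply/seteqP; split=> y /= yi i; have := yi i; by rewrite in_itv ler_norml.
  have clo : closed [set z : 'rV[R]_D | forall x, del <= comb Phi z x].
    apply: closed_forall => x.
    apply: (@closed_comp _ _ (fun z : 'rV[R]_D => comb Phi z x) [set y | del <= y]); last exact: closed_ge.
    by move=> z _; exact: continuous_linear_form.
  rewrite (_ : C = [set z : 'rV[R]_D | forall x, del <= comb Phi z x] `&` [set z : 'rV[R]_D | forall k, `|z 0 k| <= B]).
    by rewrite setIC; exact: compact_closedI.
  by apply/seteqP; split => z [] /= ? ?; split.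
(* Outside C the density may leave E and the operator loses its meaning. The value 0 keeps T affine
   in z for every w, whereas monotonicity is claimed on C only. *)
pose T (w z : 'rV[R]_D) : R := if pselect (C w) then
    VI (comb Phi w) (comb Psi w) (fun x => comb Phi w x - comb Phi z x) (fun x => comb Psi w x - comb Psi z x) else 0.
have TE w z : C w -> T w z =
    VI (comb Phi w) (comb Psi w) (fun x => comb Phi w x - comb Phi z x) (fun x => comb Psi w x - comb Psi z x).
  by rewrite /T; case: pselect.
have affT w : exists (a : R) (b : 'I_D -> R), forall z, T w z = a - \sum_k z 0 k * b k.
  case: (pselect (C w)) => Cw; last first.
    exists 0, (fun=> 0) => z; rewrite /T; case: pselect => [/Cw//|nCw] /=.
    by rewrite big1 ?subr0// => k _; rewrite mulr0.
  have [c1 c2] := A_continuous (sP w) (fun x => C0 w x Cw) (sQ w).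
  have cw1 := torus_smooth_continuous (sP w); have cw2 := torus_smooth_continuous (sQ w).
  pose b k := \int[mu]_x (A1 h V sigma (comb Phi w) (comb Psi w) x * Phi k x) +
              \int[mu]_x (A2 sigma (comb Phi w) (comb Psi w) x * Psi k x).
  exists (VI (comb Phi w) (comb Psi w) (comb Phi w) (comb Psi w)), b => z.
  have pair (A : Rd -> R) (F : 'I_D -> Rd -> R) : torus_continuous A -> (forall k, torus_continuous (F k)) ->
      \int[mu]_x (A x * (comb F w x - comb F z x)) =
      \int[mu]_x (A x * comb F w x) - \sum_k z 0 k * \int[mu]_x (A x * F k x).
    move=> cA cFk.
    have cc (y : 'rV[R]_D) : torus_continuous (comb F y).
      by apply: torus_continuous_sum => k; apply: torus_continuousM; [exact: torus_continuous_cst|exact: cFk].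
    have ccw := cc w; have ccz := cc z.
    rewrite -comb_pairing//.
    rewrite -RintB; [|by ti_solve|by ti_solve].
    by apply: tint_ext => x; rewrite mulrBr.
  rewrite TE// /VI pair// pair//.
  have -> : \sum_k z 0 k * b k = \sum_k z 0 k * \int[mu]_x (A1 h V sigma (comb Phi w) (comb Psi w) x * Phi k x) +
     \sum_k z 0 k * \int[mu]_x (A2 sigma (comb Phi w) (comb Psi w) x * Psi k x).
    by rewrite -big_split; apply: eq_bigr => k _; rewrite /b /= mulrDr.
  by move: (\sum_k _) (\sum_k _) (\int[mu]_x _) (\int[mu]_x _) => *; ring.
have monT w z : C w -> C z -> 0 <= T w z + T z w.
  move=> Cw Cz; rewrite !TE//; apply: VI_monotone => //.
  - by apply: nem_V_smooth => // x; exact: C0.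
  - by apply: nem_V_smooth => // x; exact: C0.
  - by move=> x; apply: ltW; exact: C0.
  - by move=> x; apply: ltW; exact: C0.
  - by apply: (V_monotone S); split => // x; apply: (E_gt0 S); exact: C0.
have [z Cz hz] := minty_finite_dim cC (ex_intro _ z1 Cz1) convC affT monT.
exists z => // w Cw.
have sp := smoothB (sP w) (sP z); have sq := smoothB (sQ w) (sQ z).
apply: (hemicontinuity (sP z) (sQ z) sp sq del0).
- by move=> x; have [_] := Cz; apply.
- by move=> x; rewrite addrC subrK; have [_] := Cw; apply.
move=> k; set t : R := k.+1%:R^-1.
have t0 : 0 < t by rewrite invr_gt0 ltr0Sn.
have t1 : t <= 1 by rewrite invf_le1 ?ltr0Sn// ler1n.
pose y : 'rV[R]_D := \sum_(j < 2) (if j == 0 then 1 - t else t) *: (if j == 0 then z else w).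
have Cy : C y.
  apply: convC; last by move=> j; case: ifP.
    by move=> j; case: ifP => _; [rewrite subr_ge0|exact: ltW].
  by rewrite big_ord_recl big_ord1 /= subrK.
have ye F x : comb F y x = comb F z x + t * (comb F w x - comb F z x).
  by rewrite comb_lin big_ord_recl big_ord1 /=; ring.
have := hz y Cy; rewrite TE//.
rewrite (_ : comb Phi y = fun x => comb Phi z x + t * (comb Phi w x - comb Phi z x)); last by apply/funext => x.
rewrite (_ : comb Psi y = fun x => comb Psi z x + t * (comb Psi w x - comb Psi z x)); last by apply/funext => x.
set mt := fun x => comb Phi z x + _; set ut := fun x => comb Psi z x + _.
have smt : torus_smooth mt by exact (smoothDZ t (sP z) sp).
have sut : torus_smooth ut by exact (smoothDZ t (sQ z) sq).
have mt0 x : 0 < mt x by rewrite /mt -ye; exact: C0.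
have cp := torus_smooth_continuous sp; have cq := torus_smooth_continuous sq.
rewrite (_ : VI mt ut _ _ = VI mt ut (fun x => t * (comb Phi w x - comb Phi z x))
  (fun x => t * (comb Psi w x - comb Psi z x))).
  by rewrite VIZ// pmulr_rge0.
by congr (VI _ _ _ _); apply/funext => x; rewrite /mt /ut; ring.
Qed.

End galerkin.

(** * Norms on spaces of trigonometric polynomials *)

Section coefficients.
Context {R : realType} {d : nat}.
Local Notation Rd := 'rV[R]_d.
Local Notation mu := (torus_measure R d).
Implicit Types f phi eta v m u p q : Rd -> R.

(* Coefficients are recovered from the moments of f by a pseudo-inverse of the Gram matrix. *)
Lemma trig_coefficients n : exists D (F : 'I_D -> Rd -> R) (C : R),
  [/\ forall k, trig_poly n (F k), 0 <= C & forall f, trig_poly n f ->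
    exists2 z : 'rV[R]_D, f = comb F z & forall k, `|z 0 k| <= C * \int[mu]_x `|f x|].
Proof.
have [J [phi [tphi hphi]]] := @trig_poly_family R d n.
pose D := #|J|; pose F (k : 'I_D) := phi (enum_val k).
have tF k : trig_poly n (F k) by exact: tphi.
have cF k : torus_continuous (F k) by exact: trig_poly_continuous (tF k).
pose G : 'M[R]_D := \matrix_(i, j) \int[mu]_x (F i x * F j x).
have bF k : exists M : R, forall x, `|F k x| <= M by exact: torus_continuous_bounded.
have [M hM] : exists M : 'I_D -> R, forall k x, `|F k x| <= M k.
  by have [M hM] := choice bF; exists M.
have M0 k : 0 <= M k by exact: le_trans (hM k 0).
pose C : R := \sum_i \sum_j M i * `|pinvmx G i j|.
exists D, F, C; split => //.
  by apply: sumr_ge0 => i _; apply: sumr_ge0 => j _; rewrite mulr_ge0.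
move=> f tf; have cf := trig_poly_continuous tf.
have [c fc] := hphi f tf.
pose z0 : 'rV[R]_D := \row_k c (enum_val k).
have f0 : f = comb F z0.
  apply/funext => x; rewrite fc /comb (reindex_onto enum_val enum_rank) /=; last by move=> j _; rewrite enum_rankK.
  by under eq_bigl do rewrite enum_valK eqxx; apply: eq_bigr => k _; rewrite mxE.
have moment z i : \int[mu]_x (comb F z x * F i x) = (z *m G) 0 i.
  rewrite mxE (@tint_ext _ _ (fun x => F i x * comb F z x)); last by move=> x; rewrite mulrC.
  by rewrite comb_pairing//; apply: eq_bigr => k _; rewrite mxE; congr (_ * _); apply: tint_ext => x; rewrite mulrC.
pose p : 'rV[R]_D := \row_i \int[mu]_x (f x * F i x).
have pE : p = z0 *m G by apply/rowP => i; rewrite mxE f0 moment.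
pose z := p *m pinvmx G.
have zG : z *m G = p by rewrite /z mulmxKpV// pE submxMl.
(* As the family may be linearly dependent, z and z0 may differ. Their difference lies in the kernel
   of the Gram matrix, so the function it represents has norm 0 in L^2 and, being continuous,
   vanishes identically. *)
pose e := z - z0.
have eG : e *m G = 0 by rewrite mulmxBl zG pE subrr.
have ce : torus_continuous (comb F e) by exact: trig_poly_continuous (comb_trig e tF).
have e0 : \int[mu]_x (comb F e x ^+ 2) = 0.
  rewrite (@tint_ext _ _ (fun x => comb F e x * comb F e x)); last by move=> x; rewrite expr2.
  by rewrite comb_pairing//; apply: big1 => k _; rewrite moment eG [X in _ * X]mxE mulr0.
have ez := torus_full_support (torus_continuousX 2 ce) (fun x => sqr_ge0 (comb F e x)) e0.
exists z.
  apply/funext => x; rewrite f0; apply/eqP; rewrite eq_sym -subr_eq0.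
  rewrite (_ : _ - _ = comb F e x); first by rewrite -sqrf_eq0 ez.
  by rewrite /comb -sumrB; apply: eq_bigr => k _; rewrite !mxE mulrBl.
move=> k; rewrite mxE; apply: (le_trans (ler_norm_sum _ _ _)).
have I1 := integrableR_abs (tcI cf).
have I0 : 0 <= \int[mu]_x `|f x| by exact: Rint_ge0.
have pi0 i : `|p 0 i| <= M i * \int[mu]_x `|f x|.
  have cFi := cF i; rewrite mxE; apply: (le_trans (Rint_abs _)); first by ti_solve.
  rewrite -RintZ//; apply: Rint_le; [|exact: integrableRZ|by move=> x; rewrite normrM mulrC ler_wpM2r].
  by apply: integrableR_abs; ti_solve.
rewrite /C big_distrl; apply: ler_sum => i _ /=.
rewrite (bigD1 k)//= mulrDl normrM -[X in X <= _]addr0; apply: lerD.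
  by rewrite mulrAC; apply: ler_wpM2r.
by rewrite mulr_ge0// sumr_ge0// => j _; rewrite mulr_ge0.
Qed.

(** An inverse inequality of Bernstein type, from the equivalence of norms in finite dimension.
    Since the approximate densities have mass 1, it bounds their derivatives by constants known
    before the densities themselves. *)
Lemma trig_inverse_estimate n s : exists2 L : R, 0 <= L & forall f, trig_poly n f ->
  forall x, `|pds s f x| <= L * \int[mu]_x `|f x|.
Proof.
have [D [F [C [tF C0 hF]]]] := trig_coefficients n.
have cF k : torus_continuous (pds s (F k)).
  by apply: torus_smooth_continuous; apply: torus_smooth_pds; exact: trig_poly_smooth (tF k).
have [M hM] : exists M : 'I_D -> R, forall k x, `|pds s (F k) x| <= M k.
  by have [M hM] := choice (fun k => torus_continuous_bounded (cF k)); exists M.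
have M0 k : 0 <= M k by exact: le_trans (hM k 0).
exists (\sum_k C * M k); first by apply: sumr_ge0 => k _; rewrite mulr_ge0.
move=> f tf x; have [z -> hz] := hF f tf.
have pdsE : pds s (comb F z) = comb (fun k => pds s (F k)) z.
  elim: s {cF hM} => [//|i s IH]; rewrite -[LHS]/(pd i (pds s (comb F z))) IH.
  apply: (torus_C1_lincomb (fun k => z 0 k) (F := fun k => pds s (F k)) _).2 => k.
  exact: trig_poly_Cinf (tF k) s.
rewrite pdsE /comb; apply: (le_trans (ler_norm_sum _ _ _)).
rewrite big_distrl; apply: ler_sum => k _ /=; rewrite normrM mulrAC.
by apply: ler_pM.
Qed.

Lemma poincare u : torus_smooth u -> \int[mu]_x u x ^+ 2 <= d%:R * \int[mu]_x gdot u u x + 2 * (\int[mu]_x u x) ^+ 2.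
Proof.
move=> su; have Cu := torus_smooth_C1 su; have cu := Cu.1.
have := tconv_sqr 0 Cu.
have k0 (z : Rd) : kern 0 z = 1 :> R.
  rewrite /kern; have b1 (y : Rd) : bump 0 y = 1 :> R by rewrite /bump big1// => i _; rewrite expr0.
  by rewrite (@tint_ext _ _ (fun=> 1))// Rint_cst b1 divr1.
have tE (x : Rd) : tconv 0 u x = \int[mu]_x u x.
  by rewrite /tconv; apply: tint_ext => y; rewrite k0 mul1r.
rewrite (@tint_ext _ _ (fun x => (\int[mu]_x u x - u x) ^+ 2)); last by move=> x; rewrite tE.
set a := \int[mu]_x u x.
have gE : \int[mu]_x gdot u u x = \sum_i \int[mu]_x pd i u x ^+ 2.
  rewrite /gdot Rint_sum; last by move=> i; ti_solve.
  by apply: eq_bigr => i _; apply: tint_ext => x; rewrite expr2.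
rewrite -gE mulr1 => hP.
apply: (@le_trans _ _ (2 * \int[mu]_x (a - u x) ^+ 2 + 2 * a ^+ 2)).
  rewrite -[X in _ + X](@Rint_cst R d) -RintZ; last by ti_solve.
  rewrite -RintD; [|by ti_solve|by ti_solve].
  apply: Rint_le; [by ti_solve|by ti_solve|].
  move=> x; rewrite -subr_ge0 (_ : _ - _ = (u x - 2 * a) ^+ 2) ?sqr_ge0//; ring.
rewrite lerD2r; move: hP; move: (\int[mu]_x gdot u u x) => b hP.
by rewrite (_ : d%:R * b = 2 * (d%:R / 2 * b)); [rewrite ler_pM2l|field].
Qed.

End coefficients.

Section galerkin_solution.
Context {R : realType} {d : nat} (E : set R) (h : ('rV[R]_d -> R) -> 'rV[R]_d -> R)
  (g g1 g2 V : 'rV[R]_d -> R -> R -> R) (alpha kappa1 sigma : R).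
Local Notation Rd := 'rV[R]_d.
Local Notation mu := (torus_measure R d).
Implicit Types f phi eta v m u p q : Rd -> R.
Hypothesis S : mfg_setting E h g g1 g2 V alpha kappa1.
Local Notation VI := (VI h V sigma).

Lemma galerkin_energy : exists2 C : R, 0 < C & forall m u, torus_smooth m -> (forall x, 0 < m x) ->
  torus_smooth u -> (forall c : R, 1 / 2 <= c <= 2 -> 0 <= VI m u (fun x => c - m x) (fun x => 0 - u x)) ->
  [/\ \int[mu]_x m x <= C, \int[mu]_x m x `^ (alpha + 1) <= C, \int[mu]_x gdot u u x <= C,
      \int[mu]_x (m x * gdot u u x) <= C & \int[mu]_x u x ^+ 2 <= C].
Proof.
have [a [K [a0 K0 hV]]] := V_energy S.
pose C : R := K * (K / a + 1) + 2 * K + d%:R * (2 * K) + 8 * K ^+ 2.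
have d0 : 0 <= d%:R :> R by exact: ler0n.
have t1 : 0 < K * (K / a + 1) by rewrite mulr_gt0// addr_gt0// divr_gt0.
have t2 : 0 <= d%:R * (2 * K) by rewrite mulr_ge0// mulr_ge0// ltW.
have t3 : 0 <= 8 * K ^+ 2 by rewrite mulr_ge0// sqr_ge0.
have t4 : 0 < 2 * K by rewrite mulr_gt0.
exists C; first by rewrite /C; move: (K * (K / a + 1)) (2 * K) (8 * K ^+ 2) t1 t2 t3 t4 => *; lra.
move=> m u sm m0 su hVI.
have cm := torus_smooth_continuous sm; have cu := torus_smooth_continuous su.
have Cu := torus_smooth_C1 su; have cg := gdot_continuous Cu Cu.
have [G [G0 mG aG hG]] := hV m cm (fun x => E_gt0 S (m0 x)).
pose U := \int[mu]_x u x; pose D0 := \int[mu]_x gdot u u x; pose D1 := \int[mu]_x (m x * gdot u u x).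
have D00 : 0 <= D0 by apply: Rint_ge0 => x; exact: gdot_ge0.
have D10 : 0 <= D1 by apply: Rint_ge0 => x; rewrite mulr_ge0 ?gdot_ge0// ltW.
have key c : 1 / 2 <= c <= 2 -> a * G - K + (c * D0 + D1) / 2 <= (1 - c) * U.
  move=> hc; have := hVI c hc; rewrite VI_constant//; last by exact: (nem_V_smooth S).
  have -> : \int[mu]_x ((c + m x) / 2 * gdot u u x) = (c * D0 + D1) / 2.
    rewrite -RintZ; last by ti_solve.
    rewrite -RintD; [|by ti_solve|by ti_solve].
    rewrite mulrC -RintZ; last by ti_solve.
    by apply: tint_ext => x; field.
  have hc' : 0 <= c <= 2 by move/andP: hc => [h1 h2]; apply/andP; split => //; apply: le_trans h1; lra.
  have := hG c hc'; rewrite /U; move: (\int[mu]_x (_ * (_ - c))) (\int[mu]_x u x) ((c * D0 + D1) / 2) (a * G) => w1 w2 w3 w4 h1 h2.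
  by move: ((1 - c) * w2) h2 => w5; lra.
have aG0 : 0 <= a * G by rewrite mulr_ge0// ltW.
have k1 : a * G - K + (1 * D0 + D1) / 2 <= (1 - 1) * U by apply: key; apply/andP; split; lra.
have k2 : a * G - K + (2^-1 * D0 + D1) / 2 <= (1 - 2^-1) * U by apply: key; apply/andP; split; lra.
have k3 : a * G - K + (2 * D0 + D1) / 2 <= (1 - 2) * U by apply: key; apply/andP; split; lra.
(* For c = 1 the mean U of u disappears, which bounds the energies; then c = 1/2 bounds U from below
   and c = 2 from above, as the factor 1 - c changes sign. *)
have [U1 U2 D2 G1] : [/\ - (2 * K) <= U, U <= 2 * K, D0 + D1 <= 2 * K & a * G <= K].
  by move: (a * G) aG0 k1 k2 k3 => w *; split; lra.
have GK : K * (G + 1) <= K * (K / a + 1).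
  by rewrite ler_wpM2l ?(ltW K0)// lerD2r ler_pdivlMr// mulrC.
have U3 : U ^+ 2 <= 4 * K ^+ 2.
  rewrite (_ : 4 * K ^+ 2 = (2 * K) ^+ 2); last by ring.
  by rewrite -ler_sqrt ?sqr_ge0// ?exprn_gt0// !sqrtr_sqr (ger0_norm (ltW t4)) ler_norml U1.
have P := poincare su; rewrite -/D0 -/U in P.
have dD : d%:R * D0 <= d%:R * (2 * K) by rewrite ler_wpM2l//; lra.
rewrite -/D0 -/D1 /C; split.
- by move: (\int[mu]_x m x) (K * (G + 1)) (K * (K / a + 1)) (8 * K ^+ 2) (2 * K) mG GK t1 t2 t3 t4 => *; lra.
- by move: (\int[mu]_x _) (K * (G + 1)) (K * (K / a + 1)) (8 * K ^+ 2) (2 * K) aG GK t1 t2 t3 t4 => *; lra.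
- by move: (K * (K / a + 1)) (8 * K ^+ 2) (2 * K) t1 t2 t3 t4 D2 => *; lra.
- by move: (K * (K / a + 1)) (8 * K ^+ 2) (2 * K) t1 t2 t3 t4 D2 => *; lra.
- rewrite (_ : 8 * K ^+ 2 = 2 * (4 * K ^+ 2)) in t3 *; last by ring.
  move: (K * (K / a + 1)) (4 * K ^+ 2) (2 * K) (\int[mu]_x _) (U ^+ 2) t1 t2 t3 t4 P U3 dD => *; lra.
Qed.

(** The energy bounds come from tests (c, 0) that lie in the box for all c in [1/2, 2], because del
    <= 1/2, and they do not involve the size of the box. The box can thus be chosen larger than what
    they imply; a short step from (m, u) towards an arbitrary admissible (eta, v) then remains in
    it, and linearity in the direction removes the length t of the step. *)
Lemma galerkin_solution : exists2 C : R, 0 < C & forall n N (del : R), 0 < del -> del <= 2^-1 ->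
  exists m u, [/\ trig_poly n m, trig_poly N u, forall x, del <= m x,
    [/\ \int[mu]_x m x <= C, \int[mu]_x m x `^ (alpha + 1) <= C, \int[mu]_x gdot u u x <= C,
      \int[mu]_x (m x * gdot u u x) <= C & \int[mu]_x u x ^+ 2 <= C] &
    forall eta v, trig_poly n eta -> trig_poly N v -> (forall x, del <= eta x) ->
      0 <= VI m u (fun x => eta x - m x) (fun x => v x - u x)].
Proof.
have [C C0 hC] := galerkin_energy; exists C => // n N del del0 del2.
have [D1 [F1 [C1 [tF1 C10 h1]]]] := @trig_coefficients R d n.
have [D2 [F2 [C2 [tF2 C20 h2]]]] := @trig_coefficients R d N.
pose Phi (k : 'I_(D1 + D2)) : Rd -> R := match fintype.split k with inl j => F1 j | inr _ => fun=> 0 end.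
pose Psi (k : 'I_(D1 + D2)) : Rd -> R := match fintype.split k with inl _ => fun=> 0 | inr j => F2 j end.
have tPhi k : trig_poly n (Phi k).
  by rewrite /Phi; case: fintype.split => j; [exact: tF1|exact: trig_poly_cst].
have tPsi k : trig_poly N (Psi k).
  by rewrite /Psi; case: fintype.split => j; [exact: trig_poly_cst|exact: tF2].
have sl j : fintype.split (lshift D2 j : 'I_(D1 + D2)) = inl j by exact: (unsplitK (inl _ j)).
have sr j : fintype.split (rshift D1 j : 'I_(D1 + D2)) = inr j by exact: (unsplitK (inr _ j)).
have PhiE (y1 : 'rV[R]_D1) (y2 : 'rV[R]_D2) : comb Phi (row_mx y1 y2) = comb F1 y1.
  apply/funext => x; rewrite /comb big_split_ord /= [X in _ + X]big1 ?addr0.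
    by apply: eq_bigr => j _; rewrite row_mxEl /Phi sl.
  by move=> j _; rewrite /Phi sr mulr0.
have PsiE (y1 : 'rV[R]_D1) (y2 : 'rV[R]_D2) : comb Psi (row_mx y1 y2) = comb F2 y2.
  apply/funext => x; rewrite /comb big_split_ord /= big1 ?add0r.
    by apply: eq_bigr => j _; rewrite row_mxEr /Psi sr.
  by move=> j _; rewrite /Psi sl mulr0.
(* The first two terms bound the coefficients of a solution obeying the energy estimates, and of the
   constants up to 2; the margin 1 is the room left for a step towards a test pair. *)
pose B : R := C1 * (C + 2) + C2 * (1 + C) + 1.
have p1 : 0 <= C1 * (C + 2) by rewrite mulr_ge0// addr_ge0// ltW.
have p2 : 0 <= C2 * (1 + C) by rewrite mulr_ge0// addr_ge0// ltW.
have Brow (y1 : 'rV[R]_D1) (y2 : 'rV[R]_D2) : (forall k, `|y1 0 k| <= C1 * (C + 2) + 1) ->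
    (forall k, `|y2 0 k| <= C2 * (1 + C) + 1) -> forall k, `|row_mx y1 y2 0 k| <= B.
  move=> b1 b2 k; case: (split_ordP k) => j ->; rewrite ?row_mxEl ?row_mxEr.
    by apply: le_trans (b1 j) _; rewrite /B lerD2r lerDl.
  by apply: le_trans (b2 j) _; rewrite /B lerD2r lerDr.
pose CB := [set z : 'rV[R]_(D1 + D2) | (forall k, `|z 0 k| <= B) /\ forall x, del <= comb Phi z x].
have hcst (c : R) : 1 / 2 <= c <= 2 -> exists2 z, CB z & comb Phi z = (fun=> c) /\ comb Psi z = fun=> 0.
  move=> /andP[c1 c2]; have [z1 z1E bz1] := h1 _ (trig_poly_cst n c).
  have c0 : 0 <= c by apply: le_trans c1; lra.
  have F20 : comb F2 0 = fun=> 0.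
    by apply/funext => x; rewrite /comb big1// => k _; rewrite mxE mul0r.
  exists (row_mx z1 0); last by rewrite PhiE PsiE -z1E F20.
  split; last by move=> x; rewrite PhiE -z1E; apply: le_trans del2 _; apply: le_trans c1; lra.
  apply: Brow => k; last by rewrite mxE normr0 addr_ge0.
  apply: le_trans (bz1 k) _; rewrite Rint_cst (ger0_norm c0) -[X in X <= _]addr0 lerD// ler_wpM2l//.
  by apply: le_trans c2 _; rewrite lerDr ltW.
have [z1 Cz1 _] := hcst 1 ltac:(apply/andP; split; lra).
have [z [bz dz] hz] := galerkin_ball sigma S tPhi tPsi del0 Cz1.
pose m := comb Phi z; pose u := comb Psi z.
have tm : trig_poly n m by exact: comb_trig.
have tu : trig_poly N u by exact: comb_trig.
have sm := trig_poly_smooth tm; have su := trig_poly_smooth tu.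
have m0 x : 0 < m x by exact: lt_le_trans (dz x).
have En := hC m u sm m0 su.
have {}En : [/\ \int[mu]_x m x <= C, \int[mu]_x m x `^ (alpha + 1) <= C, \int[mu]_x gdot u u x <= C,
      \int[mu]_x (m x * gdot u u x) <= C & \int[mu]_x u x ^+ 2 <= C].
  by apply: En => c hc; have [zc Czc [e1 e2]] := hcst c hc; have := hz zc Czc; rewrite e1 e2.
exists m, u; split => // eta v te tv de.
have cm := torus_smooth_continuous sm; have cu := torus_smooth_continuous su.
have ce := trig_poly_continuous te; have cv := trig_poly_continuous tv.
have [y1 y1E by1] := h1 _ te; have [y2 y2E by2] := h2 _ tv.
(* The coefficients z are merely bounded by B. Since they are not unique, they are traded for other
   coefficients of the same functions that are controlled by the L^1 norms, and so by the energy
   estimates. *)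
have [w1 w1E bw1] := h1 _ tm; have [w2 w2E bw2] := h2 _ tu.
pose Y1 := C1 * \int[mu]_x `|eta x|; pose Y2 := C2 * \int[mu]_x `|v x|.
have Y10 : 0 <= Y1 by rewrite mulr_ge0// Rint_ge0.
have Y20 : 0 <= Y2 by rewrite mulr_ge0// Rint_ge0.
pose t : R := (1 + Y1 + Y2)^-1.
have YY : 1 <= 1 + Y1 + Y2 by rewrite -addrA lerDl addr_ge0.
have t0 : 0 < t by rewrite invr_gt0 (lt_le_trans ltr01).
have t1 : t <= 1 by rewrite invf_le1// (lt_le_trans ltr01).
have tY1 : t * Y1 <= 1.
  by rewrite mulrC ler_pdivrMr ?(lt_le_trans ltr01)// mul1r; lra.
have tY2 : t * Y2 <= 1.
  by rewrite mulrC ler_pdivrMr ?(lt_le_trans ltr01)// mul1r; lra.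
pose w : 'rV[R]_(D1 + D2) := row_mx ((1 - t) *: w1 + t *: y1) ((1 - t) *: w2 + t *: y2).
have combE D (F : 'I_D -> Rd -> R) (a b : 'rV[R]_D) x :
    comb F ((1 - t) *: a + t *: b) x = comb F a x + t * (comb F b x - comb F a x).
  rewrite /comb mulrBr !big_distrr /= -sumrB -big_split /=; apply: eq_bigr => k _.
  by rewrite !mxE; ring.
have t1' : 0 <= 1 - t by rewrite subr_ge0.
have mix (a b A B' : R) : `|a| <= A -> `|b| <= B' -> t * B' <= 1 -> `|(1 - t) * a + t * b| <= A + 1.
  move=> ha hb hB; apply: (le_trans (ler_normD _ _)); rewrite !normrM (ger0_norm t1') (ger0_norm (ltW t0)).
  apply: lerD; last by apply: le_trans hB; rewrite ler_wpM2l// ltW.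
  have A0 : 0 <= A by exact: le_trans ha.
  by apply: le_trans (_ : (1 - t) * A <= A); [rewrite ler_wpM2l|rewrite ler_piMl// gerBl ltW].
have Im : \int[mu]_x `|m x| <= C + 2.
  rewrite (@tint_ext _ _ m); last by move=> x; rewrite ger0_norm// ltW.
  by case: En => i1 _ _ _ _; apply: le_trans i1 _; rewrite lerDl.
have Iu : \int[mu]_x `|u x| <= 1 + C.
  apply: (@le_trans _ _ (\int[mu]_x (1 + u x ^+ 2))).
    apply: Rint_le; [by apply: integrableR_abs; ti_solve|by ti_solve|].
    move=> x; rewrite -(real_normK (num_real (u x))); move: `|u x| => a.
    by have := sqr_ge0 (a - 2^-1); rewrite sqrrB => ?; lra.
  rewrite RintD; [|by ti_solve|by ti_solve].
  by rewrite Rint_cst lerD2l; case: En.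
have Cw : CB w.
  split.
    apply: Brow => k; rewrite !mxE.
      apply: mix (by1 k) tY1; apply: le_trans (bw1 k) _; exact: ler_wpM2l.
    by apply: mix (by2 k) tY2; apply: le_trans (bw2 k) _; exact: ler_wpM2l.
  move=> x; rewrite PhiE combE -y1E -w1E.
  move: (de x) (dz x : del <= m x) => e1 e2.
  have q1 : (1 - t) * del <= (1 - t) * m x by rewrite ler_wpM2l.
  have q2 : t * del <= t * eta x by rewrite ler_wpM2l// ltW.
  move: q1 q2; rewrite !mulrBl !mul1r mulrBr.
  by move: (t * del) (t * m x) (t * eta x) => ? ? ?; lra.
have := hz w Cw; rewrite -/m -/u PhiE PsiE.
rewrite (_ : VI m u _ _ = VI m u (fun x => t * (eta x - m x)) (fun x => t * (v x - u x))); last first.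
  by congr (VI _ _ _ _); apply/funext => x; rewrite combE -?y1E -?w1E -?y2E -?w2E; ring.
rewrite (VIZ sigma S); [|exact: sm|exact: m0|exact: su|by tc_solve|by tc_solve].
by rewrite pmulr_rge0.
Qed.

End galerkin_solution.

(** * Estimates independent of the dimension *)

Section second_order_calculus.
Context {R : realType} {d : nat}.
Local Notation Rd := 'rV[R]_d.
Local Notation mu := (torus_measure R d).
Implicit Types f phi eta v m u p q : Rd -> R.
Local Notation e_ i := (delta_mx 0 i : Rd).

Lemma double_difference f i j (x : Rd) (s t : R) : torus_smooth f ->
  exists s' t' : R, [/\ `|s'| <= `|s|, `|t'| <= `|t| &
   f (x + s *: e_ i + t *: e_ j) - f (x + s *: e_ i) - (f (x + t *: e_ j) - f x) =
   s * t * pd j (pd i f) (x + s' *: e_ i + t' *: e_ j)].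
Proof.
move=> sf; have Cf := torus_smooth_C1 sf; have Cfi := torus_smooth_C1 (torus_smooth_pd i sf).
have [Ct et] := torus_C1_shift (t *: e_ j) Cf.
have [CN eN] := torus_C1Z (-1) Cf; have [CD eD] := torus_C1D Ct CN.
have [s' [hs]] := line_mvt (fun y => (CD.2 i).1 y) x s.
rewrite -[X in s * X]/(pd i _ (x + s' *: e_ i)) eD et eN !mulN1r => E1.
have [t' [ht E2]] := line_mvt (fun y => (Cfi.2 j).1 y) (x + s' *: e_ i) t.
exists s', t'; split => //.
rewrite -mulrA -[pd j (pd i f)]/('D_(e_ j) (pd i f)) -E2 -E1.
by move: (f _) (f _) (f _) (f _) => *; ring.
Qed.

Lemma cvg_perturbation f (x : Rd) i j (s t : nat -> R) : torus_continuous f ->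
  (forall n, `|s n| <= 2 * n.+1%:R^-1) -> (forall n, `|t n| <= 2 * n.+1%:R^-1) ->
  f (x + s n *: e_ i + t n *: e_ j) @[n --> \oo] --> f x.
Proof.
move=> [_ cf] hs ht.
have small (r : nat -> R) : (forall n, `|r n| <= 2 * n.+1%:R^-1) -> r n @[n --> \oo] --> (0 : R).
  move=> hr; apply/cvg_seqP => e e0.
  have /cvg_seqP/(_ (e / 2))[|N hN] : (fun n : nat => n.+1%:R^-1 : R) @ \oo --> (0 : R) by exact: cvg_harmonic.
    by rewrite divr_gt0.
  exists N => n /hN; rewrite !subr0 ger0_norm ?invr_ge0// => hn.
  by apply: le_trans (hr n) _; rewrite mulrC -ler_pdivlMr.
have c1 : x + s n *: e_ i + t n *: e_ j @[n --> \oo] --> x + 0 *: e_ i + 0 *: e_ j.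
  by apply: cvgD; [apply: cvgD; [exact: cvg_cst|]|]; apply: cvgZr_tmp; exact: small.
rewrite !scale0r !addr0 in c1.
by apply: continuous_cvg c1; exact: cf.
Qed.

(** The second difference of f in the directions i and j is symmetric, and equals each of the two
    mixed derivatives at a point that tends to x. *)
Lemma pd_comm f i j : torus_smooth f -> pd i (pd j f) = pd j (pd i f).
Proof.
move=> sf; apply/funext => x.
pose r n : R := n.+1%:R^-1.
have r0 n : 0 < r n by rewrite invr_gt0 ltr0Sn.
have [s' h1] := choice (fun n => double_difference i j x (r n) (r n) sf).
have [t' h2] := choice h1.
have [s2 h3] := choice (fun n => double_difference j i x (r n) (r n) sf).
have [t2 h4] := choice h3.
have rr n : r n <= 2 * n.+1%:R^-1 by rewrite -/(r n); have := r0 n; lra.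
have bd (a : nat -> R) : (forall n, `|a n| <= `|r n|) -> forall n, `|a n| <= 2 * n.+1%:R^-1.
  by move=> ha n; apply: le_trans (ha n) _; rewrite ger0_norm// ltW.
have c1 : pd j (pd i f) (x + s' n *: e_ i + t' n *: e_ j) @[n --> \oo] --> pd j (pd i f) x.
  apply: cvg_perturbation; [by tc_solve| |]; apply: bd => n; by have [] := h2 n.
have c2 : pd i (pd j f) (x + s2 n *: e_ j + t2 n *: e_ i) @[n --> \oo] --> pd i (pd j f) x.
  apply: cvg_perturbation; [by tc_solve| |]; apply: bd => n; by have [] := h4 n.
have eqf n : pd i (pd j f) (x + s2 n *: e_ j + t2 n *: e_ i) = pd j (pd i f) (x + s' n *: e_ i + t' n *: e_ j).
  have [_ _ E1] := h2 n; have [_ _ E2] := h4 n.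
  have rn0 : r n * r n != 0 by rewrite mulf_neq0// gt_eqF.
  apply: (mulfI rn0); apply: (etrans (esym E2)); apply: etrans E1.
  have -> : x + r n *: e_ j + r n *: e_ i = x + r n *: e_ i + r n *: e_ j by rewrite addrAC.
  by move: (f _) (f _) (f _) (f _) => *; ring.
rewrite (funext eqf) in c2; exact: cvg_seq_unique c2 c1.
Qed.

Lemma pd_gdot f p i : torus_smooth f -> torus_smooth p ->
  torus_C1 (gdot f p) /\ pd i (gdot f p) = fun x => gdot (pd i f) p x + gdot f (pd i p) x.
Proof.
move=> sf sp.
have CM k := torus_C1M (torus_smooth_C1 (torus_smooth_pd k sf)) (torus_smooth_C1 (torus_smooth_pd k sp)).
have [C e] := torus_C1_sum (index_enum 'I_d) (fun k => (CM k).1).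
split => //; rewrite -[LHS]/(pd i (fun x => \sum_k pd k f x * pd k p x)) e; apply/funext => x.
rewrite /gdot -big_split; apply: eq_bigr => k _ /=; rewrite (CM k).2 (pd_comm i k sf) (pd_comm i k sp).
by move: (pd k f x) (pd k p x) (pd k (pd i p) x) (pd k (pd i f) x) => *; ring.
Qed.

Lemma by_parts_r f p i : torus_C1 f -> torus_C1 p ->
  \int[mu]_x (f x * pd i p x) = - \int[mu]_x (pd i f x * p x).
Proof. by move=> Cf Cp; rewrite (Rintegral_by_parts i Cf Cp) opprK. Qed.

Lemma VI_split (s : R) (f1 f2 f3 f4 f5 f6 f7 f8 : Rd -> R) :
  integrableR mu f1 -> integrableR mu f2 -> integrableR mu f3 -> integrableR mu f4 ->
  integrableR mu f5 -> integrableR mu f6 -> integrableR mu f7 -> integrableR mu f8 ->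
  \int[mu]_x (f1 x + (- f2 x - f3 x / 2 - s * f4 x + (f5 x + f6 x + s * f7 x - f8 x))) =
  \int[mu]_x f1 x - \int[mu]_x f2 x - 2^-1 * \int[mu]_x f3 x - s * \int[mu]_x f4 x +
  \int[mu]_x f5 x + \int[mu]_x f6 x + s * \int[mu]_x f7 x - \int[mu]_x f8 x.
Proof.
move=> I1 I2 I3 I4 I5 I6 I7 I8.
rewrite (@tint_ext _ _ (fun x => f1 x - f2 x - 2^-1 * f3 x - s * f4 x + f5 x + f6 x + s * f7 x - f8 x)); last first.
  by move=> x; field.
have J1 := integrableRB I1 I2; have J2 := integrableRB J1 (integrableRZ 2^-1 I3).
have J3 := integrableRB J2 (integrableRZ s I4); have J4 := integrableRD J3 I5.
have J5 := integrableRD J4 I6; have J6 := integrableRD J5 (integrableRZ s I7).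
rewrite (RintB J6 I8) (RintD J5 (integrableRZ s I7)) (RintD J4 I6) (RintD J3 I5).
rewrite (RintB J2 (integrableRZ s I4)) (RintB J1 (integrableRZ 2^-1 I3)) (RintB I1 I2).
by rewrite !RintZ.
Qed.

Lemma pd2_by_parts f p i : torus_smooth f -> torus_smooth p ->
  \int[mu]_x (pd i (pd i f) x * p x) = \int[mu]_x (f x * pd i (pd i p) x).
Proof.
move=> sf sp.
rewrite (Rintegral_by_parts i (torus_smooth_C1 (torus_smooth_pd i sf)) (torus_smooth_C1 sp)).
rewrite (Rintegral_by_parts i (torus_smooth_C1 sf) (torus_smooth_C1 (torus_smooth_pd i sp))).
by rewrite opprK.
Qed.

Lemma gdot_int f p : torus_C1 f -> torus_C1 p ->
  \int[mu]_x gdot f p x = \sum_k \int[mu]_x (pd k f x * pd k p x).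
Proof. by move=> Cf Cp; rewrite /gdot Rint_sum// => k; ti_solve. Qed.

Lemma gdot_pd2 f p i : torus_smooth f -> torus_smooth p ->
  \int[mu]_x gdot (pd i (pd i f)) p x = \int[mu]_x gdot f (pd i (pd i p)) x.
Proof.
move=> sf sp; have s1 := torus_smooth_pd i (torus_smooth_pd i sf); have s2 := torus_smooth_pd i (torus_smooth_pd i sp).
rewrite (gdot_int (torus_smooth_C1 s1) (torus_smooth_C1 sp)) (gdot_int (torus_smooth_C1 sf) (torus_smooth_C1 s2)).
apply: eq_bigr => k _.
have ek (w : Rd -> R) : torus_smooth w -> pd k (pd i (pd i w)) = pd i (pd i (pd k w)).
  by move=> sw; rewrite (pd_comm k i (torus_smooth_pd i sw)) (pd_comm k i sw).
have P := pd2_by_parts i (torus_smooth_pd k sf) (torus_smooth_pd k sp).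
exact (etrans (congr1 (fun w : Rd -> R => \int[mu]_x (w x * pd k p x)) (ek f sf))
  (etrans P (congr1 (fun w : Rd -> R => \int[mu]_x (pd k f x * w x)) (esym (ek p sp))))).
Qed.

Lemma second_difference f i (x : Rd) (t : R) : torus_smooth f -> exists s s' : R,
  [/\ `|s| <= 2 * `|t|, `|s'| <= 2 * `|t| & f (x + t *: e_ i) + f (x - t *: e_ i) - 2 * f x =
   t ^+ 2 * pd i (pd i f) (x + s *: e_ i + s' *: e_ i)].
Proof.
move=> sf; have [s [s' [hs hs']]] := double_difference i i (x - t *: e_ i) t t sf.
rewrite subrK => E; exists (s - t), s'; split.
- by apply: le_trans (ler_normB _ _) _; rewrite mulr_natl mulr2n lerD2r.
- by apply: le_trans hs' _; rewrite mulr_natl mulr2n lerDl.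
rewrite scalerBl addrA (addrAC x) expr2 -E.
by move: (f _) (f _) (f _) => *; ring.
Qed.

End second_order_calculus.

Local Opaque pd.

Section estimates.
Context {R : realType} {d : nat} (E : set R) (h : ('rV[R]_d -> R) -> 'rV[R]_d -> R)
  (g g1 g2 V : 'rV[R]_d -> R -> R -> R) (alpha kappa1 sigma : R).
Local Notation Rd := 'rV[R]_d.
Local Notation mu := (torus_measure R d).
Implicit Types f phi eta v m u p q : Rd -> R.
Hypothesis S : mfg_setting E h g g1 g2 V alpha kappa1.
Local Notation VI := (VI h V sigma).
Variables (n N : nat) (del : R) (m u : Rd -> R).
Hypotheses (del0 : 0 < del) (tm : trig_poly n m) (tu : trig_poly N u) (dm : forall x, del <= m x).
Hypothesis st : forall eta v, trig_poly n eta -> trig_poly N v -> (forall x, del <= eta x) ->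
      0 <= VI m u (fun x => eta x - m x) (fun x => v x - u x).

Let sm : torus_smooth m := trig_poly_smooth tm.
Let su : torus_smooth u := trig_poly_smooth tu.
Let m0 x : 0 < m x. Proof. exact: lt_le_trans (dm x). Qed.
Let cA1 : torus_continuous (A1 h V sigma m u). Proof. exact: (A_continuous sigma S sm m0 su).1. Qed.
Let cA2 : torus_continuous (A2 sigma m u). Proof. exact: (A_continuous sigma S sm m0 su).2. Qed.

Lemma galerkin_fp w : trig_poly N w -> \int[mu]_x (A2 sigma m u x * w x) = 0.
Proof.
move=> tw; have cw := trig_poly_continuous tw.
have key (c : R) : 0 <= c * \int[mu]_x (A2 sigma m u x * w x).
  have := st tm (trig_polyD tu (trig_polyZ c tw)) dm; rewrite /VI.
  rewrite (@tint_ext _ _ (fun=> 0)) ?Rint_cst ?add0r; last by move=> x; rewrite subrr mulr0.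
  by rewrite -RintZ; [|by ti_solve]; congr (0 <= _); apply: tint_ext => x; ring.
have := key 1; have := key (-1); rewrite mulN1r mul1r oppr_ge0 => h1 h2.
by apply/eqP; rewrite eq_le h1.
Qed.

Lemma galerkin_mass : \int[mu]_x m x = 1.
Proof.
have := galerkin_fp (trig_poly_cst N 1).
have [C1c e1] := @torus_C1_cst R d 1.
have cm := torus_smooth_continuous sm.
rewrite A2_weak//.
have g0 (k : Rd -> R) : gdot k (fun=> 1) = fun=> 0.
  by apply/funext => x; rewrite /gdot; apply: big1 => i _; rewrite e1 mulr0.
rewrite (@tint_ext _ _ (fun x => m x - 1)); last by move=> x; rewrite !g0; ring.
by rewrite RintB; [|by ti_solve|by ti_solve]; rewrite Rint_cst => /eqP; rewrite subr_eq0 => /eqP.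
Qed.

Lemma galerkin_hj phi : trig_poly n phi -> (forall x, 0 <= phi x) -> 0 <= \int[mu]_x (A1 h V sigma m u x * phi x).
Proof.
move=> tphi phi0.
have := st (trig_polyD tm tphi) tu (fun x => ler_wpDr (phi0 x) (dm x)); rewrite /VI.
rewrite [X in _ + X](@tint_ext _ _ (fun=> 0)) ?Rint_cst ?addr0; last by move=> x; rewrite subrr mulr0.
by congr (0 <= _); apply: tint_ext => x; ring.
Qed.

(** In Minty's form the operator is evaluated at the test pair and (m, u) enters affinely, which
    makes the inequality stable under weak convergence. *)
Lemma galerkin_minty eta v : trig_poly n eta -> trig_poly N v -> (forall x, del <= eta x) ->
  0 <= VI eta v (fun x => eta x - m x) (fun x => v x - u x).
Proof.
move=> te tv de.
have se := trig_poly_smooth te; have sv := trig_poly_smooth tv.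
have e0 x : 0 < eta x by exact: lt_le_trans (de x).
have := @VI_monotone _ _ h V sigma m u eta v (nem_V_smooth S sm m0) (nem_V_smooth S se e0) sm su se sv
  (fun x => ltW (m0 x)) (fun x => ltW (e0 x)).
have Em f : torus_smooth f -> (forall x, 0 < f x) -> smooth_in E f.
  by move=> sf f0; split => // x; exact: (E_gt0 S).
move=> /(_ (V_monotone S (Em _ se e0) (Em _ sm m0))).
have -> : VI m u (fun x => m x - eta x) (fun x => u x - v x) =
   -1 * VI m u (fun x => eta x - m x) (fun x => v x - u x).
  rewrite -(VIZ sigma S)//; last 2 first.
  - by tc_solve.
  - by tc_solve.
  by congr (VI _ _ _ _); apply/funext => x; ring.
by have := st te tv de; move: (VI _ _ _ _) (VI _ _ _ _) => a b; lra.
Qed.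

(* The average of two opposite translates of m is an admissible test function. *)
Lemma galerkin_second_variation i : 0 <= \int[mu]_x (A1 h V sigma m u x * pd i (pd i m) x).
Proof.
pose e_ : Rd := delta_mx 0 i.
pose t k : R := k.+1%:R^-1.
have t0 k : 0 < t k by rewrite invr_gt0 ltr0Sn.
pose F k (x : Rd) : R := (t k ^+ 2)^-1 * (m (x + t k *: e_) + m (x - t k *: e_) - 2 * m x).
have cm := torus_smooth_continuous sm.
have cmp (a : Rd) : torus_continuous (fun x => m (x + a)) by exact: torus_continuous_shift.
have cF k : torus_continuous (F k).
  by have c1 := cmp (t k *: e_); have c2 := cmp (- (t k *: e_)); rewrite /F; tc_solve.
have c2 : torus_continuous (pd i (pd i m)) by tc_solve.
have [M hM] := torus_continuous_bounded c2; have [M1 hM1] := torus_continuous_bounded cA1.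
have hF k x : exists r : R * R, [/\ `|r.1| <= 2 * k.+1%:R^-1, `|r.2| <= 2 * k.+1%:R^-1 &
   F k x = pd i (pd i m) (x + r.1 *: e_ + r.2 *: e_)].
  have [s [s' [h1 h2 E1]]] := second_difference i x (t k) sm.
  have nt : `|t k| = t k by rewrite ger0_norm// ltW.
  rewrite nt in h1 h2; exists (s, s'); split; [exact: h1|exact: h2|].
  have -> : F k x = (t k ^+ 2)^-1 * (t k ^+ 2 * pd i (pd i m) (x + s *: e_ + s' *: e_)) by rewrite -E1.
  rewrite mulKf//.
  by rewrite expf_neq0// gt_eqF.
have [_ cI] : integrableR mu (fun x => A1 h V sigma m u x * pd i (pd i m) x) /\
   \int[mu]_x (A1 h V sigma m u x * F k x) @[k --> \oo] --> \int[mu]_x (A1 h V sigma m u x * pd i (pd i m) x).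
  apply: (@Rintegral_dominated R _ Rd mu _ _ (fun=> M1 * M)).
  - by move=> k; apply: torus_continuous_measurable; exact: torus_continuousM.
  - by apply: torus_continuous_measurable; exact: torus_continuousM.
  - apply: aeW => x; apply: cvgM; first exact: cvg_cst.
    have [r hr] := choice (fun k => hF k x).
    rewrite (_ : (fun k => F k x) = fun k => pd i (pd i m) (x + (r k).1 *: e_ + (r k).2 *: e_)); last first.
      by apply/funext => k; have [] := hr k.
    by apply: cvg_perturbation => // k; have [] := hr k.
  - exact: tcI (torus_continuous_cst _).
  - apply: aeW => x k; rewrite normrM; apply: ler_pM => //.
    by have [r [_ _ ->]] := hF k x.
apply: (cvg_seq_ge cI) => k.
pose eta x := 2^-1 * m (x + t k *: e_) + 2^-1 * m (x - t k *: e_).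
have te : trig_poly n eta by apply: trig_polyD; apply: trig_polyZ; exact: trig_poly_shift.
have de x : del <= eta x.
  by rewrite /eta; have := dm (x + t k *: e_); have := dm (x - t k *: e_); lra.
have := st te tu de; rewrite /VI.
rewrite [X in _ + X](@tint_ext _ _ (fun=> 0)) ?Rint_cst ?addr0; last by move=> x; rewrite subrr mulr0.
rewrite (@tint_ext _ _ (fun x => (t k ^+ 2 / 2) * (A1 h V sigma m u x * F k x))); last first.
  by move=> x; rewrite /eta /F; field; rewrite gt_eqF.
rewrite RintZ; last by apply: tcI; exact: torus_continuousM.
by rewrite pmulr_rge0// divr_gt0// exprn_gt0.
Qed.

Lemma hessian_arith (W H s i1 i2 i3 i4 i5 i6 i7 i8 : R) : i1 = - W -> i2 = i5 -> i3 = 2 * (i6 + H) ->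
  i4 = i7 -> i8 = 0 -> 0 <= i1 - i2 - 2^-1 * i3 - s * i4 + i5 + i6 + s * i7 - i8 -> W + H <= 0.
Proof. by move=> -> -> -> -> ->; move: (s * i7) => z; lra. Qed.

(** The direction is the pair of i-th second derivatives: the Hamilton-Jacobi part has a sign and
    the Fokker-Planck part vanishes. After integrations by parts the zeroth-order terms and the
    sigma terms cancel in pairs; two derivatives of |Du|^2 / 2 produce m |D u_i|^2 and a term that
    the transport of m cancels. *)
Lemma galerkin_hessian_identity i :
  \int[mu]_x (pd i (nem h V m) x * pd i m x) + \int[mu]_x (m x * gdot (pd i u) (pd i u) x) <= 0.
Proof.
have s1 := torus_smooth_pd i (torus_smooth_pd i sm); have s2 := torus_smooth_pd i (torus_smooth_pd i su).
have si := torus_smooth_pd i su; have smi := torus_smooth_pd i sm.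
have Cu := torus_smooth_C1 su; have Cm := torus_smooth_C1 sm.
have C1 := torus_smooth_C1 s1; have C2 := torus_smooth_C1 s2; have Ci := torus_smooth_C1 si.
have CV := nem_V_C1 S sm m0; have cV := CV.1.
have a1 := gdot_continuous Cu Cu; have a2 := gdot_continuous Cu C1; have a3 := gdot_continuous Cu C2.
have a4 := gdot_continuous Cm C2; have a5 := gdot_continuous Ci Ci; have a6 := gdot_continuous Ci Cu.
have : 0 <= VI m u (pd i (pd i m)) (pd i (pd i u)).
  have fp := galerkin_fp (trig_poly_pd i (trig_poly_pd i tu)).
  have ge0_eq0 (a : R) : a = 0 -> 0 <= a by move=> ->.
  exact (addr_ge0 (galerkin_second_variation i) (ge0_eq0 _ fp)).
rewrite VI_weak//.
have e1 : \int[mu]_x (nem h V m x * pd i (pd i m) x) = - \int[mu]_x (pd i (nem h V m) x * pd i m x).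
  by exact (by_parts_r i CV (torus_smooth_C1 smi)).
have e2 : \int[mu]_x (u x * pd i (pd i m) x) = \int[mu]_x (m x * pd i (pd i u) x).
  exact (etrans (tint_ext (fun x => mulrC (u x) (pd i (pd i m) x))) (pd2_by_parts i sm su)).
have e3 : \int[mu]_x (gdot u u x * pd i (pd i m) x) =
    2 * (\int[mu]_x (m x * gdot u (pd i (pd i u)) x) + \int[mu]_x (m x * gdot (pd i u) (pd i u) x)).
  have [G1 G1e] := pd_gdot i su su; have [G2 G2e] := pd_gdot i si su.
  have -> : \int[mu]_x (gdot u u x * pd i (pd i m) x) = - \int[mu]_x (pd i (gdot u u) x * pd i m x).
    exact (by_parts_r i G1 (torus_smooth_C1 smi)).
  have -> : \int[mu]_x (pd i (gdot u u) x * pd i m x) = 2 * \int[mu]_x (gdot (pd i u) u x * pd i m x).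
    rewrite -RintZ; last by ti_solve.
    by apply: tint_ext => x; rewrite G1e (gdotC u (pd i u)); ring.
  have -> : \int[mu]_x (gdot (pd i u) u x * pd i m x) = - \int[mu]_x (pd i (gdot (pd i u) u) x * m x).
    exact (by_parts_r i G2 Cm).
  have J1 : integrableR mu (fun x => m x * gdot u (pd i (pd i u)) x) by ti_solve.
  have J2 : integrableR mu (fun x => m x * gdot (pd i u) (pd i u) x) by ti_solve.
  have P : \int[mu]_x (pd i (gdot (pd i u) u) x * m x) =
      \int[mu]_x (m x * gdot u (pd i (pd i u)) x) + \int[mu]_x (m x * gdot (pd i u) (pd i u) x).
    apply: etrans (RintD J1 J2); apply: tint_ext => x; rewrite G2e (gdotC (pd i (pd i u)) u).
    by move: (gdot u _ x) (gdot (pd i u) _ x) (m x) => *; ring.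
  by rewrite P mulrN opprK.
have e4 : \int[mu]_x gdot u (pd i (pd i m)) x = \int[mu]_x gdot m (pd i (pd i u)) x.
  exact (etrans (esym (gdot_pd2 i su sm)) (congr1 (fun w : Rd -> R => \int[mu]_x w x) (gdotC (pd i (pd i u)) m))).
have e5 : \int[mu]_x pd i (pd i u) x = 0 by exact: Rintegral_pd.
have I1 : integrableR mu (fun x => nem h V m x * pd i (pd i m) x) by ti_solve.
have I2 : integrableR mu (fun x => u x * pd i (pd i m) x) by ti_solve.
have I3 : integrableR mu (fun x => gdot u u x * pd i (pd i m) x) by ti_solve.
have I4 : integrableR mu (gdot u (pd i (pd i m))) by exact: tcI.
have I5 : integrableR mu (fun x => m x * pd i (pd i u) x) by ti_solve.
have I6 : integrableR mu (fun x => m x * gdot u (pd i (pd i u)) x) by ti_solve.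
have I7 : integrableR mu (gdot m (pd i (pd i u))) by exact: tcI.
have I8 : integrableR mu (pd i (pd i u)) by ti_solve.
rewrite (VI_split (sigma ^+ 2) I1 I2 I3 I4 I5 I6 I7 I8).
exact (hessian_arith e1 e2 e3 e4 e5).
Qed.

Lemma galerkin_second_order :
  \sum_i \int[mu]_x (m x * gdot (pd i u) (pd i u) x) <= kappa1 /\
  \int[mu]_x (m x `^ (alpha - 1) * gdot m m x) <= kappa1 ^+ 2.
Proof.
have [_ k0 _ _] := mfg_V2 S.
have := V_coercive S sm m0.
have -> : \int[mu]_x (m x `^ (alpha - 1) * \sum_i pd i m x ^+ 2) = \int[mu]_x (m x `^ (alpha - 1) * gdot m m x).
  by apply: tint_ext => x; congr (_ * _); apply: eq_bigr => i _; rewrite expr2.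
set W := \int[mu]_x (m x `^ (alpha - 1) * _).
have W0 : 0 <= W by apply: Rint_ge0 => x; rewrite mulr_ge0 ?powR_ge0 ?gdot_ge0.
have : \sum_i (\int[mu]_x (pd i (nem h V m) x * pd i m x) + \int[mu]_x (m x * gdot (pd i u) (pd i u) x)) <= 0.
  by apply: sumr_le0 => i _; exact: galerkin_hessian_identity.
have H0 : 0 <= \sum_i \int[mu]_x (m x * gdot (pd i u) (pd i u) x).
  by apply: sumr_ge0 => i _; apply: Rint_ge0 => x; rewrite mulr_ge0 ?gdot_ge0// ltW.
have kW : 0 <= kappa1^-1 * W by rewrite mulr_ge0// invr_ge0 ltW.
rewrite big_split /=; move: (\sum_i _) (\sum_i _) H0 => a b b0 h1 h2; split; first by lra.
have h3 : kappa1^-1 * W <= kappa1 by lra.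
by rewrite expr2 -ler_pdivrMl.
Qed.

End estimates.

(** * The logarithmic estimate and the choice of the degrees *)

Section log_estimate.
Context {R : realType} {d : nat}.
Local Notation Rd := 'rV[R]_d.
Local Notation mu := (torus_measure R d).
Implicit Types f phi eta v m u p q : Rd -> R.

Lemma gdot_perturbation f p q (e : R) x : (forall i, `|pd i p x - pd i q x| <= e) ->
  `|gdot f p x - gdot f q x| <= e * \sum_i `|pd i f x|.
Proof.
move=> h; rewrite /gdot -sumrB; apply: (le_trans (ler_norm_sum _ _ _)).
rewrite big_distrr; apply: ler_sum => i _ /=.
by rewrite -mulrBr normrM mulrC ler_wpM2r.
Qed.

Lemma sum_norm_gdot f x : \sum_i `|pd i f x| <= (d%:R + gdot f f x) / 2.
Proof.
rewrite (_ : d%:R = \sum_(i < d) (1 : R)); last by rewrite sumr_const card_ord.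
rewrite /gdot -big_split big_distrl; apply: ler_sum => i _ /=.
rewrite -expr2 -(real_normK (num_real (pd i f x))); move: `|pd i f x| => a.
by have := sqr_ge0 (a - 1); rewrite sqrrB => ?; lra.
Qed.

Lemma sqr_pd_gdot i f x : pd i f x ^+ 2 <= gdot f f x.
Proof. by rewrite /gdot (bigD1 i)//= -expr2 lerDl; apply: sumr_ge0 => k _; rewrite -expr2 sqr_ge0. Qed.

Lemma ln_weighted (x : R) : 0 < x -> x - 1 <= x * ln x.
Proof.
move=> x0; have h : ln x^-1 <= x^-1 - 1.
    rewrite -[X in ln X](subrK 1) addrC.
    by apply: le_ln1Dx; rewrite ltrBrDl addrN invr_gt0.
have := ler_wpM2l (ltW x0) h; rewrite lnV ?posrE// mulrN mulrBr mulfV ?gt_eqF// mulr1.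
by move: (x * ln x) => y; lra.
Qed.

(* w is a trigonometric polynomial close to ln m in C^1, as ln m itself is not an admissible test. *)
Lemma log_estimate m u w (sigma e L C K : R) : torus_smooth m -> torus_smooth u -> torus_smooth w ->
  (forall x, 0 < m x) -> \int[mu]_x (A2 sigma m u x * w x) = 0 -> \int[mu]_x m x = 1 ->
  0 < e <= 1 -> sigma ^+ 2 * (e * (d%:R * L)) <= 1 -> (forall i x, `|pd i m x| <= L) ->
  (forall x, `|w x - ln (m x)| <= e) ->
  (forall i x, `|pd i w x - pd i (fun y => ln (m y)) x| <= e) ->
  \int[mu]_x (m x * gdot u u x) <= C -> \sum_i \int[mu]_x (m x * gdot (pd i u) (pd i u) x) <= K ->
  - (3 + d%:R + (C + K) / 2) <= \int[mu]_x ln (m x).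
Proof.
move=> sm su sw m0 fp mass /andP[e0 e1] eL hL hw hdw hC hK.
have Cm := torus_smooth_C1 sm; have Cu := torus_smooth_C1 su; have Cw := torus_smooth_C1 sw.
have [Cl el] := torus_C1_ln Cm m0; pose l x := ln (m x); rewrite -/l in Cl el hw hdw *.
have cl : torus_continuous l := Cl.1.
have a1 := gdot_continuous Cu Cw; have a2 := gdot_continuous Cm Cw; have a3 := gdot_continuous Cu Cm.
have a4 := gdot_continuous Cu Cu.
have cd (i : 'I_d) : torus_continuous (gdot (pd i u) (pd i u)).
  by have Ci := torus_smooth_C1 (torus_smooth_pd i su); exact: gdot_continuous.
have cm := Cm.1; have cw := Cw.1.
(* [Q] is a lower bound for the integrand of the Fokker-Planck equation tested on w. It replaces m w
   by means of m ln m >= m - 1, and m Du . Dw by Du . Dm up to an error controlled by the energy;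
   the sigma term is at least -1, as Dm . D ln m >= 0 and e is small compared with 1/L. *)
pose Q x := m x - 1 - e * m x + (gdot u m x - e * ((d%:R * m x + m x * gdot u u x) / 2)) - 1 - l x - e.
have cQ : torus_continuous Q by rewrite /Q; tc_solve.
have hQ : \int[mu]_x Q x <= 0.
  rewrite -fp A2_weak//; apply: Rint_le; [exact: tcI|by ti_solve|].
  move=> x; rewrite /Q.
  have q1 : m x - 1 - e * m x <= m x * w x.
    have := ln_weighted (m0 x); have := hw x; rewrite ler_norml => /andP[h1 _].
    have := ler_wpM2l (ltW (m0 x)) h1; rewrite mulrBr -[ln (m x)]/(l x) mulrN (mulrC (m x) e).
    by move: (m x * w x) (m x * l x) (e * m x) => *; lra.
  have q2 : gdot u m x - e * ((d%:R * m x + m x * gdot u u x) / 2) <= m x * gdot u w x.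
    have gl : m x * gdot u l x = gdot u m x.
      rewrite /gdot big_distrr; apply: eq_bigr => i _ /=; rewrite el.
      by rewrite mulrCA [X in _ * X]mulrA mulfV ?gt_eqF// mul1r.
    have := gdot_perturbation u (fun i => hdw i x); rewrite ler_norml => /andP[h1 _].
    have h2 := sum_norm_gdot u x.
    have h3 : m x * (e * \sum_i `|pd i u x|) <= m x * (e * ((d%:R + gdot u u x) / 2)).
      by apply: ler_wpM2l; [exact: ltW|apply: ler_wpM2l => //; exact: ltW].
    have := ler_wpM2l (ltW (m0 x)) h1; rewrite mulrN mulrBr gl.
    have -> : e * ((d%:R * m x + m x * gdot u u x) / 2) = m x * (e * ((d%:R + gdot u u x) / 2)) by field.
    move: h3; move: (m x * (e * _)) (m x * (e * _)) (m x * gdot u w x) (gdot u m x) => *; lra.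
  have q3 : - 1 <= sigma ^+ 2 * gdot m w x.
    have gl : 0 <= gdot m l x.
      rewrite /gdot; apply: sumr_ge0 => i _; rewrite el mulrCA -expr2.
      by rewrite mulr_ge0 ?sqr_ge0// invr_ge0 ltW.
    have := gdot_perturbation m (fun i => hdw i x); rewrite ler_norml => /andP[h1 _].
    have h2 : \sum_i `|pd i m x| <= d%:R * L.
      rewrite (_ : d%:R * L = \sum_(i < d) L); last by rewrite sumr_const card_ord mulr_natl.
      by apply: ler_sum => i _; exact: hL.
    have h3 : e * \sum_i `|pd i m x| <= e * (d%:R * L) by apply: ler_wpM2l => //; exact: ltW.
    have h4 : - (e * (d%:R * L)) <= gdot m w x by move: (e * _) (e * _) h1 h3 => *; lra.
    have := ler_wpM2l (sqr_ge0 sigma) h4; rewrite mulrN.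
    by move: (sigma ^+ 2 * (e * _)) (sigma ^+ 2 * gdot m w x) eL => *; lra.
  have := hw x; rewrite ler_norml -[ln (m x)]/(l x) => /andP[_ q4].
  move: (m x * w x) (m x * gdot u w x) (sigma ^+ 2 * gdot m w x) (w x) (l x) (m x - 1 - e * m x)
    (gdot u m x - _) q1 q2 q3 q4 => *; lra.
have I1 : integrableR mu m by exact: tcI.
have I2 : integrableR mu (fun x => m x * gdot u u x) by ti_solve.
have QE : \int[mu]_x Q x = (1 - e - e * d%:R / 2) * \int[mu]_x m x + \int[mu]_x gdot u m x
   - e / 2 * \int[mu]_x (m x * gdot u u x) - \int[mu]_x l x - (2 + e).
  have I0 : integrableR mu (fun=> 2 + e) by exact: tcI (torus_continuous_cst _).
  rewrite -[in RHS](@Rint_cst R d (2 + e)) -(RintZ _ I1) -(RintZ _ I2).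
  have J1 := integrableRD (integrableRZ (1 - e - e * d%:R / 2) I1) (tcI a3).
  have J2 := integrableRB J1 (integrableRZ (e / 2) I2).
  have J3 := integrableRB J2 (tcI cl).
  rewrite -(RintD (integrableRZ (1 - e - e * d%:R / 2) I1) (tcI a3)) -(RintB J1 (integrableRZ (e / 2) I2)).
  rewrite -(RintB J2 (tcI cl)) -(RintB J3 I0).
  by apply: tint_ext => x; rewrite /Q; field.
(* The integral of m Du . D ln m is that of Du . Dm, hence minus that of m times the Laplacian of u:
   the weighted second-order bound K controls it by x <= (1 + x^2) / 2. *)
have gum : - ((d%:R + K) / 2) <= \int[mu]_x gdot u m x.
  have -> : \int[mu]_x gdot u m x = - \int[mu]_x (laplacian u x * m x) by rewrite laplacian_weak// opprK.
  rewrite lerN2; have cL : torus_continuous (laplacian u) by rewrite /laplacian; tc_solve.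
  have cS : torus_continuous (fun x => \sum_i m x * gdot (pd i u) (pd i u) x).
    by apply: torus_continuous_sum => i; exact (torus_continuousM cm (cd i)).
  apply: (@le_trans _ _ (\int[mu]_x (2^-1 * (d%:R * m x + \sum_i m x * gdot (pd i u) (pd i u) x)))).
    apply: Rint_le; [by ti_solve|by ti_solve|].
    move=> x; rewrite -big_distrr /= (mulrC d%:R) -mulrDr mulrCA mulrC; apply: ler_wpM2l; first exact: ltW.
    rewrite /laplacian; apply: (@le_trans _ _ (\sum_i (1 + gdot (pd i u) (pd i u) x) / 2)).
      apply: ler_sum => i _.
      have := sqr_pd_gdot i (pd i u) x.
      by have := sqr_ge0 (pd i (pd i u) x - 1); rewrite sqrrB; move: (pd i (pd i u) x) (gdot _ _ x) => *; lra.
    rewrite -big_distrl big_split /= sumr_const card_ord mulrC.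
    by rewrite lexx.
  rewrite RintZ; last by ti_solve.
  rewrite RintD; [|by ti_solve|exact: tcI].
  rewrite RintZ// mass mulr1 Rint_sum; last by move=> i; exact (tcI (torus_continuousM cm (cd i))).
  by rewrite mulrC ler_pM2r ?invr_gt0// lerD2l.
have D0 : 0 <= \int[mu]_x (m x * gdot u u x) by apply: Rint_ge0 => x; rewrite mulr_ge0 ?gdot_ge0// ltW.
have d0 : 0 <= d%:R :> R by exact: ler0n.
have eD : e / 2 * \int[mu]_x (m x * gdot u u x) <= C / 2.
  rewrite mulrAC ler_pM2r ?invr_gt0//; apply: le_trans hC.
  by rewrite -[X in _ <= X]mul1r; exact: ler_wpM2r.
have ed : e * d%:R / 2 <= d%:R / 2 by rewrite ler_pM2r ?invr_gt0// -[X in _ <= X]mul1r; exact: ler_wpM2r.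
move: hQ; rewrite QE mass mulr1.
move: (\int[mu]_x gdot u m x) (\int[mu]_x l x) (e / 2 * _) (e * d%:R / 2) gum eD ed e1 d0 => *; lra.
Qed.

End log_estimate.

Section approximation.
Context {R : realType} {d : nat} (E : set R) (h : ('rV[R]_d -> R) -> 'rV[R]_d -> R)
  (g g1 g2 V : 'rV[R]_d -> R -> R -> R) (alpha kappa1 sigma : R).
Local Notation Rd := 'rV[R]_d.
Local Notation mu := (torus_measure R d).
Implicit Types f phi eta v m u p q : Rd -> R.
Hypothesis S : mfg_setting E h g g1 g2 V alpha kappa1.
Local Notation VI := (VI h V sigma).

Definition galerkin_bounds (C : R) m u :=
  [/\ \int[mu]_x m x = 1, \int[mu]_x m x `^ (alpha + 1) <= C, \int[mu]_x gdot u u x <= C,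
      \int[mu]_x (m x * gdot u u x) <= C & \int[mu]_x u x ^+ 2 <= C] /\
  \int[mu]_x (m x `^ (alpha - 1) * gdot m m x) <= C /\ - C <= \int[mu]_x ln (m x).

Definition galerkin_relations (n : nat) m u :=
  [/\ forall phi, trig_poly n phi -> (forall x, 0 <= phi x) -> 0 <= \int[mu]_x (A1 h V sigma m u x * phi x),
      forall w, trig_poly n w -> \int[mu]_x (A2 sigma m u x * w x) = 0 &
      forall eta v, trig_poly n eta -> trig_poly n v -> (forall x, n.+2%:R^-1 <= eta x) ->
        0 <= VI eta v (fun x => eta x - m x) (fun x => v x - u x)].

(** The order of the choices matters. The degree n fixes the lower bound [del] and, through the
    inverse estimates and the mass 1, a bound [L] on two derivatives of m; these fix the tolerance
    [e] and the bound [B] on two derivatives of ln m, hence the rank of mollification and the degree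
    N. Only then is the pair (m, u) produced, and ln m is within the tolerance of an admissible
    test. *)
Lemma approximation : exists2 C : R, 0 < C & forall n, exists m u,
  [/\ torus_smooth m, torus_smooth u, forall x, 0 < m x, galerkin_bounds C m u & galerkin_relations n m u].
Proof.
have [C C0 hC] := galerkin_solution sigma S.
have [_ k0 _ _] := mfg_V2 S.
have d0 : 0 <= d%:R :> R by exact: ler0n.
pose C' : R := C + kappa1 ^+ 2 + (3 + d%:R + (C + kappa1) / 2).
have k2 : 0 < kappa1 ^+ 2 by rewrite exprn_gt0.
have p3 : 0 <= 3 + d%:R + (C + kappa1) / 2 by lra.
have [c1 c2 c3] : [/\ C <= C', kappa1 ^+ 2 <= C' & 3 + d%:R + (C + kappa1) / 2 <= C'].
  by rewrite /C'; move: (kappa1 ^+ 2) (3 + _ + _) p3 k2 => *; split; lra.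
exists C'; first by rewrite /C'; move: (kappa1 ^+ 2) k2 => *; lra.
move=> n; pose del : R := n.+2%:R^-1.
have del0 : 0 < del by rewrite invr_gt0 ltr0Sn.
have del2 : del <= 2^-1 by rewrite lef_pV2 ?posrE ?ltr0Sn// ler_nat.
have [L1 hL1] := choice (fun i : 'I_d => let: ex_intro2 L _ hL := @trig_inverse_estimate R d n [:: i] in ex_intro _ L hL).
have [L2 hL2] := choice (fun ij : 'I_d * 'I_d => let: ex_intro2 L _ hL := @trig_inverse_estimate R d n [:: ij.1; ij.2] in ex_intro _ L hL).
pose L : R := \sum_i `|L1 i| + \sum_ij `|L2 ij|.
have L0 : 0 <= L by rewrite addr_ge0// sumr_ge0.
have L1L i : L1 i <= L.
  apply: le_trans (ler_norm _) _; rewrite /L (bigD1 i)//= -addrA lerDl addr_ge0// sumr_ge0//.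
have L2L ij : L2 ij <= L.
  apply: le_trans (ler_norm _) _; rewrite /L addrC (bigD1 ij)//= -addrA lerDl addr_ge0// sumr_ge0//.
pose e : R := (1 + sigma ^+ 2 * (d%:R * L))^-1.
have sL : 0 <= sigma ^+ 2 * (d%:R * L) by rewrite mulr_ge0 ?sqr_ge0// mulr_ge0.
have s1 : 0 < 1 + sigma ^+ 2 * (d%:R * L) by rewrite ltr_pwDl.
have e01 : 0 < e <= 1 by rewrite invr_gt0 s1 invf_le1// lerDl.
have e0 : 0 < e by case/andP: e01.
pose B : R := del^-1 * L + (del^-1 * L) ^+ 2.
have dL0 : 0 <= del^-1 * L by rewrite mulr_ge0// invr_ge0 ltW.
have B0 : 0 <= B by rewrite addr_ge0// sqr_ge0.
have [N0 hN0] := @tconv_lipschitz R d B e e0 B0.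
pose N := maxn (d * N0) n.
have [m [u [tm tu dm [i1 i2 i3 i4 i5] st]]] := hC n N del del0 del2.
have sm := trig_poly_smooth tm; have su := trig_poly_smooth tu.
have m0 x : 0 < m x by exact: lt_le_trans (dm x).
have mass := galerkin_mass S del0 tm tu dm st.
have fp := galerkin_fp S del0 tm tu dm st.
have [so1 so2] := galerkin_second_order S del0 tm tu dm st.
have Im : \int[mu]_x `|m x| = 1 by rewrite -mass; apply: tint_ext => x; rewrite ger0_norm// ltW.
have Lm i x : `|pd i m x| <= L.
  by apply: le_trans (hL1 i m tm x) _; rewrite Im mulr1.
have Lm2 i j x : `|pd i (pd j m) x| <= L.
  by apply: le_trans (hL2 (i, j) m tm x) _; rewrite Im mulr1.
have Cm := torus_smooth_C1 sm; have [Cl el] := torus_C1_ln Cm m0.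
pose l x := ln (m x); rewrite -/l in Cl el.
have mi x : `|(m x)^-1| <= del^-1.
  by rewrite ger0_norm ?invr_ge0 ?(ltW (m0 x))// lef_pV2 ?posrE.
have ldb i x : `|pd i l x| <= del^-1 * L by rewrite el normrM; apply: ler_pM.
have [Cinv einv] : torus_C1 (fun x => (m x)^-1) /\ forall i, pd i (fun x => (m x)^-1) = fun x => - ((m x)^-1 ^+ 2) * pd i m x.
  have [Cp ep] := torus_C1_powR (-1) Cm m0.
  have mE : (fun x => m x `^ (-1)) = fun x => (m x)^-1 by apply/funext => x; rewrite powR_inv1// ltW.
  rewrite mE in Cp ep; split => // i; rewrite ep; apply/funext => x.
  rewrite powRD; last by rewrite (gt_eqF (m0 x)) implybT.
  by rewrite !powR_inv1 ?(ltW (m0 x))// expr2 mulN1r.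
have Cli i : torus_C1 (pd i l).
  by rewrite el; exact: (torus_C1M Cinv (torus_smooth_C1 (torus_smooth_pd i sm))).1.
have ld2 i j x : `|pd j (pd i l) x| <= B.
  rewrite el (torus_C1M Cinv (torus_smooth_C1 (torus_smooth_pd i sm))).2 einv.
  apply: (le_trans (ler_normD _ _)); apply: lerD; first by rewrite normrM; apply: ler_pM.
  rewrite (_ : pd i m x * (- (m x)^-1 ^+ 2 * pd j m x) = - (((m x)^-1 * pd i m x) * ((m x)^-1 * pd j m x))); last first.
    by move: ((m x)^-1) => z; ring.
  rewrite normrN normrM expr2; apply: ler_pM => //; rewrite normrM; exact: ler_pM.
have lB i x : `|pd i l x| <= B.
  by apply: le_trans (ldb i x) _; rewrite /B lerDl sqr_ge0.
pose w := tconv N0 l.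
have tw : trig_poly N w by apply: (trig_poly_le (leq_maxl _ _)); apply: tconv_trig; exact: tcI Cl.1.
have sw := trig_poly_smooth tw.
have hw x : `|w x - ln (m x)| <= e by exact: (hN0 N0 (leqnn _) l Cl lB).
have hdw i x : `|pd i w x - pd i l x| <= e.
  rewrite /w tconv_pd//; exact: (hN0 N0 (leqnn _) (pd i l) (Cli i) (fun j => ld2 i j)).
have eL : sigma ^+ 2 * (e * (d%:R * L)) <= 1.
  rewrite mulrCA /e mulrC ler_pdivrMr// mul1r lerDr; exact: ler01.
have hl := log_estimate sm su sw m0 (fp w tw) mass e01 eL Lm hw hdw i4 so1.
have nN : (n <= N)%N by exact: leq_maxr.
exists m, u; split => //; last split.
- split; first by split; [exact: mass|exact: (le_trans i2)|exact: (le_trans i3)|exact: (le_trans i4)|exact: (le_trans i5)].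
  by split; [exact: (le_trans so2)|apply: le_trans hl; rewrite lerN2].
- exact: (galerkin_hj tm tu dm st).
- by move=> p tp; apply: fp; exact: trig_poly_le tp.
- move=> eta v te tv de; apply: (galerkin_minty S del0 tm tu dm st) => //; exact: trig_poly_le tv.
Qed.

End approximation.

(** * Passage to the limit *)

Section compactness_helpers.
Context {R : realType} {d : nat}.
Local Notation Rd := 'rV[R]_d.
Local Notation mu := (torus_measure R d).
Local Notation periodic := Defs.periodic.
Implicit Types f phi psi F H : Rd -> R.

Lemma weak_compactness_family (g : 'I_d -> nat -> Rd -> R) (C : R) :
  (forall i n, torus_continuous (g i n)) -> (forall i n, \int[mu]_x g i n x ^+ 2 <= C) ->
  exists s (G : 'I_d -> Rd -> R) (b : 'I_d -> nat -> Rd -> R), subsequence s /\ forall i,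
    [/\ torus_L2 (G i), forall n, torus_continuous (b i n),
      \int[mu]_x (b i n x - G i x) ^+ 2 @[n --> \oo] --> (0 : R) &
      forall phi, torus_continuous phi ->
        \int[mu]_x (g i (s n) x * phi x) @[n --> \oo] --> \int[mu]_x (G i x * phi x)].
Proof.
move=> cg bg.
have [s [G [b [ss hG]]]] : exists s (G : 'I_d -> Rd -> R) (b : 'I_d -> nat -> Rd -> R), subsequence s /\
    forall i, i \in enum 'I_d ->
    [/\ torus_L2 (G i), forall n, torus_continuous (b i n),
      \int[mu]_x (b i n x - G i x) ^+ 2 @[n --> \oo] --> (0 : R) &
      forall phi, torus_continuous phi ->
        \int[mu]_x (g i (s n) x * phi x) @[n --> \oo] --> \int[mu]_x (G i x * phi x)].
  elim: (enum 'I_d) => [|j r [s [G [b [ss IH]]]]].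
    by exists id, (fun _ _ => 0), (fun _ _ _ => 0); split => // n.
  have [s' [Gj [bj [ss' LG cb bG cG]]]] := weak_compactness (fun n => cg j (s n)) (fun n => bg j (s n)).
  exists (fun n => s (s' n)), (fun i => if i == j then Gj else G i), (fun i => if i == j then bj else b i).
  split; first exact: subsequence_comp.
  move=> i; rewrite inE; case: eqVneq => [->|ij] /=; first by [].
  move=> /IH[h1 h2 h3 h4]; split => // phi cphi.
  exact: (cvg_subsequence ss' (h4 phi cphi)).
by exists s, G, b; split => // i; apply: hG; rewrite mem_enum.
Qed.

Lemma dominated_pairing (f : nat -> Rd -> R) F H phi : (forall n, measurable_fun setT (f n)) ->
  measurable_fun setT F -> {ae mu, forall x, f n x @[n --> \oo] --> F x} -> integrableR mu H ->
  {ae mu, forall x n, `|f n x| <= H x} -> torus_continuous phi ->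
  integrableR mu (fun x => F x * phi x) /\
  \int[mu]_x (f n x * phi x) @[n --> \oo] --> \int[mu]_x (F x * phi x).
Proof.
move=> mf mF cf IH bf cphi; have [M hM] := torus_continuous_bounded cphi.
have mphi := torus_continuous_measurable cphi.
apply: (@Rintegral_dominated R _ Rd mu _ _ (fun x => M * H x)).
- by move=> n; exact: measurable_funM.
- exact: measurable_funM.
- by apply: filterS cf => x cx; apply: cvgM => //; exact: cvg_cst.
- exact: integrableRZ.
- by apply: filterS bf => x bx n; rewrite normrM mulrC; apply: ler_pM.
Qed.

Lemma uniform_pairing f (phi : nat -> Rd -> R) psi : integrableR mu f ->
  (forall n, torus_continuous (phi n)) -> torus_continuous psi ->
  (forall e : R, 0 < e -> exists N, forall n, (N <= n)%N -> forall x, `|phi n x - psi x| <= e) ->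
  \int[mu]_x (f x * phi n x) @[n --> \oo] --> \int[mu]_x (f x * psi x).
Proof.
move=> If cphi cpsi cu; apply/cvg_seqP => e e0.
have If1 := integrableR_abs If; set I := \int[mu]_x `|f x|.
have I0 : 0 <= I by exact: Rint_ge0.
have I1 : 0 < I + 1 by rewrite ltr_wpDl.
have [N hN] := cu (e / (I + 1)) (divr_gt0 e0 I1).
exists N => n /hN hn.
have J1 : integrableR mu (fun x => f x * phi n x) by exact: dist_of_integrable.
have J2 : integrableR mu (fun x => f x * psi x) by exact: dist_of_integrable.
rewrite -(RintB J1 J2); apply: (le_trans (Rint_abs (integrableRB J1 J2))).
apply: (@le_trans _ _ (\int[mu]_x (e / (I + 1) * `|f x|))).
  apply: Rint_le; [exact: integrableR_abs (integrableRB J1 J2)|exact: integrableRZ|].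
  by move=> x; rewrite -mulrBr normrM mulrC ler_wpM2r.
rewrite RintZ// -/I mulrAC ler_pdivrMr// ler_wpM2l ?(ltW e0)// lerDl//.
Qed.

Lemma tconv_smooth_uniform phi s (e : R) : torus_smooth phi -> 0 < e ->
  exists N0, forall N, (N0 <= N)%N -> forall x, `|pds s (tconv N phi) x - pds s phi x| <= e.
Proof.
move=> sphi e0.
have E N : pds s (tconv N phi) = tconv N (pds s phi).
  elim: s => [//|i s IH]; rewrite -[LHS]/(pd i (pds s (tconv N phi))) IH tconv_pd//.
  exact: torus_smooth_C1 (torus_smooth_pds s sphi).
have [N0 hN] := tconv_uniform (torus_smooth_continuous (torus_smooth_pds s sphi)) e0.
by exists N0 => N hNN x; rewrite E; exact: hN.
Qed.

Lemma is_weak_pds_ae s f k f' : torus_L1 k -> torus_ae_eq f k -> is_weak_pds s f f' -> is_weak_pds s k f'.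
Proof.
move=> Lk fk /is_weak_pdsP[Lf Lf' hf]; apply/is_weak_pdsP; split => // phi sphi.
rewrite hf//; congr (_ * _).
have cphi := torus_smooth_continuous (torus_smooth_pds (rev s) sphi).
congr fine; apply: ae_eq_integral => //.
- by apply: measurable_int; apply: dist_of_integrable => //; case: Lf.
- by apply: measurable_int; apply: dist_of_integrable => //; case: Lk.
- by apply: filterS fk => x -> _.
Qed.

Lemma sobolev_ae K f k : periodic k -> measurable_fun setT k -> torus_ae_eq f k -> sobolev K f -> sobolev K k.
Proof.
move=> pk mk fk [Lf hf]; have [Lk _] := torus_L2_ae pk mk fk Lf.
split => // s hs; have [f' h1 h2] := hf s hs.
by exists f' => //; exact: is_weak_pds_ae (torus_L2_L1 Lk) fk h1.
Qed.

Lemma sobolev_compactness (f : nat -> Rd -> R) (C : R) : (forall n, torus_C1 (f n)) ->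
  (forall n, \int[mu]_x f n x ^+ 2 <= C) -> (forall n, \int[mu]_x gdot (f n) (f n) x <= C) ->
  exists s F (G : 'I_d -> Rd -> R) (b : 'I_d -> nat -> Rd -> R),
  [/\ subsequence s, torus_L2 F, {ae mu, forall x, f (s n) x @[n --> \oo] --> F x},
    exists2 H : Rd -> R, integrableR mu H & {ae mu, forall x n, f (s n) x ^+ 2 <= H x} &
    sobolev 1 F /\ forall i,
    [/\ torus_L2 (G i), is_weak_pds [:: i] F (G i), forall n, torus_continuous (b i n),
      \int[mu]_x (b i n x - G i x) ^+ 2 @[n --> \oo] --> (0 : R) &
      forall phi, torus_continuous phi ->
        \int[mu]_x (pd i (f (s n)) x * phi x) @[n --> \oo] --> \int[mu]_x (G i x * phi x)]].
Proof.
move=> Cf b0 b1.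
have gE n : \int[mu]_x gdot (f n) (f n) x = \sum_i \int[mu]_x pd i (f n) x ^+ 2.
  rewrite gdot_int//; apply: eq_bigr => i _; apply: tint_ext => x; by rewrite expr2.
have [s1 [F [ss1 LF cF [H IH hH] L2F]]] := rellich Cf b0 (fun n => eq_ind _ (fun y => y <= C) (b1 n) _ (gE n)).
have cpd i n : torus_continuous (pd i (f (s1 n))) by exact: ((Cf (s1 n)).2 i).2.
have bpd i n : \int[mu]_x pd i (f (s1 n)) x ^+ 2 <= C.
  apply: le_trans (b1 (s1 n)); rewrite gE (bigD1 i)//= lerDl sumr_ge0// => k _.
  by apply: Rint_ge0 => x; exact: sqr_ge0.
have [s2 [G [b [ss2 hG]]]] := weak_compactness_family cpd bpd.
have wG i : is_weak_pds [:: i] F (G i).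
  have [LG _ _ cG] := hG i; apply/is_weak_pdsP; split; [exact: torus_L2_L1|exact: torus_L2_L1|].
  move=> phi sphi; rewrite /= expr1 mulN1r.
  have cphi := torus_smooth_continuous sphi; have cpphi := torus_smooth_continuous (torus_smooth_pd i sphi).
  have c1 := cG phi cphi.
  have c2 : \int[mu]_x (f (s1 (s2 n)) x * pd i phi x) @[n --> \oo] --> \int[mu]_x (F x * pd i phi x).
    have Lf n : torus_L2 (f (s1 n)) by apply: torus_continuous_L2; exact: (Cf _).1.
    have c0 := L2_cvg_pairing Lf LF (torus_continuous_L2 cpphi) L2F.
    exact: (cvg_subsequence ss2 c0).
  have c3 : (fun n => - \int[mu]_x (f (s1 (s2 n)) x * pd i phi x)) @ \oo --> - \int[mu]_x (F x * pd i phi x) by exact: cvgN.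
  rewrite (_ : (fun n => \int[mu]_x (pd i (f (s1 (s2 n))) x * phi x)) = fun n => - \int[mu]_x (f (s1 (s2 n)) x * pd i phi x)) in c1.
    exact: cvg_seq_unique c1 c3.
  by apply/funext => n; exact (Rintegral_by_parts i (Cf _) (torus_smooth_C1 sphi)).
exists (fun n => s1 (s2 n)), F, G, b; split.
- exact: subsequence_comp.
- exact: LF.
- by apply: filterS cF => x cx; exact: cvg_subsequence ss2 cx.
- by exists H => //; apply: filterS hH => x hx n; exact: hx.
split; last by move=> i; have [? ? ? ?] := hG i.
split => // -[|i [|j s]]// _; last by exists (G i) => //; case: (hG i).
exists F => //; apply/is_weak_pdsP; split; [exact: torus_L2_L1|exact: torus_L2_L1|].
by move=> phi sphi; rewrite /= expr0 mul1r.
Qed.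

End compactness_helpers.

(** * Positivity and convergence of the density *)

Section positivity.
Context {R : realType} {d : nat}.
Local Notation Rd := 'rV[R]_d.
Local Notation mu := (torus_measure R d).
Implicit Types f phi psi F : Rd -> R.

Lemma ln_le_sub1 (y : R) : 0 < y -> ln y <= y - 1.
Proof.
move=> y0; rewrite -[X in ln X](subrK 1) addrC; apply: le_ln1Dx.
by rewrite ltrBrDl addrN.
Qed.

Lemma cvg_powR (u : nat -> R) (l p : R) : 0 < l -> u n @[n --> \oo] --> l ->
  u n `^ p @[n --> \oo] --> l `^ p.
Proof.
move=> l0 cu; have cc : {for l, continuous (fun y : R => y `^ p)}.
  apply: differentiable_continuous; apply/derivable1_diffP.
  by have [] := is_derive1_powR p l0.
exact: (cvg_comp u (fun y : R => y `^ p) cu cc).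
Qed.

(* Fatou for -ln (w n + e), e -> 0: the set where W vanishes contributes ln e to the integral. *)
Lemma log_limit_positive (w : nat -> Rd -> R) (W H : Rd -> R) (C : R) : (forall n, torus_continuous (w n)) ->
  (forall n x, 0 < w n x) -> measurable_fun setT W -> {ae mu, forall x, w n x @[n --> \oo] --> W x} ->
  integrableR mu H -> {ae mu, forall x n, w n x ^+ 2 <= H x} ->
  (forall n, torus_continuous (fun x => ln (w n x))) -> (forall n, - C <= \int[mu]_x ln (w n x)) ->
  {ae mu, forall x, 0 < W x}.
Proof.
move=> cw w0 mW cW IH hH clw hC.
have W0 : {ae mu, forall x, 0 <= W x}.
  by apply: filterS cW => x cx; apply: cvg_seq_ge cx _ => n; exact: ltW.
pose A : set Rd := W @^-1` `]-oo, 0].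
have mA : measurable A by rewrite -[A]setTI; exact: mW.
have mind : measurable_fun setT (\1_A : Rd -> R) by exact: measurable_indic.
have Iind : integrableR mu (\1_A : Rd -> R).
  by apply: (@bounded_integrable R _ Rd mu _ 1) => // x; exact: indic_le1.
have key (k : nat) : k%:R * \int[mu]_x (\1_A x : R) <= C + 1 + \int[mu]_x H x.
  pose e : R := expR (- k%:R).
  have e0 : 0 < e by exact: expR_gt0.
  have e1 : e <= 1 by rewrite -expR0 ler_expR oppr_le0 ler0n.
  have lne : ln e = - k%:R by rewrite expRK.
  have up (y : R) : 0 <= y -> ln (y + e) <= 1 + y ^+ 2.
    move=> y0; apply: le_trans (ln_le_sub1 _) _; first by rewrite ltr_wpDl.
    by have := sqr_ge0 (y - 2^-1); rewrite sqrrB; lra.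
  have lo (y : R) : 0 <= y -> - k%:R <= ln (y + e).
    by move=> y0; rewrite -lne ler_ln ?posrE// ?ltr_wpDl// lerDr.
  have k0 : 0 <= k%:R :> R by exact: ler0n.
  have cl n : torus_continuous (fun x => ln (w n x + e)).
    split; first by move=> x i; rewrite (cw n).1.
    move=> x; apply: (@continuous_comp _ _ _ (fun y : Rd => w n y + e) (fun y : R => ln y)).
      exact: ((torus_continuousD (cw n) (torus_continuous_cst e)).2 x).
    by apply: continuous_ln; rewrite addr_gt0.
  have ae_ok : {ae mu, forall x, 0 <= W x /\ W x ^+ 2 <= H x}.
    apply: filterS3 W0 cW hH => x h1 h2 h3; split => //.
    have c2 : w n x * w n x @[n --> \oo] --> W x * W x by exact: cvgM.
    rewrite expr2; apply: cvg_seq_le c2 _ => n; rewrite -expr2; exact: h3.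
  have [IF cI] : integrableR mu (fun x => ln (W x + e)) /\
      \int[mu]_x ln (w n x + e) @[n --> \oo] --> \int[mu]_x ln (W x + e).
    apply: (@Rintegral_dominated R _ Rd mu _ _ (fun x => k%:R + 1 + H x)).
    - by move=> n; exact: torus_continuous_measurable.
    - apply: measurableT_comp; first exact: measurable_ln.
      by apply: measurable_funD => //; exact: measurable_cst.
    - apply: filterS2 cW W0 => x cx x0.
      have c1 : w n x + e @[n --> \oo] --> W x + e by apply: cvgD => //; exact: cvg_cst.
      by apply: continuous_cvg c1; apply: continuous_ln; rewrite ltr_wpDl.
    - by apply: integrableRD => //; apply: tcI; exact: torus_continuous_cst.
    - apply: filterS hH => x hx n.
      have y0 := ltW (w0 n x); have h1 := up _ y0; have h2 := lo _ y0; have h3 := hx n.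
      have h4 := sqr_ge0 (w n x).
      by rewrite ler_norml; apply/andP; split; move: (ln _) (w n x ^+ 2) (H x) h1 h2 h3 h4 => *; lra.
  have C1 : - C <= \int[mu]_x ln (W x + e).
    apply: cvg_seq_ge cI _ => n; apply: le_trans (hC n) _.
    apply: Rint_le; [exact: tcI|exact: tcI|].
    by move=> x; rewrite ler_ln ?posrE ?addr_gt0// lerDl ltW.
  have I1 : integrableR mu (fun x => 1 + H x).
    by apply: integrableRD => //; apply: tcI; exact: torus_continuous_cst.
  have C2 : \int[mu]_x ln (W x + e) <= \int[mu]_x (1 + H x - k%:R * \1_A x).
    apply: le_Rint_ae; [exact: IF|by apply: integrableRB => //; exact: integrableRZ|].
    apply: filterS ae_ok => x [x0 xH]; have := up _ x0.
    rewrite indicE; case: (boolP (x \in A)) => xA hu; rewrite /= ?mulr1 ?mulr0; last by lra.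
    have -> : W x = 0.
      by apply/eqP; rewrite eq_le x0 andbT; move: xA; rewrite in_setE /A /= in_itv.
    rewrite add0r lne; have := sqr_ge0 (W x); lra.
  move: C2; rewrite RintB//; last exact: integrableRZ.
  rewrite RintZ// RintD//; last by apply: tcI; exact: torus_continuous_cst.
  rewrite Rint_cst; move: (k%:R * _) C1 => z; lra.
have IA0 : 0 <= \int[mu]_x (\1_A x : R) by apply: Rint_ge0 => x; rewrite indicE.
have IA : \int[mu]_x (\1_A x : R) = 0.
  apply/eqP; rewrite eq_le IA0 andbT leNgt; apply/negP => I0.
  set D := C + 1 + _ in key; have [k hk] : exists k : nat, D / \int[mu]_x (\1_A x : R) < k%:R.
    by exists (Num.truncn (D / \int[mu]_x (\1_A x : R))).+1; exact: truncnS_gt.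
  by have := key k; rewrite -ler_pdivlMr// leNgt hk.
have A0 : mu A = 0.
  have := @integral_indic _ _ R mu setT measurableT A mA; rewrite setIT => <-.
  by rewrite (Rint_EFin Iind) IA.
have nA : {ae mu, forall x, ~ A x} by exists A; split => // x /=; apply: contrapT.
apply: filterS nA => x; rewrite /A /= in_itv /= => /negP; by rewrite -ltNge.
Qed.

End positivity.

Section limit_density.
Context {R : realType} {d : nat} (E : set R) (h : ('rV[R]_d -> R) -> 'rV[R]_d -> R)
  (g g1 g2 V : 'rV[R]_d -> R -> R -> R) (alpha kappa1 sigma : R).
Local Notation Rd := 'rV[R]_d.
Local Notation mu := (torus_measure R d).
Local Notation periodic := Defs.periodic.
Implicit Types f phi psi F H : Rd -> R.
Hypothesis S : mfg_setting E h g g1 g2 V alpha kappa1.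

Definition approx_seq (C : R) (m u : nat -> Rd -> R) := forall n,
  [/\ torus_smooth (m n), torus_smooth (u n), forall x, 0 < m n x,
    galerkin_bounds alpha C (m n) (u n) & galerkin_relations h V sigma n (m n) (u n)].

Lemma approx_subseq C m u s : subsequence s -> approx_seq C m u ->
  approx_seq C (fun n => m (s n)) (fun n => u (s n)).
Proof.
move=> ss ap n; have [h1 h2 h3 h4 [r1 r2 r3]] := ap (s n); have ns := subsequence_ge n ss.
split => //; split.
- by move=> phi tphi; apply: r1; exact: trig_poly_le tphi.
- by move=> w tw; apply: r2; exact: trig_poly_le tw.
- move=> eta v te tv de; apply: r3; [exact: trig_poly_le te|exact: trig_poly_le tv|].
  by move=> x; apply: le_trans (de x); rewrite lef_pV2 ?posrE ?ltr0Sn// ler_nat !ltnS.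
Qed.

Let al0 : 0 < alpha. Proof. by case: (mfg_V2 S). Qed.

(** The power a = (alpha + 1) / 2 is the one for which w = m^a is bounded in W^{1,2}: w^2 = m^(alpha
    + 1) is controlled by the energy, and |Dw|^2 = a^2 m^(alpha - 1) |Dm|^2 by the second-order
    estimate. Compactness acts on w, and the density is recovered as its power 1/a where the limit
    is positive. *)
Lemma density_limit C m u : approx_seq C m u -> exists s (mf H : Rd -> R),
  [/\ subsequence s, periodic mf /\ measurable_fun setT mf, forall x, 0 < mf x,
    {ae mu, forall x, m (s n) x @[n --> \oo] --> mf x} &
    [/\ integrableR mu H, {ae mu, forall x n, m (s n) x <= H x},
      {ae mu, forall x n, m (s n) x `^ alpha <= H x} &
      sobolev 1 (fun x => mf x `^ ((alpha + 1) / 2))]].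
Proof.
move=> ap; pose a : R := (alpha + 1) / 2.
have a0 : 0 < a by rewrite divr_gt0// addr_gt0.
pose w n x := m n x `^ a.
have Cm n : torus_C1 (m n) by case: (ap n) => /torus_smooth_C1.
have m0 n x : 0 < m n x by case: (ap n).
have w0 n x : 0 < w n x by exact: powR_gt0.
have w2 n x : w n x ^+ 2 = m n x `^ (alpha + 1).
  by rewrite /w -powR_mulrn ?powR_ge0// -powRrM; congr (_ `^ _); rewrite /a; field.
have Cw n := torus_C1_powR a (Cm n) (m0 n).
pose C' : R := C + a ^+ 2 * C.
have C0 : 0 <= C.
  have [_ _ _ [[_ _ + _ _] _] _] := ap 0%N.
  by apply: le_trans; apply: Rint_ge0 => x; exact: gdot_ge0.
have aC : 0 <= a ^+ 2 * C by rewrite mulr_ge0// sqr_ge0.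
have b0 n : \int[mu]_x w n x ^+ 2 <= C'.
  rewrite (tint_ext (w2 n)); have [_ _ _ [[_ + _ _ _] _] _] := ap n.
  by move=> /le_trans; apply; rewrite /C' lerDl.
have b1 n : \int[mu]_x gdot (w n) (w n) x <= C'.
  have [_ _ _ [_ [hb _]] _] := ap n.
  apply: (@le_trans _ _ (a ^+ 2 * C)); last by rewrite /C' lerDr.
  apply: le_trans (ler_wpM2l (sqr_ge0 a) hb).
  have cg := gdot_continuous (Cm n) (Cm n).
  have cp := torus_continuous_powR (alpha - 1) (Cm n).1 (m0 n).
  rewrite -RintZ; last by ti_solve.
  rewrite le_eqVlt; apply/orP; left; apply/eqP; apply: tint_ext => x.
  rewrite /gdot !big_distrr; apply: eq_bigr => i _ /=.
  have -> : m n x `^ (alpha - 1) = m n x `^ (a - 1) ^+ 2.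
    by rewrite -powR_mulrn ?powR_ge0// -powRrM; congr (_ `^ _); rewrite /a; field.
  rewrite (Cw n).2; ring.
have [s [W [G [b [ss [pW mW IW2] cW [H IH hH] [sW hG]]]]]] := sobolev_compactness (fun n => (Cw n).1) b0 b1.
have Wpos : {ae mu, forall x, 0 < W x}.
  apply: (@log_limit_positive R d (fun n => w (s n)) W H (a * C)) => //.
  - by move=> n; exact: (Cw _).1.1.
  - by move=> n; have [Cl _] := torus_C1_ln (Cw (s n)).1 (w0 (s n)); exact: Cl.1.
  - move=> n; have [_ _ _ [_ [_ hb]] _] := ap (s n).
    have [Cl _] := torus_C1_ln (Cm (s n)) (m0 (s n)).
    rewrite (@tint_ext _ _ (fun x => a * ln (m (s n) x))); last by move=> x; rewrite ln_powR.
    by rewrite RintZ ?(tcI Cl.1)// -mulrN; apply: ler_wpM2l => //; exact: ltW.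
(* The value 1 on the null set where W vanishes keeps mf in E everywhere. *)
pose mf x := if 0 < W x then W x `^ a^-1 else 1.
have mf0 x : 0 < mf x by rewrite /mf; case: ifP => // ?; exact: powR_gt0.
have mmf : measurable_fun setT mf.
  apply: measurable_fun_ifT.
  - by apply: measurable_fun_ltr => //; exact: measurable_cst.
  - exact: measurableT_comp (measurable_powR _) mW.
  - exact: measurable_cst.
have pmf : periodic mf by move=> x i; rewrite /mf pW.
have mfa : torus_ae_eq W (fun x => mf x `^ a).
  by apply: filterS Wpos => x x0; rewrite /mf x0 -powRrM mulVf ?gt_eqF// powRr1// ltW.
have y1 (y p : R) : 0 < y -> 0 <= p <= alpha + 1 -> y `^ p <= 1 + y `^ (alpha + 1).
  move=> y0 /andP[p0 p1]; have [y1|/ltW y1] := leP y 1.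
    apply: (@le_trans _ _ 1); last by rewrite lerDl powR_ge0.
    have := @ge0_ler_powR R p p0 y 1; rewrite !nnegrE powR1; apply => //; exact: ltW.
  by apply: (@le_trans _ _ (y `^ (alpha + 1))); [exact: ler_powR|rewrite lerDr].
exists s, mf, (fun x => 1 + H x); split; [exact: ss|by []|exact: mf0| |].
- apply: filterS2 Wpos cW => x x0 cx; rewrite /mf x0.
  have -> : (fun n => m (s n) x) = fun n => (w (s n) x) `^ a^-1.
    by apply/funext => n; rewrite /w -powRrM mulfV ?gt_eqF// powRr1// ltW.
  exact: cvg_powR x0 cx.
split.
- by apply: integrableRD => //; apply: tcI; exact: torus_continuous_cst.
- apply: filterS hH => x hx n; rewrite -[m (s n) x]powRr1 ?(ltW (m0 _ _))//.
  apply: le_trans (y1 _ _ (m0 _ _) _) _; first by rewrite ler01 lerDr ltW.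
  by rewrite lerD2l -w2; exact: hx.
- apply: filterS hH => x hx n.
  apply: le_trans (y1 _ _ (m0 _ _) _) _; first by rewrite ltW//= lerDl.
  by rewrite lerD2l -w2; exact: hx.
- have pmfa : periodic (fun x => mf x `^ a) by move=> x i; rewrite pmf.
  have mmfa : measurable_fun setT (fun x => mf x `^ a) by exact: measurableT_comp (measurable_powR _) mmf.
  exact (sobolev_ae pmfa mmfa mfa sW).
Qed.

End limit_density.

Section limits.
Context {R : realType} {d : nat} (E : set R) (h : ('rV[R]_d -> R) -> 'rV[R]_d -> R)
  (g g1 g2 V : 'rV[R]_d -> R -> R -> R) (alpha kappa1 sigma : R).
Local Notation Rd := 'rV[R]_d.
Local Notation mu := (torus_measure R d).
Local Notation periodic := Defs.periodic.
Implicit Types f phi psi F H : Rd -> R.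
Hypothesis S : mfg_setting E h g g1 g2 V alpha kappa1.

Lemma integrableR_ae f F : measurable_fun setT f -> torus_ae_eq f F -> integrableR mu F -> integrableR mu f.
Proof.
move=> mf fF IF; have mF := integrableR_measurable IF.
move/integrableP: IF => [_ IF]; apply/integrableP; split; first exact/measurable_EFinP.
rewrite (@ae_eq_integral _ _ _ mu setT (fun x => `|(F x)%:E|))%E//.
- by apply/measurable_EFinP; exact: measurableT_comp.
- by apply/measurable_EFinP; exact: measurableT_comp.
- by apply: filterS fF => x /= -> _.
Qed.

Lemma Rint_ae f F : measurable_fun setT f -> measurable_fun setT F -> torus_ae_eq f F ->
  \int[mu]_x f x = \int[mu]_x F x.
Proof.
move=> mf mF fF; congr fine; apply: ae_eq_integral => //; [exact/measurable_EFinP|exact/measurable_EFinP|].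
by apply: filterS fF => x /= -> _.
Qed.

(** [G] is a fixed representative of the weak gradient of uf, and [b] are continuous functions
    tending to it in L^2. The limit of the momentum m Du is recorded as the product mf G, since
    convergence of each factor alone would not determine it. *)
Record limit_data (C : R) (m u : nat -> Rd -> R) (mf uf : Rd -> R) (G : 'I_d -> Rd -> R)
    (b : 'I_d -> nat -> Rd -> R) (H HV : Rd -> R) : Prop := LimitData {
  lim_approx : approx_seq h V alpha sigma C m u;
  lim_dens : dens E mf;
  lim_mf0 : forall x, 0 < mf x;
  lim_m : {ae mu, forall x, m n x @[n --> \oo] --> mf x};
  lim_H : integrableR mu H;
  lim_mH : {ae mu, forall x n, `|m n x| <= H x};
  lim_power : sobolev 1 (fun x => mf x `^ ((alpha + 1) / 2));
  lim_HV : integrableR mu HV;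
  lim_V : {ae mu, forall x, nem h V (m n) x @[n --> \oo] --> nem h V mf x};
  lim_VH : {ae mu, forall x n, `|nem h V (m n) x| <= HV x};
  lim_uf : torus_L2 uf;
  lim_usob : sobolev 1 uf;
  lim_u : forall phi, torus_continuous phi ->
    \int[mu]_x (u n x * phi x) @[n --> \oo] --> \int[mu]_x (uf x * phi x);
  lim_G : forall i, torus_L2 (G i) /\ is_weak_pds [:: i] uf (G i);
  lim_b : forall i, (forall n, torus_continuous (b i n)) /\
      \int[mu]_x (b i n x - G i x) ^+ 2 @[n --> \oo] --> (0 : R);
  lim_Du : forall i phi, torus_continuous phi ->
    \int[mu]_x (pd i (u n) x * phi x) @[n --> \oo] --> \int[mu]_x (G i x * phi x);
  lim_mG : forall i, integrableR mu (fun x => mf x * G i x);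
  lim_mDu : forall i phi, torus_continuous phi ->
    \int[mu]_x (m n x * pd i (u n) x * phi x) @[n --> \oo] --> \int[mu]_x (mf x * G i x * phi x) }.

(* The weak limit of r n * Du n, r n = sqrt (m n), is identified thanks to the strong convergence of r n. *)
Lemma momentum_limit (C : R) (m u : nat -> Rd -> R) (mf H : Rd -> R) (G : 'I_d -> Rd -> R) :
  (forall n, torus_continuous (m n)) -> (forall n x, 0 < m n x) -> (forall n, torus_C1 (u n)) ->
  (forall n, \int[mu]_x gdot (u n) (u n) x <= C) -> (forall n, \int[mu]_x (m n x * gdot (u n) (u n) x) <= C) ->
  periodic mf -> integrableR mu mf -> (forall x, 0 < mf x) ->
  {ae mu, forall x, m n x @[n --> \oo] --> mf x} -> integrableR mu H ->
  {ae mu, forall x n, `|m n x| <= H x} -> (forall i, torus_L2 (G i)) ->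
  (forall i phi, torus_continuous phi ->
    \int[mu]_x (pd i (u n) x * phi x) @[n --> \oo] --> \int[mu]_x (G i x * phi x)) ->
  exists2 s, subsequence s & forall i, integrableR mu (fun x => mf x * G i x) /\
    forall phi, torus_continuous phi ->
    \int[mu]_x (m (s n) x * pd i (u (s n)) x * phi x) @[n --> \oo] --> \int[mu]_x (mf x * G i x * phi x).
Proof.
move=> cm m0 Cu b1 b2 pmf Imf mf0 lm IH mH LG lDu.
have mmf := integrableR_measurable Imf.
pose r n x := m n x `^ 2^-1; pose rf x := mf x `^ 2^-1.
have rr n x : r n x * r n x = m n x.
  by rewrite /r -powRD; [rewrite (_ : 2^-1 + 2^-1 = 1) ?powRr1 ?(ltW (m0 n x))//; field|rewrite (gt_eqF (m0 n x)) implybT].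
have rrf x : rf x * rf x = mf x.
  by rewrite /rf -powRD; [rewrite (_ : 2^-1 + 2^-1 = 1) ?powRr1 ?(ltW (mf0 x))//; field|rewrite (gt_eqF (mf0 x)) implybT].
have cr n : torus_continuous (r n) by exact: torus_continuous_powR.
have mrf : measurable_fun setT rf by exact: measurableT_comp (measurable_powR _) mmf.
have Lrf : torus_L2 rf.
  split => //; first by move=> x i; rewrite /rf pmf.
  by rewrite (_ : (fun x => (rf x ^+ 2)%:E) = (EFin \o mf)) //; apply/funext => x; rewrite /= expr2 rrf.
have lr : {ae mu, forall x, r n x @[n --> \oo] --> rf x}.
  by apply: filterS lm => x cx; exact: cvg_powR (mf0 x) cx.
have Lrfphi phi : torus_continuous phi -> torus_L2 (fun x => rf x * phi x).
  move=> cphi; have mphi := torus_continuous_measurable cphi; have [M hM] := torus_continuous_bounded cphi.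
  split; first by move=> x i; rewrite /rf pmf (cphi.1).
    exact: measurable_funM.
  rewrite -[X in mu.-integrable _ X]/(EFin \o (fun x => (rf x * phi x) ^+ 2)).
  have cp2 := torus_continuousX 2 cphi.
  rewrite (_ : (fun x => (rf x * phi x) ^+ 2) = fun x => mf x * phi x ^+ 2).
    exact: dist_of_integrable Imf cp2.
  by apply/funext => x; rewrite exprMn -(rrf x) !expr2.
have strong phi : torus_continuous phi -> \int[mu]_x (r n x * phi x - rf x * phi x) ^+ 2 @[n --> \oo] --> (0 : R).
  move=> cphi; have mphi := torus_continuous_measurable cphi; have [M hM] := torus_continuous_bounded cphi.
  have := @Rintegral_dominated R _ Rd mu (fun n x => (r n x * phi x - rf x * phi x) ^+ 2) (fun=> 0)
    (fun x => 2 * M ^+ 2 * (H x + mf x)).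
  rewrite Rint_cst; case.
  - move=> n; apply: measurable_funX; apply: measurable_funB; apply: measurable_funM => //.
    exact: torus_continuous_measurable.
  - exact: measurable_cst.
  - apply: filterS lr => x cx.
    have c1 : r n x * phi x - rf x * phi x @[n --> \oo] --> rf x * phi x - rf x * phi x.
      by apply: cvgB; [apply: cvgM => //; exact: cvg_cst|exact: cvg_cst].
    have c2 : (r n x * phi x - rf x * phi x) * (r n x * phi x - rf x * phi x) @[n --> \oo] -->
        (rf x * phi x - rf x * phi x) * (rf x * phi x - rf x * phi x) by exact: cvgM.
    rewrite subrr mul0r in c2.
    have E2 : (fun n => (r n x * phi x - rf x * phi x) ^+ 2) =
        fun n => (r n x * phi x - rf x * phi x) * (r n x * phi x - rf x * phi x) by apply/funext => n; rewrite expr2.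
    by rewrite E2.
  - by apply: integrableRZ; exact: integrableRD.
  - apply: filterS mH => x mx n; rewrite ger0_norm ?sqr_ge0//.
    have -> : (r n x * phi x - rf x * phi x) ^+ 2 = phi x ^+ 2 * (r n x - rf x) ^+ 2 by ring.
    have h1 : (r n x - rf x) ^+ 2 <= 2 * (H x + mf x).
      have := mx n; rewrite ger0_norm ?(ltW (m0 n x))// -rr -rrf => h2.
      by have := sqr_ge0 (r n x + rf x); move: (r n x) (rf x) h2 => y z h2; rewrite sqrrD sqrrB !expr2; lra.
    have h2 : phi x ^+ 2 <= M ^+ 2.
      by rewrite -(real_normK (num_real (phi x))) lerXn2r ?nnegrE//; exact: le_trans (hM x).
    have -> : 2 * M ^+ 2 * (H x + mf x) = M ^+ 2 * (2 * (H x + mf x)) by ring.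
    by apply: ler_pM; [exact: sqr_ge0|exact: sqr_ge0|exact: h2|exact: h1].
  - by [].
pose gg i n x := r n x * pd i (u n) x.
have cgg i n : torus_continuous (gg i n).
  by apply: torus_continuousM => //; exact: ((Cu n).2 i).2.
have bgg i n : \int[mu]_x gg i n x ^+ 2 <= C.
  have cg := gdot_continuous (Cu n) (Cu n); have cmn := cm n; have cgin := cgg i n.
  apply: le_trans (b2 n); apply: Rint_le; [by ti_solve|by ti_solve|].
  move=> x; rewrite /gg exprMn expr2 rr; apply: ler_wpM2l; [exact: ltW|exact: sqr_pd_gdot].
have [s [Z [bZ [ss hZ]]]] := weak_compactness_family cgg bgg.
exists s => // i; have [LZ _ _ cZ] := hZ i.
have cpd n : torus_continuous (pd i (u n)) by exact: ((Cu n).2 i).2.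
have bpd n : \int[mu]_x pd i (u n) x ^+ 2 <= C.
  have cg := gdot_continuous (Cu n) (Cu n); have cpn := cpd n.
  apply: le_trans (b1 n); apply: Rint_le; [by ti_solve|by ti_solve|].
  by move=> x; exact: sqr_pd_gdot.
have mG : measurable_fun setT (G i) by case: (LG i).
have mZ : measurable_fun setT (Z i) by case: LZ.
have crphi n phi : torus_continuous phi -> torus_continuous (fun x => r n x * phi x).
  by move=> cphi; exact: torus_continuousM.
have Zeq : torus_ae_eq (Z i) (fun x => G i x * rf x).
  apply: fundamental_lemma; [exact: (torus_L2_L1 LZ).2|exact: (L2_pairing (LG i) Lrf).1|].
  move=> phi sphi; have cphi := torus_smooth_continuous sphi.
  have c1 := cZ phi cphi.
  have c2 := strong_weak cpd (fun n => crphi n phi cphi) (LG i) (Lrfphi phi cphi) bpd (lDu i) (strong phi cphi).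
  have c3 := cvg_subsequence ss c2.
  have -> : \int[mu]_x (G i x * rf x * phi x) = \int[mu]_x (G i x * (rf x * phi x)).
    by apply: tint_ext => x; rewrite mulrA.
  apply: cvg_seq_unique c1 _.
  rewrite (_ : (fun n => \int[mu]_x (gg i (s n) x * phi x)) = fun n => \int[mu]_x (pd i (u (s n)) x * (r (s n) x * phi x))) //.
  by apply/funext => n; apply: tint_ext => x; rewrite /gg; move: (pd i _ x) (r _ x) => *; ring.
have mGE : torus_ae_eq (fun x => mf x * G i x) (fun x => Z i x * rf x).
  by apply: filterS Zeq => x ->; rewrite -mulrA rrf mulrC.
split.
  by apply: integrableR_ae mGE _; [exact: measurable_funM|exact: (L2_pairing LZ Lrf).1].
move=> phi cphi; have mphi := torus_continuous_measurable cphi.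
have c1 := strong_weak (fun n => cgg i (s n)) (fun n => crphi (s n) phi cphi) LZ (Lrfphi phi cphi) (fun n => bgg i (s n)) cZ
  (cvg_subsequence ss (strong phi cphi)).
rewrite (@Rint_ae (fun x => mf x * G i x * phi x) (fun x => Z i x * (rf x * phi x))); last first.
- by apply: filterS mGE => x ->; rewrite mulrA.
- by apply: measurable_funM => //; exact: measurable_funM.
- by apply: measurable_funM => //; exact: measurable_funM.
rewrite (_ : (fun n => \int[mu]_x (m (s n) x * pd i (u (s n)) x * phi x)) = fun n => \int[mu]_x (gg i (s n) x * (r (s n) x * phi x))) //.
apply/funext => n; apply: tint_ext => x; rewrite /gg -(rr (s n) x).
by move: (pd i _ x) (r _ x) => *; ring.
Qed.

Lemma limit_exists : exists C m u mf uf G b H HV, limit_data C m u mf uf G b H HV.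
Proof.
have [C C0 hC] := approximation sigma S.
have [m0 hm0] := choice hC; have [u0 ap0] := choice hm0.
have {}ap0 : approx_seq h V alpha sigma C m0 u0 by exact: ap0.
have [s1 [mf [H [ss1 [pmf mmf] mf0 cm1 [IH mH1 aH1 pow]]]]] := density_limit S ap0.
have ap1 := approx_subseq ss1 ap0.
have Imf : integrableR mu mf.
  have := @Rintegral_dominated R _ Rd mu (fun n => m0 (s1 n)) mf H.
  case => //.
  - by move=> n; apply: torus_continuous_measurable; case: (ap1 n) => /torus_smooth_continuous.
  - apply: filterS mH1 => x hx n; rewrite ger0_norm//.
    by case: (ap1 n) => _ _ p _ _; exact: ltW (p x).
have dmf : dens E mf by split; [split|move=> x; exact: (E_gt0 S)].
have dm1 n : dens E (m0 (s1 n)) by case: (ap1 n) => sm _ p _ _; exact: (smooth_dens S).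
have [s2 [ss2 [HV IHV [cV bV]]]] := nem_V_cvg S dm1 dmf cm1 IH mH1 aH1.
have ap2 := approx_subseq ss2 ap1.
pose m2 n := m0 (s1 (s2 n)); pose u2 n := u0 (s1 (s2 n)).
have Cu2 n : torus_C1 (u2 n) by case: (ap2 n) => _ /torus_smooth_C1.
have bu2 n : \int[mu]_x u2 n x ^+ 2 <= C by case: (ap2 n) => _ _ _ [[]].
have bgu2 n : \int[mu]_x gdot (u2 n) (u2 n) x <= C by case: (ap2 n) => _ _ _ [[]].
have [s3 [uf [G [b [ss3 Luf cu3 [Hu IHu bu3] [suf hG]]]]]] := sobolev_compactness Cu2 bu2 bgu2.
have ap3 := approx_subseq ss3 ap2.
have cm3 : {ae mu, forall x, m2 (s3 n) x @[n --> \oo] --> mf x}.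
  apply: filterS cm1 => x cx; exact: (cvg_subsequence ss3 (cvg_subsequence ss2 cx)).
have mH3 : {ae mu, forall x n, `|m2 (s3 n) x| <= H x}.
  apply: filterS mH1 => x hx n; rewrite ger0_norm; first exact: hx.
  by case: (ap3 n) => _ _ p _ _; exact: ltW (p x).
have LG i : torus_L2 (G i) by case: (hG i).
have lDu i phi : torus_continuous phi ->
    \int[mu]_x (pd i (u2 (s3 n)) x * phi x) @[n --> \oo] --> \int[mu]_x (G i x * phi x).
  by case: (hG i) => _ _ _ _; apply.
have [s4 ss4 hmom] : exists2 s, subsequence s & forall i, integrableR mu (fun x => mf x * G i x) /\
    forall phi, torus_continuous phi ->
    \int[mu]_x (m2 (s3 (s n)) x * pd i (u2 (s3 (s n))) x * phi x) @[n --> \oo] --> \int[mu]_x (mf x * G i x * phi x).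
  have q1 n : torus_continuous (m2 (s3 n)) by case: (ap3 n) => /torus_smooth_continuous.
  have q2 n x : 0 < m2 (s3 n) x by case: (ap3 n) => _ _ p _ _; exact: p.
  have q3 n : \int[mu]_x (m2 (s3 n) x * gdot (u2 (s3 n)) (u2 (s3 n)) x) <= C by case: (ap3 n) => _ _ _ [[]].
  exact (momentum_limit q1 q2 (fun n => Cu2 (s3 n)) (fun n => bgu2 (s3 n)) q3 pmf Imf mf0 cm3 IH mH3 LG lDu).
have ap4 := approx_subseq ss4 ap3.
exists C, (fun n => m2 (s3 (s4 n))), (fun n => u2 (s3 (s4 n))), mf, uf, G, b, H, HV.
have cu phi : torus_continuous phi ->
    \int[mu]_x (u2 (s3 n) x * phi x) @[n --> \oo] --> \int[mu]_x (uf x * phi x).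
  move=> cphi.
  have p1 n : measurable_fun setT (u2 (s3 n)) by exact: torus_continuous_measurable (Cu2 _).1.
  have p2 : measurable_fun setT uf by case: Luf.
  have p3 : integrableR mu (fun x => 1 + Hu x) by apply: integrableRD => //; apply: tcI; exact: torus_continuous_cst.
  have p4 : {ae mu, forall x n, `|u2 (s3 n) x| <= 1 + Hu x}.
    apply: filterS bu3 => x hx n; have := hx n; rewrite -(real_normK (num_real (u2 (s3 n) x))).
    by move: `|_| => y hy; have := sqr_ge0 (y - 2^-1); rewrite sqrrB; lra.
  exact (dominated_pairing p1 p2 cu3 p3 p4 cphi).2.
have lm4 : {ae mu, forall x, m2 (s3 (s4 n)) x @[n --> \oo] --> mf x}.
  by apply: filterS cm3 => x cx; exact: (cvg_subsequence ss4 cx).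
have lmH4 : {ae mu, forall x n, `|m2 (s3 (s4 n)) x| <= H x}.
  by apply: filterS mH3 => x hx n; exact: hx.
have lV4 : {ae mu, forall x, nem h V (m2 (s3 (s4 n))) x @[n --> \oo] --> nem h V mf x}.
  by apply: filterS cV => x cx; exact: (cvg_subsequence ss4 (cvg_subsequence ss3 cx)).
have lVH4 : {ae mu, forall x n, `|nem h V (m2 (s3 (s4 n))) x| <= HV x}.
  by apply: filterS bV => x hx n; exact: hx.
split; [exact: ap4|exact: dmf|exact: mf0|exact: lm4|exact: IH|exact: lmH4|exact: pow|exact: IHV|
  exact: lV4|exact: lVH4|exact: Luf|exact: suf| | | | | |].
- by move=> phi cphi; exact: (cvg_subsequence ss4 (cu phi cphi)).
- by move=> i; case: (hG i) => w1 w2 _ _ _; split.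
- by move=> i; case: (hG i) => _ _ w1 w2 _; split.
- by move=> i phi cphi; exact: (cvg_subsequence ss4 (lDu i phi cphi)).
- by move=> i; case: (hmom i).
- by move=> i phi cphi; have [_] := hmom i; apply.
Qed.

End limits.

Section real_limits.
Context {R : realType}.
Implicit Types (a b : nat -> R) (l k : R).

Lemma cvgR_add a b l k : a n @[n --> \oo] --> l -> b n @[n --> \oo] --> k ->
  a n + b n @[n --> \oo] --> l + k.
Proof. exact: cvgD. Qed.

Lemma cvgR_sub a b l k : a n @[n --> \oo] --> l -> b n @[n --> \oo] --> k ->
  a n - b n @[n --> \oo] --> l - k.
Proof. exact: cvgB. Qed.

Lemma cvgR_scale (c : R) a l : a n @[n --> \oo] --> l -> c * a n @[n --> \oo] --> c * l.
Proof. by move=> h; apply: cvgM => //; exact: cvg_cst. Qed.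

Lemma cvgR_cst (c : R) : (fun _ : nat => c) @ \oo --> c.
Proof. exact: cvg_cst. Qed.

Lemma quadratic_arith (p y t M : R) : p * (y - t) ^+ 2 <= M * (y - t) ^+ 2 ->
  t ^+ 2 * p - M * (y - t) ^+ 2 <= 2 * (t * (y * p)) - y ^+ 2 * p.
Proof.
have -> : p * (y - t) ^+ 2 = p * y ^+ 2 - 2 * (t * (y * p)) + p * t ^+ 2 by ring.
rewrite (mulrC (t ^+ 2)) (mulrC (y ^+ 2)); move: (p * _) (p * _) (t * _) (M * _) => *; lra.
Qed.

Lemma hj_arith (A Z X B a y s : R) : A - Z <= 2 * X - B -> 0 <= a - y - (X - 2^-1 * B) + s ->
  0 <= a - y - 2^-1 * A + s + 2^-1 * Z.
Proof. by move=> *; lra. Qed.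

End real_limits.

(** * Equation, inequality and Minty form for the limit *)

Section limit_equations.
Context {R : realType} {d : nat} (E : set R) (h : ('rV[R]_d -> R) -> 'rV[R]_d -> R)
  (g g1 g2 V : 'rV[R]_d -> R -> R -> R) (alpha kappa1 sigma : R).
Local Notation Rd := 'rV[R]_d.
Local Notation mu := (torus_measure R d).
Local Notation periodic := Defs.periodic.
Implicit Types phi psi eta v w : Rd -> R.
Hypothesis S : mfg_setting E h g g1 g2 V alpha kappa1.
Variables (C : R) (m u : nat -> Rd -> R) (mf uf : Rd -> R) (G : 'I_d -> Rd -> R)
    (b : 'I_d -> nat -> Rd -> R) (H HV : Rd -> R).
Hypothesis L : limit_data E h V alpha sigma C m u mf uf G b H HV.

Let sm n : torus_smooth (m n). Proof. by case: (lim_approx L n). Qed.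
Let su n : torus_smooth (u n). Proof. by case: (lim_approx L n). Qed.
Let m0 n x : 0 < m n x. Proof. by case: (lim_approx L n) => _ _ p _ _; exact: p. Qed.
Let cm n : torus_continuous (m n). Proof. exact: torus_smooth_continuous. Qed.
Let cu n : torus_continuous (u n). Proof. exact: torus_smooth_continuous. Qed.
Let Imf : integrableR mu mf. Proof. by case: (lim_dens L) => -[]. Qed.
Let Iuf : integrableR mu uf. Proof. exact: (torus_L2_L1 (lim_uf L)).2. Qed.
Let cVn n : torus_continuous (nem h V (m n)). Proof. exact: (nem_V_smooth S). Qed.

Lemma density_pairing phi : torus_continuous phi ->
  \int[mu]_x (m n x * phi x) @[n --> \oo] --> \int[mu]_x (mf x * phi x).
Proof.
move=> cphi.
exact (dominated_pairing (fun n => torus_continuous_measurable (cm n)) (integrableR_measurable Imf)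
  (lim_m L) (lim_H L) (lim_mH L) cphi).2.
Qed.

Lemma limit_mass : \int[mu]_x mf x = 1.
Proof.
have c1 := density_pairing (@torus_continuous_cst R d 1).
have E1 (f : Rd -> R) : \int[mu]_x (f x * 1) = \int[mu]_x f x by apply: tint_ext => x; rewrite mulr1.
rewrite E1 in c1; apply: cvg_seq_unique c1 _.
rewrite (_ : (fun n => \int[mu]_x (m n x * 1)) = fun=> 1); first exact: cvg_cst.
by apply/funext => n; rewrite E1; case: (lim_approx L n) => _ _ _ [[]].
Qed.

Lemma nem_limit : integrableR mu (nem h V mf) /\ forall phi, torus_continuous phi ->
  \int[mu]_x (nem h V (m n) x * phi x) @[n --> \oo] --> \int[mu]_x (nem h V mf x * phi x).
Proof.
have mV := nem_V_measurable S (lim_dens L).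
have D phi (cphi : torus_continuous phi) := dominated_pairing (fun n => torus_continuous_measurable (cVn n)) mV
  (lim_V L) (lim_HV L) (lim_VH L) cphi.
split; last by move=> phi /D[].
have [I1 _] := D _ (@torus_continuous_cst R d 1).
by rewrite (_ : nem h V mf = fun x => nem h V mf x * 1)//; apply/funext => x; rewrite mulr1.
Qed.

(** A test polynomial of degree N is admissible for the approximate solution of rank n once n >= N,
    so limits are taken along shifted sequences. *)
Let shift N : subsequence (fun n => n + N)%N. Proof. by move=> n; rewrite addSn. Qed.

(** The derivatives of m in the sigma term are moved onto w: in this form every term is a pairing
    whose limit is recorded in [limit_data] or given by [density_pairing]. *)
Lemma limit_fp_trig N w : trig_poly N w ->
  \int[mu]_x (mf x * w x) + \sum_i \int[mu]_x (mf x * G i x * pd i w x)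
  - sigma ^+ 2 * (\sum_i \int[mu]_x (mf x * pd i (pd i w) x)) - \int[mu]_x (1 * w x) = 0.
Proof.
move=> tw; have sw := trig_poly_smooth tw; have Cw := torus_smooth_C1 sw; have cw := Cw.1.
have c1 := density_pairing cw.
have c2 : \sum_i \int[mu]_x (m n x * pd i (u n) x * pd i w x) @[n --> \oo] --> \sum_i \int[mu]_x (mf x * G i x * pd i w x).
  by apply: cvg_sum_seq => i; apply: (lim_mDu L); tc_solve.
have c3 : \sum_i \int[mu]_x (m n x * pd i (pd i w) x) @[n --> \oo] --> \sum_i \int[mu]_x (mf x * pd i (pd i w) x).
  by apply: cvg_sum_seq => i; apply: density_pairing; tc_solve.
pose T n := \int[mu]_x (m n x * w x) + \sum_i \int[mu]_x (m n x * pd i (u n) x * pd i w x)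
  - sigma ^+ 2 * (\sum_i \int[mu]_x (m n x * pd i (pd i w) x)) - \int[mu]_x (1 * w x).
have cT : T n @[n --> \oo] --> \int[mu]_x (mf x * w x) + \sum_i \int[mu]_x (mf x * G i x * pd i w x)
  - sigma ^+ 2 * (\sum_i \int[mu]_x (mf x * pd i (pd i w) x)) - \int[mu]_x (1 * w x).
  exact (cvgR_sub (cvgR_sub (cvgR_add c1 c2) (cvgR_scale c3)) (@cvgR_cst _ _)).
have cT' := cvg_subsequence (shift N) cT.
apply: cvg_seq_unique cT' _.
rewrite (_ : (fun n => T (n + N)%N) = fun=> 0); first exact: cvg_cst.
apply/funext => n; set k := (n + N)%N.
have [_ _ _ _ [_ fp _]] := lim_approx L k.
have smk := sm k; have suk := su k; have Cu := torus_smooth_C1 suk; have Cm := torus_smooth_C1 smk.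
have := fp w (trig_poly_le (leq_addl n N) tw); rewrite A2_weak// => <-.
have a1 := gdot_continuous Cu Cw; have a2 := gdot_continuous Cm Cw.
have e1 : \int[mu]_x (m k x * gdot (u k) w x) = \sum_i \int[mu]_x (m k x * pd i (u k) x * pd i w x).
  rewrite -Rint_sum; last by move=> i; ti_solve.
  by apply: tint_ext => x; rewrite /gdot big_distrr; apply: eq_bigr => i _ /=; rewrite mulrA.
have e2 : \int[mu]_x gdot (m k) w x = - \sum_i \int[mu]_x (m k x * pd i (pd i w) x).
  rewrite (gdotC (m k)) -[LHS]opprK -(laplacian_weak sw Cm); congr (- _).
  rewrite -Rint_sum; last by move=> i; ti_solve.
  by apply: tint_ext => x; rewrite /laplacian big_distrl; apply: eq_bigr => i _ /=; rewrite mulrC.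
have I1 : integrableR mu (fun x => m k x * w x) by ti_solve.
have I2 : integrableR mu (fun x => m k x * gdot (u k) w x) by ti_solve.
have I3 : integrableR mu (fun x => sigma ^+ 2 * gdot (m k) w x) by ti_solve.
have I4 : integrableR mu w by exact: tcI.
rewrite (RintB (integrableRD (integrableRD I1 I2) I3) I4) (RintD (integrableRD I1 I2) I3) (RintD I1 I2).
rewrite RintZ ?e1 ?e2; last exact: tcI.
rewrite /T (@tint_ext _ _ w (fun x => 1 * w x)); last by move=> x; rewrite mul1r.
by rewrite mulrN.
Qed.

Lemma tconv_pairing s (f : Rd -> R) phi : integrableR mu f -> torus_smooth phi ->
  \int[mu]_x (f x * pds s (tconv n phi) x) @[n --> \oo] --> \int[mu]_x (f x * pds s phi x).
Proof.
move=> If sphi; have cphi := torus_smooth_continuous sphi.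
apply: (uniform_pairing If).
- move=> n; apply: torus_smooth_continuous; apply: torus_smooth_pds.
  exact: trig_poly_smooth (tconv_trig n (tcI cphi)).
- exact: torus_smooth_continuous (torus_smooth_pds s sphi).
- by move=> e e0; exact: tconv_smooth_uniform.
Qed.

Lemma limit_fp phi : torus_smooth phi ->
  \int[mu]_x (mf x * phi x) + \sum_i \int[mu]_x (mf x * G i x * pd i phi x)
  - sigma ^+ 2 * (\sum_i \int[mu]_x (mf x * pd i (pd i phi) x)) - \int[mu]_x (1 * phi x) = 0.
Proof.
move=> sphi; have cphi := torus_smooth_continuous sphi.
have c1 := tconv_pairing (s := [::]) Imf sphi.
have c2 i := tconv_pairing (s := [:: i]) (lim_mG L i) sphi.
have c3 i := tconv_pairing (s := [:: i; i]) Imf sphi.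
have c4 := tconv_pairing (s := [::]) (tcI (@torus_continuous_cst R d 1)) sphi.
pose T (w : Rd -> R) := \int[mu]_x (mf x * w x) + \sum_i \int[mu]_x (mf x * G i x * pd i w x)
  - sigma ^+ 2 * (\sum_i \int[mu]_x (mf x * pd i (pd i w) x)) - \int[mu]_x (1 * w x).
have cT : T (tconv n phi) @[n --> \oo] --> T phi.
  exact (cvgR_sub (cvgR_sub (cvgR_add c1 (cvg_sum_seq (r := index_enum 'I_d) c2)) (cvgR_scale (cvg_sum_seq (r := index_enum 'I_d) c3))) c4).
rewrite -[LHS]/(T phi); apply: cvg_seq_unique cT _.
rewrite (_ : (fun n => T (tconv n phi)) = fun=> 0); first exact: cvg_cst.
by apply/funext => n; exact: limit_fp_trig (tconv_trig n (tcI cphi)).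
Qed.

Let G2 i : integrableR mu (fun x => G i x ^+ 2). Proof. by case: (lim_G L i) => -[]. Qed.

Definition hj_functional phi : R := \int[mu]_x (nem h V mf x * phi x) - \int[mu]_x (uf x * phi x)
  - 2^-1 * (\sum_i \int[mu]_x (G i x ^+ 2 * phi x)) + sigma ^+ 2 * (\sum_i \int[mu]_x (uf x * pd i (pd i phi) x)).

(* Lower semicontinuity: |Du|^2 >= 2 Du . b - |b|^2 for continuous b, and then b -> G in L^2. *)
Lemma limit_hj_trig N phi : trig_poly N phi -> (forall x, 0 <= phi x) -> 0 <= hj_functional phi.
Proof.
move=> tphi phi0; have sphi := trig_poly_smooth tphi; have Cphi := torus_smooth_C1 sphi; have cphi := Cphi.1.
have [M hM] := torus_continuous_bounded cphi.
have c1 := nem_limit.2 phi cphi; have c2 := lim_u L cphi.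
have c3 : \sum_i \int[mu]_x (u n x * pd i (pd i phi) x) @[n --> \oo] --> \sum_i \int[mu]_x (uf x * pd i (pd i phi) x).
  by apply: cvg_sum_seq => i; apply: (lim_u L); tc_solve.
have key (k : nat) : 0 <= hj_functional phi + 2^-1 * (M * \sum_i \int[mu]_x (b i k x - G i x) ^+ 2).
  have cb i : torus_continuous (b i k) by exact: (lim_b L i).1.
  have cbphi i : torus_continuous (fun x => b i k x * phi x) by exact: torus_continuousM.
  have cbb i : torus_continuous (fun x => b i k x ^+ 2 * phi x).
    by apply: torus_continuousM => //; exact: torus_continuousX.
  pose Bk := \sum_i \int[mu]_x (b i k x ^+ 2 * phi x).
  have c4 : \sum_i \int[mu]_x (pd i (u n) x * (b i k x * phi x)) @[n --> \oo] --> \sum_i \int[mu]_x (G i x * (b i k x * phi x)).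
    by apply: cvg_sum_seq => i; exact: lim_Du L _ _ (cbphi i).
  pose T n := \int[mu]_x (nem h V (m n) x * phi x) - \int[mu]_x (u n x * phi x)
    - (\sum_i \int[mu]_x (pd i (u n) x * (b i k x * phi x)) - 2^-1 * Bk) + sigma ^+ 2 * \sum_i \int[mu]_x (u n x * pd i (pd i phi) x).
  have cT : T n @[n --> \oo] --> \int[mu]_x (nem h V mf x * phi x) - \int[mu]_x (uf x * phi x)
    - (\sum_i \int[mu]_x (G i x * (b i k x * phi x)) - 2^-1 * Bk) + sigma ^+ 2 * \sum_i \int[mu]_x (uf x * pd i (pd i phi) x).
    exact (cvgR_add (cvgR_sub (cvgR_sub c1 c2) (cvgR_sub c4 (@cvgR_cst _ _))) (cvgR_scale c3)).
  have cT' := cvg_subsequence (shift N) cT.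
  have : 0 <= \int[mu]_x (nem h V mf x * phi x) - \int[mu]_x (uf x * phi x)
    - (\sum_i \int[mu]_x (G i x * (b i k x * phi x)) - 2^-1 * Bk) + sigma ^+ 2 * \sum_i \int[mu]_x (uf x * pd i (pd i phi) x).
    apply: cvg_seq_ge cT' _ => n; set p := (n + N)%N.
    have [_ _ _ _ [hj _ _]] := lim_approx L p.
    have smk := sm p; have suk := su p; have Cu := torus_smooth_C1 suk; have cup := cu p; have cVp := cVn p.
    apply: (le_trans (hj phi (trig_poly_le (leq_addl n N) tphi) phi0)).
    have a1 := gdot_continuous Cu Cu; have a2 := gdot_continuous Cu Cphi.
    have e1 : \int[mu]_x gdot (u p) phi x = - \sum_i \int[mu]_x (u p x * pd i (pd i phi) x).
      rewrite (gdotC (u p)) -[LHS]opprK -(laplacian_weak sphi Cu); congr (- _).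
      rewrite -Rint_sum; last by move=> i; ti_solve.
      by apply: tint_ext => x; rewrite /laplacian big_distrl; apply: eq_bigr => i _ /=; rewrite mulrC.
    have I1 : integrableR mu (fun x => nem h V (m p) x * phi x) by ti_solve.
    have I2 : integrableR mu (fun x => u p x * phi x) by ti_solve.
    have I3 : integrableR mu (fun x => gdot (u p) (u p) x * phi x / 2) by ti_solve.
    have I4 : integrableR mu (fun x => sigma ^+ 2 * gdot (u p) phi x) by ti_solve.
    rewrite A1_weak//.
    rewrite (RintD I1 (integrableRB (integrableRB (integrableRN I2) I3) I4)).
    rewrite (RintB (integrableRB (integrableRN I2) I3) I4) (RintB (integrableRN I2) I3) (RintN I2).
    rewrite [X in _ - X]RintZ ?e1; last exact: tcI.
    have lower : \sum_i \int[mu]_x (pd i (u p) x * (b i k x * phi x)) - 2^-1 * Bk <= \int[mu]_x (gdot (u p) (u p) x * phi x / 2).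
      have Ib i : integrableR mu (fun x => pd i (u p) x * (b i k x * phi x)).
        by have cbi := cbphi i; ti_solve.
      have Ibb : integrableR mu (fun x => \sum_i b i k x ^+ 2 * phi x).
        by apply: integrableR_sum => i; exact: tcI.
      have s1 : \sum_i \int[mu]_x (pd i (u p) x * (b i k x * phi x)) =
          \int[mu]_x (\sum_i pd i (u p) x * (b i k x * phi x)) by rewrite Rint_sum.
      have s2 : Bk = \int[mu]_x (\sum_i b i k x ^+ 2 * phi x).
        by rewrite /Bk Rint_sum// => i; exact: tcI.
      rewrite s1 s2 -RintZ// -RintB; [|exact: integrableR_sum|exact: integrableRZ].
      apply: Rint_le; [by apply: integrableRB; [exact: integrableR_sum|exact: integrableRZ]|exact: I3|].
      move=> x; rewrite big_distrr -sumrB /gdot !big_distrl; apply: ler_sum => i _ /=.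
      have := mulr_ge0 (phi0 x) (sqr_ge0 (pd i (u p) x - b i k x)); rewrite sqrrB.
      by move: (pd i (u p) x) (b i k x) (phi x) => y z t; rewrite !expr2; lra.
    rewrite /T; move: lower; rewrite mulrN.
    move: (\sum_i _) (\sum_i _) (\int[mu]_x _) (\int[mu]_x _) (\int[mu]_x _) => *; lra.
  have quad : \sum_i \int[mu]_x (G i x ^+ 2 * phi x) - M * \sum_i \int[mu]_x (b i k x - G i x) ^+ 2 <=
      2 * \sum_i \int[mu]_x (G i x * (b i k x * phi x)) - Bk.
    rewrite /Bk !big_distrr -!sumrB; apply: ler_sum => i _ /=.
    have LG := (lim_G L i).1.
    have J1 : integrableR mu (fun x => G i x ^+ 2 * phi x) by exact: dist_of_integrable.
    have J2 : integrableR mu (fun x => G i x * (b i k x * phi x)).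
      by apply: dist_of_integrable => //; exact: (torus_L2_L1 LG).2.
    have J3 : integrableR mu (fun x => (b i k x - G i x) ^+ 2).
      have [_ _ J] := torus_L2_lin 1 (-1) (torus_continuous_L2 (cb i)) LG.
      rewrite (_ : (fun x => (b i k x - G i x) ^+ 2) = fun x => (1 * b i k x + -1 * G i x) ^+ 2)//.
      by apply/funext => x; rewrite mul1r mulN1r.
    have J4 : integrableR mu (fun x => b i k x ^+ 2 * phi x) by exact: tcI.
    rewrite -(RintZ M J3) -(RintZ 2 J2) -(RintB J1 (integrableRZ M J3)) -(RintB (integrableRZ 2 J2) J4).
    apply: Rint_le; [by apply: integrableRB => //; exact: integrableRZ|by apply: integrableRB => //; exact: integrableRZ|].
    move=> x /=; have h1 : phi x * (b i k x - G i x) ^+ 2 <= M * (b i k x - G i x) ^+ 2.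
      by rewrite ler_wpM2r ?sqr_ge0//; apply: le_trans (hM x); exact: ler_norm.
    exact: (quadratic_arith h1).
  exact: (hj_arith quad).
have c5 : \sum_i \int[mu]_x (b i n x - G i x) ^+ 2 @[n --> \oo] --> \sum_(i < d) (0 : R).
  by apply: cvg_sum_seq => i; exact: (lim_b L i).2.
rewrite big1// in c5.
have c6 : hj_functional phi + 2^-1 * (M * \sum_i \int[mu]_x (b i n x - G i x) ^+ 2) @[n --> \oo] -->
   hj_functional phi + 2^-1 * (M * 0).
  exact (cvgR_add (@cvgR_cst _ _) (cvgR_scale (cvgR_scale c5))).
rewrite !mulr0 addr0 in c6; exact: cvg_seq_ge c6 key.
Qed.

Lemma limit_hj phi : torus_smooth phi -> (forall x, 0 <= phi x) -> 0 <= hj_functional phi.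
Proof.
move=> sphi phi0; have cphi := torus_smooth_continuous sphi.
have c1 := tconv_pairing (s := [::]) nem_limit.1 sphi.
have c2 := tconv_pairing (s := [::]) Iuf sphi.
have c3 i := tconv_pairing (s := [::]) (G2 i) sphi.
have c4 i := tconv_pairing (s := [:: i; i]) Iuf sphi.
have cT : hj_functional (tconv n phi) @[n --> \oo] --> hj_functional phi.
  exact (cvgR_add (cvgR_sub (cvgR_sub c1 c2) (cvgR_scale (cvg_sum_seq (r := index_enum 'I_d) c3))) (cvgR_scale (cvg_sum_seq (r := index_enum 'I_d) c4))).
apply: cvg_seq_ge cT _ => n; apply: limit_hj_trig (tconv_trig n (tcI cphi)) _ => x.
have := @tconv_le R d n (fun=> 0) phi x (tcI (@torus_continuous_cst R d 0)) (tcI cphi) phi0.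
by rewrite tconv_cst.
Qed.

Lemma limit_minty_trig N eta v (c : R) : trig_poly N eta -> trig_poly N v -> 0 < c -> (forall x, c <= eta x) ->
  0 <= \int[mu]_x (A1 h V sigma eta v x * (eta x - mf x)) + \int[mu]_x (A2 sigma eta v x * (v x - uf x)).
Proof.
move=> te tv c0 ce.
have se := trig_poly_smooth te; have sv := trig_poly_smooth tv.
have e0 x : 0 < eta x by exact: lt_le_trans (ce x).
have [cA1 cA2] := A_continuous sigma S se e0 sv.
have cete := torus_smooth_continuous se; have cv := torus_smooth_continuous sv.
have EI (A p q : Rd -> R) : torus_continuous A -> torus_continuous p -> integrableR mu q ->
    \int[mu]_x (A x * (p x - q x)) = \int[mu]_x (A x * p x) - \int[mu]_x (q x * A x).
  move=> cA cp Iq; have J1 : integrableR mu (fun x => A x * p x) by ti_solve.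
  have J2 : integrableR mu (fun x => q x * A x) by exact: dist_of_integrable.
  by rewrite -(RintB J1 J2); apply: tint_ext => x; ring.
rewrite (EI _ _ _ cA1 cete Imf) (EI _ _ _ cA2 cv Iuf).
have c1 := density_pairing cA1; have c2 := lim_u L cA2.
pose T n := \int[mu]_x (A1 h V sigma eta v x * eta x) - \int[mu]_x (m n x * A1 h V sigma eta v x) +
   (\int[mu]_x (A2 sigma eta v x * v x) - \int[mu]_x (u n x * A2 sigma eta v x)).
have cT : T n @[n --> \oo] --> \int[mu]_x (A1 h V sigma eta v x * eta x) - \int[mu]_x (mf x * A1 h V sigma eta v x) +
   (\int[mu]_x (A2 sigma eta v x * v x) - \int[mu]_x (uf x * A2 sigma eta v x)).
  exact (cvgR_add (cvgR_sub (@cvgR_cst _ _) c1) (cvgR_sub (@cvgR_cst _ _) c2)).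
(* Beyond this rank the degree N is allowed and the constraint 1 / (p + 2) is below c, so that (eta,
   v) is an admissible test pair. *)
pose K := (Num.truncn c^-1 + N)%N.
have cT' := cvg_subsequence (shift K) cT.
apply: cvg_seq_ge cT' _ => n; set p := (n + K)%N.
have [_ _ _ _ [_ _ mi]] := lim_approx L p.
have Np : (N <= p)%N by rewrite /p /K addnA leq_addl.
have := mi eta v (trig_poly_le Np te) (trig_poly_le Np tv).
have cp x : p.+2%:R^-1 <= eta x.
  apply: le_trans (ce x); rewrite invf_ple ?posrE//.
  apply: ltW; apply: lt_le_trans (truncnS_gt _) _; rewrite ler_nat /p /K.
  by rewrite !ltnS addnCA leqW// leq_addr.
move=> /(_ cp); rewrite /VI /T (EI _ _ _ cA1 cete (tcI (cm p))) (EI _ _ _ cA2 cv (tcI (cu p))); exact.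
Qed.

End limit_equations.

(** * From polynomial to smooth test functions *)

Section bounded_convergence.
Context {R : realType} {d : nat}.
Local Notation Rd := 'rV[R]_d.
Local Notation mu := (torus_measure R d).
Implicit Types (f p : nat -> Rd -> R) (F P q : Rd -> R).

(** Almost everywhere convergence under a uniform bound is stable under sums and products, so the
    convergence of A at the mollified tests can be assembled term by term, and it passes to the
    limit against any integrable factor. *)
Definition bounded_cvg f F := [/\ forall n, measurable_fun setT (f n), measurable_fun setT F,
  {ae mu, forall x, f n x @[n --> \oo] --> F x} &
  exists M : R, {ae mu, forall x n, `|f n x| <= M}].

Lemma bounded_cvg_cst (a : R) : bounded_cvg (fun _ _ => a) (fun=> a).
Proof.
split; [by move=> n; exact: measurable_cst|exact: measurable_cst| |].
  by apply: aeW => x; exact: cvg_cst.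
by exists `|a|; apply: aeW.
Qed.

Lemma bounded_cvgD f p F P : bounded_cvg f F -> bounded_cvg p P ->
  bounded_cvg (fun n x => f n x + p n x) (fun x => F x + P x).
Proof.
move=> [mf mF cf [M hM]] [mp mP cp [K hK]]; split.
- by move=> n; exact: measurable_funD.
- exact: measurable_funD.
- by apply: filterS2 cf cp => x c1 c2; exact: cvgR_add.
- exists (M + K); apply: filterS2 hM hK => x h1 h2 n.
  by apply: le_trans (ler_normD _ _) _; exact: lerD.
Qed.

Lemma bounded_cvgM f p F P : bounded_cvg f F -> bounded_cvg p P ->
  bounded_cvg (fun n x => f n x * p n x) (fun x => F x * P x).
Proof.
move=> [mf mF cf [M hM]] [mp mP cp [K hK]]; split.
- by move=> n; exact: measurable_funM.
- exact: measurable_funM.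
- by apply: filterS2 cf cp => x c1 c2; exact: cvgM.
- exists (M * K); apply: filterS2 hM hK => x h1 h2 n.
  by rewrite normrM; exact: ler_pM.
Qed.

Lemma bounded_cvgZ (a : R) f F : bounded_cvg f F -> bounded_cvg (fun n x => a * f n x) (fun x => a * F x).
Proof. exact: bounded_cvgM (bounded_cvg_cst a). Qed.

Lemma bounded_cvgB f p F P : bounded_cvg f F -> bounded_cvg p P ->
  bounded_cvg (fun n x => f n x - p n x) (fun x => F x - P x).
Proof.
move=> bf bp; have := bounded_cvgD bf (bounded_cvgZ (-1) bp).
have E1 (k : nat -> Rd -> R) (K : Rd -> R) : (fun x => K x + -1 * P x) = fun x => K x - P x.
  by apply/funext => x; rewrite mulN1r.
by rewrite (E1 p) (_ : (fun n x => f n x + -1 * p n x) = fun n x => f n x - p n x)//; apply/funext => n; apply/funext => x; rewrite mulN1r.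
Qed.

Lemma bounded_cvg_sum (I : Type) (r : seq I) (f : I -> nat -> Rd -> R) (F : I -> Rd -> R) :
  (forall i, bounded_cvg (f i) (F i)) ->
  bounded_cvg (fun n x => \sum_(i <- r) f i n x) (fun x => \sum_(i <- r) F i x).
Proof.
move=> hf; elim: r => [|i r IH].
  have E1 : (fun x : Rd => \sum_(i <- [::]) F i x) = fun=> 0 by apply/funext => x; rewrite big_nil.
  have E2 : (fun (n : nat) (x : Rd) => \sum_(i <- [::]) f i n x) = fun _ _ => 0.
    by apply/funext => n; apply/funext => x; rewrite big_nil.
  by rewrite E1 E2; exact: bounded_cvg_cst.
have E1 : (fun x : Rd => \sum_(i <- i :: r) F i x) = fun x => F i x + \sum_(i <- r) F i x.
  by apply/funext => x; rewrite big_cons.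
have E2 : (fun (n : nat) (x : Rd) => \sum_(i <- i :: r) f i n x) = fun n x => f i n x + \sum_(i <- r) f i n x.
  by apply/funext => n; apply/funext => x; rewrite big_cons.
by rewrite E1 E2; exact: bounded_cvgD.
Qed.

Lemma bounded_cvg_uniform f F : (forall n, torus_continuous (f n)) -> torus_continuous F ->
  (forall e : R, 0 < e -> exists N, forall n, (N <= n)%N -> forall x, `|f n x - F x| <= e) ->
  [/\ forall x, f n x @[n --> \oo] --> F x, exists M : R, forall n x, `|f n x| <= M & bounded_cvg f F].
Proof.
move=> cf cF cu.
have pw x : f n x @[n --> \oo] --> F x.
  by apply/cvg_seqP => e /cu[N hN]; exists N => n /hN.
have bd : exists M : R, forall n x, `|f n x| <= M.
  have [MF hMF] := torus_continuous_bounded cF.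
  have [Mk hMk] := choice (fun n => torus_continuous_bounded (cf n)).
  have [N hN] := cu 1 ltr01.
  have S0 : 0 <= \sum_(k < N) `|Mk k| by apply: sumr_ge0.
  have M0 : 0 <= MF by exact: le_trans (hMF 0).
  exists (\sum_(k < N) `|Mk k| + (MF + 1)) => n x; have [nN|nN] := ltnP n N.
    apply: le_trans (hMk n x) _; apply: le_trans (ler_norm _) _.
    by rewrite (bigD1 (Ordinal nN))//= -addrA lerDl addr_ge0 ?sumr_ge0// addr_ge0.
  apply: (@le_trans _ _ (MF + 1)); last by rewrite lerDr.
  have := hN n nN x; rewrite -(subrK (F x) (f n x)) => h1.
  by apply: le_trans (ler_normD _ _) _; rewrite addrK in h1 *; rewrite addrC lerD.
split => //; split.
- by move=> n; exact: torus_continuous_measurable.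
- exact: torus_continuous_measurable.
- by apply: aeW.
- by have [M hM] := bd; exists M; apply: aeW.
Qed.

Lemma bounded_cvg_pairing f p F P q : bounded_cvg f F -> bounded_cvg p P -> integrableR mu q ->
  \int[mu]_x (f n x * (p n x - q x)) @[n --> \oo] --> \int[mu]_x (F x * (P x - q x)).
Proof.
move=> [mf mF cf [M hM]] [mp mP cp [K hK]] Iq; have mq := integrableR_measurable Iq.
have [|||||_ cI] := @Rintegral_dominated R _ Rd mu (fun n x => f n x * (p n x - q x)) (fun x => F x * (P x - q x))
  (fun x => `|M| * (`|K| + `|q x|)).
- by move=> n; apply: measurable_funM => //; exact: measurable_funB.
- by apply: measurable_funM => //; exact: measurable_funB.
- apply: filterS2 cf cp => x c1 c2; apply: cvgM => //; exact: cvgR_sub c2 (@cvgR_cst _ _).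
- by apply: integrableRZ; apply: integrableRD; [apply: tcI; exact: torus_continuous_cst|exact: integrableR_abs].
- apply: filterS2 hM hK => x h1 h2 n; rewrite normrM; apply: ler_pM => //.
    by apply: le_trans (h1 n) _; exact: ler_norm.
  apply: le_trans (ler_normB _ _) _; rewrite lerD2r; apply: le_trans (h2 n) _; exact: ler_norm.
- exact: cI.
Qed.

End bounded_convergence.

Section mollified_tests.
Context {R : realType} {d : nat} (E : set R) (h : ('rV[R]_d -> R) -> 'rV[R]_d -> R)
  (g g1 g2 V : 'rV[R]_d -> R -> R -> R) (alpha kappa1 sigma : R).
Local Notation Rd := 'rV[R]_d.
Local Notation mu := (torus_measure R d).
Implicit Types phi psi eta v w : Rd -> R.
Hypothesis S : mfg_setting E h g g1 g2 V alpha kappa1.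

(** A test density may come arbitrarily close to 0, or vanish when E contains 0, whereas
    [limit_minty_trig] asks for a positive lower bound; adding 1/(n+1) to the mollified density
    provides one and disappears in the limit. *)
Definition lift_test eta n (x : Rd) : R := tconv n eta x + n.+1%:R^-1.

Lemma lift_test_trig eta n : torus_smooth eta -> trig_poly (d * n) (lift_test eta n).
Proof.
move=> se; apply: trig_polyD; last exact: trig_poly_cst.
exact: tconv_trig (tcI (torus_smooth_continuous se)).
Qed.

Lemma lift_test_ge eta n x : torus_smooth eta -> (forall y, 0 <= eta y) -> n.+1%:R^-1 <= lift_test eta n x.
Proof.
move=> se e0; rewrite lerDr.
have := @tconv_le R d n (fun=> 0) eta x (tcI (@torus_continuous_cst R d 0)) (tcI (torus_smooth_continuous se)) e0.
by rewrite tconv_cst.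
Qed.

Lemma lift_test_uniform eta s (e : R) : torus_smooth eta -> 0 < e ->
  exists N, forall n, (N <= n)%N -> forall x, `|pds s (lift_test eta n) x - pds s eta x| <= e.
Proof.
move=> se e0; have s1 : torus_smooth (fun _ : Rd => 1 : R) by exact: (trig_poly_smooth (@trig_poly_cst R d 0 1)).
have e2 : 0 < e / 2 by rewrite divr_gt0.
have [N1 hN1] := tconv_smooth_uniform s se e2.
have [M hM] := torus_continuous_bounded (torus_smooth_continuous (torus_smooth_pds s s1)).
have M0 : 0 <= M by exact: le_trans (hM 0).
have c0 : M * n.+1%:R^-1 @[n --> \oo] --> M * (0 : R) by apply: cvgR_scale; exact: cvg_harmonic.
rewrite mulr0 in c0; have /cvg_seqP/(_ _ e2)[N2 hN2] := c0.
exists (maxn N1 N2) => n; rewrite geq_max => /andP[n1 n2] x.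
have st : torus_smooth (tconv n eta) by exact: trig_poly_smooth (tconv_trig n (tcI (torus_smooth_continuous se))).
have [_ lin] := torus_smooth_lin 1 n.+1%:R^-1 st s1.
have -> : lift_test eta n = fun x => 1 * tconv n eta x + n.+1%:R^-1 * 1.
  by apply/funext => y; rewrite /lift_test mul1r mulr1.
rewrite lin mul1r addrAC; apply: le_trans (ler_normD _ _) _.
rewrite (splitr e); apply: lerD; first exact: hN1.
have := hN2 n n2; rewrite subr0 ger0_norm ?mulr_ge0 ?invr_ge0// => h1.
apply: le_trans h1; rewrite normrM (ger0_norm (x := _^-1)) ?invr_ge0// mulrC.
by apply: ler_wpM2r; rewrite ?invr_ge0.
Qed.

(** All derivatives of the lifted densities converge uniformly, so the Frechet differentiability of
    h in a Sobolev space makes h converge uniformly, without extraction. The uniform bound comes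
    from the growth of V and holds almost everywhere. *)
Lemma nem_bounded_cvg eta : smooth_in E eta ->
  bounded_cvg (fun n => nem h V (lift_test eta n)) (nem h V eta).
Proof.
move=> sE; have [se Ee] := sE.
have e0 x : 0 <= eta x by exact: (E_ge0 S).
have sl n : torus_smooth (lift_test eta n) by exact: trig_poly_smooth (lift_test_trig n se).
have l0 n x : 0 < lift_test eta n x by apply: lt_le_trans (lift_test_ge n x se e0); rewrite invr_gt0.
have sEl n : smooth_in E (lift_test eta n) by split => // x; exact: (E_gt0 S).
have dl n := smooth_in_dens (sEl n); have de := smooth_in_dens sE.
have [pw [M hM] _] := bounded_cvg_uniform (fun n => torus_smooth_continuous (sl n)) (torus_smooth_continuous se)
  (fun e e0 => lift_test_uniform [::] se e0).
have hu := h_uniform S sE sEl (fun s e e0 => lift_test_uniform s se e0).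
have [hpw [K hK] _] := bounded_cvg_uniform (fun n => dens_h S (dl n)) (dens_h S de) hu.
have [al0 _ _ _] := mfg_V2 S.
split.
- by move=> n; exact: (nem_V_measurable S).
- exact: (nem_V_measurable S).
- apply: aeW => x; apply: (within_domain_cvg (V_within S) (Ee x)).
  + by move=> n; case: (sEl n).
  + exact: cvg_cst.
  + exact: pw.
  + exact: hpw.
have [C C0 hC] := nem_V_bound S.
exists (C * (1 + M `^ alpha + K)).
have hae : {ae mu, forall x n, `|nem h V (lift_test eta n) x| <= C * (1 + lift_test eta n x `^ alpha + `|h (lift_test eta n) x|)}.
  by apply: ae_foralln => n; exact: hC.
apply: filterS hae => x hx n; apply: le_trans (hx n) _; apply: ler_wpM2l => //.
apply: lerD => //; rewrite lerD2l; have h1 := hM n x; rewrite ger0_norm ?(ltW (l0 n x))// in h1.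
apply: ge0_ler_powR; rewrite ?nnegrE//; [exact: ltW|exact: ltW (l0 n x)|].
by apply: le_trans h1; exact: ltW (l0 n x).
Qed.

Lemma A2E eta v x : torus_smooth eta -> torus_smooth v ->
  A2 sigma eta v x = eta x - \sum_i (eta x * pd i (pd i v) x + pd i v x * pd i eta x) -
    sigma ^+ 2 * laplacian eta x - 1.
Proof.
move=> se sv; rewrite /A2; congr (_ - _ - _ - _); apply: eq_bigr => i _.
by rewrite (torus_C1M (torus_smooth_C1 se) (torus_smooth_C1 (torus_smooth_pd i sv))).2.
Qed.

Lemma A_bounded_cvg eta v : smooth_in E eta -> torus_smooth v ->
  bounded_cvg (fun n => A1 h V sigma (lift_test eta n) (tconv n v)) (A1 h V sigma eta v) /\
  bounded_cvg (fun n => A2 sigma (lift_test eta n) (tconv n v)) (A2 sigma eta v).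
Proof.
move=> sE sv; have [se Ee] := sE; have cv := torus_smooth_continuous sv.
have sl n : torus_smooth (lift_test eta n) by exact: trig_poly_smooth (lift_test_trig n se).
have st n : torus_smooth (tconv n v) by exact: trig_poly_smooth (tconv_trig n (tcI cv)).
have bl s : bounded_cvg (fun n => pds s (lift_test eta n)) (pds s eta).
  have [] // := bounded_cvg_uniform (fun n => torus_smooth_continuous (torus_smooth_pds s (sl n)))
    (torus_smooth_continuous (torus_smooth_pds s se)) (fun e e0 => lift_test_uniform s se e0).
have bt s : bounded_cvg (fun n => pds s (tconv n v)) (pds s v).
  have [] // := bounded_cvg_uniform (fun n => torus_smooth_continuous (torus_smooth_pds s (st n)))
    (torus_smooth_continuous (torus_smooth_pds s sv)) (fun e e0 => tconv_smooth_uniform s sv e0).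
have bV := nem_bounded_cvg sE.
have blap (f : nat -> Rd -> R) (F : Rd -> R) : (forall s, bounded_cvg (fun n => pds s (f n)) (pds s F)) ->
    bounded_cvg (fun n => laplacian (f n)) (laplacian F).
  by move=> hf; apply: (bounded_cvg_sum (index_enum 'I_d)) => i; exact: (hf [:: i; i]).
split.
  have b1 := bounded_cvg_sum (index_enum 'I_d) (fun i => bounded_cvgM (bt [:: i]) (bt [:: i])).
  have b2 := bounded_cvgB (bounded_cvgZ (-1) (bt [::])) (bounded_cvgZ 2^-1 b1).
  have b3 := bounded_cvgD (bounded_cvgD b2 bV) (bounded_cvgZ (sigma ^+ 2) (blap _ _ bt)).
  have E1 (w e : Rd -> R) : A1 h V sigma e w = fun x => -1 * pds [::] w x - 2^-1 * (\sum_i pds [:: i] w x * pds [:: i] w x)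
      + nem h V e x + sigma ^+ 2 * laplacian w x.
    apply/funext => x; rewrite /A1 mulN1r; congr (_ - _ + _ + _).
    by rewrite mulrC; congr (_ * _); apply: eq_bigr => i _; rewrite expr2.
  rewrite E1 (_ : (fun n => A1 h V sigma (lift_test eta n) (tconv n v)) = fun n x =>
    -1 * pds [::] (tconv n v) x - 2^-1 * (\sum_i pds [:: i] (tconv n v) x * pds [:: i] (tconv n v) x)
      + nem h V (lift_test eta n) x + sigma ^+ 2 * laplacian (tconv n v) x); first exact: b3.
  by apply/funext => n; rewrite E1.
have b1 := bounded_cvg_sum (index_enum 'I_d) (fun i => bounded_cvgD (bounded_cvgM (bl [::]) (bt [:: i; i]))
  (bounded_cvgM (bt [:: i]) (bl [:: i]))).
have b2 := bounded_cvgB (bounded_cvgB (bounded_cvgB (bl [::]) b1) (bounded_cvgZ (sigma ^+ 2) (blap _ _ bl))) (bounded_cvg_cst 1).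
have E1 (e w : Rd -> R) : torus_smooth e -> torus_smooth w -> A2 sigma e w = fun x => pds [::] e x -
     \sum_i (pds [::] e x * pds [:: i; i] w x + pds [:: i] w x * pds [:: i] e x) - sigma ^+ 2 * laplacian e x - 1.
  by move=> s1 s2; apply/funext => x; rewrite A2E.
rewrite (E1 _ _ se sv) (_ : (fun n => A2 sigma (lift_test eta n) (tconv n v)) = fun n x => pds [::] (lift_test eta n) x -
     \sum_i (pds [::] (lift_test eta n) x * pds [:: i; i] (tconv n v) x + pds [:: i] (tconv n v) x * pds [:: i] (lift_test eta n) x)
     - sigma ^+ 2 * laplacian (lift_test eta n) x - 1); first exact: b2.
by apply/funext => n; rewrite (E1 _ _ (sl n) (st n)).
Qed.

Lemma limit_minty C m u mf uf G b H HV eta v : limit_data E h V alpha sigma C m u mf uf G b H HV ->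
  smooth_in E eta -> torus_smooth v ->
  0 <= \int[mu]_x (A1 h V sigma eta v x * (eta x - mf x)) + \int[mu]_x (A2 sigma eta v x * (v x - uf x)).
Proof.
move=> L sE sv; have [se Ee] := sE; have cv := torus_smooth_continuous sv.
have e0 x : 0 <= eta x by exact: (E_ge0 S).
have [b1 b2] := A_bounded_cvg sE sv.
have Imf : integrableR mu mf by case: (lim_dens L) => -[].
have Iuf : integrableR mu uf by exact: (torus_L2_L1 (lim_uf L)).2.
have sl n : torus_smooth (lift_test eta n) by exact: trig_poly_smooth (lift_test_trig n se).
have st n : torus_smooth (tconv n v) by exact: trig_poly_smooth (tconv_trig n (tcI cv)).
have [_ _ bl] := bounded_cvg_uniform (fun n => torus_smooth_continuous (sl n)) (torus_smooth_continuous se)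
  (fun e e0 => lift_test_uniform [::] se e0).
have [_ _ bt] := bounded_cvg_uniform (fun n => torus_smooth_continuous (st n)) cv
  (fun e e0 => tconv_smooth_uniform [::] sv e0).
have c1 := bounded_cvg_pairing b1 bl Imf; have c2 := bounded_cvg_pairing b2 bt Iuf.
apply: cvg_seq_ge (cvgR_add c1 c2) _ => n.
apply: (limit_minty_trig S L (lift_test_trig n se) (tconv_trig n (tcI cv)) (c := n.+1%:R^-1)).
  by rewrite invr_gt0.
by move=> x; exact: lift_test_ge.
Qed.

End mollified_tests.

Section weak_solution_limit.
Context {R : realType} {d : nat} (E : set R) (h : ('rV[R]_d -> R) -> 'rV[R]_d -> R)
  (g g1 g2 V : 'rV[R]_d -> R -> R -> R) (alpha kappa1 sigma : R).
Local Notation Rd := 'rV[R]_d.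
Local Notation mu := (torus_measure R d).
Local Notation periodic := Defs.periodic.
Implicit Types f phi psi eta v w : Rd -> R.
Hypothesis S : mfg_setting E h g g1 g2 V alpha kappa1.

Lemma distribution_of f : integrableR mu f -> is_distribution (dist_of f).
Proof.
move=> If; split.
  move=> a phi psi sphi spsi; have cphi := torus_smooth_continuous sphi; have cpsi := torus_smooth_continuous spsi.
  have J1 := dist_of_integrable If cphi; have J2 := dist_of_integrable If cpsi.
  rewrite /dist_of -(RintZ a J1) -(RintD (integrableRZ a J1) J2).
  by apply: tint_ext => x; ring.
move=> phi sphi hphi.
have := uniform_pairing If (fun n => torus_smooth_continuous (sphi n)) (@torus_continuous_cst R d 0).
have -> : \int[mu]_x (f x * 0) = 0 by rewrite (@tint_ext _ _ (fun=> 0)) ?Rint_cst// => x; rewrite mulr0.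
apply=> e e0; have [N _ hN] := hphi [::] e e0.
by exists N => n nN x; rewrite subr0; apply: ltW; exact: hN.
Qed.

Lemma dist_laplacianE f phi : dist_laplacian (dist_of f) phi = \sum_i \int[mu]_x (f x * pd i (pd i phi) x).
Proof. by rewrite /dist_laplacian; apply: eq_bigr => i _; rewrite /dist_pd opprK. Qed.

Lemma limit_solution C m u mf uf G b H HV : limit_data E h V alpha sigma C m u mf uf G b H HV ->
  weak_solution E h V sigma (dist_of mf) (dist_of uf) /\
  [/\ represents mf (dist_of mf), represents uf (dist_of uf) & Mac_in E mf] /\
      [/\ sobolev 1 (fun x => mf x `^ ((alpha + 1) / 2)),
          sobolev 1 uf,
          (\int[mu]_x (mf x)%:E = 1)%E,
          hj_supersolution h V sigma mf uf &
          fokker_planck_ae sigma mf uf].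
Proof.
move=> L; have [Lmf Emf] := lim_dens L; have Imf := Lmf.2.
have Luf := torus_L2_L1 (lim_uf L); have Iuf := Luf.2.
have mf0 := lim_mf0 L.
(* The statement involves the representative of the weak gradient selected by [weak_pds]. It agrees
   with [G] almost everywhere, and every integral is transferred from one to the other. *)
pose D i := weak_pd i uf.
have wD i : is_weak_pds [:: i] uf (D i) by exact: weak_pdsP (lim_G L i).2.
have DG i : torus_ae_eq (G i) (D i) := is_weak_pds_unique (lim_G L i).2 (wD i).
have [pD mD] : (forall i, periodic (D i)) /\ (forall i, measurable_fun setT (D i)).
  by split => i; have /is_weak_pdsP[_ [p I] _] := wD i; [exact: p|exact: integrableR_measurable I].
have mG i : measurable_fun setT (G i) by case: (lim_G L i) => -[].
have LD i : torus_L2 (D i) by exact: (torus_L2_ae (pD i) (mD i) (DG i) (lim_G L i).1).1.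
have mmf := integrableR_measurable Imf.
have ID2 i : integrableR mu (fun x => D i x ^+ 2) by case: (LD i).
have ImD i : integrableR mu (fun x => mf x * D i x).
  apply: integrableR_ae (lim_mG L i); first exact: measurable_funM.
  by apply: filterS (DG i) => x ->.
have I2 : integrableR mu (fun x => \sum_i D i x ^+ 2) by exact: integrableR_sum.
split; [split|split; [split|split]].
- exact: distribution_of.
- exact: distribution_of.
- by move=> phi _ phi0; apply: Rint_ge0 => x; rewrite mulr_ge0// ltW.
- move=> eta v sE sv; have := limit_minty S L sE sv.
  have [se Ee] := sE.
  have ce := torus_smooth_continuous se; have cv := torus_smooth_continuous sv.
  have cV : torus_continuous (nem h V eta) by exact: (nem_V_continuous S).
  have [c1 c2] := A_torus_continuous sigma cV se sv.
  have EI (A p q : Rd -> R) : torus_continuous A -> torus_continuous p -> integrableR mu q ->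
      \int[mu]_x (A x * (p x - q x)) = dist_of p A - dist_of q A.
    move=> cA cp Iq; have J1 : integrableR mu (fun x => p x * A x) by ti_solve.
    have J2 : integrableR mu (fun x => q x * A x) by exact: dist_of_integrable.
    by rewrite /dist_of -(RintB J1 J2); apply: tint_ext => x; ring.
  by rewrite (EI _ _ _ c1 ce Imf) (EI _ _ _ c2 cv Iuf).
- by split.
- by split.
- exact: (dens_Mac S (lim_dens L)).
- exact: lim_power L.
- exact: lim_usob L.
- by rewrite (Rint_EFin Imf) (limit_mass L).
- split.
  + exact: Luf.
  + split; last exact: I2.
    by move=> x i; apply: eq_bigr => j _; rewrite [weak_pd j uf _](pD j).
  + exact: (nem_limit S L).1.
  move=> phi sphi phi0; have := limit_hj S L sphi phi0.
  rewrite /hj_functional dist_laplacianE.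
  have cphi := torus_smooth_continuous sphi; have mphi := torus_continuous_measurable cphi.
  have -> : dist_of (fun x => (\sum_(i < d) weak_pd i uf x ^+ 2) / 2) phi = 2^-1 * \sum_i \int[mu]_x (G i x ^+ 2 * phi x).
    have JD i : integrableR mu (fun x => D i x ^+ 2 * phi x) by exact: dist_of_integrable.
    rewrite (_ : \sum_i \int[mu]_x (G i x ^+ 2 * phi x) = \sum_i \int[mu]_x (D i x ^+ 2 * phi x)).
      rewrite -Rint_sum// -RintZ; last exact: integrableR_sum.
      apply: tint_ext => x; rewrite -/(D _) -big_distrl /=; ring.
    apply: eq_bigr => i _; apply: Rint_ae.
    - by apply: measurable_funM => //; exact: measurable_funX.
    - by apply: measurable_funM => //; exact: measurable_funX.
    - by apply: filterS (DG i) => x ->.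
  rewrite /dist_of; move: (2^-1 * _) (sigma ^+ 2 * _) (\int[mu]_x _) (\int[mu]_x _) => *; lra.
split.
- exact: Lmf.
- by move=> i; split; [move=> x j; rewrite [weak_pd i uf _](pD i) Lmf.1|exact: ImD].
(* The weak equation itself says that the distribution is represented by mf - 1; with this choice
   the pointwise identity is immediate. *)
exists (fun x => mf x - 1); last by apply: aeW => x; ring.
split.
  split; first by move=> x i; rewrite Lmf.1.
  by apply: integrableRB => //; apply: tcI; exact: torus_continuous_cst.
move=> phi sphi; have cphi := torus_smooth_continuous sphi.
rewrite dist_laplacianE.
have -> : \sum_(i < d) dist_pd i (dist_of (fun x => mf x * weak_pd i uf x)) phi =
    - \sum_i \int[mu]_x (mf x * G i x * pd i phi x).
  rewrite -sumrN; apply: eq_bigr => i _; rewrite /dist_pd /dist_of; congr (- _).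
  have mpphi := torus_continuous_measurable (torus_smooth_continuous (torus_smooth_pd i sphi)).
  apply: Rint_ae.
  - by apply: measurable_funM => //; apply: measurable_funM => //; exact: mD.
  - by apply: measurable_funM => //; exact: measurable_funM.
  - by apply: filterS (DG i) => x e; rewrite /= e.
have fp_arith (a y s z : R) : a + y - s - z = 0 -> - y + s = a - z.
  by move=> e; apply/eqP; rewrite -subr_eq0 -oppr_eq0 -e; apply/eqP; ring.
have := limit_fp L sphi.
have -> : dist_of (fun x => mf x - 1) phi = \int[mu]_x (mf x * phi x) - \int[mu]_x (1 * phi x).
  have J1 := dist_of_integrable Imf cphi; have J2 := dist_of_integrable (tcI (@torus_continuous_cst R d 1)) cphi.
  by rewrite /dist_of -(RintB J1 J2); apply: tint_ext => x; ring.
exact: fp_arith.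
Qed.

End weak_solution_limit.

Theorem theorem6p2 (R : realType) (d : nat) (hd : (0 < d)%N)
  (E : set R) (hE : E = [set e | 0 < e] \/ E = [set e | 0 <= e])
  (h : ('rV[R]_d -> R) -> 'rV[R]_d -> R)
  (g g1 g2 V : 'rV[R]_d -> R -> R -> R)
  (sigma alpha kappa1 : R)
  (h_op : is_operator h)
  (g_cont : param_continuous E g)
  (V_smooth : param_smooth E V)
  (h_reg : h_regularity h)
  (h_lip : h_lipschitz h)
  (g_str : g_structure E h g g1 g2)
  (hV1 : V1 E h g V)
  (hV2 : V2 E h g1 V alpha kappa1)
  (hV3 : V3 E V alpha kappa1) :
  exists m u : ('rV[R]_d -> R) -> R,
    weak_solution E h V sigma m u /\
    exists mf uf : 'rV[R]_d -> R,
      [/\ represents mf m, represents uf u & Mac_in E mf] /\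
      [/\ sobolev 1 (fun x => mf x `^ ((alpha + 1) / 2)),
          sobolev 1 uf,
          (\int[torus_measure R d]_x (mf x)%:E = 1)%E,
          hj_supersolution h V sigma mf uf &
          fokker_planck_ae sigma mf uf].
Proof.
have S : mfg_setting E h g g1 g2 V alpha kappa1 by [].
have [C [m [u [mf [uf [G [b [H [HV L]]]]]]]]] := limit_exists sigma S.
have [sol rep] := limit_solution S L.
by exists (dist_of mf), (dist_of uf); split => //; exists mf, uf.
Qed.
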